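(* Let $F,G$ satisfy the assumptions of the weighted random balls model described in the context (with parameters $\beta,C_\beta$ for $F$ and $\alpha\in(1,2]$, $\sigma>0$, $b\in[-1,1]$, $\tau\in\mathbb{R}$ for $G$), with $d<\beta<\alpha d$. Let $\lambda:(0,\infty)\to(0,\infty)$ be such that $\lambda(\rho)\to+\infty$ and $\lambda(\rho)\rho^\beta\to0$ as $\rho\to0$. Set $n_2(\rho)=\lambda(\rho)^{d/\beta}\rho^d$ and $\gamma=\beta/d\in(1,\alpha)$. Then, as $\rho\to0$, $$ \frac{M_\rho(\cdot)-\mathbb{E}[M_\rho(\cdot)]}{n_2(\rho)}\longrightarrow\widetilde Z_\gamma(\cdot) $$ in the sense of finite-dimensional distributions on $L^1(\mathbb{R}^d)\cap L^\alpha(\mathbb{R}^d)$, where, for $\mu(dx)=\phi(x)\,dx$, $$ \widetilde Z_\gamma(\mu)=\int_{\mathbb{R}^d}\phi(x)\,\widetilde M_\gamma(dx) $$ is a stable integral with respect to the $\gamma$-stable random measure $\widetilde M_\gamma$ on $\mathbb{R}^d$ with control measure $\sigma_\gamma^\gamma\,dx$, where $$ \sigma_\gamma^\gamma=\frac{c_d^\gamma C_\beta}{d}\int_0^{+\infty}\frac{1-\cos r}{r^{1+\gamma}}\,dr\int_{\mathbb{R}}|m|^\gamma\,G(dm), $$ and with constant skewness function equal to $$ b_\gamma=\frac{\int_{\mathbb{R}}\varepsilon(m)|m|^\gamma\,G(dm)}{\int_{\mathbb{R}}|m|^\gamma\,G(dm)}. $$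
   Context: Notation. $d\ge 1$ is an integer, $\|\cdot\|$ is the Euclidean norm on $\mathbb{R}^d$, $B(x,r)=\{y\in\mathbb{R}^d:\|y-x\|<r\}$, $c_d$ is the Lebesgue volume of the unit ball of $\mathbb{R}^d$, $\mathbb{R}^+=(0,\infty)$. For real $a$: $\varepsilon(a)=1$ if $a>0$, $-1$ if $a<0$, $0$ if $a=0$. Stable laws. $S_\alpha(\sigma,b,\tau)$ is the law with characteristic function $\theta\mapsto\exp\big(-\sigma^\alpha|\theta|^\alpha(1-ib\,\varepsilon(\theta)\tan(\pi\alpha/2))+i\tau\theta\big)$. If $M$ is a $\gamma$-stable random measure on a measure space with control measure $m$ and constant skewness $b'$, then for $h\in L^\gamma(m)$ the stable integral $\int h\,dM$ is well defined, linear in $h$, and has characteristic function $\theta\mapsto\exp\big(-\int|\theta h|^\gamma(1-ib'\varepsilon(\theta h)\tan(\pi\gamma/2))\,dm\big)$. Radii. $F(dr)=f(r)\,dr$ is an absolutely continuous positive measure on $\mathbb{R}^+$ with $\int_{\mathbb{R}^+}r^d F(dr)<+\infty$ and $f(r)\sim C_\beta r^{-1-\beta}$ as $r\to+\infty$, for some constant $C_\beta>0$. Weights. $G$ is a probability measure on $\mathbb{R}$ in the normal domain of attraction of $S_\alpha(\sigma,b,\tau)$, $\alpha\in(1,2]$, meaning that its characteristic function satisfies, as $\theta\to0$, $\varphi_G(\theta)=1+i\theta\tau-\sigma^\alpha|\theta|^\alpha(1-ib\,\varepsilon(\theta)\tan(\pi\alpha/2))+o(|\theta|^\alpha)$. Field.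 For $\rho>0$, $F_\rho(dr)=f(r/\rho)\,dr/\rho$ is the image of $F$ under $r\mapsto\rho r$, $N_{\lambda(\rho),\rho}$ is a Poisson random measure on $\mathbb{R}^d\times\mathbb{R}^+\times\mathbb{R}$ with intensity $\lambda(\rho)\,dx\,F_\rho(dr)\,G(dm)$, and for a signed measure $\mu$ on $\mathbb{R}^d$ with finite total variation $M_\rho(\mu)=\int_{\mathbb{R}^d\times\mathbb{R}^+\times\mathbb{R}}m\,\mu(B(x,r))\,N_{\lambda(\rho),\rho}(dx,dr,dm)$, a well-defined integrable random variable. By abuse of notation, $\mu\in L^1(\mathbb{R}^d)\cap L^\alpha(\mathbb{R}^d)$ means $\mu(dx)=\phi(x)\,dx$ with $\phi\in L^1(\mathbb{R}^d)\cap L^\alpha(\mathbb{R}^d)$. Convergence in finite-dimensional distributions on a set of measures means: for all $k$ and all $\mu_1,\dots,\mu_k$ in the set, the random vectors indexed by $(\mu_1,\dots,\mu_k)$ converge in distribution. *)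

(* Defs.v *)
From HB Require Import structures.
From mathcomp Require Import all_boot all_order all_algebra.
From mathcomp Require Import complex.
From mathcomp Require Import all_classical all_reals all_analysis measurable_realfun.

Set Implicit Arguments.
Unset Strict Implicit.
Unset Printing Implicit Defensive.

Import Order.TTheory GRing.Theory Num.Theory.
Import numFieldNormedType.Exports.

Local Open Scope classical_set_scope.
Local Open Scope ring_scope.

(* R^d is [d.-tuple (measurableTypeR R)], with the product sigma-algebra of
   its coordinates. Lebesgue measure on it is built by recursion on d, as the
   image of (Lebesgue on R) \x (Lebesgue on R^n) under (x, v) |-> x :: v. *)
Notation Rd R d := (d.-tuple (measurableTypeR R)).

Section lebesgue_tuple.
Context {R : realType}.

Definition tuple_consp n (z : measurableTypeR R * Rd R n) : Rd R n.+1 :=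
  [the n.+1.-tuple (measurableTypeR R) of z.1 :: z.2].

Lemma measurable_tuple_consp n : measurable_fun [set: _] (@tuple_consp n).
Proof. exact: (measurable_cons measurable_fst measurable_snd). Qed.

Section step.
Variables (n : nat) (mu : {sigma_finite_measure set (Rd R n) -> \bar R}).

Definition leb_step : set (Rd R n.+1) -> \bar R :=
  pushforward (lebesgue_measure \x mu)%E (@tuple_consp n).

Let leb_step0 : leb_step set0 = 0%E.
Proof. by rewrite /leb_step /pushforward preimage_set0 measure0. Qed.

Let leb_step_ge0 A : (0 <= leb_step A)%E.
Proof. exact: (measure_ge0 (lebesgue_measure \x mu)%E). Qed.

Let leb_step_sigma_additive : semi_sigma_additive leb_step.
Proof.
move=> F mF tF mUF; rewrite /leb_step /pushforward preimage_bigcup.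
have mp (A : set (Rd R n.+1)) : measurable A -> measurable (@tuple_consp n @^-1` A).
  by move=> mA; rewrite -[X in measurable X]setTI; exact: measurable_tuple_consp.
apply: measure_semi_sigma_additive.
- by move=> k; exact: mp.
- apply/trivIsetP => /= i j _ _ ij; rewrite -preimage_setI.
  by move/trivIsetP : tF => /(_ _ _ _ _ ij) ->//; rewrite preimage_set0.
- by rewrite -preimage_bigcup; exact: mp.
Qed.

HB.instance Definition _ := isMeasure.Build _ _ _ leb_step
  leb_step0 leb_step_ge0 leb_step_sigma_additive.

Let leb_step_sigma_finite : sigma_finite setT leb_step.
Proof.
have /sigma_finiteP[F [TF ndF Foo]] := sigma_finiteT (@lebesgue_measure R).
have /sigma_finiteP[G [TG ndG Goo]] := sigma_finiteT mu.
exists (fun k => (fun v : Rd R n.+1 => F k (thead v)) `&`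
    (fun v : Rd R n.+1 => G k [tuple of behead v])).
  rewrite predeqE => v; split=> // _.
  have : setT (thead v) by []. rewrite TF => -[i _ Fi].
  have : setT [tuple of behead v] by []. rewrite TG => -[j _ Gj].
  exists (maxn i j) => //; split.
    by move: Fi; exact/subsetPset/ndF/leq_maxl.
  by move: Gj; exact/subsetPset/ndG/leq_maxr.
move=> k; have [mF Fk] := Foo k; have [mG Gk] := Goo k; split.
  apply: measurableI.
    rewrite -[X in measurable X]setTI.
    exact: (measurable_tnth ord0 measurableT mF).
  rewrite -[X in measurable X]setTI.
  exact: (measurable_behead measurableT mG).
rewrite /leb_step /pushforward (_ : _ @^-1` _ = F k `*` G k).
  by rewrite product_measure1E// lte_mul_pinfty// ge0_fin_numE.
have un2 x (v : Rd R n) : [tuple of behead (tuple_consp (x, v))] = v.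
  exact: val_inj.
by rewrite predeqE => -[x v]; rewrite /preimage/= un2.
Qed.

HB.instance Definition _ := Measure_isSigmaFinite.Build _ _ _ leb_step
  leb_step_sigma_finite.
End step.

Fixpoint lebesgue_tuple n : {sigma_finite_measure set (Rd R n) -> \bar R} :=
  match n with
  | 0 => \d_([tuple] : Rd R 0)
  | n'.+1 => leb_step (lebesgue_tuple n')
  end.

Lemma lebesgue_tuple_box n (A : 'I_n -> set (measurableTypeR R)) :
  (forall i, measurable (A i)) ->
  lebesgue_tuple n [set x : Rd R n | forall i, A i (tnth x i)] =
  (\prod_(i < n) lebesgue_measure (A i))%E.
Proof.
elim: n A => [|n IHn] A mA.
  by rewrite big_ord0 /= diracE mem_set// => -[].
rewrite big_ord_recl -IHn//= /leb_step /pushforward.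
rewrite -product_measure1E//; last first.
  rewrite [X in measurable X](_ : _ = \bigcap_(i in [set: 'I_n])
    ((fun x : Rd R n => tnth x i) @^-1` A (lift ord0 i))).
    apply: fin_bigcap_measurable => // i _.
    rewrite -[X in measurable X]setTI.
    exact: (measurable_tnth i measurableT (mA _)).
  by rewrite predeqE => x; split => [+ i _|+ i]; exact.
congr (_ _); rewrite predeqE => -[x v]; split => /=.
  move=> Av; split; first exact: (Av ord0).
  by move=> i; have := Av (lift ord0 i); rewrite tnthS.
move=> [Ax Av] i; case: (unliftP ord0 i) => [j ->|->].
  by rewrite tnthS.
exact: Ax.
Qed.

End lebesgue_tuple.

Section euclidean.
Context {R : realType} {d : nat}.

Definition edist (x y : Rd R d) : R :=
  Num.sqrt (\sum_(i < d) (tnth y i - tnth x i : R) ^+ 2).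

Definition eball (x : Rd R d) (r : R) : set (Rd R d) :=
  [set y | edist x y < r].

End euclidean.

Definition unit_ball_volume {R : realType} (d : nat) : R :=
  fine (lebesgue_tuple d (eball [tuple (0 : R) | i < d] 1)).

Section stable_laws.
Local Open Scope complex_scope.
Context {R : realType}.

Definition charfun (nu : probability R R) (theta : R) : R[i] :=
  (\int[nu]_x cos (theta * x)) +i* (\int[nu]_x sin (theta * x)).

Definition expC (z : R[i]) : R[i] :=
  (expR (complex.Re z) * cos (complex.Im z)) +i*
  (expR (complex.Re z) * sin (complex.Im z)).

Definition stable_symbol (alpha sigma b theta : R) : R[i] :=
  (sigma `^ alpha * `|theta| `^ alpha)%:C *
  (1 -i* (b * Num.sg theta * tan (pi * alpha / 2))).

Definition stable_law (alpha sigma b tau : R)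
    (nu : probability R R) : Prop :=
  forall theta, charfun nu theta =
    expC (- stable_symbol alpha sigma b theta + (0 +i* (tau * theta))).

Definition normal_domain_of_attraction (alpha sigma b tau : R)
    (G : probability R R) : Prop :=
  Normc.normc (charfun G theta -
      ((1 +i* (theta * tau)) - stable_symbol alpha sigma b theta))
    / `|theta| `^ alpha @[theta --> (0 : R)^'] --> (0 : R).

End stable_laws.

Section random_measures.
Import HBSimple.
Context {R : realType}.

Definition independent dO (Om : measurableType dO) (P : probability Om R)
    dT (T : measurableType dT) n (X : 'I_n -> Om -> T) : Prop :=
  forall B : 'I_n -> set T, (forall i, measurable (B i)) ->
    P [set w | forall i, B i (X i w)] =
    (\prod_(i < n) P [set w | B i (X i w)])%E.

(* The Poisson mass function is written out because the library's
   [poisson_pmf] is constantly 1 at rate 0. *)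
Record poisson_random_measure dO (Om : measurableType dO)
    (P : probability Om R) dE (E : measurableType dE) (Lambda : set E -> \bar R)
    (N : Om -> {measure set E -> \bar R}) : Prop := {
  prm_measurable : forall A, measurable A ->
    measurable_fun [set: Om] (N ^~ A) ;
  prm_integer : forall w A, measurable A ->
    N w A = +oo%E \/ exists k : nat, N w A = k%:R%:E ;
  prm_poisson : forall A, measurable A -> (Lambda A < +oo)%E -> forall k : nat,
    P [set w | N w A = k%:R%:E] =
    (fine (Lambda A) ^+ k / k`!%:R * expR (- fine (Lambda A)))%:E ;
  prm_infinite : forall A, measurable A -> Lambda A = +oo%E ->
    P [set w | N w A = +oo%E] = 1%E ;
  prm_independent : forall n (A : 'I_n -> set E), (forall i, measurable (A i)) ->
    trivIset setT A -> independent P (fun i w => N w (A i)) }.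

(* A stable random measure is only meaningful on sets of finite control
   measure; the values [M A] for other [A] are unconstrained. *)
Record stable_random_measure dO (Om : measurableType dO)
    (P : probability Om R) dE (E : measurableType dE) (gamma : R)
    (m : {measure set E -> \bar R}) (b : R)
    (M : set E -> {RV P >-> R}) : Prop := {
  srm_law : forall A, measurable A -> (m A < +oo)%E ->
    stable_law gamma (fine (m A) `^ gamma^-1) b 0 (distribution P (M A)) ;
  srm_independent : forall n (A : 'I_n -> set E),
    (forall i, measurable (A i)) -> (forall i, m (A i) < +oo)%E ->
    trivIset setT A -> independent P (fun i => M (A i) : Om -> R) ;
  srm_sigma_additive : forall A : nat -> set E, (forall i, measurable (A i)) ->
    trivIset setT A -> (m (\bigcup_i A i) < +oo)%E ->
    {ae P, forall w, (fun n => \sum_(0 <= i < n) M (A i) w) @ \oo -->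
      M (\bigcup_i A i) w} }.

Definition cvg_in_probability dO (Om : measurableType dO)
    (P : probability Om R) (X : nat -> Om -> R) (Y : Om -> R) : Prop :=
  forall e : R, 0 < e ->
    P [set w | e <= `|X n w - Y w|] @[n --> \oo] --> 0%E.

(* The integral of a simple function [h] is \sum_y y M(h = y), where the term
   y = 0 vanishes. The integral of a general h in L^gamma(m) is the limit in
   probability along simple functions converging to h in L^gamma(m). *)
Definition simple_stable_integral dO (Om : measurableType dO)
    (P : probability Om R) dE (E : measurableType dE)
    (M : set E -> {RV P >-> R}) (h : {sfun E >-> R})
    (w : Om) : R :=
  \sum_(y \in range h) (y * M (h @^-1` [set y]) w).

Definition stable_integral dO (Om : measurableType dO)
    (P : probability Om R) dE (E : measurableType dE) (gamma : R)
    (m : {measure set E -> \bar R}) (M : set E -> {RV P >-> R})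
    (h : E -> R) (Y : Om -> R) : Prop :=
  h \in Lfun m gamma%:E /\
  exists h_ : nat -> {sfun E >-> R},
  [/\ forall n, (h_ n : E -> R) \in Lfun m gamma%:E,
      Lnorm m gamma%:E (EFin \o (h_ n \- h)) @[n --> \oo] --> 0%E &
      cvg_in_probability P (fun n => simple_stable_integral M (h_ n)) Y].

End random_measures.

Section convergence.
Context {R : realType}.
Variables (dO : R -> measure_display) (Om : forall rho, measurableType (dO rho)).
Variable P : forall rho, probability (Om rho) R.
Variables (dO' : measure_display) (Om' : measurableType dO').
Variable P' : probability Om' R.

Definition cvg_in_law k (X : forall rho, Om rho -> 'rV[R]_k)
    (F : set_system R) (Y : Om' -> 'rV[R]_k) : Prop :=
  forall g : 'rV[R]_k -> R, continuous g -> (exists C, forall x, `|g x| <= C) ->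
    'E_(P rho)[fun w => g (X rho w)]%E @[rho --> F] -->
    'E_P'[fun w => g (Y w)]%E.

Definition cvg_fdd (I : Type) (S : set I) (X : forall rho, I -> Om rho -> R)
    (F : set_system R) (Y : I -> Om' -> R) : Prop :=
  forall k (t : 'I_k -> I), (forall j, S (t j)) ->
    cvg_in_law (fun rho w => \row_j X rho (t j) w) F
      (fun w => \row_j Y (t j) w).

End convergence.

(* Centre, radius and weight of a ball. The radius component ranges over R, but
   intensities and integrals are restricted to [positive_radii]. *)
Notation weighted_ball R d := (Rd R d * measurableTypeR R * R)%type.

(* Charges take finite values, so they are exactly the signed measures with
   finite total variation. *)
Notation signed_measure R d := (charge (Rd R d) R).

Section weighted_balls.
Context {R : realType} {d : nat}.

Definition positive_radii : set (weighted_ball R d) :=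
  [set z | (0 : R) < z.1.2].

Record radius_density (beta Cbeta : R) (f : R -> R) : Prop := {
  radius_measurable : measurable_fun (`]0, +oo[ : set R) f ;
  radius_ge0 : forall r, 0 < r -> 0 <= f r ;
  radius_volume :
    (\int[lebesgue_measure]_(r in `]0%R, +oo[) (r ^+ d * f r)%:E < +oo)%E ;
  radius_tail : f r / r `^ (- 1 - beta) @[r --> +oo] --> Cbeta }.

(* [f (r / rho) / rho] is the density of the image under r |-> rho r of the
   measure with density [f]. *)
Definition ball_intensity (l : R) (f : R -> R) (G : probability R R) (rho : R)
    (A : set (weighted_ball R d)) : \bar R :=
  (\int[((lebesgue_tuple d \x lebesgue_measure) \x G)]_
     (z in A `&` positive_radii) (l * (f (z.1.2 / rho) / rho))%:E)%E.

Definition ball_field dO (Om : measurableType dO)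
    (N : Om -> {measure set (weighted_ball R d) -> \bar R})
    (mu : signed_measure R d) (w : Om) : R :=
  \int[N w]_(z in positive_radii) (z.2 * fine (mu (eball z.1.1 z.1.2))).

Definition has_density (mu : signed_measure R d)
    (phi : Rd R d -> R) : Prop :=
  forall A, measurable A -> mu A = (\int[lebesgue_tuple d]_(x in A) (phi x)%:E)%E.

Definition L1_Lp (p : R) (phi : Rd R d -> R) : Prop :=
  phi \in Lfun (lebesgue_tuple d) 1%E /\ phi \in Lfun (lebesgue_tuple d) p%:E.

Definition L1_Lp_measure (p : R) : set (signed_measure R d) :=
  [set mu | exists2 phi, L1_Lp p phi & has_density mu phi].

End weighted_balls.

Section limit_parameters.
Context {R : realType} (d : nat) (Cbeta gamma : R).
Variable G : probability R R.

(* This is sigma_gamma ^ gamma. *)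
Definition limit_scale : R :=
  unit_ball_volume d `^ gamma * Cbeta / d%:R *
  (\int[lebesgue_measure]_(r in `]0%R, +oo[) ((1 - cos r) / r `^ (1 + gamma))) *
  (\int[G]_m (`|m| `^ gamma)).

Definition limit_skewness : R :=
  (\int[G]_m (Num.sg m * `|m| `^ gamma)) /
  (\int[G]_m (`|m| `^ gamma)).

Lemma limit_scale_ge0 : 0 <= Cbeta -> 0 <= limit_scale.
Proof.
move=> C0; rewrite /limit_scale mulr_ge0//; last first.
  by apply: Rintegral_ge0 => m _; exact: powR_ge0.
rewrite !mulr_ge0 ?invr_ge0 ?powR_ge0//.
apply: Rintegral_ge0 => r _.
by rewrite divr_ge0 ?powR_ge0// subr_ge0 cos_le1.
Qed.

Definition limit_control (C0 : 0 <= Cbeta) : {measure set (Rd R d) -> \bar R} :=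
  mscale (NngNum (limit_scale_ge0 C0)) (lebesgue_tuple d).

End limit_parameters.

(* Main.v *)
(* By Levy's continuity theorem it suffices that the characteristic functions of
   linear combinations converge. By linearity such a combination is the field of
   one measure with density phi, and its log-characteristic function is the
   integral of e^(ih) - 1 - ih against the intensity, with h = m mu(B(x,r)) / n2.
   Put L = lambda^(1/beta), s = L rho -> 0, so that n2 = s^d. The substitution
   r = s u turns the exponent into int_0^oo w(u) Q_s(u) du, where
   w(u) = L^(1+beta) f(L u) -> Cbeta u^(-1-beta) by the tail of f, and
   Q_s(u) = int int psi(m s^(-d) mu(B(x, s u))) dx G(dm) -> int int psi(m c_d u^d phi(x)) dx G(dm)
   because averages over small balls converge in L^1. Choosing gamma < p < alpha,
   |psi(y)| <= C min(|y|, |y|^p) gives Q_s(u) <= K min(u^d, u^(pd)), uniformly in s;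
   the p-th moment of G is finite by the behaviour of its characteristic function
   at 0. The limit is recognized as a stable exponent by scaling in u and by
   int v^(-1-gamma) (v - sin v) dv = - tan(pi gamma / 2) int v^(-1-gamma) (1 - cos v) dv.
   Real and imaginary parts are treated through nonnegative functions psi that are
   Lipschitz and vanish at 0: 1 - cos y, and the positive and negative parts of
   y - sin y. *)
Require Import Defs.
From HB Require Import structures.
From mathcomp Require Import all_boot all_order all_algebra.
From mathcomp Require Import complex ring lra.
From mathcomp Require Import all_classical all_reals all_analysis measurable_realfun.

Set Implicit Arguments.
Unset Strict Implicit.
Unset Printing Implicit Defensive.

Import Order.TTheory GRing.Theory Num.Theory.
Import numFieldNormedType.Exports.

Local Open Scope classical_set_scope.
Local Open Scope ring_scope.

(** The moments of G dictate the exponents: a moment of order alpha need not exist, so p stays below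
    alpha, while p > gamma makes u^(-1-beta) u^(pd) integrable at 0; near infinity the first moment
    of G suffices because beta > d. With nonnegative psi every exchange of integrals is Tonelli's
    theorem in [0, +oo], and integrability is a consequence of the computation instead of a
    condition for it. The Poisson and stable random measures are given by the laws and the
    independence of their values on sets, together with additivity. Their characteristic functions
    are therefore computed for simple functions on disjoint cells and extended by continuity, in L^1
    of the intensity and in L^gamma of the control measure. The tangent arises when the half-line of
    integration is turned from the real to the imaginary axis; this is done by a differential
    equation in the angle, without complex integration. Since each rho has its own probability space
    and dominated convergence concerns sequences, the limit at 0 is taken along arbitrary sequences
    of positive rho. *)

Section integration_complements.
Context d (T : measurableType d) (R : realType).
Implicit Types (mu : {measure set T -> \bar R}) (D : set T) (f g : T -> R).

Lemma bounded_integrable (mu : {finite_measure set T -> \bar R}) f C :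
  measurable_fun setT f -> (forall x, `|f x| <= C) ->
  mu.-integrable setT (EFin \o f).
Proof.
move=> mf fC; apply: measurable_bounded_integrable => //.
  by rewrite ltey_eq fin_num_measure.
by exists C; split; rewrite ?num_real// => M CM x _ /=; exact: le_trans (ltW CM).
Qed.

Lemma EFin_Rintegral mu D f : measurable D -> mu.-integrable D (EFin \o f) ->
  (\int[mu]_(x in D) (f x)%:E = (\int[mu]_(x in D) f x)%:E)%E.
Proof. by move=> mD fi; rewrite fineK//; exact: integrable_fin_num. Qed.

Lemma integrable_realZl mu D (c : R) f : measurable D ->
  mu.-integrable D (EFin \o f) -> mu.-integrable D (EFin \o (fun x => c * f x)).
Proof. by move=> mD fi; exact: (integrableZl mD c fi). Qed.

Lemma integrable_realD mu D f g : measurable D ->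
  mu.-integrable D (EFin \o f) -> mu.-integrable D (EFin \o g) ->
  mu.-integrable D (EFin \o (fun x => f x + g x)).
Proof. by move=> mD fi gi; exact: (integrableD mD fi gi). Qed.

Lemma integrable_realB mu D f g : measurable D ->
  mu.-integrable D (EFin \o f) -> mu.-integrable D (EFin \o g) ->
  mu.-integrable D (EFin \o (fun x => f x - g x)).
Proof. by move=> mD fi gi; exact: (integrableB mD fi gi). Qed.

Lemma integrable_real_sum mu D (I : Type) (s : seq I) (f : I -> T -> R) :
  measurable D -> (forall i, mu.-integrable D (EFin \o f i)) ->
  mu.-integrable D (EFin \o (fun x => \sum_(i <- s) f i x)).
Proof.
move=> mD fi; rewrite (_ : EFin \o _ = fun x => \sum_(j <- s) (f j x)%:E)%E; last first.
  by apply/funext => x /=; rewrite sumEFin.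
by apply: integrable_sum => // j _; exact: fi.
Qed.

Lemma Rintegral_sum mu D (I : Type) (s : seq I) (f : I -> T -> R) :
  measurable D -> (forall i, mu.-integrable D (EFin \o f i)) ->
  \int[mu]_(x in D) (\sum_(i <- s) f i x) = \sum_(i <- s) \int[mu]_(x in D) f i x.
Proof.
move=> mD fi; elim: s => [|i s IH].
  by under eq_Rintegral do rewrite big_nil; rewrite big_nil Rintegral_cst ?mul0r.
under eq_Rintegral do rewrite big_cons; rewrite big_cons RintegralD//; first by rewrite IH.
exact: integrable_real_sum.
Qed.

Lemma le_integrable_real mu D f g : measurable D -> measurable_fun D f ->
  (forall x, D x -> `|f x| <= g x) -> mu.-integrable D (EFin \o g) ->
  mu.-integrable D (EFin \o f).
Proof.
move=> mD mf fg; apply: le_integrable => //; first exact/measurable_EFinP.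
by move=> x Dx; rewrite /= lee_fin (le_trans (fg x Dx))// ler_norm.
Qed.

Lemma Rintegral_dct mu D (f_ : nat -> T -> R) f g : measurable D ->
  (forall n, measurable_fun D (f_ n)) ->
  (forall x, D x -> f_ ^~ x @ \oo --> f x) ->
  mu.-integrable D (EFin \o g) ->
  (forall n x, D x -> `|f_ n x| <= g x) ->
  \int[mu]_(x in D) f_ n x @[n --> \oo] --> \int[mu]_(x in D) f x.
Proof.
move=> mD mf_ f_f ig fg.
have mf : measurable_fun D f by exact: measurable_fun_cvg f_f.
have [] := @dominated_convergence _ _ _ mu D mD
  (fun n => EFin \o f_ n) (EFin \o f) (EFin \o g) _ _ _ ig.
- by move=> n; exact/measurable_EFinP.
- exact/measurable_EFinP.
- by apply: aeW => x Dx; apply: cvg_EFin; [exact: nearW|exact: f_f].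
- by apply: aeW => x n Dx; rewrite lee_fin; exact: fg.
- move=> fi _ H; apply: fine_cvg; move: H => /=.
  by rewrite EFin_Rintegral.
Qed.

Lemma Rintegral_cvg_dist mu D (f_ : nat -> T -> R) f : measurable D ->
  (forall n, mu.-integrable D (EFin \o f_ n)) -> mu.-integrable D (EFin \o f) ->
  \int[mu]_(x in D) `|f_ n x - f x| @[n --> \oo] --> 0 ->
  \int[mu]_(x in D) f_ n x @[n --> \oo] --> \int[mu]_(x in D) f x.
Proof.
move=> mD fi_ fi H; apply/cvgrPdist_le => e e0.
move/cvgrPdist_le : H => /(_ e e0) [N _ HN]; exists N => // n Nn /=.
rewrite distrC -RintegralB//.
apply: (le_trans (le_normr_Rintegral mD _)).
  exact: (integrableB mD (fi_ n) fi).
have := HN n Nn; rewrite sub0r normrN ger0_norm//.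
by apply: Rintegral_ge0 => x _.
Qed.

Lemma measurable_set_ler f (a : R) : measurable_fun setT f ->
  measurable [set x | a <= f x].
Proof.
move=> mf; rewrite -[X in measurable X]setTI.
rewrite (_ : [set x | _] = f @^-1` `[a, +oo[%classic); first exact: mf.
by apply/seteqP; split=> w /=; rewrite in_itv/= andbT.
Qed.

End integration_complements.

Section real_complements.
Context {R : realType}.

Lemma measurable_fun_cos d (T : measurableType d) (D : set T) (f : T -> R) :
  measurable_fun D f -> measurable_fun D (fun x => cos (f x)).
Proof.
by apply: measurableT_comp; apply: continuous_measurable_fun; exact: continuous_cos.
Qed.

Lemma measurable_fun_sin d (T : measurableType d) (D : set T) (f : T -> R) :
  measurable_fun D f -> measurable_fun D (fun x => sin (f x)).
Proof.
by apply: measurableT_comp; apply: continuous_measurable_fun; exact: continuous_sin.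
Qed.

Lemma is_derive1_continuous (f : R -> R) (x df : R) :
  is_derive x 1 f df -> {for x, continuous f}.
Proof. by case=> fx _; apply: differentiable_continuous; exact/derivable1_diffP. Qed.

Lemma is_derive1_mulr (z x : R) : is_derive x 1 (fun t => t * z) z.
Proof.
rewrite (_ : (fun t => t * z) = z \*: id); last first.
  by apply/funext => t; rewrite /= mulrC.
by rewrite -[X in is_derive _ _ _ X]mulr1; exact: is_deriveZ.
Qed.

Lemma sin_le_abs (x : R) : `|sin x| <= `|x|.
Proof.
wlog x0 : x / 0 < x.
  move=> H; have [x0|x0|->] := ltgtP x 0; last by rewrite sin0.
    by rewrite -normrN -sinN -[leRHS]normrN; apply: H; rewrite oppr_gt0.
  exact: H.
have [|c _] := @MVT R sin cos 0 x x0 (fun y _ => is_derive_sin y).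
  by apply: continuous_subspaceT; exact: continuous_sin.
by rewrite sin0 !subr0 => ->; rewrite normrM ler_piMl// cos_max.
Qed.

End real_complements.

Lemma Rintegral_prob_cst d (T : measurableType d) (R : realType)
  (P : probability T R) (c : R) : \int[P]_w c = c.
Proof. by rewrite Rintegral_cst//= probability_setT mulr1. Qed.

Lemma cvg_sumr (R : realType) (T : Type) (F : set_system T) (I : Type)
    (s : seq I) (f : I -> T -> R) (l : I -> R) : Filter F ->
  (forall i, f i x @[x --> F] --> l i) ->
  \sum_(i <- s) f i x @[x --> F] --> \sum_(i <- s) l i.
Proof.
move=> FF fl; elim: s => [|i s IH].
  by under eq_fun do rewrite big_nil; rewrite big_nil; exact: cvg_cst.
by under eq_fun do rewrite big_cons; rewrite big_cons; exact: cvgD.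
Qed.

Lemma nneseries_EFin (R : realType) (u : R^nat) (l : R) :
  series u @ \oo --> l -> (\sum_(k <oo) (u k)%:E = l%:E)%E.
Proof.
move=> ul; apply: cvg_lim => //.
under eq_fun do rewrite sumEFin.
by apply: cvg_EFin => //; exact: nearW.
Qed.

(** * Levy's continuity theorem *)

Section fejer.
Context {R : realType}.
Implicit Types (x y : R) (n N m : nat).

(** The Fejer kernel |sum_(j <= n) e^(ijy)|^2 / (n+1). As a double sum of cosines it is visibly a
    trigonometric polynomial of degree n; its nonnegativity comes from the square. *)
Definition fejer n y : R :=
  n.+1%:R^-1 * \sum_(i < n.+1) \sum_(j < n.+1) cos ((i%:R - j%:R) * y).

Lemma fejer_ge0 n y : 0 <= fejer n y.
Proof.
rewrite /fejer mulr_ge0//.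
rewrite (_ : \sum_(i < n.+1) _ = (\sum_(i < n.+1) cos (i%:R * y)) ^+ 2 +
    (\sum_(i < n.+1) sin (i%:R * y)) ^+ 2); first by rewrite addr_ge0// sqr_ge0.
rewrite !expr2 !big_distrlr /= -big_split /=; apply: eq_bigr => i _.
rewrite -big_split /=; apply: eq_bigr => j _.
by rewrite mulrBl cosB.
Qed.

Definition grid N l : R := 2 * pi * l%:R / N%:R - pi.

(** Multiplied by 2 sin(a/2), where a = 2 pi m / N is the step of the arguments, the sum telescopes;
    its two ends differ by N a = 2 pi m, hence cancel. The condition 0 < m < N makes sin(a/2)
    nonzero. *)
Lemma sum_cos_grid N m x : (0 < m < N)%N ->
  \sum_(l < N) cos (m%:R * (x - grid N l)) = 0.
Proof.
move=> /andP[m0 mN]; have N0 : (0 < N)%N by exact: leq_trans mN.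
have N0' : N%:R != 0 :> R by rewrite pnatr_eq0 -lt0n.
pose a : R := 2 * pi * m%:R / N%:R; pose c : R := m%:R * (x + pi).
have sa : 0 < sin (a / 2).
  apply: sin_gt0_pi; apply/andP; split.
    by rewrite divr_gt0// divr_gt0 ?ltr0n// !mulr_gt0 ?pi_gt0// ltr0n.
  rewrite (_ : a / 2 = pi * (m%:R / N%:R)); last by rewrite /a; field.
  by rewrite gtr_pMr ?pi_gt0// ltr_pdivrMr ?ltr0n// mul1r ltr_nat.
have tele M : 2 * sin (a / 2) * \sum_(l < M) cos (c - l%:R * a) =
    sin (c + a / 2) - sin (c - M%:R * a + a / 2).
  elim: M => [|M IH]; first by rewrite big_ord0 mul0r subr0 subrr mulr0.
  rewrite big_ord_recr/= mulrDr IH.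
  rewrite (_ : c - M.+1%:R * a + a / 2 = c - M%:R * a - a / 2); last first.
    by rewrite -natr1; field.
  by rewrite [sin (c - M%:R * a + _)]sinD [sin (c - M%:R * a - _)]sinB; ring.
have := tele N; rewrite (_ : c - N%:R * a + a / 2 = c + a / 2 - (pi *+ 2) *+ m); last first.
  rewrite (_ : N%:R * a = (pi *+ 2) *+ m); first by ring.
  by rewrite /a mulrC divfK// -mulr_natr -[pi *+ 2]mulr_natr; ring.
rewrite -[X in _ - X](periodicn (@sinD2pi R) m) subrK subrr.
move/eqP; rewrite mulf_eq0 mulf_eq0 pnatr_eq0/= (gt_eqF sa)/= => /eqP c0.
rewrite -[RHS]c0; apply: eq_bigr => l _; congr cos; rewrite /c /a /grid.
by move: (N%:R^-1) (m%:R) (l%:R) => u v z; ring.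
Qed.

Lemma sum_cos_gridB N i j x : (i < N)%N -> (j < N)%N ->
  \sum_(l < N) cos ((i%:R - j%:R) * (x - grid N l)) = N%:R * (i == j)%:R.
Proof.
move=> iN jN; have [->|nij] := eqVneq i j.
  under eq_bigr do rewrite subrr mul0r cos0.
  by rewrite sumr_const card_ord mulr1.
rewrite mulr0; wlog ij : i j iN jN nij / (j < i)%N.
  move=> H; move: (nij); rewrite neq_ltn => /orP[ij|ij]; last exact: H.
  rewrite -[RHS](H j i)//; last by rewrite eq_sym.
  by apply: eq_bigr => l _; rewrite -cosN -mulNr opprB.
rewrite -[RHS](@sum_cos_grid N (i - j)%N x); last first.
  by rewrite subn_gt0 ij/= (leq_ltn_trans (leq_subr _ _)).
by apply: eq_bigr => l _; rewrite natrB// ltnW.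
Qed.

(** All frequencies i - j have absolute value at most n < N, so only the n+1 diagonal terms survive
    the sum over the grid. *)
Lemma sum_fejer_grid n N x : (n < N)%N ->
  \sum_(l < N) fejer n (x - grid N l) = N%:R.
Proof.
move=> nN; rewrite /fejer -mulr_sumr exchange_big/=.
rewrite (eq_bigr (fun i : 'I_n.+1 => N%:R)).
  by rewrite sumr_const card_ord -[N%:R *+ _]mulr_natl mulKf// pnatr_eq0.
move=> i _; rewrite exchange_big/= (bigD1 i)//= [X in _ + X]big1 ?addr0.
  by rewrite sum_cos_gridB ?eqxx ?mulr1//; apply: leq_trans nN; exact: ltn_ord.
move=> j ji; rewrite sum_cos_gridB.
- by rewrite (_ : (i == j :> nat) = false) ?mulr0// eq_sym; exact/negbTE.
- by apply: leq_trans nN; exact: ltn_ord.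
- by apply: leq_trans nN; exact: ltn_ord.
Qed.

Lemma sum_succ_eq n :
  \sum_(i < n.+1) \sum_(j < n.+1) (i.+1 == j)%:R = n%:R :> R.
Proof.
rewrite big_ord_recr/= [X in _ + X]big1 ?addr0; last first.
  by move=> j _; rewrite gtn_eqF.
rewrite (eq_bigr (fun=> 1)); first by rewrite sumr_const card_ord.
move=> i _; rewrite (bigD1 (lift ord0 i))//= /bump /= add1n eqxx big1 ?addr0//.
move=> j /negbTE; rewrite -val_eqE/= /bump /= add1n eq_sym => ->.
by [].
Qed.

(** The product with a cosine shifts frequencies by one: after summation only the pairs with i - j =
    1 or -1 contribute, n of each with weight 1/2, so the mean cosine is n/(n+1). Frequencies now
    reach n+1, whence n+1 < N. *)
Lemma sum_fejer_cos_grid n N x : (n.+1 < N)%N ->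
  \sum_(l < N) fejer n (x - grid N l) * (1 - cos (x - grid N l)) =
  N%:R / n.+1%:R.
Proof.
move=> nN; under eq_bigr do rewrite mulrBr mulr1.
rewrite sumrB sum_fejer_grid; last exact: ltnW.
suff -> : \sum_(l < N) fejer n (x - grid N l) * cos (x - grid N l) =
    n.+1%:R^-1 * (N%:R * n%:R).
  by rewrite -[n.+1%:R]natr1; field; rewrite natr1 pnatr_eq0.
have iN (i : 'I_n.+1) : (i.+1 < N)%N.
  by apply: leq_ltn_trans nN; exact: ltn_ord.
have iN' (i : 'I_n.+1) : (i < N)%N by exact: ltnW.
rewrite /fejer; under eq_bigr do rewrite -mulrA mulr_suml.
rewrite -mulr_sumr; congr (_ * _).
rewrite exchange_big/=.
transitivity (\sum_(i < n.+1) \sum_(j < n.+1)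
   (2^-1 * (N%:R * (i.+1 == j)%:R) + 2^-1 * (N%:R * (i == j.+1 :> nat)%:R)) : R).
  apply: eq_bigr => i _; under eq_bigr do rewrite mulr_suml.
  rewrite exchange_big/=; apply: eq_bigr => j _.
  rewrite -(@sum_cos_gridB N i.+1 j x)// -(@sum_cos_gridB N i j.+1 x)//.
  rewrite !mulr_sumr -big_split/=; apply: eq_bigr => l _.
  rewrite -!natr1; move: (x - _) => y.
  rewrite (_ : (i%:R + 1 - j%:R) * y = (i%:R - j%:R) * y + y); last by ring.
  rewrite (_ : (i%:R - (j%:R + 1)) * y = (i%:R - j%:R) * y - y); last by ring.
  by rewrite cosD cosB; field.
under eq_bigr do rewrite big_split/= -!mulr_sumr.
rewrite big_split/= -!mulr_sumr sum_succ_eq exchange_big/=.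
under [X in _ + 2^-1 * (_ * X)]eq_bigr => j _ do under eq_bigr => i _ do rewrite eq_sym.
by rewrite sum_succ_eq; field.
Qed.

End fejer.

(** * Trigonometric polynomials in several variables and approximation on cubes *)

Section trigonometric_polynomials.
Context {R : realType} {k : nat}.
Implicit Types (S T : ('I_k -> R) -> R).

(** A term is a triple of amplitude, frequency vector and phase. The phase makes the class closed
    under products without a separate family of sines. *)
Definition trig_poly T := exists s : seq (R * ('I_k -> R) * R),
  forall x, T x = \sum_(e <- s) e.1.1 * cos (\sum_j e.1.2 j * x j + e.2).

Lemma trig_polyD S T : trig_poly S -> trig_poly T ->
  trig_poly (fun x => S x + T x).
Proof.
by move=> [s sS] [t tT]; exists (s ++ t) => x; rewrite big_cat/= sS tT.
Qed.

Lemma trig_polyM S T : trig_poly S -> trig_poly T ->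
  trig_poly (fun x => S x * T x).
Proof.
move=> [s sS] [t tT].
exists ([seq (a.1.1 * b.1.1 / 2, fun j => a.1.2 j + b.1.2 j, a.2 + b.2) | a <- s, b <- t] ++
  [seq (a.1.1 * b.1.1 / 2, fun j => a.1.2 j - b.1.2 j, a.2 - b.2) | a <- s, b <- t]) => x.
rewrite big_cat/= !big_allpairs_dep/= sS tT big_distrlr/= -big_split/=.
apply: eq_bigr => a _; rewrite -big_split/=; apply: eq_bigr => b _.
set A := \sum_j _; set B := \sum_j _.
rewrite (_ : \sum_j (a.1.2 j + b.1.2 j) * x j = A + B); last first.
  by rewrite /A /B -big_split/=; apply: eq_bigr => j _; rewrite mulrDl.
rewrite (_ : \sum_j (a.1.2 j - b.1.2 j) * x j = A - B); last first.
  by rewrite /A /B -sumrB; apply: eq_bigr => j _; rewrite mulrBl.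
rewrite (_ : A + B + (a.2 + b.2) = (A + a.2) + (B + b.2)); last by ring.
rewrite (_ : A - B + (a.2 - b.2) = (A + a.2) - (B + b.2)); last by ring.
by move: (A + _) (B + _) => u v; rewrite cosD cosB; field.
Qed.

Lemma trig_poly_cst c : trig_poly (fun=> c).
Proof.
exists [:: (c, fun=> 0, 0)] => x.
by rewrite big_seq1/= big1 ?addr0 ?cos0 ?mulr1// => j _; rewrite mul0r.
Qed.

Lemma trig_poly_cos j (a b : R) : trig_poly (fun x => cos (a * x j + b)).
Proof.
exists [:: (1, fun i => a * (i == j)%:R, b)] => x.
rewrite big_seq1/= mul1r (bigD1 j)//= big1 ?addr0 ?eqxx ?mulr1//.
by move=> i /negbTE ->; rewrite mulr0 mul0r.
Qed.

Lemma trig_poly_sum (I : Type) (r : seq I) (F : I -> ('I_k -> R) -> R) :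
  (forall i, trig_poly (F i)) -> trig_poly (fun x => \sum_(i <- r) F i x).
Proof.
move=> H; elim: r => [|i r IH].
  by have [s sE] := trig_poly_cst 0; exists s => x; rewrite big_nil -sE.
by have [s sE] := trig_polyD (H i) IH; exists s => x; rewrite big_cons -sE.
Qed.

Lemma trig_poly_prod (I : Type) (r : seq I) (F : I -> ('I_k -> R) -> R) :
  (forall i, trig_poly (F i)) -> trig_poly (fun x => \prod_(i <- r) F i x).
Proof.
move=> H; elim: r => [|i r IH].
  by have [s sE] := trig_poly_cst 1; exists s => x; rewrite big_nil -sE.
by have [s sE] := trig_polyM (H i) IH; exists s => x; rewrite big_cons -sE.
Qed.

Lemma trig_poly_fejer n j (a b : R) :
  trig_poly (fun x => fejer n (a * x j + b)).
Proof.
apply: trig_polyM; first exact: trig_poly_cst.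
apply: trig_poly_sum => p; apply: trig_poly_sum => q.
have [s sE] := trig_poly_cos j ((p%:R - q%:R) * a) ((p%:R - q%:R) * b).
by exists s => x; rewrite -sE; congr cos; ring.
Qed.

End trigonometric_polynomials.

(** Only u is confined to K; v may be any nearby point. This matters because the nodes at which g
    will be sampled can lie outside the cube. *)
Lemma compact_unif_cont {R : realType} (V : normedModType R) (K : set V) (g : V -> R) (e : R) :
  compact K -> continuous g -> 0 < e ->
  exists2 r, 0 < r & forall u v, K u -> `|v - u| < r -> `|g v - g u| < e.
Proof.
move=> /compact_near_coveringP cK cg e0.
have /= H := cK R (0%R^'+) (fun r u => forall v, `|v - u| < r -> `|g v - g u| < e) _.
have [r [Kr r0]] : exists r, K `<=` (fun u => forall v, `|v - u| < r -> `|g v - g u| < e) /\ 0 < r.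
  apply: (@filter_ex _ (0%R^'+)); near=> r; split.
    near: r; apply: H => u Ku.
    have /cvgrPdist_lt/(_ (e/2)) := cg u; rewrite divr_gt0// => /(_ isT).
    move=> /nbhs_ballP[d /= d0 dP].
    near=> u' r => v vu'.
    have vd (w : V) : ball u d w -> `|g u - g w| < e / 2 by exact: dP.
    have u'd : `|u - u'| < d / 2 by near: u'; apply: cvgr_dist_lt => //; rewrite divr_gt0.
    have rd : r < d / 2 by near: r; apply: nbhs_right_lt; rewrite divr_gt0.
    rewrite -[g v](subrK (g u)) -addrA (le_lt_trans (ler_normD _ _))// [e]splitr ltrD//.
      rewrite distrC vd// -ball_normE/= -(subrK u' u) -addrA (le_lt_trans (ler_normD _ _))//.
      by rewrite [d]splitr ltrD// distrC (lt_trans vu').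
    by rewrite vd// -ball_normE/= (lt_trans u'd)// gtr_pMr// invf_lt1// ltr1n.
  near: r; exact: nbhs_right_gt.
by exists r => // u v Ku; exact: Kr.
Unshelve. all: by end_near. Qed.

Section trig_approximation.
Context {R : realType}.

Lemma rV_norm_le k (v : 'rV[R]_k) (b : R) :
  0 <= b -> (forall j, `|v ord0 j| <= b) -> `|v| <= b.
Proof.
move=> b0 vb; rewrite /Num.norm/= mx_normrE; apply: bigmax_le => // -[i j] _ /=.
by rewrite ord1.
Qed.

(** The bound pi + 1 is what |x/A - grid point| can reach when |x| <= A. Past pi the cosine is read
    at 2 pi - |y|, which is at least pi - 1 >= 1 >= d. *)
Lemma cos_le_cos_far (y d : R) : 0 < d <= 1 -> d <= `|y| <= pi + 1 -> cos y <= cos d.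
Proof.
move=> /andP[d0 d1] /andP[dy ypi]; rewrite -cos_norm.
have p2 := @pi_ge2 R.
wlog yp : y dy ypi / `|y| <= pi.
  move=> H; have [yp|yp] := leP `|y| pi; first exact: H.
  have y2 : `|pi *+ 2 - `|y| | = pi *+ 2 - `|y|.
    by rewrite ger0_norm// -mulr_natr; lra.
  have <- : cos (pi *+ 2 - `|y|) = cos `|y| by rewrite addrC cosD2pi cosN.
  by rewrite -y2; apply: H; rewrite y2 -mulr_natr; lra.
move: dy; rewrite le_eqVlt => /orP[/eqP ->//|dy].
by rewrite ltW// ltr_cos// in_itv/= ?(ltW d0) ?(le_trans d1)//; lra.
Qed.

(* The Fejer kernel is averaged over a grid instead of integrated, so that the
   approximant is a finite sum: the weights w are nonnegative, sum to 1 exactly,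
   and concentrate near x because their first cosine moment is 1/(n+1). *)
Lemma trig_poly_approx k (g : 'rV[R]_k -> R) (C A e : R) :
  continuous g -> (forall v, `|g v| <= C) -> 0 < A -> 0 < e ->
  exists T : ('I_k -> R) -> R, [/\ trig_poly T,
    forall x, `|T x| <= C &
    forall x, (forall j, `|x j| <= A) -> `|T x - g (\row_j x j)| <= e].
Proof.
move=> cg gC A0 e0.
have C0 : 0 <= C by apply: le_trans (gC 0).
pose K : set 'rV[R]_k := [set v | forall j, `[(- A), A]%classic (v ord0 j)].
have cK : compact K.
  by apply: (@rV_compact R k (fun=> `[(- A), A]%classic)) => j; exact: segment_compact.
have e20 : 0 < e / 2 by rewrite divr_gt0.
have [r r0 Kr] := compact_unif_cont cK cg e20.
(* If every |y j| is below d, the node lies within A d <= r/2 < r of x, and uniform continuity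
   applies. *)
pose d := Num.min 1 (r / A / 2).
have d01 : 0 < d <= 1 by rewrite lt_min ltr01 !divr_gt0//= ge_min lexx.
have [d0 d1] := andP d01.
pose h := 1 - cos d.
have h0 : 0 < h.
  rewrite subr_gt0 -[ltRHS](@cos0 R) ltr_cos// in_itv/= ?lexx ?pi_ge0 ?(ltW d0)//=.
  by rewrite (le_trans d1)// (le_trans _ (pi_ge2 R))// ler1n.
(* n is such that (2C/h) k / (n+1) <= e/2, the total contribution of the distant nodes. *)
pose n := Num.truncn (2 * (C * 2) * k%:R / (h * e)).
have nP : 2 * (C * 2) * k%:R / (h * e) < n.+1%:R.
  by apply: truncnS_gt.
pose N := n.+2.
have N0 : N%:R != 0 :> R by rewrite pnatr_eq0.
pose y (x : 'I_k -> R) (l : {ffun 'I_k -> 'I_N}) j := x j / A - grid N (l j).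
pose w x l := \prod_j (fejer n (y x l j) / N%:R).
have w0 x l : 0 <= w x l.
  by apply: prodr_ge0 => j _; rewrite divr_ge0// fejer_ge0.
have w1 x : \sum_l w x l = 1.
  rewrite /w -(bigA_distr_bigA (fun j (l : 'I_N) => fejer n (x j / A - grid N l) / N%:R))/=.
  by apply: big1 => j _; rewrite -mulr_suml sum_fejer_grid// divff.
have wcos x j0 : \sum_l w x l * (1 - cos (y x l j0)) = n.+1%:R^-1.
  pose F j (l : 'I_N) := fejer n (x j / A - grid N l) / N%:R *
    (if j == j0 then 1 - cos (x j / A - grid N l) else 1).
  transitivity (\sum_(l : {ffun 'I_k -> 'I_N}) \prod_j F j (l j)).
    apply: eq_bigr => l _; rewrite /w /F [RHS]big_split/=; congr (_ * _).
    rewrite (bigD1 j0)//= eqxx big1 ?mulr1// => j /negbTE -> //.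
  rewrite -bigA_distr_bigA/= (bigD1 j0)//= [X in _ * X]big1 ?mulr1; last first.
    move=> j /negbTE jj0; rewrite /F jj0; under eq_bigr do rewrite mulr1.
    by rewrite -mulr_suml sum_fejer_grid// divff.
  rewrite /F eqxx; under eq_bigr do rewrite mulrAC.
  by rewrite -mulr_suml sum_fejer_cos_grid// mulrAC divff// mul1r.
pose a (l : {ffun 'I_k -> 'I_N}) : 'rV[R]_k := \row_j (A * grid N (l j)).
exists (fun x => \sum_l w x l * g (a l)); split.
- apply: trig_poly_sum => l; apply: trig_polyM; last exact: trig_poly_cst.
  apply: trig_poly_prod => j; apply: trig_polyM; last exact: trig_poly_cst.
  have [s sE] := @trig_poly_fejer R k n j A^-1 (- grid N (l j)).
  by exists s => x; rewrite -sE /y mulrC.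
- move=> x; rewrite (le_trans (ler_norm_sum _ _ _))//.
  rewrite (@le_trans _ _ (\sum_l w x l * C))//.
    by apply: ler_sum => l _; rewrite normrM ger0_norm// ler_wpM2l.
  by rewrite -mulr_suml w1 mul1r.
- move=> x xA; rewrite -[g _]mul1r -(w1 x) mulr_suml -sumrB.
  rewrite (le_trans (ler_norm_sum _ _ _))//.
  (* Chebyshev's argument: a near node costs e/2; at a far node some coordinate has 1 - cos y >= h,
     so the crude bound 2C is at most 2C/h times the sum of the 1 - cos y. *)
  rewrite (@le_trans _ _ (\sum_l w x l * (e / 2 + C * 2 / h * \sum_j (1 - cos (y x l j)))))//.
    apply: ler_sum => l _; rewrite -mulrBr normrM ger0_norm// ler_wpM2l//.
    have c0 j : 0 <= 1 - cos (y x l j) by rewrite subr_ge0 cos_le1.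
    have [yd|] := pselect (forall j, `|y x l j| < d).
      rewrite (@le_trans _ _ (e / 2))//; last first.
        by rewrite lerDl mulr_ge0 ?divr_ge0 ?mulr_ge0 ?(ltW h0)// sumr_ge0.
      apply/ltW/Kr.
        move=> j; rewrite /= mxE in_itv/= -ler_norml; exact: xA.
      rewrite (@le_lt_trans _ _ (A * d))//; last first.
        rewrite (@le_lt_trans _ _ (r / 2))//; last by rewrite gtr_pMr// invf_lt1// ltr1n.
        rewrite -ler_pdivlMl//; rewrite /d ge_min; apply/orP; right.
        by rewrite le_eqVlt; apply/orP; left; apply/eqP; field; exact: lt0r_neq0.
      apply: rV_norm_le => [|j]; first by rewrite mulr_ge0// ltW.
      rewrite !mxE; have := yd j; rewrite /y => /ltW.
      rewrite -(ler_pM2l A0) -[A in X in X -> _](gtr0_norm A0) -normrM distrC.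
      by rewrite (gtr0_norm A0) mulrBr mulrCA divff ?mulr1 ?lt0r_neq0.
    move=> /existsNP[j /negP]; rewrite -leNgt => dy.
    rewrite (@le_trans _ _ (C * 2))//.
      by rewrite (le_trans (ler_normB _ _))// mulr_natr mulr2n lerD.
    rewrite (@le_trans _ _ (C * 2 / h * (1 - cos (y x l j))))//.
      rewrite -mulrA ler_peMr ?mulr_ge0// ler_pdivlMl// mulr1 lerD2l lerN2.
      apply: cos_le_cos_far => //; rewrite dy/=.
      rewrite /y /grid opprB addrA addrAC.
      rewrite ler_norml; have p0 := @pi_gt0 R.
      have : `|x j / A| <= 1.
        by rewrite normrM normfV (gtr0_norm A0) ler_pdivrMr// mul1r.
      rewrite ler_norml => /andP[x1 x2].
      have l1 : (l j)%:R / N%:R <= 1 :> R.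
        by rewrite ler_pdivrMr ?ltr0n// mul1r ler_nat ltnW.
      have l0 : 0 <= (l j)%:R / N%:R :> R by rewrite divr_ge0.
      move: l0 l1; rewrite -[2 * pi * _ / _]mulrA; move: (_ / N%:R) => z z0 z1.
      by apply/andP; split; nra.
    rewrite (@le_trans _ _ (C * 2 / h * \sum_j (1 - cos (y x l j))))//.
      rewrite ler_wpM2l ?divr_ge0 ?mulr_ge0 ?(ltW h0)//.
      by rewrite (bigD1 j)//= lerDl sumr_ge0.
    by rewrite lerDr divr_ge0// ltW.
  under eq_bigr do rewrite mulrDr.
  rewrite big_split/= -mulr_suml w1 mul1r.
  under eq_bigr do rewrite mulrCA mulr_sumr.
  rewrite -mulr_sumr exchange_big/=.
  under [in leLHS]eq_bigr do rewrite wcos.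
  rewrite sumr_const card_ord [leRHS]splitr lerD2l.
  rewrite -[_ *+ k]mulr_natl mulrA ler_pdivrMr ?ltr0n//.
  rewrite -ler_pdivrMl ?divr_gt0// ltW//; apply: le_lt_trans nP.
  by rewrite le_eqVlt; apply/orP; left; apply/eqP; field; rewrite !lt0r_neq0.
Qed.

End trig_approximation.

(** * Tail bounds from characteristic functions *)

Section tightness.
Context {R : realType}.

Lemma integral_uniform_1Bcos (z : R) : z != 0 ->
  (\int[uniform_prob (@ltr01 R)]_t (1 - cos (t * z))%:E = (1 - sin z / z)%:E)%E.
Proof.
move=> z0; rewrite integral_uniform.
- rewrite subr0 invr1 mul1e.
  have dF (x : R) : is_derive x 1 (fun t : R => t - sin (t * z) / z) (1 - cos (x * z)).
    apply: is_deriveB; rewrite (_ : cos _ = z^-1 *: (cos (x * z) * z)); last first.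
      by rewrite /GRing.scale/= mulrCA mulVf// mulr1.
    rewrite (_ : (fun t => sin (t * z) / z) = z^-1 \*: (sin \o (fun t => t * z))); last first.
      by apply/funext => t /=; rewrite mulrC.
    by apply: is_deriveZ; apply: is_derive1_comp; exact: is_derive1_mulr.
  rewrite (@continuous_FTC2 _ _ (fun t : R => t - sin (t * z) / z))//.
  + by rewrite mul1r mul0r sin0 mul0r subrr sube0.
  + apply: continuous_subspaceT => x; apply: cvgB; first exact: cvg_cst.
    apply: continuous_comp; last exact: continuous_cos.
    exact: is_derive1_continuous (is_derive1_mulr _ _).
  + split.
    * by move=> x _; have := dF x; case.
    * by apply: cvg_at_right_filter; exact: is_derive1_continuous (dF 0).
    * by apply: cvg_at_left_filter; exact: is_derive1_continuous (dF 1).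
  + by move=> x _; rewrite derive1E; case: (dF x).
- apply/measurable_EFinP/measurable_funB => //; apply: measurable_fun_cos.
  exact: measurable_funM.
- by move=> x; rewrite lee_fin subr_ge0 cos_le1.
Qed.

Lemma integrable_cos d (T : measurableType d) (mu : {finite_measure set T -> \bar R})
    (X : T -> R) : measurable_fun setT X ->
  mu.-integrable setT (EFin \o (fun w => cos (X w))).
Proof.
move=> mX; apply: (@bounded_integrable _ _ _ _ _ 1) => [|w]; last exact: cos_max.
exact: measurable_fun_cos.
Qed.

Lemma integrable_sin d (T : measurableType d) (mu : {finite_measure set T -> \bar R})
    (X : T -> R) : measurable_fun setT X ->
  mu.-integrable setT (EFin \o (fun w => sin (X w))).
Proof.
move=> mX; apply: (@bounded_integrable _ _ _ _ _ 1) => [|w]; last exact: sin_max.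
exact: measurable_fun_sin.
Qed.

Lemma integral_1Bcos d (T : measurableType d) (P : probability T R) (X : T -> R) :
  measurable_fun setT X ->
  (\int[P]_w (1 - cos (X w))%:E = (1 - \int[P]_w cos (X w))%:E)%E.
Proof.
move=> mX.
have i1 : P.-integrable setT (EFin \o (fun _ : T => 1 : R)).
  by apply: (@bounded_integrable _ _ _ _ _ 1) => // w; rewrite normr1.
rewrite EFin_Rintegral//; last first.
  exact: (integrableB measurableT i1 (integrable_cos P mX)).
by rewrite RintegralB ?Rintegral_prob_cst//; exact: integrable_cos.
Qed.

Lemma normr_Rintegral_cos d (T : measurableType d) (P : probability T R) (X : T -> R) :
  measurable_fun setT X -> `|\int[P]_w cos (X w)| <= 1.
Proof.
move=> mX; rewrite (le_trans (le_normr_Rintegral _ _))//; first exact: integrable_cos.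
rewrite -[leRHS](Rintegral_prob_cst P).
apply: le_Rintegral => //.
- exact: (integrable_norm (integrable_cos P mX)).
- by apply: (@bounded_integrable _ _ _ _ _ 1) => // w; rewrite normr1.
- by move=> w _; exact: cos_max.
Qed.

Lemma measurable_Rintegral_cos d (T : measurableType d) (P : probability T R) (X : T -> R) :
  measurable_fun setT X ->
  measurable_fun setT (fun t : measurableTypeR R => \int[P]_w cos (t * X w)).
Proof.
move=> mX; have m2 : measurable_fun setT
    (fun z : measurableTypeR R * T => (1 - cos (z.1 * X z.2))%:E).
  apply/measurable_EFinP/measurable_funB => //; apply: measurable_fun_cos.
  by apply: measurable_funM => //; exact: measurableT_comp.
have := @measurable_fun_fubini_tonelli_F _ _ _ _ _ P _ m2.
rewrite /fubini_F/= => Hm.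
rewrite (_ : (fun t => _) = (fun t : R => 1 - fine (\int[P]_w (1 - cos (t * X w))%:E)%E)).
  apply: measurable_funB => //; apply: measurableT_comp => //; apply: Hm.
  by move=> z; rewrite lee_fin subr_ge0 cos_le1.
apply/funext => t; rewrite integral_1Bcos/= ?subKr//.
exact: measurable_funM.
Qed.

(** Averaging 1 - cos(t e X) over t in [0, 1] gives 1 - sin(eX)/(eX), which is at least 1/2 as soon
    as |eX| >= 2; Tonelli exchanges the average with the expectation. *)
Lemma tail_le_charfun d (T : measurableType d) (P : probability T R) (X : T -> R) (e : R) :
  measurable_fun setT X -> 0 < e ->
  (P [set w | (2 / e <= `|X w|)%R] <=
  (2 * \int[uniform_prob (@ltr01 R)]_t (1 - \int[P]_w cos (t * (e * X w))))%:E)%E.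
Proof.
move=> mX e0.
pose U : probability _ R := uniform_prob (@ltr01 R).
have meX (t : R) : measurable_fun setT (fun w => t * (e * X w)).
  by apply: measurable_funM => //; exact: measurable_funM.
have m2 : measurable_fun setT (fun z : measurableTypeR R * T => cos (z.1 * (e * X z.2))).
  apply: measurable_fun_cos.
  apply: measurable_funM => //; apply: measurable_funM => //.
  exact: measurableT_comp.
have mA : measurable [set w | (2 / e <= `|X w|)%R].
  by apply: measurable_set_ler; exact: measurableT_comp.
have -> : (2 * \int[U]_t (1 - \int[P]_w cos (t * (e * X w))))%:E =
    (2%:E * \int[P]_w \int[U]_t (1 - cos (t * (e * X w)))%:E)%E.
  rewrite EFinM; congr (_ * _)%E.
  rewrite -(@fubini_tonelli _ _ _ _ _ U P (fun z => (1 - cos (z.1 * (e * X z.2)))%:E))/=.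
  - under eq_integral do rewrite integral_1Bcos//.
    rewrite EFin_Rintegral//.
    apply: (@bounded_integrable _ _ _ _ _ 2) => [|t].
      by apply: measurable_funB => //; apply: measurable_Rintegral_cos; exact: measurable_funM.
    apply: (@le_trans _ _ (1 + 1)) => //.
    by rewrite (le_trans (ler_normB _ _))// normr1 lerD2l normr_Rintegral_cos.
  - by apply/measurable_EFinP; exact: measurable_funB.
  - by move=> z; rewrite lee_fin subr_ge0 cos_le1.
rewrite (_ : P _ = 2%:E * (2^-1%:E * P [set w | (2 / e <= `|X w|)%R]))%E; last first.
  by rewrite muleA -EFinM divff// mul1e.
rewrite lee_pmul2l// -integral_cst// [leLHS]integral_mkcond.
apply: ge0_le_integral => //.
- move=> w _; rewrite patchE; case: ifP => // _; rewrite lee_fin//.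
- by apply/measurable_restrict => //; exact: measurable_cst.
- have := @measurable_fun_fubini_tonelli_G _ _ _ _ _ U (fun z : measurableTypeR R * T => (1 - cos (z.1 * (e * X z.2)))%:E).
  apply.
  + by apply/measurable_EFinP; exact: measurable_funB.
  + by move=> z; rewrite lee_fin subr_ge0 cos_le1.
- move=> w _; rewrite patchE; case: ifPn => [|_]; last first.
    by apply: integral_ge0 => t _; rewrite lee_fin subr_ge0 cos_le1.
  rewrite inE/= => Xw.
  have z2 : 2 <= `|e * X w| by rewrite normrM (gtr0_norm e0) -ler_pdivrMl// mulrC.
  have z0 : e * X w != 0 by rewrite -normr_gt0 (lt_le_trans _ z2).
  rewrite integral_uniform_1Bcos// lee_fin.
  have : `|sin (e * X w) / (e * X w)| <= 2^-1.
    rewrite normrM normfV ler_pdivrMr ?normr_gt0//.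
    by rewrite (le_trans (sin_max _))// ler_pdivlMl ?mulr1.
  by rewrite ler_norml; lra.
Qed.

End tightness.

(** On the exceptional sets the integrands differ by at most 2C. This serves both the truncation to
    a cube and the use of convergence in probability. *)
Lemma Rintegral_dist_le (R : realType) k d (T : measurableType d) (Q : probability T R) (f g : T -> R)
    (A : 'I_k -> set T) (C a : R) :
  measurable_fun setT f -> measurable_fun setT g -> (forall j, measurable (A j)) ->
  0 <= C -> (forall w, `|f w| <= C) -> (forall w, `|g w| <= C) -> 0 <= a ->
  (forall w, (forall j, ~ A j w) -> `|f w - g w| <= a) ->
  `|\int[Q]_w f w - \int[Q]_w g w| <= a + C *+ 2 * \sum_j fine (Q (A j)).
Proof.
move=> mf mg mA C0 fC gC a0 fg.
have i_f := bounded_integrable Q mf fC.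
have ig := bounded_integrable Q mg gC.
rewrite -RintegralB// (le_trans (le_normr_Rintegral _ _))//; first exact: integrable_realB.
have iA j : Q.-integrable setT (EFin \o \1_(A j)) by exact: integrable_indic.
have isA : Q.-integrable setT (EFin \o (fun w => \sum_j (\1_(A j) w : R))).
  exact: integrable_real_sum.
have isA2 := integrable_realZl (C *+ 2) measurableT isA.
have ia : Q.-integrable setT (EFin \o (fun _ : T => a)).
  by apply: (@bounded_integrable _ _ _ _ _ a) => // w; rewrite ger0_norm.
rewrite (@le_trans _ _ (\int[Q]_w (a + C *+ 2 * \sum_j \1_(A j) w)))//.
  apply: le_Rintegral => //.
  - exact: (integrable_norm (integrable_realB measurableT i_f ig)).
  - exact: integrable_realD.
  - move=> w _; have [Aw|/existsNP[j /contrapT Ajw]] := pselect (forall j, ~ A j w).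
      rewrite (le_trans (fg w Aw))// lerDl mulr_ge0 ?mulrn_wge0// sumr_ge0//.
    rewrite (le_trans (ler_normB _ _))// (le_trans (lerD (fC w) (gC w)))// -mulr2n.
    rewrite ler_wpDl// ler_peMr ?mulrn_wge0// (bigD1 j)//= indicE mem_set//.
    by rewrite lerDl sumr_ge0.
rewrite RintegralD// RintegralZl// Rintegral_sum// Rintegral_prob_cst.
rewrite le_eqVlt; apply/orP; left; apply/eqP; congr (_ + _ * _).
by apply: eq_bigr => j _; rewrite /Rintegral integral_indic// setIT.
Qed.

(** * From characteristic functions to convergence in law *)

Section levy_continuity.
Context {R : realType}.

(** By dominated convergence the averaged 1 - Re(characteristic function) of the limit tends to 0
    with the scale a. At one fixed a the averages for [P n] converge to that of the limit, and they
    control the tails beyond 2/a. *)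
Lemma tight_of_cvg_charfun (dO : nat -> measure_display)
    (Om : forall n, measurableType (dO n)) (P : forall n, probability (Om n) R)
    (X : forall n, Om n -> R)
    d' (Om' : measurableType d') (P' : probability Om' R) (Y : Om' -> R) (e : R) :
  (forall n, measurable_fun setT (X n)) -> measurable_fun setT Y ->
  (forall t, \int[P n]_w cos (t * X n w) @[n --> \oo] --> \int[P']_w cos (t * Y w)) ->
  0 < e ->
  exists2 A, 0 < A & \forall n \near \oo, (P n [set w | (A <= `|X n w|)%R] <= e%:E)%E.
Proof.
move=> mX mY XY e0.
pose U : probability _ R := uniform_prob (@ltr01 R).
pose h (a : R) := \int[U]_t (1 - \int[P']_w cos (t * (a * Y w))).
have mcosY (t a : R) : measurable_fun setT (fun w => t * (a * Y w)).
  by apply: measurable_funM => //; exact: measurable_funM.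
have i2 : U.-integrable setT (EFin \o (fun _ : R => 2 : R)).
  by apply: (@bounded_integrable _ _ _ _ _ 2) => // w; rewrite ger0_norm.
have h0 : h (m.+1%:R^-1) @[m --> \oo] --> 0.
  rewrite /h -[X in _ --> X](_ : \int[U]_t (1 - \int[P']_w (cst 1) w) = 0); last first.
    by rewrite !Rintegral_prob_cst subrr.
  apply: (Rintegral_dct _ _ _ i2) => //.
  - move=> m; apply: measurable_funB => //; apply: measurable_Rintegral_cos.
    exact: measurable_funM.
  - move=> t _; apply: cvgB; first exact: cvg_cst.
    apply: (@Rintegral_dct _ _ _ P' _ _ _ (cst 1)) => //.
    + by move=> m; exact: measurable_fun_cos.
    + move=> w _; rewrite -[X in _ --> X](@cos0 R) -[X in _ --> cos X](mulr0 t).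
      apply: continuous_cvg; first exact: continuous_cos.
      apply: cvgMr; rewrite -(mul0r (Y w)); apply: cvgMl.
      exact: cvg_harmonic.
    + by apply: (@bounded_integrable _ _ _ _ _ 1) => // w; rewrite normr1.
    + by move=> m w _; exact: cos_max.
  - move=> m t _; rewrite (le_trans (ler_normB _ _))// normr1 -[2]/(1+1) lerD2l.
    exact: normr_Rintegral_cos.
(* The tail bound carries a factor 2, and the average will be at most e/4 for the limit plus e/4 for
   the deviation from it. *)
have e4 : 0 < e / 4 by rewrite divr_gt0.
have [m hm] : exists m, h (m.+1%:R^-1) <= e / 4.
  have /cvgrPdist_le/(_ _ e4)[N _ HN] := h0; exists N.
  by have := HN N (leqnn N); rewrite sub0r normrN; exact: le_trans (ler_norm _).
pose a : R := m.+1%:R^-1; have a0 : 0 < a by rewrite invr_gt0.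
exists (2 / a); first by rewrite divr_gt0.
pose H n := \int[U]_t (1 - \int[P n]_w cos (t * (a * X n w))).
have mcosX n (t : R) : measurable_fun setT (fun w => t * (a * X n w)).
  by apply: measurable_funM => //; exact: measurable_funM.
have Hh : H n @[n --> \oo] --> h a.
  apply: (Rintegral_dct _ _ _ i2) => //.
  - move=> n; apply: measurable_funB => //; apply: measurable_Rintegral_cos.
    exact: measurable_funM.
  - move=> t _; apply: cvgB; first exact: cvg_cst.
    under eq_fun do under eq_Rintegral do rewrite mulrA.
    under eq_Rintegral do rewrite mulrA.
    exact: XY.
  - move=> n t _; rewrite (le_trans (ler_normB _ _))// normr1 -[2]/(1+1) lerD2l.
    exact: normr_Rintegral_cos.
move/cvgrPdist_le : Hh => /(_ _ e4)[N _ HN]; exists N => // n Nn /=.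
apply: (le_trans (tail_le_charfun (P n) (mX n) a0)); rewrite lee_fin -/U -/(H n).
have := HN n Nn; rewrite ler_norml => /andP[+ _]; rewrite -/a in hm; lra.
Qed.

Lemma measurable_trig_poly k d (T : measurableType d) (X : 'I_k -> T -> R) S :
  trig_poly S -> (forall j, measurable_fun setT (X j)) ->
  measurable_fun setT (fun w => S (X ^~ w)).
Proof.
move=> [s sS] mX; under eq_fun do rewrite sS.
apply: measurable_sum => i; apply: measurable_funM => //.
apply: measurable_fun_cos; apply: measurable_funD => //.
by apply: measurable_sum => j; exact: measurable_funM.
Qed.

(** Measurability is given coordinate by coordinate. The composite with g is the pointwise limit of
    trigonometric polynomials that approximate g within 1/(n+1) on the cube of half-side n+1. *)
Lemma measurable_continuous_rV k d (T : measurableType d) (X : 'I_k -> T -> R)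
    (g : 'rV[R]_k -> R) (C : R) :
  continuous g -> (forall v, `|g v| <= C) ->
  (forall j, measurable_fun setT (X j)) ->
  measurable_fun setT (fun w => g (\row_j X j w)).
Proof.
move=> cg gC mX.
have /choice[S SP] n := trig_poly_approx cg gC (ltr0Sn R n) (divr_gt0 (@ltr01 R) (ltr0Sn R n)).
apply: (@measurable_fun_cvg _ _ _ _ (fun n w => S n (X ^~ w))) => [n|w _].
  by apply: measurable_trig_poly => //; case: (SP n).
apply/cvgrPdist_le => e e0.
pose B := \sum_j `|X j w|.
have BX j : `|X j w| <= B by rewrite /B (bigD1 j)//= lerDl sumr_ge0.
near=> n; rewrite distrC.
have [_ _ Sn] := SP n.
apply: le_trans (Sn (X ^~ w) _) _ => [j|].
  apply: (le_trans (BX j)); near: n; exists (Num.truncn B) => // n /= Bn.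
  by rewrite ltW// (lt_le_trans (truncnS_gt B))// ler_nat.
rewrite div1r; near: n.
have /cvgrPdist_le/(_ _ e0)[N _ HN] := @cvg_harmonic R.
exists N => // m Nm /=; have := HN m Nm.
by rewrite /harmonic /= sub0r normrN ger0_norm// invr_ge0.
Unshelve. all: by end_near. Qed.

Section vectors.
Context (k : nat) (dO : nat -> measure_display)
  (Om : forall n, measurableType (dO n)) (P : forall n, probability (Om n) R)
  (X : forall n, 'I_k -> Om n -> R)
  (d' : measure_display) (Om' : measurableType d') (P' : probability Om' R)
  (Y : 'I_k -> Om' -> R).
Arguments X : clear implicits.
Hypothesis mX : forall n j, measurable_fun setT (X n j).
Hypothesis mY : forall j, measurable_fun setT (Y j).
Hypothesis cvg_cos : forall t : 'I_k -> R,
  \int[P n]_w cos (\sum_j t j * X n j w) @[n --> \oo] -->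
  \int[P']_w cos (\sum_j t j * Y j w).
Hypothesis cvg_sin : forall t : 'I_k -> R,
  \int[P n]_w sin (\sum_j t j * X n j w) @[n --> \oo] -->
  \int[P']_w sin (\sum_j t j * Y j w).

Let Rintegral_trig_poly d (T : measurableType d) (Q : probability T R) (V : 'I_k -> T -> R)
    (s : seq (R * ('I_k -> R) * R)) : (forall j, measurable_fun setT (V j)) ->
  \int[Q]_w (\sum_(e <- s) e.1.1 * cos (\sum_j e.1.2 j * V j w + e.2)) =
  \sum_(e <- s) e.1.1 * (cos e.2 * \int[Q]_w cos (\sum_j e.1.2 j * V j w) -
    sin e.2 * \int[Q]_w sin (\sum_j e.1.2 j * V j w)).
Proof.
move=> mV.
have mS (t : 'I_k -> R) : measurable_fun setT (fun w => \sum_j t j * V j w).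
  by apply: measurable_sum => j; exact: measurable_funM.
have ic a c : Q.-integrable setT (EFin \o (fun w => c * cos (\sum_j a j * V j w))).
  by apply: integrable_realZl => //; exact: integrable_cos.
have iS a c : Q.-integrable setT (EFin \o (fun w => c * sin (\sum_j a j * V j w))).
  by apply: integrable_realZl => //; exact: integrable_sin.
rewrite Rintegral_sum//.
  apply: eq_bigr => -[[c a] b] _ /=.
  under eq_Rintegral do rewrite cosD mulrBr ![cos (\sum_j _) * _]mulrC ![sin (\sum_j _) * _]mulrC !mulrA.
  rewrite RintegralB// !RintegralZl//; first by rewrite mulrBr !mulrA.
  - exact: integrable_sin.
  - exact: integrable_cos.
move=> [[c a] b] /=; apply: integrable_realZl => //; apply: integrable_cos.
exact: measurable_funD.
Qed.

Let cvg_trig_poly (S : ('I_k -> R) -> R) : trig_poly S ->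
  \int[P n]_w S ((X n) ^~ w) @[n --> \oo] --> \int[P']_w S (Y ^~ w).
Proof.
move=> [s sS].
under eq_fun do (under eq_Rintegral do rewrite sS; rewrite Rintegral_trig_poly//).
under eq_Rintegral do rewrite sS.
rewrite Rintegral_trig_poly//.
apply: cvg_sumr => e; apply: cvgMr; apply: cvgB; apply: cvgMr; [exact: cvg_cos|exact: cvg_sin].
Qed.

(** Tightness confines all the vectors, up to small probability, to one cube on which g is close to
    a trigonometric polynomial. That polynomial obeys the bound C everywhere, so the outside of the
    cube costs at most 2C times its probability, and its own expectations converge by hypothesis. *)
Lemma levy_continuity (g : 'rV[R]_k -> R) : continuous g ->
  (exists C, forall v, `|g v| <= C) ->
  ('E_(P n)[fun w => g (\row_j X n j w)] @[n --> \oo] --> 'E_P'[fun w => g (\row_j Y j w)])%E.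
Proof.
move=> cg [C gC].
have C0 : 0 <= C by exact: le_trans (gC 0).
have mgX n : measurable_fun setT (fun w => g (\row_j X n j w)).
  exact: measurable_continuous_rV gC _.
have mgY : measurable_fun setT (fun w => g (\row_j Y j w)).
  exact: measurable_continuous_rV gC _.
have igX n := bounded_integrable (P n) (mgX n) (fun w => gC _).
have igY := bounded_integrable P' mgY (fun w => gC _).
rewrite unlock; under eq_fun do rewrite EFin_Rintegral//.
rewrite EFin_Rintegral//; apply: cvg_EFin; first exact: nearW.
rewrite (_ : fine \o _ = fun n => \int[P n]_w g (\row_j X n j w))//.
apply/cvgrPdist_le => e e0.
have e8 : 0 < e / 8 by rewrite divr_gt0.
(* q bounds the probability that one coordinate leaves the cube: together the k coordinates cost at
   most 2C k q <= e/8. The added units keep the denominators positive when C or k is 0. *)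
pose q := e / 8 / (C *+ 2 + 1) / k.+1%:R.
have C21 : 0 < C *+ 2 + 1 by rewrite ltr_wpDl// mulrn_wge0.
have q0 : 0 < q by rewrite !divr_gt0.
have tX j : exists2 A, 0 < A & \forall n \near \oo, (P n [set w | (A <= `|X n j w|)%R] <= q%:E)%E.
  apply: (@tight_of_cvg_charfun _ _ P (fun n => X n j) _ _ P' (Y j)) => // t.
  have tE (V : 'I_k -> R) : \sum_i (if i == j then t else 0) * V i = t * V j.
    by rewrite (bigD1 j)//= eqxx big1 ?addr0// => i /negbTE ->; rewrite mul0r.
  (* A vector with a single nonzero entry isolates one coordinate. *)
  have := @cvg_cos (fun i => if i == j then t else 0).
  under eq_fun do under eq_Rintegral do rewrite tE.
  by under [X in _ --> X]eq_Rintegral do rewrite tE.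
have tY j : exists2 A, 0 < A & (P' [set w | (A <= `|Y j w|)%R] <= q%:E)%E.
  have [||||A A0 [N _ HN]] := @tight_of_cvg_charfun _ _ (fun=> P') (fun=> Y j) _ _ P' (Y j) q => //.
    by move=> t; exact: cvg_cst.
  by exists A => //; exact: (HN N (leqnn N)).
have /choice[AX AXP] j : exists A, 0 < A /\ \forall n \near \oo, (P n [set w | (A <= `|X n j w|)%R] <= q%:E)%E.
  by have [A ? ?] := tX j; exists A.
have /choice[AY AYP] j : exists A, 0 < A /\ (P' [set w | (A <= `|Y j w|)%R] <= q%:E)%E.
  by have [A ? ?] := tY j; exists A.
(* A exceeds every individual bound; the leading 1 keeps it positive when k = 0. *)
pose A := 1 + \sum_j (AX j + AY j).
have A0 : 0 < A.
  by rewrite ltr_wpDr// sumr_ge0// => j _; rewrite addr_ge0// ltW ?(AXP j).1 ?(AYP j).1.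
have AXA j : AX j <= A /\ AY j <= A.
  have : AX j + AY j <= A.
    rewrite /A (bigD1 j)//= addrCA lerDl addr_ge0// sumr_ge0// => i _.
    by rewrite addr_ge0// ltW ?(AXP i).1 ?(AYP i).1.
  by have := (AXP j).1; have := (AYP j).1; lra.
have [S [tS SC Sg]] := trig_poly_approx cg gC A0 e8.
have bad d (T : measurableType d) (Q : probability T R) (V : 'I_k -> T -> R) :
    (forall j, measurable_fun setT (V j)) ->
    (forall j, Q [set w | (A <= `|V j w|)%R] <= q%:E)%E ->
    `|\int[Q]_w g (\row_j V j w) - \int[Q]_w S (V ^~ w)| <= e / 4.
  move=> mV VA.
  have mA j : measurable [set w | (A <= `|V j w|)%R].
    by apply: measurable_set_ler; exact: measurableT_comp.
  rewrite (le_trans (@Rintegral_dist_le _ _ _ _ Q _ _ (fun j => [set w | (A <= `|V j w|)%R]) C (e / 8) _ _ mA _ _ _ _ _))//.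
  - exact: measurable_continuous_rV gC _.
  - exact: measurable_trig_poly.
  - exact: ltW.
  - move=> w Bw; rewrite distrC; apply: Sg => j; rewrite leNgt; apply/negP => jA.
    by apply: (Bw j) => /=; rewrite ltW.
  rewrite (_ : e / 4 = e / 8 + e / 8); last by field.
  rewrite lerD2l (@le_trans _ _ (C *+ 2 * (q *+ k)))//.
    rewrite ler_wpM2l ?mulrn_wge0// -[k in leRHS]card_ord -sumr_const ler_sum// => j _.
    by rewrite -lee_fin fineK// fin_num_measure.
  rewrite /q -mulr_natr; have D0 : 0 <= C *+ 2 by rewrite mulrn_wge0.
  move: (C *+ 2) D0 C21 => D D0 C21.

  rewrite (_ : D * _ = e / 8 * (D / (D + 1) * (k%:R / k.+1%:R))); last by ring.
  rewrite ler_piMr ?(ltW e8)// mulr_ile1 ?divr_ge0 ?(ltW C21)//.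
    by rewrite ler_pdivrMr// mul1r lerDl.
  by rewrite ler_pdivrMr ?ltr0n// mul1r ler_nat.
have YS := bad _ _ P' Y mY (fun j => le_trans (le_measure _ _ _ _) (AYP j).2).
have XS : \forall n \near \oo, `|\int[P n]_w g (\row_j X n j w) - \int[P n]_w S (X n ^~ w)| <= e / 4.
  have : \forall n \near \oo, forall j : 'I_k, (P n [set w | (AX j <= `|X n j w|)%R] <= q%:E)%E.
    by apply: filter_forall => j; exact: (AXP j).2.
  apply: filterS => n Hn; apply: bad => // j.
  apply: le_trans (Hn j); apply: le_measure; rewrite ?inE.
  - by apply: measurable_set_ler; exact: measurableT_comp.
  - by apply: measurable_set_ler; exact: measurableT_comp.
  - by move=> w /=; exact: le_trans (AXA j).1.
have SS : \forall n \near \oo, `|\int[P n]_w S (X n ^~ w) - \int[P']_w S (Y ^~ w)| <= e / 4.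
  have e4 : 0 < e / 4 by rewrite divr_gt0.
  by move/cvgrPdist_le : (cvg_trig_poly tS) => /(_ _ e4); apply: filterS => n; rewrite distrC.
have {}YS : `|\int[P']_w g (\row_j Y j w) - \int[P']_w S (Y ^~ w)| <= e / 4.
  apply: YS => j; rewrite ?inE.
  - by apply: measurable_set_ler; exact: measurableT_comp.
  - by apply: measurable_set_ler; exact: measurableT_comp.
  - by move=> w /=; exact: le_trans (AXA j).2.
near=> n.
have H1 : `|\int[P n]_w g (\row_j X n j w) - \int[P n]_w S (X n ^~ w)| <= e / 4 by near: n.
have H2 : `|\int[P n]_w S (X n ^~ w) - \int[P']_w S (Y ^~ w)| <= e / 4 by near: n.
move: H1 H2 YS; rewrite !ler_norml => /andP[? ?] /andP[? ?] /andP[? ?]; apply/andP; split; lra.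
Unshelve. all: by end_near. Qed.

End vectors.
End levy_continuity.

(** * Characteristic functions of Poisson integrals *)

Section standard_machine.
Context d (T : measurableType d) (R : realType).
Import HBNNSimple.
Local Open Scope ereal_scope.

(** Approximation by simple functions, packaged as an induction principle; the integration rule for
    densities and Campbell's formula are instances. *)
Lemma ge0_measurable_fun_ind (Q : (T -> \bar R) -> Prop) :
  (forall A, measurable A -> Q (fun x => (\1_A x)%:E)) ->
  (forall f g, (forall x, 0 <= f x) -> measurable_fun setT f ->
    (forall x, 0 <= g x) -> measurable_fun setT g -> Q f -> Q g ->
    Q (fun x => f x + g x)) ->
  (forall (c : R) f, (0 <= c)%R -> (forall x, 0 <= f x) -> measurable_fun setT f ->
    Q f -> Q (fun x => c%:E * f x)) ->
  (forall f_ : nat -> T -> \bar R, (forall n x, 0 <= f_ n x) ->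
    (forall n, measurable_fun setT (f_ n)) -> (forall n, Q (f_ n)) ->
    (forall x, nondecreasing_seq (f_ ^~ x)) -> Q (fun x => limn (f_ ^~ x))) ->
  forall f, (forall x, 0 <= f x) -> measurable_fun setT f -> Q f.
Proof.
move=> Q1 QD QZ Ql f f0 mf.
have Qs (h : {nnsfun T >-> R}) : Q (EFin \o h).
  have [N [s hE]] : exists N (s : nat -> R),
      forall x, h x = (\sum_(i < N) s i * \1_(h @^-1` [set s i]) x)%R.
    by eexists; eexists; exact: fimfunEord.
  (* The absolute values provide nonnegative coefficients and change nothing: s i matters only where
     h takes the value s i, and h >= 0. *)
  rewrite (_ : EFin \o h = fun x => \sum_(i < N) (`|s i| * \1_(h @^-1` [set s i]) x)%:E); last first.
    apply/funext => x; rewrite sumEFin /= {1}hE; congr EFin.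
    apply: eq_bigr => i _; rewrite indicE; have [|] := boolP (x \in _); last by rewrite !mulr0.
    by rewrite inE /= => <-; rewrite ger0_norm.
  elim: (index_enum _) => [|i r IH].
    rewrite (_ : (fun _ => _) = (fun x => (\1_(@set0 T) x)%:E)); first exact: Q1.
    by apply/funext => x; rewrite big_nil indic0.
  rewrite (_ : (fun _ => _) = (fun x => `|s i|%:E * (\1_(h @^-1` [set s i]) x)%:E +
    \sum_(i <- r) (`|s i| * \1_(h @^-1` [set s i]) x)%:E)); last first.
    by apply/funext => x; rewrite big_cons EFinM.
  apply: QD => //.
  - by apply: emeasurable_funM => //; exact/measurable_EFinP/measurable_indic.
  - by move=> x; apply: sume_ge0 => z _; rewrite lee_fin mulr_ge0.
  - apply: emeasurable_sum => z; apply/measurable_EFinP/measurable_funM => //.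
  - by apply: QZ => //; [exact/measurable_EFinP/measurable_indic|exact: Q1].
have -> : f = fun x => limn ((fun n x => (EFin \o nnsfun_approx measurableT mf n) x) ^~ x).
  by apply/funext => x; apply/esym/cvg_lim => //; exact: cvg_nnsfun_approx.
apply: Ql => //.
- by move=> n x /=; rewrite lee_fin; exact: fun_ge0.
- by move=> n; apply/measurable_EFinP.
- by move=> x m n mn; rewrite /= lee_fin; exact/lefP/nd_nnsfun_approx.
Qed.

End standard_machine.

(** * Products of characteristic functions under independence *)

Section independence.
Context {R : realType} d (Om : measurableType d) (P : probability Om R).
Import HBNNSimple.

(** The characteristic function at 1. Its argument is absorbed into the random variable, so that
    joint characteristic functions are values at linear combinations. *)
Definition cfun (X : Om -> R) : R[i] :=
  ((\int[P]_w cos (X w)) +i* (\int[P]_w sin (X w)))%C.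

(** Q will be a bounded function of the earlier variables times indicators of the later ones, so it
    has no sign: the passage from indicators to bounded h uses dominated convergence with bound C
    |Q|. *)
Lemma factor_bounded dT (T : measurableType dT) (X : Om -> T) (Q : Om -> R)
    (c C : R) (h : T -> R) :
  measurable_fun setT X -> P.-integrable setT (EFin \o Q) ->
  (forall A, measurable A ->
    \int[P]_w (\1_A (X w) * Q w) = c * fine (P (X @^-1` A))) ->
  measurable_fun setT h -> (forall x, `|h x| <= C) ->
  \int[P]_w (h (X w) * Q w) = c * \int[P]_w h (X w).
Proof.
move=> mX iQ H mh hC.
have mQ : measurable_fun setT Q by apply/measurable_EFinP; exact: measurable_int iQ.
have inQ : P.-integrable setT (EFin \o (fun w => C * `|Q w|)).
  by apply: integrable_realZl => //; exact: integrable_norm.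
have mhX (g : T -> R) : measurable_fun setT g -> measurable_fun setT (g \o X).
  by move=> mg; exact: measurableT_comp.
have ighX (g : T -> R) B : measurable_fun setT g -> (forall x, `|g x| <= B) ->
    P.-integrable setT (EFin \o (fun w => g (X w) * Q w)).
  move=> mg gB; apply: (@le_integrable_real _ _ _ _ _ _ (fun w => B * `|Q w|)) => //.
  - by apply: measurable_funM => //; exact: mhX.
  - by move=> w _; rewrite normrM ler_wpM2r.
  - by apply: integrable_realZl => //; exact: integrable_norm.
have sf (s : {nnsfun T >-> R}) : \int[P]_w (s (X w) * Q w) = c * \int[P]_w s (X w).
  have i1 (y : R) (A : set T) : measurable A -> P.-integrable setT (EFin \o (fun w => y * (\1_A (X w) * Q w))).
    move=> mA; apply: integrable_realZl => //; apply: (ighX _ 1).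
      exact: measurable_indic.
    by move=> x; rewrite indicE ger0_norm ?lern1 ?leq_b1.
  have i2 (y : R) (A : set T) : measurable A -> P.-integrable setT (EFin \o (fun w => y * \1_A (X w))).
    move=> mA; apply: integrable_realZl => //; apply: (@bounded_integrable _ _ _ _ _ 1).
      by apply: mhX; exact: measurable_indic.
    by move=> x; rewrite indicE ger0_norm ?lern1 ?leq_b1.
  under eq_Rintegral do (rewrite fimfunEord mulr_suml; under eq_bigr do rewrite -mulrA).
  under [in RHS]eq_Rintegral do rewrite fimfunEord.
  rewrite !Rintegral_sum// => [|i|i]; [|exact: i2|exact: i1].
  rewrite mulr_sumr; apply: eq_bigr => i _.
  set y := nth _ _ _; set A := s @^-1` [set y]; have mA : measurable A by exact: measurable_sfunP.
  have := i1 1 A mA; under [EFin \o _]eq_fun do rewrite mul1r; move=> i11.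
  have := i2 1 A mA; under [EFin \o _]eq_fun do rewrite mul1r; move=> i21.
  rewrite !RintegralZl// H// mulrCA; congr (_ * (_ * _)).
  rewrite /Rintegral; congr fine.
  rewrite (_ : (fun x => _) = (fun x => (\1_(X @^-1` A) x)%:E))//.
  rewrite integral_indic ?setIT//.
  by rewrite -[X in measurable X]setTI; exact: mX.
have pos (g : T -> R) B : measurable_fun setT g -> (forall x, 0 <= g x) ->
    (forall x, g x <= B) -> \int[P]_w (g (X w) * Q w) = c * \int[P]_w g (X w).
  move=> mg g0 gB; have mEg : measurable_fun setT (EFin \o g) by exact/measurable_EFinP.
  pose s := nnsfun_approx measurableT mEg.
  have sg x : s n x @[n --> \oo] --> g x.
    have Hx : EFin \o s ^~ x @ \oo --> (EFin \o g) x.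
      by apply: cvg_nnsfun_approx => // y _; rewrite lee_fin.
    exact: (fine_cvg Hx).
  have s0 n x : 0 <= s n x by exact: fun_ge0.
  have sB n x : s n x <= g x.
    rewrite -lee_fin /s nnsfun_approxE; apply: le_approx => // y _.
    by rewrite lee_fin.
  have L : \int[P]_w (s n (X w) * Q w) @[n --> \oo] --> \int[P]_w (g (X w) * Q w).
    apply: (@Rintegral_dct _ _ _ _ _ _ _ (fun w => B * `|Q w|)) => //.
    - by move=> n; apply: measurable_funM => //; exact: mhX.
    - by move=> w _; apply: cvgMl; exact: sg.
    - by apply: integrable_realZl => //; exact: integrable_norm.
    - by move=> n w _; rewrite normrM ler_wpM2r// ger0_norm// (le_trans (sB _ _)).
  have L2 : c * \int[P]_w s n (X w) @[n --> \oo] --> c * \int[P]_w g (X w).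
    apply: cvgMr; apply: (@Rintegral_dct _ _ _ _ _ _ _ (fun w => B)) => //.
    - by move=> n; exact: mhX.
    - apply: (@bounded_integrable _ _ _ _ _ `|B|) => //.
    - by move=> n w _; rewrite ger0_norm// (le_trans (sB _ _)).
  rewrite -(cvg_lim (@Rhausdorff R) L) -(cvg_lim (@Rhausdorff R) L2).
  by under eq_fun do rewrite sf.
have C0 w : 0 <= h w + C by have := hC w; rewrite ler_norml => /andP[+ _]; lra.
have iC : P.-integrable setT (EFin \o (fun w => C * Q w)) by exact: integrable_realZl.
have QE : \int[P]_w Q w = c.
  have := H setT measurableT; rewrite preimage_setT probability_setT /= mulr1.
  by under eq_Rintegral do rewrite indicE in_setT mul1r.
have ihX : P.-integrable setT (EFin \o (fun w => h (X w))).
  by apply: (bounded_integrable P (mhX _ mh)) => w; exact: hC.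
have ihQ : P.-integrable setT (EFin \o (fun w => h (X w) * Q w)) by exact: (ighX h C).
have iCc : P.-integrable setT (EFin \o (fun _ : Om => C)).
  by apply: (@bounded_integrable _ _ _ _ _ `|C|).
(* The case of nonnegative functions applied to h + C; the constant cancels because c is the
   integral of Q, as the choice A = [setT] shows. *)
have := pos (fun x => h x + C) (C + C) _ C0.
under eq_Rintegral do rewrite mulrDl.
rewrite !RintegralD// RintegralZl// QE Rintegral_prob_cst mulrDr [c * C]mulrC.
move=> /(_ _ _)/addIr; apply; first exact: measurable_funD.
by move=> x; rewrite lerD2r (le_trans (ler_norm _)).
Qed.

(** [independent] speaks of events only. The indicators of the n variables are exchanged one at a
    time for exponentials: [S m] collects the first m variables, [J m B] keeps the indicators of the
    others, and [key] is the induction on m. *)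
Lemma cfun_sum_independent dT (T : measurableType dT) n (X : 'I_n -> Om -> T)
    (f : 'I_n -> T -> R) :
  (forall i, measurable_fun setT (X i)) -> (forall i, measurable_fun setT (f i)) ->
  independent P X ->
  cfun (fun w => \sum_i f i (X i w)) = \prod_i cfun (fun w => f i (X i w)).
Proof.
move=> mX mf ind.
pose S m w := \sum_(i < n | (i < m)%N) f i (X i w).
pose J m (B : 'I_n -> set T) w : R := \prod_(i < n | (m <= i)%N) \1_(B i) (X i w).
pose z m := \prod_(i < n | (i < m)%N) cfun (fun w => f i (X i w)).
pose p m (B : 'I_n -> set T) : R := \prod_(i < n | (m <= i)%N) fine (P (X i @^-1` B i)).
have mfX i : measurable_fun setT (fun w => f i (X i w)) by exact: measurableT_comp.
have mS m : measurable_fun setT (S m).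
  rewrite /S; under eq_fun do rewrite -big_filter.
  by apply: measurable_sum.
have mJ m B : (forall i, measurable (B i)) -> measurable_fun setT (J m B).
  move=> mB; rewrite /J; under eq_fun do rewrite -big_filter.
  by apply: measurable_prod => i _; apply: measurableT_comp => //; exact: measurable_indic.
have J1 m B w : `|J m B w| <= 1.
  rewrite /J normr_prod prodr_ile1// => i _; rewrite normr_ge0/= indicE.
  by rewrite ger0_norm ?lern1 ?leq_b1.
have key m : (m <= n)%N -> forall B, (forall i, measurable (B i)) ->
    \int[P]_w (cos (S m w) * J m B w) = complex.Re (z m) * p m B /\
    \int[P]_w (sin (S m w) * J m B w) = complex.Im (z m) * p m B.
  elim: m => [_ B mB|m IH mn B mB].
    rewrite /S /z; under eq_Rintegral do rewrite big_pred0// cos0 mul1r.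
    under [X in _ /\ X = _]eq_Rintegral do rewrite big_pred0// sin0 mul0r.
    rewrite big_pred0//= mul1r mul0r Rintegral_prob_cst; split=> //.
    have := ind B mB; rewrite (_ : [set w | _] = \bigcap_(i in [set: 'I_n]) (X i @^-1` B i)); last first.
      by apply/seteqP; split=> w /= Hw i => [_|]; exact: Hw.
    set A := \bigcap_(_ in _) _.
    have mA : measurable A.
      apply: fin_bigcap_measurable => // i _.
      by rewrite -[X in measurable X]setTI; exact: mX.
    have -> : \int[P]_w J 0%N B w = fine (P A).
      rewrite -[A in RHS]setIT -integral_indic//; congr fine; apply: eq_integral => w _.
      congr EFin; rewrite /J indicE; have [Aw|/negP Aw] := boolP (w \in A).
        by apply: big1 => i _; rewrite indicE mem_set//; move: Aw; rewrite inE; exact.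
      have : ~ A w by move=> ?; apply: Aw; rewrite inE.
      move=> nAw; have /existsNP[i Bi] : ~ forall i, B i (X i w).
        by move=> H; apply: nAw => i _; exact: H.
      by rewrite (bigD1 i)//= indicE memNset// mul0r.
    move=> ->; rewrite /p -[RHS]/(fine (_%:E)) -prodEFin; congr fine.
    apply: eq_bigr => i _; rewrite fineK// fin_num_measure//.
    by rewrite -[X in measurable X]setTI; exact: mX.
  pose j := Ordinal mn.
  pose Bj (A : set T) i := if i == j then A else B i.
  have jE i : (i < m.+1)%N = (i == j) || (i < m)%N by rewrite ltnS leq_eqVlt.
  have SS w : S m.+1 w = S m w + f j (X j w).
    rewrite /S (bigD1 j)//= addrC; congr (_ + _); apply: eq_bigl => i.
    by rewrite ltnS andbC -ltn_neqAle.
  have zS : z m.+1 = z m * cfun (fun w => f j (X j w)).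
    rewrite /z (bigD1 j)//= mulrC; congr (_ * _); apply: eq_bigl => i.
    by rewrite ltnS andbC -ltn_neqAle.
  have JB A w : J m (Bj A) w = \1_A (X j w) * J m.+1 B w.
    rewrite /J (bigD1 j)//= /Bj eqxx; congr (_ * _); apply: eq_big => i.
      by rewrite andbC [RHS]ltn_neqAle eq_sym.
    by move=> /andP[_ /negbTE ->].
  have pB A : p m (Bj A) = fine (P (X j @^-1` A)) * p m.+1 B.
    rewrite /p (bigD1 j)//= /Bj eqxx; congr (_ * _); apply: eq_big => i.
      by rewrite andbC [RHS]ltn_neqAle eq_sym.
    by move=> /andP[_ /negbTE ->].
  have mBj A : measurable A -> forall i, measurable (Bj A i).
    by move=> mA i; rewrite /Bj; case: ifP.
  have iQ (g : R -> R) : measurable_fun setT g -> (forall x, `|g x| <= 1) ->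
      P.-integrable setT (EFin \o (fun w => g (S m w) * J m.+1 B w)).
    move=> mg g1; apply: (@bounded_integrable _ _ _ _ _ 1).
      by apply: measurable_funM; [exact: measurableT_comp|exact: mJ].
    by move=> w; rewrite normrM mulr_ile1.
  have mcos : measurable_fun setT (@cos R) by exact: measurable_fun_cos.
  have msin : measurable_fun setT (@sin R) by exact: measurable_fun_sin.
  have F (g : R -> R) (v : R) (h : T -> R) : measurable_fun setT g -> (forall x, `|g x| <= 1) ->
      (forall A, measurable A -> \int[P]_w (g (S m w) * J m (Bj A) w) = v * p m (Bj A)) ->
      measurable_fun setT h -> (forall x, `|h x| <= 1) ->
      \int[P]_w (h (X j w) * (g (S m w) * J m.+1 B w)) = v * p m.+1 B * \int[P]_w h (X j w).
    move=> mg g1 Hg mh h1; apply: factor_bounded h1 => //; first exact: iQ.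
    move=> A mA; under eq_Rintegral do rewrite mulrCA -JB.
    by rewrite Hg// pB [X in _ * X]mulrC mulrA.
  have Fcos h := F cos _ h mcos (@cos_max R) (fun A mA => (IH (ltnW mn) _ (mBj A mA)).1).
  have Fsin h := F sin _ h msin (@sin_max R) (fun A mA => (IH (ltnW mn) _ (mBj A mA)).2).
  have mhf (g : R -> R) : measurable_fun setT g -> measurable_fun setT (fun x => g (f j x)).
    by move=> mg; exact: measurableT_comp.
  have iT (g h : R -> R) : measurable_fun setT g -> (forall x, `|g x| <= 1) ->
     measurable_fun setT h -> (forall x, `|h x| <= 1) ->
     P.-integrable setT (EFin \o (fun w => h (f j (X j w)) * (g (S m w) * J m.+1 B w))).
    move=> mg g1 mh h1; apply: (@bounded_integrable _ _ _ _ _ 1).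
      apply: measurable_funM; first exact: measurableT_comp.
      by apply: measurable_funM; [exact: measurableT_comp|exact: mJ].
    by move=> w; rewrite normrM mulr_ile1// normrM mulr_ile1.
  have Ecc := Fcos (fun x => cos (f j x)) (mhf _ mcos) (fun x => cos_max _).
  have Ecs := Fcos (fun x => sin (f j x)) (mhf _ msin) (fun x => sin_max _).
  have Esc := Fsin (fun x => cos (f j x)) (mhf _ mcos) (fun x => cos_max _).
  have Ess := Fsin (fun x => sin (f j x)) (mhf _ msin) (fun x => sin_max _).
  have -> : \int[P]_w (cos (S m.+1 w) * J m.+1 B w) =
      \int[P]_w (cos (f j (X j w)) * (cos (S m w) * J m.+1 B w) -
                  sin (f j (X j w)) * (sin (S m w) * J m.+1 B w)).
    by apply: eq_Rintegral => w _; rewrite SS cosD; ring.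
  have -> : \int[P]_w (sin (S m.+1 w) * J m.+1 B w) =
      \int[P]_w (cos (f j (X j w)) * (sin (S m w) * J m.+1 B w) +
                  sin (f j (X j w)) * (cos (S m w) * J m.+1 B w)).
    by apply: eq_Rintegral => w _; rewrite SS sinD; ring.
  rewrite RintegralB ?RintegralD//; [|exact: iT (@sin_max R) _ (@cos_max R)|
    exact: iT (@cos_max R) _ (@sin_max R)|exact: iT (@cos_max R) _ (@cos_max R)|
    exact: iT (@sin_max R) _ (@sin_max R)].
  rewrite Ecc Ess Esc Ecs zS /cfun; case: (z m) => a b /=; split; ring.
have [c s] := key n (leqnn n) (fun=> setT) (fun=> measurableT).
have Jn w : J n (fun=> setT) w = 1.
  by rewrite /J big_pred0// => i; rewrite leqNgt ltn_ord.
have pn : p n (fun=> setT) = 1.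
  by rewrite /p big_pred0// => i; rewrite leqNgt ltn_ord.
have Sn w : S n w = \sum_i f i (X i w).
  by rewrite /S; apply: eq_bigl => i; rewrite ltn_ord.
have -> : \prod_i cfun (fun w => f i (X i w)) = z n.
  by rewrite /z; apply: eq_bigl => i; rewrite ltn_ord.
move: c s; under eq_Rintegral do rewrite Jn mulr1 Sn.
under [X in _ -> X = _ -> _]eq_Rintegral do rewrite Jn mulr1 Sn.
by rewrite pn !mulr1 /cfun; case: (z n) => a b /= -> ->.
Qed.

End independence.

(** * The series of exp(x e^(iy)) and the Poisson law *)

Section exponential_series.
Context {R : realType}.

Lemma is_cvg_pseries_fact (u : nat -> R) (x : R) : (forall k, `|u k| <= 1) ->
  cvgn (pseries (fun k => u k / k`!%:R) x).
Proof.
move=> u1; apply: normed_cvg.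
apply: (series_le_cvg _ _ _ (is_cvg_series_exp_coeff `|x|)) => k /=.
- by [].
- by rewrite exp_coeff_ge0.
- rewrite /exp_coeff /= normrM normrX mulrC ler_wpM2l// ?exprn_ge0//.
  by rewrite normrM [X in _ * X]ger0_norm ?invr_ge0// ler_piMl// invr_ge0.
Qed.

Lemma is_derive_pseries_fact (u : nat -> R) (x : R) : (forall k, `|u k| <= 1) ->
  is_derive x 1 (fun x => limn (pseries (fun k => u k / k`!%:R) x))
    (limn (pseries (fun k => u k.+1 / k`!%:R) x)).
Proof.
move=> u1.
have dE (v : nat -> R) : pseries_diffs (fun k => v k / k`!%:R) = (fun k => v k.+1 / k`!%:R).
  apply/funext => k; rewrite /pseries_diffs factS natrM invfM mulrCA.
  by congr (_ * _); rewrite mulrA divff ?pnatr_eq0// mul1r.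
rewrite -dE; apply: (@pseries_snd_diffs _ _ (`|x| + 1)); rewrite ?dE.
- exact: is_cvg_pseries_fact.
- by apply: (@is_cvg_pseries_fact (fun k => u k.+1)).
- by apply: (@is_cvg_pseries_fact (fun k => u k.+2)).
- by rewrite [ltRHS]ger0_norm ?addr_ge0// ltrDl.
Qed.

(** The sums C and S satisfy C' = cos y C - sin y S and S' = cos y S + sin y C in x. Multiplied by
    e^(-x cos y) and rotated back by the angle x sin y, the pair has zero derivative, hence keeps
    its value (1, 0) at x = 0. *)
Lemma cvg_exp_cis_series (x y : R) :
  (series (fun k => cos (k%:R * y) * (x ^+ k / k`!%:R)) @ \oo --> expR (x * cos y) * cos (x * sin y)) /\
  (series (fun k => sin (k%:R * y) * (x ^+ k / k`!%:R)) @ \oo --> expR (x * cos y) * sin (x * sin y)).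
Proof.
pose c k : R := cos (k%:R * y); pose s k : R := sin (k%:R * y).
have c1 k : `|c k| <= 1 by exact: cos_max.
have s1 k : `|s k| <= 1 by exact: sin_max.
have Sc k : c k.+1 = cos y * c k - sin y * s k.
  by rewrite /c /s -natr1 mulrDl mul1r cosD; ring.
have Ss k : s k.+1 = cos y * s k + sin y * c k.
  by rewrite /c /s -natr1 mulrDl mul1r sinD; ring.
pose C : R -> R := fun x => limn (pseries (fun k => c k / k`!%:R) x).
pose S : R -> R := fun x => limn (pseries (fun k => s k / k`!%:R) x).
have cC t : pseries (fun k => c k / k`!%:R) t @ \oo --> C t by exact: is_cvg_pseries_fact.
have cS t : pseries (fun k => s k / k`!%:R) t @ \oo --> S t by exact: is_cvg_pseries_fact.
have dC t : is_derive t (1 : R) C (cos y * C t - sin y * S t).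
  have := @is_derive_pseries_fact c t c1; rewrite (_ : limn _ = cos y * C t - sin y * S t)//.
  apply: cvg_lim => //; rewrite (_ : pseries _ _ = fun n =>
      cos y * pseries (fun k => c k / k`!%:R) t n - sin y * pseries (fun k => s k / k`!%:R) t n).
    by apply: cvgB; apply: cvgMr.
  apply/funext => n; rewrite /pseries /series/= !mulr_sumr -sumrB; apply: eq_bigr => k _.
  by rewrite Sc; ring.
have dS t : is_derive t (1 : R) S (cos y * S t + sin y * C t).
  have := @is_derive_pseries_fact s t s1; rewrite (_ : limn _ = cos y * S t + sin y * C t)//.
  apply: cvg_lim => //; rewrite (_ : pseries _ _ = fun n =>
      cos y * pseries (fun k => s k / k`!%:R) t n + sin y * pseries (fun k => c k / k`!%:R) t n).
    by apply: cvgD; apply: cvgMr.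
  apply/funext => n; rewrite /pseries /series/= !mulr_sumr -big_split; apply: eq_bigr => k _.
  by rewrite Ss /=; ring.
pose E : R -> R := fun t => expR (t * - cos y).
pose u : R -> R := fun t => cos (t * sin y); pose v : R -> R := fun t => sin (t * sin y).
have dE t : is_derive t (1 : R) E (E t * - cos y).
  by apply: is_derive1_comp; exact: is_derive1_mulr.
have du t : is_derive t (1 : R) u (- v t * sin y).
  by apply: is_derive1_comp; exact: is_derive1_mulr.
have dv t : is_derive t (1 : R) v (u t * sin y).
  by apply: is_derive1_comp; exact: is_derive1_mulr.
have C0 : C 0 = 1.
  rewrite /C; apply: cvg_lim => //; apply/cvgrPdist_le => e e0; near=> n.
  rewrite /pseries /series/=.
  have -> : (n = n.-1.+1)%N by rewrite prednK//; near: n; exists 1%N.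
  rewrite big_nat_recl//= big1 ?addr0; last by move=> i _; rewrite expr0n mulr0.
  by rewrite /c mul0r cos0 fact0 invr1 expr0 !mulr1 subrr normr0 ltW.
have S0 : S 0 = 0.
  rewrite /S; apply: cvg_lim => //; apply/cvgrPdist_le => e e0; near=> n.
  rewrite /pseries /series/=.
  have -> : (n = n.-1.+1)%N by rewrite prednK//; near: n; exists 1%N.
  rewrite big_nat_recl//= big1 ?addr0; last by move=> i _; rewrite expr0n mulr0.
  by rewrite /s mul0r sin0 !mul0r subrr normr0 ltW.
have D1 : E x * (C x * u x + S x * v x) = 1.
  have dD1 t : is_derive t (1 : R) (fun t => E t * (C t * u t + S t * v t)) 0.
    rewrite (_ : (fun t => _) = E * (C * u + S * v))//.
    apply: is_derive_eq; rewrite /GRing.scale/=.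
    by rewrite !fctE; ring.
  rewrite (is_derive_0_is_cst x 0 dD1 : E x * (C x * u x + S x * v x) = _).
  by rewrite /E /u /v !mul0r expR0 cos0 sin0 C0 mulr0 addr0 !mulr1.
have D2 : E x * (S x * u x - C x * v x) = 0.
  have dD2 t : is_derive t (1 : R) (fun t => E t * (S t * u t - C t * v t)) 0.
    rewrite (_ : (fun t => _) = E * (S * u - C * v))//.
    apply: is_derive_eq; rewrite /GRing.scale/=.
    by rewrite !fctE; ring.
  rewrite (is_derive_0_is_cst x 0 dD2 : E x * (S x * u x - C x * v x) = _).
  by rewrite /E /u /v !mul0r expR0 cos0 sin0 S0 mulr0 mul0r subrr mulr0.
have uv : u x * u x + v x * v x = 1 by rewrite -!expr2 cos2Dsin2.
have EE : expR (x * cos y) * E x = 1 by rewrite /E mulrN -expRD subrr expR0.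
have CE : C x = expR (x * cos y) * u x.
  transitivity ((expR (x * cos y) * E x) * C x * (u x * u x + v x * v x)).
    by rewrite EE uv mul1r mulr1.
  transitivity (expR (x * cos y) * ((E x * (C x * u x + S x * v x)) * u x -
     (E x * (S x * u x - C x * v x)) * v x)); first by ring.
  by rewrite D1 D2; ring.
have SE : S x = expR (x * cos y) * v x.
  transitivity ((expR (x * cos y) * E x) * S x * (u x * u x + v x * v x)).
    by rewrite EE uv mul1r mulr1.
  transitivity (expR (x * cos y) * ((E x * (C x * u x + S x * v x)) * v x +
     (E x * (S x * u x - C x * v x)) * u x)); first by ring.
  by rewrite D1 D2; ring.
rewrite -/(u x) -/(v x) -CE -SE; split.
  by have := cC x; rewrite /pseries; under [X in series X]eq_fun do rewrite mulrAC -mulrA.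
by have := cS x; rewrite /pseries; under [X in series X]eq_fun do rewrite mulrAC -mulrA.
Unshelve. all: by end_near. Qed.

Lemma cvg_series_poisson (l : R) :
  series (fun k => l ^+ k / k`!%:R * expR (- l)) @ \oo --> (1 : R).
Proof.
have [+ _] := cvg_exp_cis_series l 0; rewrite cos0 sin0 mulr1 mulr0 cos0 mulr1 => H.
have : (fun n => series (fun k => cos (k%:R * 0) * (l ^+ k / k`!%:R)) n * expR (- l)) @ \oo -->
    expR l * expR (- l) by exact: cvgMl.
rewrite -expRD subrr expR0; apply: cvg_trans; apply: near_eq_cvg; apply: nearW => n.
rewrite /series/= mulr_suml; apply: eq_bigr => k _.
by rewrite mulr0 cos0 mul1r.
Qed.

Lemma cvg_series_poisson_mean (l : R) :
  series (fun k => k%:R * (l ^+ k / k`!%:R * expR (- l))) @ \oo --> l.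
Proof.
rewrite -cvg_shiftS /=.
have : (fun n => l * series (fun k => l ^+ k / k`!%:R * expR (- l)) n) @ \oo --> l * 1.
  by apply: cvgMr; exact: cvg_series_poisson.
rewrite mulr1; apply: cvg_trans; apply: near_eq_cvg; apply: nearW => n.
rewrite /series/= big_nat_recl//= mul0r add0r mulr_sumr; apply: eq_bigr => k _.
rewrite exprS factS natrM invfM.
have k0 : k.+1%:R != 0 :> R by rewrite pnatr_eq0.
move: (k.+1%:R) (k`!%:R^-1) (l ^+ k) (expR _) k0 => c a b e c0.
by field.
Qed.

End exponential_series.

Section poisson.
Context {R : realType} d (Om : measurableType d) (P : probability Om R).
Variables (N : Om -> \bar R) (l : R).
Hypothesis mN : measurable_fun setT N.
Hypothesis Nint : forall w, N w = +oo%E \/ exists k : nat, N w = k%:R%:E.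
Hypothesis l0 : 0 <= l.
Hypothesis NP : forall k : nat,
  P [set w | N w = k%:R%:E] = (l ^+ k / k`!%:R * expR (- l))%:E.

Let A k := [set w | N w = k%:R%:E].
Let mA k : measurable (A k).
Proof.
rewrite -[X in measurable X]setTI (_ : A k = N @^-1` [set k%:R%:E]); last by [].
exact: mN.
Qed.
Let p k : R := l ^+ k / k`!%:R * expR (- l).
Let p0 k : 0 <= p k.
Proof. by rewrite mulr_ge0 ?expR_ge0// divr_ge0// exprn_ge0. Qed.

Let sum_p : series p @ \oo --> (1 : R).
Proof. exact: cvg_series_poisson. Qed.

Let integral_indic_A k : \int[P]_w \1_(A k) w = p k.
Proof.
transitivity (fine (P (A k))); last by rewrite NP.
by rewrite /Rintegral integral_indic// setIT.
Qed.

(** The n-th partial sum is the integral of g(N) over {N < n}. The remaining probability is the tail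
    of a series of sum 1, which also disposes of the event N = +oo. *)
Lemma cvg_poisson_expect (g : R -> R) (C : R) : measurable_fun setT g ->
  (forall x, `|g x| <= C) ->
  series (fun k => g k%:R * p k) @ \oo --> \int[P]_w g (fine (N w)).
Proof.
move=> mg gC; apply/cvgrPdist_le => e e0.
have mgN : measurable_fun setT (fun w => g (fine (N w))).
  by apply: measurableT_comp => //; exact: measurableT_comp.
have igN := bounded_integrable P mgN (fun w => gC _).
have iA k : P.-integrable setT (EFin \o \1_(A k)) by exact: integrable_indic.
have igA k : P.-integrable setT (EFin \o (fun w => g k%:R * \1_(A k) w)).
  exact: integrable_realZl.
have C0 : 0 <= C by exact: le_trans (gC 0).
have : 0 < e / (C + 1) by rewrite divr_gt0// ltr_wpDl.
move/cvgrPdist_le : sum_p => /[apply]; apply: filterS => n Hn.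
have -> : series (fun k => g k%:R * p k) n = \int[P]_w (\sum_(k < n) g k%:R * \1_(A k) w).
  rewrite Rintegral_sum// /series/= big_mkord; apply: eq_bigr => k _.
  by rewrite RintegralZl// integral_indic_A.
rewrite -RintegralB//; last exact: integrable_real_sum.
have iD : P.-integrable setT (EFin \o (fun w => g (fine (N w)) - \sum_(k < n) g k%:R * \1_(A k) w)).
  by apply: integrable_realB => //; exact: integrable_real_sum.
rewrite (le_trans (le_normr_Rintegral _ iD))//.
have i1 : P.-integrable setT (EFin \o (fun w => C * (1 - \sum_(k < n) \1_(A k) w))).
  apply: integrable_realZl => //; apply: integrable_realB => //.
    by apply: (@bounded_integrable _ _ _ _ _ 1) => // w; rewrite normr1.
  exact: integrable_real_sum.
rewrite (@le_trans _ _ (\int[P]_w (C * (1 - \sum_(k < n) \1_(A k) w))))//.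
  apply: le_Rintegral => //; first exact: (integrable_norm iD).
  move=> w _; have [[k [kn Ak]]|H] := pselect (exists k, (k < n)%N /\ A k w).
    have E (a : nat -> R) : \sum_(j < n) a j * \1_(A j) w = a k.
      rewrite (bigD1 (Ordinal kn))//= indicE mem_set// mulr1 big1 ?addr0// => j jk.
      rewrite indicE memNset ?mulr0// => Aj; move/eqP : jk; apply; apply: val_inj => /=.
      by move: Ak; rewrite /A /= Aj => -[] /eqP; rewrite eqr_nat => /eqP.
    have := E (fun=> 1); under eq_bigr do rewrite mul1r; move=> ->.
    by rewrite (E (fun k => g k%:R)) Ak /= subrr normr0 subrr mulr0.
  have E j : (j < n)%N -> \1_(A j) w = 0 :> R.
    by move=> jn; rewrite indicE memNset// => Aj; apply: H; exists j.
  by rewrite !big1 ?subr0 ?mulr1// => j _; rewrite E// mulr0.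
rewrite RintegralZl//; last first.
  apply: integrable_realB => //; last exact: integrable_real_sum.
  by apply: (@bounded_integrable _ _ _ _ _ 1) => // w; rewrite normr1.
rewrite RintegralB//; last exact: integrable_real_sum; last first.
  by apply: (@bounded_integrable _ _ _ _ _ 1) => // w; rewrite normr1.
rewrite Rintegral_prob_cst Rintegral_sum//.
under eq_bigr do rewrite integral_indic_A.
rewrite -(big_mkord xpredT p); move: Hn; rewrite /series/= => Hn.
rewrite (le_trans (ler_wpM2l C0 (le_trans (ler_norm _) Hn)))//.
by rewrite mulrCA ler_piMr ?(ltW e0)// ler_pdivrMr ?ltr_wpDl// mul1r lerDl.
Qed.

Lemma cfun_poisson (y : R) : cfun P (fun w => y * fine (N w)) =
  expC ((l * (cos y - 1)) +i* (l * sin y))%C.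
Proof.
have [Hc Hs] := cvg_exp_cis_series l y.
have mul (g : R -> R) (a : R) : series (fun k => g (k%:R * y) * (l ^+ k / k`!%:R)) @ \oo --> a ->
    series (fun k => g (y * k%:R) * p k) @ \oo --> a * expR (- l).
  move=> Ha; have : (fun n => series (fun k => g (k%:R * y) * (l ^+ k / k`!%:R)) n * expR (- l)) @ \oo -->
    a * expR (- l) by exact: cvgMl.
  apply: cvg_trans; apply: near_eq_cvg.
  apply: nearW => n; rewrite /series/= mulr_suml; apply: eq_bigr => k _.
  by rewrite [y * _]mulrC /p -!mulrA.
have mcos : measurable_fun setT (fun x : R => cos (y * x)).
  by apply: measurable_fun_cos; exact: measurable_funM.
have msin : measurable_fun setT (fun x : R => sin (y * x)).
  by apply: measurable_fun_sin; exact: measurable_funM.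
have Lc := cvg_poisson_expect mcos (fun x => cos_max _).
have Ls := cvg_poisson_expect msin (fun x => sin_max _).
rewrite /cfun -(cvg_lim (@Rhausdorff R) Lc) -(cvg_lim (@Rhausdorff R) Ls).
rewrite (cvg_lim (@Rhausdorff R) (mul _ _ Hc)) (cvg_lim (@Rhausdorff R) (mul _ _ Hs)).
rewrite /expC/= mulrBr mulr1 expRD; congr (_ +i* _)%C; ring.
Qed.

End poisson.

(** * Simple functions on disjoint cells *)

Section disjoint_indicators.
Context {R : realType} (E : Type) n (A : 'I_n -> set E).
Hypothesis tA : trivIset setT A.

Lemma sum_indic_disjoint (s : 'I_n -> R) i x : A i x -> \sum_j s j * \1_(A j) x = s i.
Proof.
move=> Aix; rewrite (bigD1 i)//= indicE mem_set// mulr1 big1 ?addr0// => j ji.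
rewrite indicE memNset ?mulr0// => Ajx; move/eqP : ji; apply.
by apply: tA => //; exists x.
Qed.

Lemma sum_indic_out (s : 'I_n -> R) x : (forall i, ~ A i x) -> \sum_j s j * \1_(A j) x = 0.
Proof. by move=> H; apply: big1 => j _; rewrite indicE memNset ?mulr0//; exact: H. Qed.

Lemma comp_sum_indic (s : 'I_n -> R) (k : R -> R) x : k 0 = 0 ->
  k (\sum_i s i * \1_(A i) x) = \sum_i k (s i) * \1_(A i) x.
Proof.
move=> k0; have [[i Aix]|H] := pselect (exists i, A i x).
  by rewrite !(sum_indic_disjoint _ Aix).
by rewrite !sum_indic_out// => i Aix; apply: H; exists i.
Qed.

End disjoint_indicators.

Section common_refinement.
Context {R : realType} dE (E : measurableType dE) (m : {measure set E -> \bar R}).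
Import HBSimple.

(** Chebyshev's inequality: the indicator of the level set is at most |y|^(-g) |h|^g. *)
Lemma measure_level_set_lty (g : R) (h : {sfun E >-> R}) (y : R) :
  m.-integrable setT (EFin \o (fun x => `|h x| `^ g)) -> y != 0 ->
  (m (h @^-1` [set y]) < +oo)%E.
Proof.
move=> ih y0; set B := h @^-1` _; have mB : measurable B by exact: measurable_sfunP.
have : m.-integrable setT (EFin \o (\1_B : E -> R)).
  apply: (@le_integrable_real _ _ _ _ _ _ (fun x => (`|y| `^ g)^-1 * `|h x| `^ g)) => //.
  - move=> x _; rewrite indicE; have [|_] := boolP (x \in B).
      by rewrite inE /B /= => ->; rewrite mulVf ?normr1// gt_eqF// powR_gt0 ?normr_gt0.
    by rewrite normr0 mulr_ge0 ?invr_ge0 ?powR_ge0.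
  - exact: integrable_realZl.
move=> /integrableP[_]; under eq_integral do rewrite /= ger0_norm//.
by rewrite integral_indic// setIT.
Qed.

(** The cells are the common level sets, indexed by tuples of positions in the lists of values. The
    cell on which all functions vanish may have infinite measure and is left out; it would add 0 to
    every sum. *)
Lemma sfun_common_repr k (h : 'I_k -> {sfun E >-> R}) :
  (forall j y, y != 0 -> (m (h j @^-1` [set y]) < +oo)%E) ->
  exists n (s : 'I_n -> 'I_k -> R) (A : 'I_n -> set E),
  [/\ forall i, measurable (A i), trivIset setT A, forall i, (m (A i) < +oo)%E &
      forall j x, h j x = \sum_i s i j * \1_(A i) x].
Proof.
move=> hfin; pose L j : seq R := finmap.enum_fset (fset_set (range (h j))).
have hL j x : h j x \in L j.
  have -> : (h j x \in L j) = (h j x \in range (h j)) by rewrite -in_fset_set.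
  by rewrite inE; exists x.
have uL j : uniq (L j) by exact: finmap.fset_uniq.
pose N := \max_(j < k) size (L j).
have LN j : (size (L j) <= N)%N by exact: (leq_bigmax j).
pose v (c : {ffun 'I_k -> 'I_N}) j : R := (L j)`_(c j).
(* The first condition discards positions beyond the end of a list, where the default value 0 would
   be read. *)
pose ok (c : {ffun 'I_k -> 'I_N}) := [forall j, (c j < size (L j))%N] && [exists j, v c j != 0].
pose A c := if ok c then [set x | forall j, h j x = v c j] else set0.
pose n := #|{ffun 'I_k -> 'I_N}|.
have AE c : ok c -> A c = \bigcap_j (h j @^-1` [set v c j]).
  rewrite /A => ->; apply/seteqP; split=> [x H j _|x H j]; first exact: H.
  exact: H.
have tA (i j : 'I_n) x : A (enum_val i) x -> A (enum_val j) x -> i = j.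
  rewrite /A; case: ifP => // /andP[/forallP oi _] Hi; case: ifP => // /andP[/forallP oj _] Hj.
  apply: enum_val_inj; apply/ffunP => l; apply: val_inj => /=; apply/eqP.
  by rewrite -(nth_uniq 0 (oi l) (oj l) (uL l)); have := Hi l; rewrite Hj => /esym/eqP.
have tT : trivIset setT (fun i : 'I_n => A (enum_val i)).
  by move=> i j _ _ [x [Hi Hj]]; exact: tA Hi Hj.
exists n, (fun i => v (enum_val i)), (fun i => A (enum_val i)); split => //.
- move=> i; have [oki|/negbTE oki] := boolP (ok (enum_val i)); last by rewrite /A oki.
  rewrite AE//.
  by apply: fin_bigcap_measurable => // j _; exact: measurable_sfunP.
- move=> i; have [oki|/negbTE oki] := boolP (ok (enum_val i)); last by rewrite /A oki measure0.
  have /andP[_ /existsP[j vj]] := oki; apply: le_lt_trans (hfin j _ vj).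
  apply: le_measure; rewrite ?inE.
  + rewrite AE//; apply: fin_bigcap_measurable => // l _; exact: measurable_sfunP.
  + exact: measurable_sfunP.
  by rewrite AE// => x; exact.
move=> j x.
have [[l hl]|H] := pselect (exists l, h l x != 0); last first.
  have h0 l : h l x = 0 by apply/eqP/negP => /negP hl; apply: H; exists l.
  rewrite h0 sum_indic_out// => i; rewrite /A; case: ifPn => [oki Hx|_ []].
  have /andP[_ /existsP[l' vl']] := oki.
  by have := Hx l'; rewrite h0 => v0; rewrite -v0 eqxx in vl'.
have iL l' : (index (h l' x) (L l') < size (L l'))%N by rewrite index_mem.
pose c : {ffun 'I_k -> 'I_N} := [ffun l' => Ordinal (leq_trans (iL l') (LN l'))].
have vc l' : v c l' = h l' x by rewrite /v ffunE/= nth_index.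
have okc : ok c.
  apply/andP; split; last by apply/existsP; exists l; rewrite vc.
  by apply/forallP => l'; rewrite ffunE; exact: iL.
have Acx : A (enum_val (enum_rank c)) x by rewrite enum_rankK /A okc => l'; rewrite vc.
by rewrite (sum_indic_disjoint tT (fun i => v (enum_val i) j) Acx) enum_rankK vc.
Qed.

Lemma sfun_integrable_repr (h : {sfun E >-> R}) : m.-integrable setT (EFin \o h) ->
  exists n (s : 'I_n -> R) (A : 'I_n -> set E),
  [/\ forall i, measurable (A i), trivIset setT A, forall i, (m (A i) < +oo)%E &
      forall x, h x = \sum_i s i * \1_(A i) x].
Proof.
move=> ih; have ih1 : m.-integrable setT (EFin \o (fun x => `|h x| `^ 1)).
  rewrite (_ : (fun x => _) = (fun x => `|h x|)); first exact: (integrable_norm ih).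
  by apply/funext => x; rewrite powRr1.
have [n [s [A [mA tA Afin hE]]]] :=
  sfun_common_repr (h := fun=> h) (fun (_ : 'I_1) y => measure_level_set_lty (y := y) ih1).
by exists n, (fun i => s i ord0), A; split => // x; exact: hE ord0 x.
Qed.

End common_refinement.

(** * Measures with a density, and Campbell's formula *)

Section density.
Local Open Scope ereal_scope.
Context d (T : measurableType d) (R : realType) (mu : {measure set T -> \bar R}).
Variables (g : T -> R).
Hypotheses (g0 : forall x, (0 <= g x)%R) (mg : measurable_fun setT g).

(* The proofs are arguments so that the measure structure can be inferred. *)
Definition density_measure of (forall x, (0 <= g x)%R) & measurable_fun setT g :=
  fun A : set T => \int[mu]_(x in A) (g x)%:E.

Local Notation nu := (density_measure g0 mg).

Let nu0 : nu set0 = 0. Proof. by rewrite /density_measure integral_set0. Qed.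
Let nu_ge0 A : 0 <= nu A. Proof. by apply: integral_ge0 => x _; rewrite lee_fin. Qed.
Let nu_sigma_additive : semi_sigma_additive nu.
Proof.
move=> /= F mF tF mUF; rewrite /density_measure; apply: cvg_toP.
  apply: ereal_nondecreasing_is_cvgn => m n mn.
  by apply: lee_sum_nneg_natr => // k _ _; apply: integral_ge0 => x _; rewrite lee_fin.
rewrite ge0_integral_bigcup//=.
- exact/measurable_EFinP/measurable_funTS.
- by move=> x _; rewrite lee_fin.
Qed.

HB.instance Definition _ := isMeasure.Build _ _ _ nu nu0 nu_ge0 nu_sigma_additive.

Lemma ge0_integral_density_measure (f : T -> \bar R) :
  (forall x, 0 <= f x) -> measurable_fun setT f ->
  \int[nu]_x f x = \int[mu]_x (f x * (g x)%:E).
Proof.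
have g0' x : 0 <= (g x)%:E by rewrite lee_fin.
have mg' : measurable_fun setT (EFin \o g) by exact/measurable_EFinP.
move: f; apply: ge0_measurable_fun_ind.
- move=> A mA; rewrite integral_indic// setIT /= /density_measure [LHS]integral_mkcond.
  apply: eq_integral => x _; rewrite patchE indicE; case: ifP => _; first by rewrite mul1e.
  by rewrite mul0e.
- move=> f h f0 mf h0 mh fE hE; rewrite ge0_integralD// fE hE -ge0_integralD//.
  + by apply: eq_integral => x _; rewrite ge0_muleDl.
  + by move=> x _; rewrite mule_ge0.
  + exact: emeasurable_funM.
  + by move=> x _; rewrite mule_ge0.
  + exact: emeasurable_funM.
- move=> c f c0 f0 mf fE; rewrite ge0_integralZl// fE -ge0_integralZl//.
  + by apply: eq_integral => x _; rewrite muleA.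
  + exact: emeasurable_funM.
  + by move=> x _; rewrite mule_ge0.
- move=> f_ f0 mf fE ndf.
  have limM x : limn (f_ ^~ x) * (g x)%:E = limn (fun n => f_ n x * (g x)%:E).
    apply/esym/cvg_lim => //; apply: cvgeZr => //.
    by apply: ereal_nondecreasing_is_cvgn; exact: ndf.
  rewrite monotone_convergence//.
  under [in RHS]eq_integral do rewrite limM.
  rewrite [RHS]monotone_convergence//.
  + by congr (limn _); apply/funext => n; rewrite fE.
  + by move=> n; exact: emeasurable_funM.
  + by move=> n x _; rewrite mule_ge0.
  + by move=> x _ m n mn; rewrite lee_wpmul2r//; exact: ndf.
Qed.

End density.

Section campbell.
Context {R : realType} dO (Om : measurableType dO) (P : probability Om R)
  dE (E : measurableType dE) (N : Om -> {measure set E -> \bar R}).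
Local Open Scope ereal_scope.

(** If the intensity is infinite, the count is almost surely +oo. Otherwise the events {N A = k}
    fill a set of probability 1, the Poisson weights having sum 1, and the mean is summed over
    them. *)
Lemma poisson_random_measure_mean (Lam : set E -> \bar R) A :
  poisson_random_measure P Lam N -> measurable A -> 0 <= Lam A ->
  \int[P]_w N w A = Lam A.
Proof.
case=> mN Nint NP Ninf _ mA LA0.
have NA0 w : 0 <= N w A by [].
have [LAoo|LAfin] := eqVneq (Lam A) +oo.
  have moo : measurable [set w | N w A = +oo].
    rewrite -[X in measurable X]setTI (_ : [set w | _] = (N ^~ A) @^-1` [set +oo])//.
    exact: mN.
  rewrite LAoo; apply/eqP; rewrite -leye_eq.
  rewrite -[leLHS]mule1 -(Ninf A mA LAoo) -integral_cst//.
  rewrite (eq_integral (N ^~ A)); last by move=> w; rewrite inE /= => ->.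
  by apply: ge0_subset_integral => //; exact: mN.
have {LAfin} LAfin : Lam A < +oo by rewrite ltey.
have LE : (fine (Lam A))%:E = Lam A by rewrite fineK// ge0_fin_numE.
set l := fine (Lam A) in LE *; have l0 : (0 <= l)%R by exact: fine_ge0.
have mNk (k : nat) : measurable [set w | N w A = k%:R%:E].
  rewrite -[X in measurable X]setTI (_ : [set w | _] = (N ^~ A) @^-1` [set k%:R%:E])//.
  exact: mN.
pose B k := [set w | N w A = k%:R%:E].
have tB : trivIset setT B.
  by apply/trivIsetP => i j _ _ ij; apply/seteqP; split=> // w [] /=; rewrite /B /= => -> [] /eqP; rewrite eqr_nat (negbTE ij).
have mUB : measurable (\bigcup_k B k) by apply: bigcup_measurable => k _; exact: mNk.
have PB k : P (B k) = (l ^+ k / k`!%:R * expR (- l))%:E by exact: NP.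
have PUB : P (\bigcup_k B k) = 1.
  rewrite -[LHS]mul1e -integral_cst// ge0_integral_bigcup//.
  rewrite -[RHS](nneseries_EFin (cvg_series_poisson l)); apply: eq_eseriesr => k _.
  transitivity (1 * P (B k)); last by rewrite mul1e PB.
  by apply: integral_cst; exact: mNk.
have PUC : P (~` \bigcup_k B k) = 0 by rewrite probability_setC// PUB subee.
rewrite (@ge0_negligible_integral _ _ _ P setT (~` \bigcup_k B k))//; last first.
- exact: mN.
- exact: measurableC.
rewrite setTD setCK ge0_integral_bigcup//; last by apply: measurable_funTS; exact: mN.
rewrite -LE -(nneseries_EFin (@cvg_series_poisson_mean R l)).
apply: eq_eseriesr => k _; rewrite (eq_integral (cst k%:R%:E)); last by move=> w; rewrite inE.
transitivity (k%:R%:E * P (B k))%E; [by apply: integral_cst; exact: mNk|by rewrite PB -EFinM].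
Qed.

Lemma campbell (Lam : {measure set E -> \bar R}) (f : E -> \bar R) :
  poisson_random_measure P Lam N ->
  (forall x, 0 <= f x) -> measurable_fun setT f ->
  \int[P]_w \int[N w]_z f z = \int[Lam]_z f z.
Proof.
move=> prm; have mN := prm_measurable prm.
have mI f' := @measurable_fun_integral_kernel _ _ _ _ _ N mN f'.
move: f; apply: ge0_measurable_fun_ind.
- move=> A mA; transitivity (\int[P]_w N w A).
    by apply: eq_integral => w _; rewrite integral_indic// setIT.
  by rewrite integral_indic// setIT (poisson_random_measure_mean prm).
- move=> f h f0 mf h0 mh fE hE; transitivity (\int[P]_w (\int[N w]_z f z + \int[N w]_z h z)).
    by apply: eq_integral => w _; rewrite ge0_integralD.
  rewrite ge0_integralD ?fE ?hE ?ge0_integralD//.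
  + by move=> w _; exact: integral_ge0.
  + exact: mI.
  + by move=> w _; exact: integral_ge0.
  + exact: mI.
- move=> c f c0 f0 mf fE; transitivity (\int[P]_w (c%:E * \int[N w]_z f z)).
    by apply: eq_integral => w _; rewrite ge0_integralZl.
  transitivity (c%:E * \int[P]_w \int[N w]_z f z); last by rewrite fE ge0_integralZl.
  by apply: ge0_integralZl => //; (exact: mI || by move=> w _; exact: integral_ge0).
- move=> f_ f0 mf fE ndf.
  transitivity (\int[P]_w (limn (fun n => \int[N w]_z f_ n z))).
    by apply: eq_integral => w _; rewrite monotone_convergence.
  transitivity (limn (fun n => \int[P]_w \int[N w]_z f_ n z)).
    apply: monotone_convergence => //.
    + by move=> n; exact: mI.
    + by move=> n w _; exact: integral_ge0.
    + by move=> w _ m n mn; apply: ge0_le_integral => // x _; exact: ndf.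
  by rewrite monotone_convergence//; congr (limn _); apply/funext => n; rewrite fE.
Qed.

End campbell.

(** * Integrals against a Poisson random measure *)

Section prm_charfun.
Context {R : realType} dO (Om : measurableType dO) (P : probability Om R)
  dE (E : measurableType dE) (N : Om -> {measure set E -> \bar R})
  (Lam : {measure set E -> \bar R}).
Hypothesis prm : poisson_random_measure P Lam N.

Lemma normB_cos (a b : R) : `|cos a - cos b| <= `|a - b|.
Proof.
have -> : cos a - cos b = - 2 * (sin ((a - b) / 2) * sin ((a + b) / 2)).
  have Ea : a = (a + b) / 2 + (a - b) / 2 by field.
  have Eb : b = (a + b) / 2 - (a - b) / 2 by field.
  rewrite [X in cos X - _]Ea [X in _ - cos X]Eb.
  by rewrite cosD cosB; ring.
rewrite normrM normrN [`|2|]ger0_norm// normrM.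
rewrite (@le_trans _ _ (2 * (`|(a - b) / 2| * 1)))//.
  by rewrite ler_wpM2l// ler_pM// ?sin_le_abs// sin_max.
by rewrite mulr1 normrM [`|2^-1|]ger0_norm// mulrCA divff// mulr1.
Qed.

Lemma normB_sin (a b : R) : `|sin a - sin b| <= `|a - b|.
Proof.
have -> : sin a - sin b = 2 * (sin ((a - b) / 2) * cos ((a + b) / 2)).
  have Ea : a = (a + b) / 2 + (a - b) / 2 by field.
  have Eb : b = (a + b) / 2 - (a - b) / 2 by field.
  rewrite [X in sin X - _]Ea [X in _ - sin X]Eb.
  by rewrite sinD sinB; ring.
rewrite normrM [`|2|]ger0_norm// normrM.
rewrite (@le_trans _ _ (2 * (`|(a - b) / 2| * 1)))//.
  by rewrite ler_wpM2l// ler_pM// ?sin_le_abs// cos_max.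
by rewrite mulr1 normrM [`|2^-1|]ger0_norm// mulrCA divff// mulr1.
Qed.

Definition prm_integral (h : E -> R) (w : Om) : R := \int[N w]_z h z.

Lemma measurable_prm_integral h : measurable_fun setT h ->
  measurable_fun setT (prm_integral h).
Proof.
move=> mh; rewrite /prm_integral /Rintegral.
apply: measurableT_comp => //.
under eq_fun do rewrite integralE.
have mN := prm_measurable prm.
have mh' : measurable_fun setT (EFin \o h) by exact/measurable_EFinP.
apply: emeasurable_funB; apply: (measurable_fun_integral_kernel mN) => //.
- exact: measurable_funepos.
- exact: measurable_funeneg.
Qed.

(** Campbell's formula for |h| shows that the random integral of |h| has finite mean. *)
Lemma prm_ae_integrable (h : E -> R) : Lam.-integrable setT (EFin \o h) ->
  {ae P, forall w, (N w).-integrable setT (EFin \o h)}.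
Proof.
move=> ih; have mh := measurable_int _ ih.
have mh' : measurable_fun setT (fun z => `|(h z)%:E|%E) by exact: measurableT_comp.
have mI : measurable_fun setT (fun w => \int[N w]_z `|(h z)%:E|)%E.
  exact: (measurable_fun_integral_kernel (prm_measurable prm)).
have : P.-integrable setT (fun w => \int[N w]_z `|(h z)%:E|)%E.
  apply/integrableP; split=> //.
  under eq_integral do rewrite gee0_abs ?integral_ge0//.
  by rewrite (campbell prm)//; case/integrableP : ih.
move=> /(integrable_ae measurableT); apply: filterS => w /(_ I) fw.
by apply/integrableP; split=> //; rewrite -ge0_fin_numE// integral_ge0.
Qed.

(** The Poisson integral is a contraction from L^1 of the intensity to L^1 of the probability; this
    carries identities from simple to integrable functions. *)
Lemma integral_prm_integral_le (h : E -> R) : Lam.-integrable setT (EFin \o h) ->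
  (\int[P]_w `|prm_integral h w|%:E <= \int[Lam]_z `|h z|%:E)%E.
Proof.
move=> ih; have mh : measurable_fun setT h by apply/measurable_EFinP; exact: measurable_int ih.
have mh' : measurable_fun setT (fun z => `|h z|%:E) by apply/measurable_EFinP; exact: measurableT_comp.
rewrite -(campbell prm)//; apply: ae_ge0_le_integral => //.
- by apply/measurable_EFinP; apply: measurableT_comp => //; exact: measurable_prm_integral.
- by move=> w _; exact: integral_ge0.
- exact: (measurable_fun_integral_kernel (prm_measurable prm)).
have := prm_ae_integrable ih; apply: filterS => w iw _.
rewrite /prm_integral EFin_normr_Rintegral//.
by apply: le_abse_integral => //; exact: measurable_int iw.
Qed.

Lemma prm_integralB (f h : E -> R) : Lam.-integrable setT (EFin \o f) ->
  Lam.-integrable setT (EFin \o h) ->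
  {ae P, forall w, prm_integral (fun z => f z - h z) w = prm_integral f w - prm_integral h w}.
Proof.
move=> fi hi; have := prm_ae_integrable fi; have := prm_ae_integrable hi.
by apply: filterS2 => w h1 h2; rewrite /prm_integral RintegralB.
Qed.

Lemma prm_integral_lin (k : nat) (t : 'I_k -> R) (h : 'I_k -> E -> R) :
  (forall j, Lam.-integrable setT (EFin \o h j)) ->
  {ae P, forall w, prm_integral (fun z => \sum_j t j * h j z) w =
    \sum_j t j * prm_integral (h j) w}.
Proof.
move=> hi.
have : {ae P, forall w, forall j, (N w).-integrable setT (EFin \o h j)}.
  by apply: filter_forall => j; exact: prm_ae_integrable.
apply: filterS => w hw; rewrite /prm_integral Rintegral_sum//.
  by apply: eq_bigr => j _; rewrite RintegralZl.
by move=> j; exact: integrable_realZl.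
Qed.

Lemma prm_integrable_integral (h : E -> R) : Lam.-integrable setT (EFin \o h) ->
  P.-integrable setT (EFin \o prm_integral h).
Proof.
move=> ih; have mh : measurable_fun setT h by apply/measurable_EFinP; exact: measurable_int ih.
apply/integrableP; split; first by apply/measurable_EFinP; exact: measurable_prm_integral.
by apply: le_lt_trans (integral_prm_integral_le ih) _; case/integrableP : ih.
Qed.

Lemma prm_expectation (h : E -> R) : Lam.-integrable setT (EFin \o h) ->
  \int[P]_w prm_integral h w = \int[Lam]_z h z.
Proof.
move=> ih; have mh : measurable_fun setT h by apply/measurable_EFinP; exact: measurable_int ih.
have ip : Lam.-integrable setT (EFin \o (fun z => Num.max (h z) 0)).
  by have := integrable_funrpos measurableT ih.
have iN : Lam.-integrable setT (EFin \o (fun z => Num.max (- h z) 0)).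
  by have := integrable_funrneg measurableT ih.
have pos (g : E -> R) : (forall z, 0 <= g z) -> Lam.-integrable setT (EFin \o g) ->
    \int[P]_w prm_integral g w = \int[Lam]_z g z.
  move=> g0 ig; rewrite /prm_integral [in LHS]/Rintegral; congr fine.
  have mg : measurable_fun setT g by apply/measurable_EFinP; exact: measurable_int ig.
  rewrite -(campbell prm) => [|z|]; [|by rewrite lee_fin|exact/measurable_EFinP].
  apply: ge0_ae_eq_integral => //.
  - by apply/measurable_EFinP; exact: measurable_prm_integral.
  - apply: (measurable_fun_integral_kernel (prm_measurable prm)) => [z|].
      by rewrite lee_fin.
    exact/measurable_EFinP.
  - by move=> w _; rewrite lee_fin Rintegral_ge0.
  - by move=> w _; apply: integral_ge0 => z _; rewrite lee_fin.
  - have := prm_ae_integrable ig; apply: filterS => w iw _.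
    by rewrite EFin_Rintegral.
have E1 : h = (fun z => Num.max (h z) 0 - Num.max (- h z) 0).
  apply/funext => z; have [h0|h0] := leP (h z) 0.
    by rewrite max_l ?oppr_ge0// sub0r opprK.
  by rewrite max_r ?subr0// oppr_le0 ltW.
transitivity (\int[P]_w (prm_integral (fun z => Num.max (h z) 0) w -
    prm_integral (fun z => Num.max (- h z) 0) w)).
  rewrite /Rintegral; congr fine; apply: ae_eq_integral => //.
  - by apply/measurable_EFinP; exact: measurable_prm_integral.
  - apply/measurable_EFinP; apply: measurable_funB; apply: measurable_prm_integral.
    + by apply/measurable_EFinP; exact: measurable_int ip.
    + by apply/measurable_EFinP; exact: measurable_int iN.
  - have := prm_integralB ip iN; apply: filterS => w H _.
    by rewrite -H -E1.
rewrite RintegralB//; [|exact: prm_integrable_integral..].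
rewrite !pos//; [|by move=> z; rewrite le_max lexx orbT..].
by rewrite -RintegralB// -E1.
Qed.

End prm_charfun.

Section expC.
Context {R : realType}.
Implicit Types z : R[i].

Lemma expCD z1 z2 : expC (z1 + z2) = expC z1 * expC z2.
Proof.
case: z1 z2 => [a b] [c d]; rewrite /expC /=.
by congr (_ +i* _)%C; rewrite expRD ?cosD ?sinD; ring.
Qed.

Lemma expC0 : expC (0 : R[i]) = 1.
Proof. by rewrite /expC /= expR0 cos0 sin0 mulr1 mulr0. Qed.

Lemma expC_sum (I : Type) (r : seq I) (z : I -> R[i]) :
  expC (\sum_(i <- r) z i) = \prod_(i <- r) expC (z i).
Proof.
by elim: r => [|i r IH]; rewrite ?big_nil ?expC0// !big_cons expCD IH.
Qed.

Lemma sum_complex (I : Type) (r : seq I) (a b : I -> R) :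
  \sum_(i <- r) (a i +i* b i)%C = ((\sum_(i <- r) a i) +i* (\sum_(i <- r) b i))%C.
Proof. by elim: r => [|i r IH]; rewrite ?big_nil// !big_cons IH. Qed.

End expC.

Section prm_charfun.
Context {R : realType} dO (Om : measurableType dO) (P : probability Om R)
  dE (E : measurableType dE) (N : Om -> {measure set E -> \bar R})
  (Lam : {measure set E -> \bar R}).
Hypothesis prm : poisson_random_measure P Lam N.
Import HBSimple.

Lemma eq_cfun_ae (X Y : Om -> R) : measurable_fun setT X -> measurable_fun setT Y ->
  {ae P, forall w, X w = Y w} -> cfun P X = cfun P Y.
Proof.
move=> mX mY XY; rewrite /cfun /Rintegral; congr (fine _ +i* fine _)%C.
  apply: ae_eq_integral => //.
  - exact/measurable_EFinP/measurable_fun_cos.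
  - exact/measurable_EFinP/measurable_fun_cos.
  - by apply: filterS XY => w -> _.
apply: ae_eq_integral => //.
- exact/measurable_EFinP/measurable_fun_sin.
- exact/measurable_EFinP/measurable_fun_sin.
- by apply: filterS XY => w -> _.
Qed.

(** On disjoint cells of finite intensity the counts are independent Poisson variables, and their
    exponents add up to integrals: cos - 1 and sin vanish at 0, so the complement of the cells
    contributes 0. *)
Lemma cfun_prm_simple (h : {sfun E >-> R}) : Lam.-integrable setT (EFin \o h) ->
  cfun P (prm_integral N h) =
  expC ((\int[Lam]_z (cos (h z) - 1)) +i* (\int[Lam]_z sin (h z)))%C.
Proof.
move=> ih; have [n [s [A [mA tA LA hE]]]] := sfun_integrable_repr ih.
have iA i : Lam.-integrable setT (EFin \o (\1_(A i) : E -> R)).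
  apply/integrableP; split; first exact/measurable_EFinP/measurable_indic.
  by under eq_integral do rewrite /= ger0_norm//; rewrite integral_indic// setIT.
have intE (k : R -> R) : k 0 = 0 -> \int[Lam]_z k (h z) = \sum_i k (s i) * fine (Lam (A i)).
  move=> k0; under eq_Rintegral do rewrite hE comp_sum_indic//.
  rewrite Rintegral_sum//; last by move=> i; exact: integrable_realZl.
  apply: eq_bigr => i _; rewrite RintegralZl//; congr (_ * _).
  by rewrite /Rintegral integral_indic// setIT.
have mN i : measurable_fun setT (fun w => N w (A i)) by exact: (prm_measurable prm).
transitivity (cfun P (fun w => \sum_i s i * fine (N w (A i)))).
  apply: eq_cfun_ae.
  - exact: (measurable_prm_integral prm).
  - apply: measurable_sum => i; apply: measurable_funM => //.
    exact: measurableT_comp.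
  - have : {ae P, forall w, forall i, (N w).-integrable setT (EFin \o (\1_(A i) : E -> R))}.
      by apply: filter_forall => i; exact: (prm_ae_integrable prm).
    apply: filterS => w iN; rewrite /prm_integral.
    under eq_Rintegral do rewrite hE.
    rewrite Rintegral_sum//; last by move=> i; exact: integrable_realZl.
    apply: eq_bigr => i _; rewrite RintegralZl//; congr (_ * _).
    by rewrite /Rintegral integral_indic// setIT.
rewrite (@cfun_sum_independent _ _ _ _ _ _ _ (fun i w => N w (A i)) (fun i x => s i * fine x))//.
- rewrite (intE (fun x => cos x - 1)) ?cos0 ?subrr// (intE sin) ?sin0// -sum_complex expC_sum.
  apply: eq_bigr => i _; rewrite (@cfun_poisson _ _ _ _ _ (fine (Lam (A i))))//.
  + by congr expC; congr (_ +i* _)%C; rewrite mulrC.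
  + by move=> k; rewrite (prm_poisson prm).
- by move=> i; apply: measurable_funM => //.
- exact: (prm_independent prm).
Qed.

Lemma cvg_cfun_L1 (X_ : nat -> Om -> R) (X : Om -> R) :
  (forall n, measurable_fun setT (X_ n)) -> measurable_fun setT X ->
  (forall n, P.-integrable setT (EFin \o (fun w => X_ n w - X w))) ->
  \int[P]_w `|X_ n w - X w| @[n --> \oo] --> 0 ->
  \int[P]_w cos (X_ n w) @[n --> \oo] --> \int[P]_w cos (X w) /\
  \int[P]_w sin (X_ n w) @[n --> \oo] --> \int[P]_w sin (X w).
Proof.
move=> mX_ mX iX H.
have iN n := integrable_norm (iX n).
have ic n := integrable_cos P (mX_ n); have iS n := integrable_sin P (mX_ n).
have ic' := integrable_cos P mX; have iS' := integrable_sin P mX.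
split.
- apply: Rintegral_cvg_dist => //.
  apply: squeeze_cvgr (cvg_cst 0) H; apply: nearW => n; apply/andP; split.
    exact: Rintegral_ge0.
  apply: le_Rintegral => //; [|exact: iN|by move=> w _; exact: normB_cos].
  by apply: integrable_norm; exact: integrable_realB.
- apply: Rintegral_cvg_dist => //.
  apply: squeeze_cvgr (cvg_cst 0) H; apply: nearW => n; apply/andP; split.
    exact: Rintegral_ge0.
  apply: le_Rintegral => //; [|exact: iN|by move=> w _; exact: normB_sin].
  by apply: integrable_norm; exact: integrable_realB.
Qed.

(** Simple functions approximate h in L^1 of the intensity, and both sides are continuous for this:
    the left by the contraction property, the right because cos and sin are 1-Lipschitz. Subtracting
    the mean puts - h into the imaginary part. *)
Lemma cfun_prm (h : E -> R) : Lam.-integrable setT (EFin \o h) ->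
  cfun P (fun w => prm_integral N h w - \int[Lam]_z h z) =
  expC ((\int[Lam]_z (cos (h z) - 1)) +i* (\int[Lam]_z (sin (h z) - h z)))%C.
Proof.
move=> ih.
have [h_ [ih_ hh dh]] := approximation_sfun_integrable measurableT ih.
have mh : measurable_fun setT h by apply/measurable_EFinP; exact: measurable_int ih.
have idh n : Lam.-integrable setT (EFin \o (fun z => h_ n z - h z)).
  exact: integrable_realB.
have idh' n : Lam.-integrable setT (EFin \o (fun z => `|h_ n z - h z|)).
  exact: integrable_norm.
have dR : \int[Lam]_z `|h_ n z - h z| @[n --> \oo] --> 0.
  apply: fine_cvg; move: dh; apply: cvg_trans; apply: near_eq_cvg; apply: nearW => n.
  by apply: eq_integral => z _ /=; rewrite distrC.
have mI g : measurable_fun setT g -> measurable_fun setT (prm_integral N g).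
  exact: (measurable_prm_integral prm).
have [Lc Ls] : \int[P]_w cos (prm_integral N (h_ n) w) @[n --> \oo] --> \int[P]_w cos (prm_integral N h w) /\
  \int[P]_w sin (prm_integral N (h_ n) w) @[n --> \oo] --> \int[P]_w sin (prm_integral N h w).
  have iI n : P.-integrable setT (EFin \o (fun w => prm_integral N (h_ n) w - prm_integral N h w)).
    by apply: integrable_realB => //; exact: (prm_integrable_integral prm).
  apply: cvg_cfun_L1 => //.
  - by move=> n; exact: mI.
  - exact: mI.
  apply: squeeze_cvgr (cvg_cst 0) dR; apply: nearW => n; apply/andP; split.
    exact: Rintegral_ge0.
  rewrite -lee_fin -!EFin_Rintegral//; last exact: integrable_norm.
  rewrite (le_trans _ (integral_prm_integral_le prm (idh n)))//.
  rewrite le_eqVlt; apply/orP; left; apply/eqP; apply: ge0_ae_eq_integral => //.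
  - apply/measurable_EFinP; apply: measurableT_comp => //.
    by apply: measurable_funB; exact: mI.
  - apply/measurable_EFinP; apply: measurableT_comp => //; apply: mI.
    exact: measurable_funB.
  - by have := prm_integralB prm (ih_ n) ih; apply: filterS => w -> _.
have ic g : Lam.-integrable setT (EFin \o g) -> Lam.-integrable setT (EFin \o (fun z => cos (g z) - 1)).
  move=> ig; have mg : measurable_fun setT g by apply/measurable_EFinP; exact: measurable_int ig.
  apply: (@le_integrable_real _ _ _ _ _ _ (fun z => `|g z|)) => //.
  - by apply: measurable_funB => //; exact: measurable_fun_cos.
  - by move=> z _; rewrite -(@cos0 R) -[X in _ <= `|X|]subr0 normB_cos.
  - exact: integrable_norm.
have iS g : Lam.-integrable setT (EFin \o g) -> Lam.-integrable setT (EFin \o (fun z => sin (g z))).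
  move=> ig; have mg : measurable_fun setT g by apply/measurable_EFinP; exact: measurable_int ig.
  apply: (@le_integrable_real _ _ _ _ _ _ (fun z => `|g z|)) => //.
  - exact: measurable_fun_sin.
  - by move=> z _; exact: sin_le_abs.
  - exact: integrable_norm.
have Rc : \int[Lam]_z (cos (h_ n z) - 1) @[n --> \oo] --> \int[Lam]_z (cos (h z) - 1).
  apply: Rintegral_cvg_dist => //; [by move=> n; exact: ic|exact: ic|].
  apply: squeeze_cvgr (cvg_cst 0) dR; apply: nearW => n; apply/andP; split.
    exact: Rintegral_ge0.
  apply: le_Rintegral => //.
    by apply: integrable_norm; apply: integrable_realB => //; exact: ic.
  by move=> z _; rewrite opprB addrA subrK normB_cos.
have Rs : \int[Lam]_z sin (h_ n z) @[n --> \oo] --> \int[Lam]_z sin (h z).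
  apply: Rintegral_cvg_dist => //; [by move=> n; exact: iS|exact: iS|].
  apply: squeeze_cvgr (cvg_cst 0) dR; apply: nearW => n; apply/andP; split.
    exact: Rintegral_ge0.
  apply: le_Rintegral => //.
    by apply: integrable_norm; apply: integrable_realB => //; exact: iS.
  by move=> z _; rewrite normB_sin.
have E1 n := cfun_prm_simple (ih_ n).
set a := \int[Lam]_z (cos (h z) - 1) in Rc *.
set b := \int[Lam]_z sin (h z) in Rs *.
have Ec n : \int[P]_w cos (prm_integral N (h_ n) w) =
    expR (\int[Lam]_z (cos (h_ n z) - 1)) * cos (\int[Lam]_z sin (h_ n z)).
  by have [] := E1 n.
have Es n : \int[P]_w sin (prm_integral N (h_ n) w) =
    expR (\int[Lam]_z (cos (h_ n z) - 1)) * sin (\int[Lam]_z sin (h_ n z)).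
  by have [] := E1 n.
have Hc : \int[P]_w cos (prm_integral N h w) = expR a * cos b.
  rewrite -(cvg_lim (@Rhausdorff R) Lc); apply: cvg_lim => //.
  under eq_fun do rewrite Ec.
  apply: cvgM; first by apply: continuous_cvg => //; exact: continuous_expR.
  by apply: continuous_cvg => //; exact: continuous_cos.
have Hs : \int[P]_w sin (prm_integral N h w) = expR a * sin b.
  rewrite -(cvg_lim (@Rhausdorff R) Ls); apply: cvg_lim => //.
  under eq_fun do rewrite Es.
  apply: cvgM; first by apply: continuous_cvg => //; exact: continuous_expR.
  by apply: continuous_cvg => //; exact: continuous_sin.
set c := \int[Lam]_z h z.
have icP := integrable_cos P (mI h mh); have isP := integrable_sin P (mI h mh).
rewrite RintegralB//; last exact: iS.
rewrite -/a -/b -/c /cfun /expC /=; congr (_ +i* _)%C.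
  under eq_Rintegral do rewrite cosB ![_ * cos c]mulrC ![_ * sin c]mulrC.
  by rewrite RintegralD ?RintegralZl ?Hc ?Hs ?cosB//; [ring|exact: integrable_realZl..].
under eq_Rintegral do rewrite sinB ![_ * cos c]mulrC ![_ * sin c]mulrC.
by rewrite RintegralB ?RintegralZl ?Hc ?Hs ?sinB//; [ring|exact: integrable_realZl..].
Qed.

End prm_charfun.

(** * Averages over small balls *)

Section boxes.
Context {R : realType} {d : nat}.
Implicit Types (a b : 'I_d -> R) (x y : Rd R d).

Definition box a b : set (Rd R d) := [set x | forall i, a i < tnth x i <= b i].

Definition boxes : set (set (Rd R d)) := [set A | exists a b, A = box a b].

Definition cube (n : nat) : set (Rd R d) :=
  box (fun=> - n%:R) (fun=> n%:R).

Lemma boxE a b : box a b = [set x | forall i, `]a i, b i]%classic (tnth x i)].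
Proof. by apply/seteqP; split => x /= H i; have := H i; rewrite in_itv. Qed.

Lemma boxI a b a' b' :
  box a b `&` box a' b' = box (fun i => Num.max (a i) (a' i)) (fun i => Num.min (b i) (b' i)).
Proof.
apply/seteqP; split => x /=.
  by move=> [H H'] i; rewrite gt_max le_min; move: (H i) (H' i) => /andP[-> ->] /andP[-> ->].
move=> H; split=> i; have := H i; rewrite gt_max le_min.
  by move=> /andP[/andP[-> _] /andP[-> _]].
by move=> /andP[/andP[_ ->] /andP[_ ->]].
Qed.

Lemma tuple_bounded x : exists n : nat, forall i, `|tnth x i : R| < n%:R.
Proof.
exists (Num.bound (\sum_(i < d) `|tnth x i : R|)) => i.
apply: le_lt_trans (archi_boundP _); last by apply: sumr_ge0.
by rewrite (bigD1 i)//= lerDl sumr_ge0.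
Qed.

Lemma cubeP n x : (forall i, `|tnth x i : R| < n%:R) -> cube n x.
Proof. by move=> H i; have := H i; rewrite ltr_norml => /andP[-> /ltW]. Qed.

Lemma bigcup_cube : \bigcup_n cube n = setT.
Proof.
apply/seteqP; split => // x _; have [n xn] := tuple_bounded x.
by exists n => //; exact: cubeP.
Qed.

Lemma boxes_setI_closed : setI_closed boxes.
Proof. by move=> _ _ [a [b ->]] [a' [b' ->]]; rewrite boxI; do 2 eexists. Qed.

Lemma measurable_box a b : measurable (box a b).
Proof.
rewrite (_ : box a b = \bigcap_(i in [set: 'I_d])
    ((fun x : Rd R d => tnth x i) @^-1` `]a i, b i]%classic)).
  apply: fin_bigcap_measurable => // i _.
  rewrite -[X in measurable X]setTI.
  exact: (measurable_tnth i measurableT (measurable_itv _)).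
rewrite boxE; apply/seteqP; split => x /=; first by move=> + i _; exact.
by move=> H i; exact: H.
Qed.

(** A half-space {x_i > r} is the countable union of the boxes with i-th side ]r, n] and the other
    sides ]-n, n], and half-spaces make the coordinates measurable. *)
Lemma measurable_boxesE : @measurable _ (Rd R d) = <<s boxes >>.
Proof.
apply/seteqP; split; last first.
  by apply: smallest_sub; [exact: sigma_algebra_measurable|move=> _ [a [b ->]]; exact: measurable_box].
suff mid : measurable_fun [set: g_sigma_algebraType boxes]
    (id : g_sigma_algebraType boxes -> Rd R d).
  by move=> A mA; have := mid measurableT A mA; rewrite setTI.
apply/measurable_fun_tnthP => i mD.
apply: (measurability _ (RGenOInfty.measurableE R)) => //.
move=> /= _ [_ [r ->] <-]; rewrite setTI.
rewrite [X in measurable X](_ : _ = \bigcup_n (box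
  (fun j => if j == i then r else - n%:R) (fun=> n%:R) : set (g_sigma_algebraType boxes))).
  by apply: bigcupT_measurable => n; apply: sub_sigma_algebra; do 2 eexists.
apply/seteqP; split => x /=.
  rewrite in_itv/= andbT => rx; have [n xn] := tuple_bounded x; exists n => // j.
  by have := xn j; rewrite ltr_norml => /andP[jn /ltW ->]; case: eqP => [->|_]; rewrite ?rx ?jn.
by move=> [n _] /(_ i); rewrite eqxx in_itv/= andbT => /andP[].
Qed.

Lemma lebesgue_box a b : lebesgue_tuple d (box a b) =
  (\prod_(i < d) Num.max 0 (b i - a i))%:E.
Proof.
rewrite boxE (@lebesgue_tuple_box _ _ (fun i => `]a i, b i]%classic)); last first.
  by move=> i; exact: measurable_itv.
rewrite -prodEFin; apply: eq_bigr => i _.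
rewrite lebesgue_measure_itv/= lte_fin.
have [ab|ba] := ltP (a i) (b i); first by rewrite max_r ?EFinB// subr_ge0 ltW.
by rewrite max_l// subr_le0.
Qed.

Lemma lebesgue_tuple_unique (m : {measure set (Rd R d) -> \bar R}) :
  (forall a b, m (box a b) = lebesgue_tuple d (box a b)) ->
  forall A, measurable A -> m A = lebesgue_tuple d A.
Proof.
move=> H; apply: (measure_unique boxes cube).
- exact: measurable_boxesE.
- exact: boxes_setI_closed.
- by move=> n; do 2 eexists.
- exact: bigcup_cube.
- by move=> _ [a [b ->]].
- by move=> n; rewrite /cube H lebesgue_box ltry.
Qed.

Definition affine (x : Rd R d) (r : R) (z : Rd R d) : Rd R d :=
  [tuple (tnth x i + r * tnth z i : R) | i < d].

Lemma measurable_affine x r : measurable_fun setT (affine x r).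
Proof.
apply/measurable_fun_tnthP => i.
rewrite (_ : _ \o _ = fun z : Rd R d => (tnth x i + r * (tnth z i : R))); last first.
  by apply/funext => z /=; rewrite tnth_mktuple.
apply: measurable_funD => //; apply: measurable_funM => //.
exact: measurable_tnth.
Qed.

Lemma affine_box x (r : R) a b : 0 < r ->
  affine x r @^-1` box a b =
  box (fun i => (a i - (tnth x i : R)) / r) (fun i => (b i - (tnth x i : R)) / r).
Proof.
move=> r0; apply/seteqP; split => z /= H i; have := H i;
  by rewrite tnth_mktuple ltr_pdivrMr// ler_pdivlMr// ltrBlDl lerBrDl [_ * r]mulrC.
Qed.

(** Both sides are measures in A, and they agree on boxes, whose sides are divided by r under the
    preimage. *)
Lemma lebesgue_affine x (r : R) A : 0 < r -> measurable A ->
  (lebesgue_tuple d A = (r ^+ d)%:E * lebesgue_tuple d (affine x r @^-1` A))%E.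
Proof.
move=> r0 mA; have rd0 : 0 <= r ^+ d by rewrite exprn_ge0// ltW.
have -> : ((r ^+ d)%:E * lebesgue_tuple d (affine x r @^-1` A) = mscale (NngNum rd0)
  (pushforward (lebesgue_tuple d) (mfun_Sub (mem_set (measurable_affine x r)))) A)%E by [].
apply/esym; apply: lebesgue_tuple_unique => // a b.
rewrite /= /mscale/= /pushforward/= affine_box// !lebesgue_box -EFinM; congr EFin.
rewrite -[in r ^+ _](card_ord d) -prodr_const -big_split/=; apply: eq_bigr => i _.
by rewrite maxr_pMr ?(ltW r0)// mulr0 -mulrBl opprB addrA subrK mulrC divfK ?gt_eqF.
Qed.

End boxes.

(** * Euclidean balls and their volume *)

Section euclidean_balls.
Context {R : realType} {d : nat}.
Implicit Types (x y : Rd R d) (r : R).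
Local Notation leb := (lebesgue_tuple (R := R) d).
Local Notation cd := (unit_ball_volume (R := R) d).
Local Notation edist := Defs.edist.

Lemma edistC x y : edist x y = edist y x.
Proof. by rewrite /edist; congr Num.sqrt; apply: eq_bigr => i _; rewrite -sqrrN opprB. Qed.

Lemma le_coord_edist x y (i : 'I_d) : `|(tnth y i - tnth x i : R)| <= edist x y.
Proof.
rewrite /edist -sqrtr_sqr ler_sqrt; last by apply: sumr_ge0 => j _; exact: sqr_ge0.
by rewrite (bigD1 i)//= lerDl; apply: sumr_ge0 => j _; exact: sqr_ge0.
Qed.

Lemma measurable_edist : measurable_fun setT (fun p : Rd R d * Rd R d => edist p.1 p.2).
Proof.
apply: (@measurableT_comp _ _ _ _ _ _ (@Num.sqrt R)).
  by apply: continuous_measurable_fun; exact: sqrt_continuous.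
apply: measurable_sum => i; apply: measurable_funX; apply: measurable_funB.
  by apply: (measurableT_comp (measurable_tnth i)).
by apply: (measurableT_comp (measurable_tnth i)).
Qed.

(** The ball as a kernel symmetric in centre and point, which turns families of integrals over balls
    into double integrals. *)
Definition ballk r x y : R := \1_(eball x r) y.

Lemma ballkE r x y : ballk r x y = ((edist x y < r)%R : bool)%:R.
Proof. by rewrite /ballk indicE mem_setE. Qed.

Lemma ballkC r x y : ballk r x y = ballk r y x.
Proof. by rewrite !ballkE edistC. Qed.

Lemma ballk_ge0 r x y : 0 <= ballk r x y.
Proof. by rewrite ballkE. Qed.

Lemma measurable_ballk dT (T : measurableType dT) (r : T -> R) (x y : T -> Rd R d) :
  measurable_fun setT r -> measurable_fun setT x -> measurable_fun setT y ->
  measurable_fun setT (fun t => ballk (r t) (x t) (y t)).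
Proof.
move=> mr mx my; under eq_fun do rewrite ballkE.
apply: (@measurableT_comp _ _ _ _ _ _ (fun b : bool => b%:R : R) _ (fun t => edist (x t) (y t) < r t)).
  by [].
apply: measurable_fun_ltr => //.
  apply: (@measurableT_comp _ _ _ _ _ _ (fun p : Rd R d * Rd R d => edist p.1 p.2) _ (fun t => (x t, y t))).
    exact: measurable_edist.
  exact: measurable_fun_pair.
Qed.

Lemma measurable_eball x r : measurable (eball x r).
Proof.
rewrite -[X in measurable X]setTI (_ : eball x r = ballk r x @^-1` [set 1]).
  by apply: measurable_ballk.
apply/seteqP; split => y; rewrite /= ballkE /eball/=; first by move->.
by case: (edist x y < r) => // /eqP; rewrite eq_sym oner_eq0.
Qed.

Lemma affine_eball x r : 0 < r -> affine x r @^-1` eball x r =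
  eball [tuple (0 : R) | i < d] 1.
Proof.
move=> r0; apply/seteqP; split => z; rewrite /eball/=;
  rewrite (_ : edist x (affine x r z) = r * edist [tuple (0 : R) | i < d] z) ?gtr_pMr//;
  rewrite /edist -[in RHS](ger0_norm (ltW r0)) -sqrtr_sqr -sqrtrM ?sqr_ge0// mulr_sumr;
  by congr Num.sqrt; apply: eq_bigr => i _; rewrite !tnth_mktuple addrAC subrr add0r subr0 exprMn.
Qed.

Lemma lebesgue_unit_ball : leb (eball [tuple (0 : R) | i < d] 1) = cd%:E.
Proof.
rewrite fineK// ge0_fin_numE//.
apply: (@le_lt_trans _ _ (leb (box (fun=> - 1) (fun=> 1)))).
  rewrite le_measure ?inE//; [exact: measurable_eball|exact: measurable_box|].
  move=> z; rewrite /eball/= => z1 i.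
  have := le_lt_trans (le_coord_edist _ z i) z1.
  by rewrite tnth_mktuple subr0 ltr_norml => /andP[-> /ltW].
by rewrite lebesgue_box ltry.
Qed.

Lemma unit_ball_volume_ge0 : 0 <= cd.
Proof. by rewrite -lee_fin -lebesgue_unit_ball. Qed.

Lemma lebesgue_eball x r : 0 < r -> leb (eball x r) = (cd * r ^+ d)%:E.
Proof.
move=> r0; rewrite (@lebesgue_affine _ _ x r)//; last exact: measurable_eball.
by rewrite affine_eball// lebesgue_unit_ball -EFinM mulrC.
Qed.

Lemma integral_ballk x r : 0 < r -> (\int[leb]_y (ballk r x y)%:E = (cd * r ^+ d)%:E)%E.
Proof.
move=> r0; rewrite -(lebesgue_eball x r0) -[in RHS](setIT (eball x r)).
by apply: integral_indic => //; exact: measurable_eball.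
Qed.

Lemma ge0_integral_ballk_fst r (g : Rd R d -> R) : 0 < r -> (forall y, 0 <= g y) ->
  measurable_fun setT g ->
  (\int[leb]_x \int[leb]_y (ballk r x y * g x)%:E = (cd * r ^+ d)%:E * \int[leb]_y (g y)%:E)%E.
Proof.
move=> r0 g0 mg; have C0 : 0 <= cd * r ^+ d by rewrite mulr_ge0 ?unit_ball_volume_ge0 ?exprn_ge0 ?ltW.
rewrite -ge0_integralZl_EFin//; [|by move=> y _; rewrite lee_fin|exact/measurable_EFinP].
apply: eq_integral => x _; under eq_integral do rewrite mulrC EFinM.
rewrite ge0_integralZl_EFin//; first by rewrite integral_ballk// muleC.
  by move=> y _; rewrite lee_fin ballk_ge0.
by apply/measurable_EFinP; exact: measurable_ballk.
Qed.

(** Tonelli and the symmetry of the kernel reduce this to the case where g is evaluated at the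
    centre. *)
Lemma ge0_integral_ballk r (g : Rd R d -> R) : 0 < r -> (forall y, 0 <= g y) ->
  measurable_fun setT g ->
  (\int[leb]_x \int[leb]_y (ballk r x y * g y)%:E = (cd * r ^+ d)%:E * \int[leb]_y (g y)%:E)%E.
Proof.
move=> r0 g0 mg; rewrite -(ge0_integral_ballk_fst r0 g0 mg).
rewrite (@fubini_tonelli _ _ _ _ _ leb leb (fun p => (ballk r p.1 p.2 * g p.2)%:E)).
- by apply: eq_integral => x _; apply: eq_integral => y _; rewrite /= ballkC.
- apply/measurable_EFinP; apply: measurable_funM; first exact: measurable_ballk.
  exact: measurableT_comp.
- by move=> p; rewrite lee_fin mulr_ge0// ballk_ge0.
Qed.

End euclidean_balls.

(** * Mean oscillation at small scales *)

Section oscillation.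
Context {R : realType} {d : nat}.
Implicit Types (x y : Rd R d) (r e : R) (f g h : Rd R d -> R).
Local Notation leb := (lebesgue_tuple (R := R) d).
Local Notation cd := (unit_ball_volume (R := R) d).

Lemma half_bound (c e : R) : 0 <= c -> 0 < e -> c * (e / (2 * (c + 1))) <= e / 2.
Proof.
move=> c0 e0; have c1 : 0 < c + 1 by rewrite ltr_pwDr.
rewrite (_ : c * _ = e / 2 * (c / (c + 1))); last by field; rewrite gt_eqF.
by rewrite ler_piMr ?divr_ge0 ?(ltW e0)// ler_pdivrMr ?mul1r ?lerDl.
Qed.

(** The variation of f summed over all pairs at distance less than r. It is compared with r^d, the
    order of the volume of a ball, so that vanishing oscillation means o(r^d). *)
Definition osc r f : \bar R :=
  (\int[leb \x leb]_p (ballk r p.1 p.2 * `|f p.2 - f p.1|)%:E)%E.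

(* These functions form a linear space closed under L^1-limits and containing the
   indicators of boxes, hence (Dynkin) all of L^1. *)
Definition vanishing_osc f := measurable_fun setT f /\
  forall e, 0 < e -> exists2 s, 0 < s & forall r, 0 < r < s -> (osc r f <= (e * r ^+ d)%:E)%E.

Lemma measurable_ballk_pair r : measurable_fun setT (fun p : Rd R d * Rd R d => ballk r p.1 p.2).
Proof. exact: measurable_ballk. Qed.

Lemma measurable_osc r f : measurable_fun setT f ->
  measurable_fun setT (fun p : Rd R d * Rd R d => ballk r p.1 p.2 * `|f p.2 - f p.1|).
Proof.
move=> mf; apply: measurable_funM; first exact: measurable_ballk_pair.
apply: (measurableT_comp (@normr_measurable R setT)).
by apply: measurable_funB; exact: measurableT_comp.
Qed.

Lemma integral_ballk_sum r g : 0 < r -> (forall y, 0 <= g y) -> measurable_fun setT g ->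
  (\int[leb \x leb]_p (ballk r p.1 p.2 * (g p.1 + g p.2))%:E =
   (2 * cd * r ^+ d)%:E * \int[leb]_y (g y)%:E)%E.
Proof.
move=> r0 g0 mg; have C0 : 0 <= cd * r ^+ d by rewrite mulr_ge0 ?unit_ball_volume_ge0 ?exprn_ge0 ?ltW.
under eq_integral do rewrite mulrDr EFinD.
have m1 : measurable_fun setT (fun p : Rd R d * Rd R d => (ballk r p.1 p.2 * g p.1)%:E).
  apply/measurable_EFinP; apply: measurable_funM; [exact: measurable_ballk_pair|exact: measurableT_comp].
have m2 : measurable_fun setT (fun p : Rd R d * Rd R d => (ballk r p.1 p.2 * g p.2)%:E).
  apply/measurable_EFinP; apply: measurable_funM; [exact: measurable_ballk_pair|exact: measurableT_comp].
have p1 (p : Rd R d * Rd R d) : (0 <= (ballk r p.1 p.2 * g p.1)%:E)%E by rewrite lee_fin mulr_ge0 ?ballk_ge0.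
have p2 (p : Rd R d * Rd R d) : (0 <= (ballk r p.1 p.2 * g p.2)%:E)%E by rewrite lee_fin mulr_ge0 ?ballk_ge0.
have E1 : (\int[leb \x leb]_p (ballk r p.1 p.2 * g p.1)%:E =
  (cd * r ^+ d)%:E * \int[leb]_y (g y)%:E)%E.
  by rewrite fubini_tonelli1// -ge0_integral_ballk_fst.
have E2 : (\int[leb \x leb]_p (ballk r p.1 p.2 * g p.2)%:E =
  (cd * r ^+ d)%:E * \int[leb]_y (g y)%:E)%E.
  by rewrite fubini_tonelli1// -ge0_integral_ballk.
rewrite ge0_integralD// E1 E2 -mulrA -ge0_muleDl ?lee_fin//.
by rewrite -EFinD mulr_natl mulr2n.
Qed.

(** The error g is counted once at each end of a pair. The case a = 1 serves approximation; the case
    a = 0 serves boxes, where g carries everything and the comparison holds only for pairs closer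
    than r. *)
Lemma osc_le r (a : R) f f' g : 0 < r -> 0 <= a -> measurable_fun setT f -> measurable_fun setT f' ->
  (forall y, 0 <= g y) -> measurable_fun setT g ->
  (forall x y, ballk r x y = 1 -> `|f y - f x| <= a * `|f' y - f' x| + (g x + g y)) ->
  (osc r f <= a%:E * osc r f' + (2 * cd * r ^+ d)%:E * \int[leb]_y (g y)%:E)%E.
Proof.
move=> r0 a0 mf mf' g0 mg H; rewrite /osc -integral_ballk_sum// -ge0_integralZl_EFin//; last first.
- by apply/measurable_EFinP; exact: measurable_osc.
- by move=> p _; rewrite lee_fin mulr_ge0 ?ballk_ge0.
have mB : measurable_fun setT (fun p : Rd R d * Rd R d => (ballk r p.1 p.2 * (g p.1 + g p.2))%:E).
  apply/measurable_EFinP; apply: measurable_funM; first exact: measurable_ballk_pair.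
  by apply: measurable_funD; exact: measurableT_comp.
rewrite -ge0_integralD//; last 3 first.
- by move=> p _; rewrite -EFinM lee_fin !mulr_ge0 ?ballk_ge0.
- by apply: measurable_funeM; apply/measurable_EFinP; exact: measurable_osc.
- by move=> p _; rewrite lee_fin mulr_ge0 ?ballk_ge0// addr_ge0.
apply: ge0_le_integral => //.
- by move=> p _; rewrite lee_fin mulr_ge0 ?ballk_ge0.
- by apply/measurable_EFinP; exact: measurable_osc.
- by apply: emeasurable_funD => //; apply: measurable_funeM; apply/measurable_EFinP; exact: measurable_osc.
move=> p _; rewrite -EFinM -EFinD lee_fin mulrCA -mulrDr.
have := H p.1 p.2; rewrite ballkE; case: (Defs.edist p.1 p.2 < r)%R => /=; last by rewrite !mul0r.
by rewrite !mul1r; apply.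
Qed.

(** The error g, typically |f - f'|, adds at most 2 c_d r^d times its integral, a bound of the right
    order in r. *)
Lemma vanishing_osc_approx f : measurable_fun setT f ->
  (forall e, 0 < e -> exists f' g, [/\ vanishing_osc f', forall y, 0 <= g y, measurable_fun setT g,
    (\int[leb]_y (g y)%:E <= e%:E)%E &
    forall x y, `|f y - f x| <= `|f' y - f' x| + (g x + g y)]) ->
  vanishing_osc f.
Proof.
move=> mf H; split=> // e e0.
have c0 : 0 < 2 * (2 * cd + 1) by rewrite mulr_gt0// ltr_pwDr// mulr_ge0 ?unit_ball_volume_ge0.
have [f' [g [[mf' Hf'] g0 mg ge fg]]] := H _ (divr_gt0 e0 c0).
have [s s0 Hs] := Hf' _ (divr_gt0 e0 (ltr0n _ 2)).
exists s => // r /andP[r0 rs].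
apply: (le_trans (@osc_le r 1 f f' g r0 ler01 mf mf' g0 mg _)).
  by move=> x y _; rewrite mul1r.
rewrite mul1e; apply: (le_trans (leeD (Hs r _) (lee_wpmul2l _ ge))).
- by rewrite r0.
- by rewrite lee_fin !mulr_ge0 ?unit_ball_volume_ge0 ?exprn_ge0 ?ltW.
rewrite -EFinM -EFinD lee_fin [X in _ + X <= _]mulrAC -mulrDl ler_wpM2r ?exprn_ge0 ?(ltW r0)//.
by have := half_bound (mulr_ge0 (ler0n _ 2) (@unit_ball_volume_ge0 R d)) e0; lra.
Qed.

Lemma vanishing_osc_lin (a : R) f f' : vanishing_osc f -> vanishing_osc f' ->
  vanishing_osc (fun x => a * f x + f' x).
Proof.
move=> [mf Hf] [mf' Hf'].
have ma : measurable_fun setT (fun x => a * f x) by exact: measurable_funM.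
split=> [|e e0]; first exact: measurable_funD.
have a1 : 0 < 2 * (`|a| + 1) by rewrite mulr_gt0// ltr_pwDr.
have [s s0 Hs] := Hf _ (divr_gt0 e0 a1).
have [t t0 Ht] := Hf' _ (divr_gt0 e0 (ltr0n _ 2)).
exists (Num.min s t); first by rewrite lt_min s0.
move=> r /andP[r0]; rewrite lt_min => /andP[rs rt].
have : (osc r (fun x => (a * f x + f' x)%R) <= `|a|%R%:E * osc r f + osc r f')%E.
  rewrite /osc -ge0_integralZl_EFin//; last first.
  - by apply/measurable_EFinP; exact: measurable_osc.
  - by move=> p _; rewrite lee_fin mulr_ge0 ?ballk_ge0.
  rewrite -ge0_integralD//; last 4 first.
  - by move=> p _; rewrite -EFinM lee_fin !mulr_ge0 ?ballk_ge0.
  - by apply: measurable_funeM; apply/measurable_EFinP; exact: measurable_osc.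
  - by move=> p _; rewrite lee_fin mulr_ge0 ?ballk_ge0.
  - by apply/measurable_EFinP; exact: measurable_osc.
  apply: ge0_le_integral => //.
  - by move=> p _; rewrite lee_fin mulr_ge0 ?ballk_ge0.
  - by apply/measurable_EFinP; apply: (@measurable_osc r (fun x => a * f x + f' x)); exact: measurable_funD.
  - apply: emeasurable_funD; last by apply/measurable_EFinP; exact: measurable_osc.
    by apply: measurable_funeM; apply/measurable_EFinP; exact: measurable_osc.
  move=> p _; rewrite -EFinM -EFinD lee_fin mulrCA -mulrDr ler_wpM2l ?ballk_ge0//.
  by rewrite -normrM mulrBr (le_trans _ (ler_normD _ _))// opprD addrACA.
move/le_trans; apply; apply: (le_trans (leeD (lee_wpmul2l _ (Hs r _)) (Ht r _))) => //.
- by rewrite r0.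
- by rewrite r0.
rewrite -EFinM -EFinD lee_fin mulrA -mulrDl ler_wpM2r ?exprn_ge0 ?(ltW r0)//.
by have := half_bound (normr_ge0 a) e0; lra.
Qed.

Lemma vanishing_osc0 : vanishing_osc (cst 0).
Proof.
split=> // e e0; exists 1 => // r /andP[r0 _].
rewrite /osc; under eq_integral do rewrite subrr normr0 mulr0.
by rewrite integral0 lee_fin mulr_ge0 ?exprn_ge0 ?ltW.
Qed.

Lemma vanishing_osc_sum (I : Type) (s : seq I) (a : I -> R) (F : I -> Rd R d -> R) :
  (forall i, vanishing_osc (F i)) -> vanishing_osc (fun x => \sum_(i <- s) a i * F i x).
Proof.
move=> H; elim: s => [|i s IH].
  by under eq_fun do rewrite big_nil; exact: vanishing_osc0.
by under eq_fun do rewrite big_cons; exact: vanishing_osc_lin.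
Qed.

End oscillation.

Section vanishing_oscillation_L1.
Context {R : realType} {d : nat}.
Implicit Types (x y : Rd R d) (r e : R) (f g h : Rd R d -> R) (A : set (Rd R d)).
Local Notation leb := (lebesgue_tuple (R := R) d).
Local Notation cd := (unit_ball_volume (R := R) d).

Lemma box_shrink_cvg (a b : 'I_d -> R) :
  \prod_(i < d) Num.max 0 (b i - t - (a i + t)) @[t --> (0 : R)^'+] -->
  \prod_(i < d) Num.max 0 (b i - a i).
Proof.
elim: (index_enum _) => [|i s IH].
  by under eq_fun do rewrite big_nil; rewrite big_nil; exact: cvg_cst.
under eq_fun do rewrite big_cons; rewrite big_cons; apply: cvgM => //.
suff : {for 0, continuous (fun t : R => Num.max 0 (b i - t - (a i + t)))}.
  by move=> /cvg_at_right_filter; rewrite subr0 addr0.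
apply: (@continuous_max _ _ (cst 0) (fun t : R => b i - t - (a i + t))); first exact: cst_continuous.
by apply: cvgB; [apply: cvgB => //; exact: cvg_cst|apply: cvgD => //; exact: cvg_cst].
Qed.

(** If two points at distance less than r < t are separated by the boundary of the box, the one
    inside lies in the shell between the box and the box shrunk by t on every side. The volume of
    this shell tends to 0 with t. *)
Lemma vanishing_osc_box (a b : 'I_d -> R) : vanishing_osc (\1_(box a b) : Rd R d -> R).
Proof.
split=> [|e e0]; first by apply: measurable_indic; exact: measurable_box.
have c0 : 0 < 2 * cd + 1 by rewrite ltr_pwDr// mulr_ge0 ?unit_ball_volume_ge0.
have [t [t0 Ht]] : exists t : R, 0 < t /\ \prod_(i < d) Num.max 0 (b i - a i) -
    \prod_(i < d) Num.max 0 (b i - t - (a i + t)) <= e / (2 * cd + 1).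
  have /cvgrPdist_le/(_ _ (divr_gt0 e0 c0)) H := @box_shrink_cvg a b.
  near (0 : R)^'+ => t; exists t; split; first by near: t; exact: nbhs_right_gt.
  by apply: le_trans (ler_norm _) _; near: t.
pose B' := box (fun i => a i + t) (fun i => b i - t).
have B'B : B' `<=` box a b.
  move=> x + i => /(_ i) /andP[h1 h2]; apply/andP; split; first by apply: lt_trans h1; rewrite ltrDl.
  by rewrite (le_trans h2)// gerBl ltW.
exists t => // r /andP[r0 rt].
apply: (le_trans (@osc_le _ _ r 0 _ (cst 0) (\1_(box a b `\` B')) r0 (lexx _) _ _ _ _ _)) => //.
- by apply: measurable_indic; exact: measurable_box.
- by apply: measurable_indic; apply: measurableD; exact: measurable_box.
- have key x y : ballk r x y = 1 -> B' x -> box a b y.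
    rewrite ballkE => + B'x i.
    have [xy _|_ /eqP] := ltP; last by rewrite eq_sym oner_eq0.
    have := le_lt_trans (le_coord_edist x y i) (lt_trans xy rt).
    by rewrite ltr_norml; have /andP[] := B'x i; lra.
  move=> x y xy; rewrite mul0r add0r !indicE.
  have xy' : ballk r y x = 1 by rewrite ballkC.
  have kx := key _ _ xy; have ky := key _ _ xy'.
  have [Bx|Bx] := boolP (x \in box a b); have [By|By] := boolP (y \in box a b).
  + by rewrite subrr normr0 addr_ge0.
  + have -> : x \in box a b `\` B'.
      rewrite inE; split; [by rewrite inE in Bx|move=> /kx Bxy].
      by move: By; rewrite notin_setE.
    by rewrite sub0r normrN normr1 lerDl.
  + have -> : y \in box a b `\` B'.
      rewrite inE; split; [by rewrite inE in By|move=> /ky Bxy].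
      by move: Bx; rewrite notin_setE.
    by rewrite subr0 normr1 lerDr.
  + by rewrite subrr normr0 addr_ge0.
rewrite mul0e add0e.
rewrite [X in (_ * X)%E](_ : _ = (\prod_(i < d) Num.max 0 (b i - a i) -
    \prod_(i < d) Num.max 0 (b i - t - (a i + t)))%:E); last first.
  have mB a' b' : measurable (box a' b' : set (Rd R d)) by exact: measurable_box.
  have Boo : (leb (box a b) < +oo)%E by rewrite lebesgue_box ltry.
  have mD : measurable (box a b `\` B') by apply: measurableD; exact: mB.
  transitivity (leb (box a b `\` B')); first by rewrite integral_indic ?setIT.
  transitivity (leb (box a b) - leb (box a b `&` B'))%E.
    by apply: measureD; [exact: mB|exact: mB|exact: Boo].
  rewrite (_ : box a b `&` B' = B'); last by apply/setIidPr.
  by rewrite !lebesgue_box EFinB.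
rewrite -EFinM lee_fin mulrAC ler_wpM2r ?exprn_ge0 ?(ltW r0)//.
apply: (le_trans (ler_wpM2l _ Ht)); first by rewrite mulr_ge0 ?unit_ball_volume_ge0.
by rewrite mulrCA ler_piMr ?(ltW e0)// ler_pdivrMr// mul1r lerDl.
Unshelve. all: by end_near. Qed.

Lemma quadrangle_ineq (a b a' b' : R) : `|b - a| <= `|b' - a'| + (`|a - a'| + `|b - b'|).
Proof.
rewrite (_ : b - a = (b' - a') + ((a' - a) + (b - b'))); last by ring.
by rewrite (le_trans (ler_normD _ _))// lerD2l (le_trans (ler_normD _ _))// distrC.
Qed.

Lemma indic_dist_le A A' x : A' `<=` A -> `|\1_A x - \1_A' x| = \1_(A `\` A') x :> R.
Proof.
move=> AA'; rewrite !indicE in_setD; have [xA'|xA'] := boolP (x \in A').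
  by rewrite (mem_set (AA' _ (set_mem xA'))) subrr normr0.
by rewrite subr0 ger0_norm ?andbT.
Qed.

Lemma vanishing_osc_indic_nondecreasing (F : (set (Rd R d))^nat) :
  (forall n, measurable (F n)) -> nondecreasing_seq F -> (leb (\bigcup_n F n) < +oo)%E ->
  (forall n, vanishing_osc (\1_(F n) : Rd R d -> R)) ->
  vanishing_osc (\1_(\bigcup_n F n) : Rd R d -> R).
Proof.
move=> mF ndF Foo HF; have mUF : measurable (\bigcup_n F n) by exact: bigcupT_measurable.
apply: vanishing_osc_approx; first exact: measurable_indic.
move=> e e0.
have Ffin : leb (\bigcup_n F n) \is a fin_num by rewrite ge0_fin_numE.
have FU n : F n `<=` \bigcup_n F n by exact: bigcup_sup.
have Fnoo n : (leb (F n) < +oo)%E by apply: le_lt_trans Foo; rewrite le_measure ?inE.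
have : (leb \o F) @ \oo --> (fine (leb (\bigcup_n F n)))%:E.
  by rewrite fineK//; exact: nondecreasing_cvg_mu.
move=> /fine_cvgP[_ /cvgrPdist_le/(_ _ e0)[n _ /(_ n (leqnn n)) Hn]].
exists (\1_(F n)), (\1_((\bigcup_n F n) `\` F n)); split => //.
- by apply: measurable_indic; exact: measurableD.
- rewrite integral_indic ?setIT//; last exact: measurableD.
  rewrite measureD// (_ : _ `&` _ = F n); last by apply/setIidPr.
  apply: (@le_trans _ _ (fine (leb (\bigcup_n F n)) - fine (leb (F n)))%:E).
    by rewrite EFinB !fineK// ge0_fin_numE.
  by rewrite lee_fin (le_trans (ler_norm _)).
move=> x y; rewrite -!indic_dist_le//.
exact: quadrangle_ineq.
Qed.

(** Dynkin's argument. Intersecting with a cube keeps all the measures finite, so that complements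
    are differences and increasing unions are limits in L^1. *)
Lemma vanishing_osc_indic_cube A n : measurable A ->
  vanishing_osc (\1_(A `&` cube n) : Rd R d -> R).
Proof.
rewrite measurable_boxesE => mA; move: A mA n.
apply: (@dynkin_induction _ _ boxes (fun A => forall n, vanishing_osc (\1_(A `&` cube n) : Rd R d -> R))).
- exact: measurable_boxesE.
- exact: boxes_setI_closed.
- by move=> n; rewrite setTI; exact: vanishing_osc_box.
- by move=> _ [a [b ->]] n; rewrite boxI; exact: vanishing_osc_box.
- move=> S mS HS n.
  rewrite (_ : \1_(~` S `&` cube n) = fun x => -1 * \1_(S `&` cube n) x + \1_(cube n) x); last first.
    by apply/funext => x; rewrite !indicE !in_setI in_setC; case: (x \in S) => /=; case: (x \in cube n) => /=; ring.
  by apply: vanishing_osc_lin => //; exact: vanishing_osc_box.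
move=> F mF tF HF n.
have mK : measurable (cube n : set (Rd R d)) by exact: measurable_box.
pose U k := \big[setU/set0]_(i < k) F i.
have mU k : measurable (U k) by exact: bigsetU_measurable.
rewrite -(bigcup_bigsetU_bigcup F) setI_bigcupl.
have EUn k : U k.+1 = U k `|` F k by rewrite /U big_ord_recr.
apply: vanishing_osc_indic_nondecreasing.
- by move=> k; apply: measurableI => //; exact: mU.
- by apply/nondecreasing_seqP => k; apply/subsetPset; apply: setSI; rewrite [X in _ `<=` X]big_ord_recr; exact: subsetUl.
- apply: (@le_lt_trans _ _ (leb (cube n))); last by rewrite lebesgue_box ltry.
  apply: le_measure; rewrite ?inE//.
    by apply: bigcupT_measurable => k; apply: measurableI => //; exact: mU.
  by move=> x [k _ []].
move=> k; elim: k.+1 => [|{}k IH].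
  by rewrite big_ord0 set0I indic0; exact: vanishing_osc0.
rewrite (_ : \1_(_ `&` _) = fun x => 1 * \1_(U k `&` cube n) x + \1_(F k `&` cube n) x).
  exact: vanishing_osc_lin.
apply/funext => x; rewrite -/(U k.+1) EUn !indicE !in_setI in_setU.
have [xU|_] := boolP (x \in U k); have [xF|_] := boolP (x \in F k); case: (x \in cube n); rewrite /= ?mul1r ?mulr0 ?addr0 ?add0r//.
move: xU; rewrite inE /U -bigcup_mkord => -[i /= ik Fix].
move/trivIsetP : tF => /(_ i k Logic.I Logic.I) -/(_ (negbT (ltn_eqF ik))) E.
by have : (F i `&` F k) x; [split => //; exact: set_mem|rewrite E].
Qed.

Lemma vanishing_osc_indic A : measurable A -> (leb A < +oo)%E ->
  vanishing_osc (\1_A : Rd R d -> R).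
Proof.
move=> mA Aoo.
have EA : A = \bigcup_n (A `&` cube n) by rewrite -setI_bigcupr bigcup_cube setIT.
rewrite EA; apply: vanishing_osc_indic_nondecreasing; rewrite -?EA//.
- by move=> n; apply: measurableI => //; exact: measurable_box.
- apply/nondecreasing_seqP => n; apply/subsetPset; apply: setIS => x + i => /(_ i) /andP[h1 h2].
  have nn : n%:R <= n.+1%:R :> R by rewrite ler_nat.
  by rewrite (le_lt_trans _ h1) ?lerN2// (le_trans h2).
- by move=> n; exact: vanishing_osc_indic_cube.
Qed.

Import HBSimple.

Lemma vanishing_osc_integrable f : leb.-integrable setT (EFin \o f) -> vanishing_osc f.
Proof.
move=> fi; have mf : measurable_fun setT f by case/integrableP : fi => /measurable_EFinP.
apply: vanishing_osc_approx => // e e0.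
have [h [hi _ hf]] := approximation_sfun_integrable measurableT fi.
move/fine_cvgP : hf => [[m _ Hm] /cvgrPdist_le/(_ _ e0)[n _ Hn]].
pose k := maxn m n.
have {}Hn := Hn k (leq_maxr _ _); have {}Hm := Hm k (leq_maxl _ _).
exists (h k), (fun x => `|f x - h k x|); split => //.
- have [N [s [B [mB _ LB hE]]]] := sfun_integrable_repr (hi k).
  rewrite (_ : (h k : Rd R d -> R) = fun x => \sum_(i < N) s i * \1_(B i) x).
    by apply: vanishing_osc_sum => i; apply: vanishing_osc_indic; [exact: mB|exact: LB].
  by apply/funext => x; exact: hE.
- apply: (measurableT_comp (@normr_measurable R setT)).
  by apply: measurable_funB.
- move: Hn; rewrite sub0r normrN /= => Hn.
  rewrite -(fineK Hm) lee_fin; exact: le_trans (ler_norm _) Hn.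
by move=> x y; exact: quadrangle_ineq.
Qed.

End vanishing_oscillation_L1.

Lemma measurable_norm_powR (R : realType) d (T : measurableType d) (f : T -> R) (p : R) :
  measurable_fun setT f -> measurable_fun setT (fun x => `|f x| `^ p).
Proof.
move=> mf; apply: (@measurableT_comp _ _ _ _ _ _ (@powR R ^~ p)) => //.
exact: (measurableT_comp (@normr_measurable R setT)).
Qed.

(** * Fubini's theorem for real-valued integrals *)

Section real_fubini.
Context {R : realType} d1 d2 (T1 : measurableType d1) (T2 : measurableType d2).
Implicit Type f : T1 * T2 -> R.

Lemma measurable_Rintegral_snd (m2 : {sigma_finite_measure set T2 -> \bar R}) f :
  measurable_fun setT f -> measurable_fun setT (fun x => \int[m2]_y f (x, y)).
Proof.
move=> mf; rewrite /Rintegral; apply: measurableT_comp => //.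
under eq_fun do rewrite integralE.
apply: emeasurable_funB.
  have mp : measurable_fun setT ((EFin \o f)^\+)%E.
    by apply: measurable_funepos; exact/measurable_EFinP.
  apply: eq_measurable_fun (@measurable_fun_fubini_tonelli_F _ _ _ _ _ m2 _ mp (fun z => funepos_ge0 _ z)).
  by move=> x _; apply: eq_integral => y _; rewrite !funeposE.
have mn : measurable_fun setT ((EFin \o f)^\-)%E.
  by apply: measurable_funeneg; exact/measurable_EFinP.
apply: eq_measurable_fun (@measurable_fun_fubini_tonelli_F _ _ _ _ _ m2 _ mn (fun z => funeneg_ge0 _ z)).
by move=> x _; apply: eq_integral => y _; rewrite !funenegE.
Qed.

Variables (m1 : {sigma_finite_measure set T1 -> \bar R})
  (m2 : {sigma_finite_measure set T2 -> \bar R}).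

Lemma Rintegral_fubini f : (m1 \x m2)%E.-integrable setT (EFin \o f) ->
  \int[(m1 \x m2)%E]_z f z = \int[m1]_x \int[m2]_y f (x, y).
Proof.
move=> fi; have mf : measurable_fun setT f by case/integrableP : fi => /measurable_EFinP.
rewrite /Rintegral -(integral12_prod_meas1 fi); congr fine.
apply: ae_eq_integral => //.
- by case/integrableP : (integrable_fubini_F fi).
- by apply/measurable_EFinP; exact: measurable_Rintegral_snd.
have := integrable_ae measurableT (integrable_fubini_F fi).
by apply: filterS => x /(_ Logic.I) Fx _; rewrite fineK.
Qed.

Lemma integrable_prodM (a : T1 -> R) (b : T2 -> R) :
  m1.-integrable setT (EFin \o a) -> m2.-integrable setT (EFin \o b) ->
  (m1 \x m2)%E.-integrable setT (EFin \o (fun z => a z.1 * b z.2)).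
Proof.
move=> ia ib; have [/measurable_EFinP ma fa] := integrableP _ _ _ ia.
have [/measurable_EFinP mb fb] := integrableP _ _ _ ib.
have mab : measurable_fun setT (fun z : T1 * T2 => a z.1 * b z.2).
  by apply: measurable_funM; exact: measurableT_comp.
apply/integrableP; split; first exact/measurable_EFinP.
rewrite fubini_tonelli1//; last first.
  by apply: measurableT_comp => //; exact/measurable_EFinP.
rewrite (_ : (\int[m1]_x _)%E = (\int[m1]_x (`|(a x)%:E| * \int[m2]_y `|(b y)%:E|))%E).
  rewrite ge0_integralZr//.
  - by apply: lte_mul_pinfty; rewrite ?ge0_fin_numE//; exact: integral_ge0.
    by apply: measurableT_comp => //; exact/measurable_EFinP.
  exact: integral_ge0.
apply: eq_integral => x _; rewrite /fubini_F /=.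
under eq_integral do rewrite normrM EFinM.
by rewrite ge0_integralZl_EFin//; exact/measurable_EFinP/measurableT_comp.
Qed.

Lemma Rintegral_prodM (a : T1 -> R) (b : T2 -> R) :
  m1.-integrable setT (EFin \o a) -> m2.-integrable setT (EFin \o b) ->
  \int[(m1 \x m2)%E]_z (a z.1 * b z.2) = (\int[m1]_x a x) * (\int[m2]_y b y).
Proof.
move=> ia ib; rewrite (Rintegral_fubini (integrable_prodM ia ib))/=.
under eq_Rintegral do rewrite RintegralZl//.
by rewrite RintegralZr.
Qed.

End real_fubini.

(** * Integrals of a function over balls, in L^1 and L^p *)

Section ball_integrals.
Context {R : realType} {d : nat}.
Implicit Types (x y : Rd R d) (r e p : R) (f : Rd R d -> R).
Local Notation leb := (lebesgue_tuple (R := R) d).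
Local Notation cd := (unit_ball_volume (R := R) d).

Definition ball_int f x r : R := \int[leb]_y (ballk r x y * f y).

Lemma Rintegral_eball f x r : \int[leb]_(y in eball x r) f y = ball_int f x r.
Proof.
rewrite /ball_int Rintegral_mkcond; apply: eq_Rintegral => y _.
by rewrite patchE /ballk indicE; case: ifP; rewrite ?mul1r ?mul0r.
Qed.

Lemma measurable_ball_int f : measurable_fun setT f ->
  measurable_fun setT (fun p : Rd R d * measurableTypeR R => ball_int f p.1 p.2).
Proof.
move=> mf; apply: (@measurable_Rintegral_snd _ _ _ _ _ leb
  (fun q : (Rd R d * measurableTypeR R) * Rd R d => ballk q.1.2 q.1.1 q.2 * f q.2)).
apply: measurable_funM; last exact: measurableT_comp.
by apply: measurable_ballk => //; exact: measurableT_comp.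
Qed.

Lemma measurable_ballkl r x : measurable_fun setT (ballk r x).
Proof. exact: measurable_ballk. Qed.

Lemma integrable_ballkM f x r : leb.-integrable setT (EFin \o f) ->
  leb.-integrable setT (EFin \o (fun y => ballk r x y * f y)).
Proof.
move=> fi; have mf : measurable_fun setT f by case/integrableP : fi => /measurable_EFinP.
apply: le_integrable fi => //.
  by apply/measurable_EFinP; apply: measurable_funM => //; exact: measurable_ballkl.
move=> y _ /=; rewrite lee_fin normrM ballkE.
by case: (_ < r)%R; rewrite /= ?normr1 ?normr0 ?mul1r ?mul0r.
Qed.

Lemma integrable_ballk x r : 0 < r -> leb.-integrable setT (EFin \o ballk r x).
Proof.
move=> r0; apply/integrableP; split; first by apply/measurable_EFinP; exact: measurable_ballkl.
under eq_integral do rewrite /= ger0_norm ?ballk_ge0//.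
by rewrite integral_ballk// ltry.
Qed.

Lemma Rintegral_ballk x r : 0 < r -> \int[leb]_y ballk r x y = cd * r ^+ d.
Proof. by move=> r0; rewrite /Rintegral integral_ballk. Qed.

(** The difference is the integral in y of the kernel times f(y) - f(x). Through this bound,
    vanishing oscillation becomes convergence of ball averages in L^1. *)
Lemma ball_int_dist f r : leb.-integrable setT (EFin \o f) -> 0 < r ->
  (\int[leb]_x (`|ball_int f x r - cd * r ^+ d * f x|)%:E <= osc r f)%E.
Proof.
move=> fi r0; have mf : measurable_fun setT f by case/integrableP : fi => /measurable_EFinP.
have mb : measurable_fun setT (ball_int f ^~ r).
  exact: (measurableT_comp (measurable_ball_int mf) (measurable_pair2 r)).
rewrite /osc fubini_tonelli1//; last 2 first.
- by apply/measurable_EFinP; exact: measurable_osc.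
- by move=> p; rewrite lee_fin mulr_ge0 ?ballk_ge0.
apply: ge0_le_integral => //.
- apply/measurable_EFinP; apply: (measurableT_comp (@normr_measurable R setT)).
  by apply: measurable_funB => //; exact: measurable_funM.
- apply: measurable_fun_fubini_tonelli_F.
    by apply/measurable_EFinP; exact: measurable_osc.
  by move=> p; rewrite lee_fin mulr_ge0 ?ballk_ge0.
move=> x _; rewrite /fubini_F /=.
have iB : leb.-integrable setT (EFin \o (fun y => ballk r x y * (f y - f x))).
  rewrite (_ : (fun y => _) = fun y => ballk r x y * f y - f x * ballk r x y); last first.
    by apply/funext => y; ring.
  by apply: integrable_realB => //; [exact: integrable_ballkM|apply: integrable_realZl => //; exact: integrable_ballk].
have -> : ball_int f x r - cd * r ^+ d * f x = \int[leb]_y (ballk r x y * (f y - f x)).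
  rewrite -(Rintegral_ballk x r0) [_ * f x]mulrC -RintegralZl//; last exact: integrable_ballk.
  rewrite -RintegralB//; [|exact: integrable_ballkM|by apply: integrable_realZl => //; exact: integrable_ballk].
  by apply: eq_Rintegral => y _; ring.
apply: (@le_trans _ _ (\int[leb]_y `|ballk r x y * (f y - f x)|)%:E).
  by rewrite lee_fin le_normr_Rintegral.
rewrite -EFin_Rintegral//; last exact: (integrable_norm iB).
apply: ge0_le_integral => //.
- by apply/measurable_EFinP; case/integrableP : (integrable_norm iB) => /measurable_EFinP.
- apply/measurable_EFinP; apply: measurable_funM; first exact: measurable_ballkl.
  apply: (measurableT_comp (@normr_measurable R setT)).
  exact: measurable_funB.
by move=> y _; rewrite lee_fin normrM (ger0_norm (ballk_ge0 _ _ _)).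
Qed.

(** The cube of half-side 1/(d+1) lies in the unit ball, the sum of squares being at most d/(d+1) <
    1. *)
Lemma unit_ball_volume_gt0 : 0 < cd.
Proof.
have e0 : 0 < (d.+1%:R^-1 : R) by rewrite invr_gt0.
rewrite -lte_fin -lebesgue_unit_ball.
apply: (@lt_le_trans _ _ (leb (box (fun=> - d.+1%:R^-1) (fun=> d.+1%:R^-1)))).
  rewrite lebesgue_box lte_fin; apply: prodr_gt0 => i _.
  by rewrite lt_max opprK addr_gt0 ?orbT.
apply: le_measure; rewrite ?inE; [exact: measurable_box|exact: measurable_eball|].
move=> z bz; rewrite /eball/= /edist -[ltRHS]sqrtr1 ltr_sqrt//.
apply: (@le_lt_trans _ _ (\sum_(i < d) (d.+1%:R^-1 : R))).
  apply: ler_sum => i _; rewrite tnth_mktuple subr0.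
  have /andP[h1 h2] := bz i.
  have h3 : `|tnth z i : R| <= d.+1%:R^-1 by rewrite ler_norml h2 ltW.
  rewrite -real_normK ?num_real// expr2 (le_trans (ler_pM _ _ h3 h3))//.
  by rewrite ler_piMl ?invf_le1 ?ler1n// ltW.
by rewrite sumr_const card_ord -[ltLHS]mulr_natr ltr_pdivrMl// mulr1 ltr_nat.
Qed.

Lemma powR_subr1 (p v : R) : 0 < v -> v `^ p = v `^ (p - 1) * v.
Proof.
move=> v0; rewrite -[in LHS](subrK 1 p) (@powRD _ v (p - 1) 1); last by rewrite (gt_eqF v0) implybT.
by rewrite powRr1 ?ltW.
Qed.

(** The convex function t^p lies above its tangent at a. It is Young's inequality with exponents p
    and p/(p-1), whence the separate case p = 1. *)
Lemma powR_tangent p (t a : R) : 1 <= p -> 0 <= t -> 0 < a ->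
  p * a `^ (p - 1) * t <= t `^ p + (p - 1) * a `^ p.
Proof.
move=> p1 t0 a0; have [->|pn1] := eqVneq p 1.
  by rewrite subrr powRr0 !mul1r mul0r addr0 powRr1.
have {pn1} p1' : 0 < p - 1 by rewrite subr_gt0 lt_neqAle eq_sym pn1.
have p0 : 0 < p by lra.
have pq : p^-1 + (p / (p - 1))^-1 = 1 by rewrite invf_div; field; rewrite gt_eqF.
have := conjugate_powR t0 (powR_ge0 a (p - 1)) p0 (divr_gt0 p0 p1') pq.
rewrite -powRrM (_ : (p - 1) * _ = p); last by field; rewrite gt_eqF.
move/(ler_wpM2l (ltW p0)) => H.
rewrite -mulrA [a `^ _ * t]mulrC (le_trans H)// le_eqVlt; apply/orP; left; apply/eqP.
by field; rewrite !gt_eqF.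
Qed.

(** Jensen's inequality for a kernel of total mass V, by integrating the tangent inequality at the
    mean a = I/V. *)
Lemma jensen_powR dT (T : measurableType dT) (mu : {measure set T -> \bar R}) p V (k g : T -> R) :
  1 <= p -> 0 < V -> (forall t : T, 0 <= k t) -> (forall t : T, 0 <= g t) ->
  mu.-integrable setT (EFin \o k) -> mu.-integrable setT (EFin \o (fun t => k t * g t)) ->
  mu.-integrable setT (EFin \o (fun t => k t * g t `^ p)) ->
  \int[mu]_t k t = V ->
  (\int[mu]_t (k t * g t)) `^ p <= V `^ (p - 1) * \int[mu]_t (k t * g t `^ p).
Proof.
move=> p1 V0 k0 g0 ik ikg ikp kV.
set I := \int[mu]_t (k t * g t); set J := \int[mu]_t (k t * g t `^ p).
have J0 : 0 <= J by apply: Rintegral_ge0 => t _; rewrite mulr_ge0 ?powR_ge0.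
have I0 : 0 <= I by apply: Rintegral_ge0 => t _; rewrite mulr_ge0.
move: I0; rewrite le_eqVlt => /predU1P[<-|I0].
  by rewrite powR0 ?mulr_ge0 ?powR_ge0// gt_eqF// (lt_le_trans ltr01).
have a0 : 0 < I / V by rewrite divr_gt0.
set a := I / V in a0.
have : p * a `^ (p - 1) * I <= J + (p - 1) * a `^ p * V.
  rewrite /I /J -kV -!RintegralZl// -RintegralD//; last exact: integrable_realZl.
  apply: le_Rintegral => //; [exact: integrable_realZl|apply: integrable_realD => //; exact: integrable_realZl|].
  move=> t _; rewrite mulrCA [X in _ <= _ + X]mulrC -mulrDr ler_wpM2l//.
  exact: powR_tangent.
have aI : a `^ (p - 1) * I = a `^ p * V.
  by rewrite [in RHS](powR_subr1 p a0) -mulrA /a divfK// gt_eqF.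
rewrite -mulrA aI => H; have {H} : a `^ p * V <= J by lra.
have VE : V `^ p = V `^ (p - 1) * V.
  exact: powR_subr1.
move=> H; rewrite (_ : I `^ p = V `^ (p - 1) * (a `^ p * V)); first by rewrite ler_wpM2l ?powR_ge0.
by rewrite mulrCA -VE -powRM ?(ltW a0) ?(ltW V0)// /a divfK// gt_eqF.
Qed.

(** Jensen in y for each centre x, then Tonelli in x: convolution with the ball kernel acts on L^p
    with norm at most its mass c_d r^d. *)
Lemma ball_int_Lp f p r : leb.-integrable setT (EFin \o f) ->
  leb.-integrable setT (EFin \o (fun y => `|f y| `^ p)) -> 1 <= p -> 0 < r ->
  (\int[leb]_x (`|ball_int f x r| `^ p)%:E <=
   ((cd * r ^+ d) `^ p)%:E * \int[leb]_x (`|f x| `^ p)%:E)%E.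
Proof.
move=> fi fp p1 r0; have mf : measurable_fun setT f by case/integrableP : fi => /measurable_EFinP.
have mb : measurable_fun setT (ball_int f ^~ r).
  exact: (measurableT_comp (measurable_ball_int mf) (measurable_pair2 r)).
have mfp : measurable_fun setT (fun y => `|f y| `^ p).
  by case/integrableP : fp => /measurable_EFinP.
have V0 : 0 < cd * r ^+ d by rewrite mulr_gt0 ?exprn_gt0// unit_ball_volume_gt0.
set V := cd * r ^+ d in V0 *.
have VE : V `^ p = V `^ (p - 1) * V.
  exact: powR_subr1.
have mK : measurable_fun setT (fun q : Rd R d * Rd R d => (ballk r q.1 q.2 * `|f q.2| `^ p)%:E).
  apply/measurable_EFinP; apply: measurable_funM; first exact: measurable_ballk_pair.
  exact: (measurableT_comp mfp).
rewrite VE EFinM -muleA -(ge0_integral_ballk r0 _ mfp); last by move=> y; exact: powR_ge0.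
rewrite -ge0_integralZl_EFin ?powR_ge0//; last 2 first.
- by move=> x _; apply: integral_ge0 => y _; rewrite lee_fin mulr_ge0 ?ballk_ge0 ?powR_ge0.
- apply: (@measurable_fun_fubini_tonelli_F _ _ _ _ _ leb _ mK).
  by move=> q; rewrite lee_fin mulr_ge0 ?ballk_ge0 ?powR_ge0.
apply: ge0_le_integral => //.
- apply/measurable_EFinP; exact: measurable_norm_powR.
- apply: measurable_funeM; apply: (@measurable_fun_fubini_tonelli_F _ _ _ _ _ leb _ mK).
  by move=> q; rewrite lee_fin mulr_ge0 ?ballk_ge0 ?powR_ge0.
move=> x _; have ip := integrable_ballkM x r fp.
have iK := integrable_ballkM x r (integrable_norm fi).
rewrite EFin_Rintegral// -EFinM lee_fin.
apply: (le_trans _ (jensen_powR p1 V0 (ballk_ge0 r x) (fun y => normr_ge0 (f y)) _ iK ip _)).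
- rewrite ge0_ler_powR ?nnegrE//; first by rewrite (le_trans ler01).
    by apply: Rintegral_ge0 => y _; rewrite mulr_ge0 ?ballk_ge0.
  apply: (le_trans (le_normr_Rintegral _ _)) => //; first exact: integrable_ballkM.
  rewrite le_eqVlt; apply/orP; left; apply/eqP; apply: eq_Rintegral => y _.
  by rewrite normrM (ger0_norm (ballk_ge0 _ _ _)).
- exact: integrable_ballk.
- exact: Rintegral_ballk.
Qed.

End ball_integrals.

(** * Integrals against powers on the half-line *)

Section half_line.
Context {R : realType}.
Implicit Types (p q x u a b c : R).
Local Notation leb1 := (@lebesgue_measure R).

Definition posr : set R := `]0, +oo[%classic.

Lemma posrE x : posr x = (0 < x).
Proof. by rewrite /posr/= in_itv/= andbT. Qed.

Lemma measurable_posr : measurable posr. Proof. exact: measurable_itv. Qed.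

(** Compact intervals exhausting the open half-line, on which the fundamental theorem of calculus
    applies. The shift by 2 keeps the endpoints distinct for every n. *)
Definition segment n : set R := `[n.+2%:R^-1, n.+2%:R]%classic.

Lemma segmentE n x : segment n x = (n.+2%:R^-1 <= x <= n.+2%:R).
Proof. by rewrite /segment/= in_itv. Qed.

Lemma segment_gt0 n x : segment n x -> 0 < x.
Proof. by rewrite segmentE => /andP[+ _]; apply: lt_le_trans; rewrite invr_gt0. Qed.

Lemma nondecreasing_segment : nondecreasing_seq segment.
Proof.
move=> m n mn; apply/subsetPset => x; rewrite !segmentE => /andP[h1 h2].
rewrite (le_trans _ h1) ?lef_pV2 ?posrE ?qualifE/= ?ler_nat ?ltr0n//.
by rewrite (le_trans h2)// ler_nat.
Qed.

Lemma bigcup_segment : \bigcup_n segment n = posr.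
Proof.
apply/seteqP; split=> [x [n _ /segment_gt0]|x]; first by rewrite posrE.
rewrite posrE => x0; exists (maxn (Num.bound x) (Num.bound x^-1)) => //; rewrite segmentE.
have b1 := archi_boundP (ltW x0).
have b2 : x^-1 < (Num.bound x^-1)%:R by apply: archi_boundP; rewrite invr_ge0 ltW.
apply/andP; split.
  rewrite -[leRHS]invrK lef_pV2 ?qualifE/= ?invr_gt0 ?ltr0n//.
  by rewrite (le_trans (ltW b2))// ler_nat (leq_trans (leq_maxr (Num.bound x) _))// -addn2 leq_addr.
by rewrite (le_trans (ltW b1))// ler_nat (leq_trans (leq_maxl _ (Num.bound x^-1)))// -addn2 leq_addr.
Qed.

Lemma continuous_powR x p : 0 < x -> {for x, continuous (fun t : R => t `^ p)}.
Proof. by move=> x0; exact: (is_derive1_continuous (is_derive1_powR p x0)). Qed.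

Lemma derivable_oo_LRcontinuous_pos (F f : R -> R) a b : 0 < a ->
  (forall x, 0 < x -> is_derive x (1 : R) F (f x)) -> a <= b ->
  derivable_oo_LRcontinuous F a b.
Proof.
move=> a0 dF ab; have cF x : 0 < x -> {for x, continuous F}.
  by move=> x0; exact: is_derive1_continuous (dF _ x0).
split.
- by move=> x; rewrite in_itv/= => /andP[ax _]; have [] := dF _ (lt_trans a0 ax).
- by apply: cvg_at_right_filter; exact: cF.
- by apply: cvg_at_left_filter; apply: cF; exact: lt_le_trans ab.
Qed.

Lemma continuous_pos_within (F : R -> R) (A : set R) : (forall x, A x -> 0 < x) ->
  (forall x, 0 < x -> {for x, continuous F}) -> {within A, continuous F}.
Proof.
move=> A0 cF; apply: continuous_in_subspaceT => x /set_mem/A0; exact: cF.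
Qed.

Lemma derive1_pos (F f : R -> R) x : is_derive x (1 : R) F (f x) -> F^`()%classic x = f x.
Proof. by move=> dF; rewrite derive1E derive_val. Qed.

Lemma ge0_integral_segment_cvg (f : R -> R) : measurable_fun posr f ->
  (forall x, 0 < x -> 0 <= f x) ->
  (\int[leb1]_(x in segment n) (f x)%:E @[n --> \oo] --> \int[leb1]_(x in posr) (f x)%:E)%E.
Proof.
move=> mf f0; rewrite -bigcup_segment; apply: ge0_nondecreasing_set_cvg_integral.
- exact: nondecreasing_segment.
- by move=> n; exact: measurable_itv.
- move=> n; apply/measurable_EFinP; apply: measurable_funS mf; first exact: measurable_posr.
  by move=> x /segment_gt0; rewrite posrE.
- by move=> n x /segment_gt0/f0; rewrite lee_fin.
Qed.

Lemma continuous_posr_measurable (f : R -> R) :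
  (forall x, 0 < x -> {for x, continuous f}) -> measurable_fun posr f.
Proof.
move=> cf; apply: open_continuous_measurable_fun; first exact: interval_open.
by move=> x /set_mem; rewrite posrE => /cf.
Qed.

Lemma powRDr x p q : 0 < x -> x `^ p * x `^ q = x `^ (p + q).
Proof. by move=> x0; rewrite powRD// (gt_eqF x0) implybT. Qed.

(** With a the smaller of b - p and q - b, the function is bounded by 4/a times the derivative of
    the bounded function 1 - 1/(1 + u^a). This derivative behaves like u^(a-1) at 0 and like
    u^(-1-a) at infinity, so one primitive covers both ends. *)
Lemma integrable_powR_min p q b : p < b -> b < q ->
  leb1.-integrable posr (EFin \o (fun u => u `^ (- 1 - b) * Num.min (u `^ p) (u `^ q))).
Proof.
move=> pb bq; pose a := Num.min (b - p) (q - b).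
have a0 : 0 < a by rewrite lt_min !subr_gt0 pb.
pose f u := a * u `^ (a - 1) / (1 + u `^ a) ^+ 2.
pose F u := 1 - (1 + u `^ a)^-1.
have den0 u : 0 < 1 + u `^ a by rewrite ltr_pwDl// powR_ge0.
have dF u : 0 < u -> is_derive u (1 : R) F (f u).
  move=> u0; have D := is_derive1_powR a u0.
  pose g (t : R) := 1 + t `^ a.
  have D1 : is_derive u (1 : R) g (0 + a * u `^ (a - 1)) by exact: is_deriveD.
  have D2 := @is_deriveV _ g u _ 1 (lt0r_neq0 (den0 u)) D1.
  have D3 := is_deriveB (is_derive_cst (1 : R) u 1) D2.
  have -> : f u = 0 - - g u ^- 2 *: (0 + a * u `^ (a - 1)).
    by rewrite /f /g sub0r add0r scaleNr opprK /GRing.scale/= mulrC.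
  exact: D3.
have f0 u : 0 <= f u by rewrite /f divr_ge0 ?exprn_ge0 ?(ltW (den0 u))// mulr_ge0 ?powR_ge0 ?ltW.
have cf u : 0 < u -> {for u, continuous f}.
  move=> u0; apply: cvgM; first by apply: cvgM; [exact: cvg_cst|exact: continuous_powR].
  apply: cvgV; first by rewrite expf_neq0// gt_eqF.
  have cd : {for u, continuous (fun t : R => 1 + t `^ a)}.
    by apply: cvgD; [exact: cvg_cst|exact: continuous_powR].
  by apply: cvgM.
have If : leb1.-integrable posr (EFin \o f).
  apply/integrableP; split; first by apply/measurable_EFinP; exact: continuous_posr_measurable.
  under eq_integral do rewrite /= ger0_norm//.
  apply: (@le_lt_trans _ _ 1%:E); last exact: ltry.
  have C := ge0_integral_segment_cvg (continuous_posr_measurable cf) (fun x _ => f0 x).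
  apply: (cvge_le _ C); apply: nearW => n.
  have n0 : 0 < n.+2%:R^-1 :> R by rewrite invr_gt0.
  have nn : n.+2%:R^-1 < n.+2%:R :> R.
    by rewrite (@lt_trans _ _ 1)// ?invf_lt1 ?ltr0n// ltr1n.
  rewrite (@continuous_FTC2 R f F)//.
  - rewrite -EFinB lee_fin /F.
    have h : 0 <= (1 + n.+2%:R `^ a)^-1 :> R by rewrite invr_ge0 ltW.
    have h' : (1 + n.+2%:R^-1 `^ a)^-1 <= 1 :> R by rewrite invf_le1// lerDl powR_ge0.
    lra.
  - by apply: continuous_pos_within cf => x; exact: (@segment_gt0 n).
  - exact: derivable_oo_LRcontinuous_pos dF (ltW nn).
  - by move=> x; rewrite in_itv/= => /andP[nx _]; apply: derive1_pos; apply: dF; exact: lt_trans nx.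
have mh : measurable_fun posr (fun u => u `^ (- 1 - b) * Num.min (u `^ p) (u `^ q)).
  apply: measurable_funM; first by apply: measurable_funTS; exact: measurable_powR.
  by apply: measurable_minr; apply: measurable_funTS; exact: measurable_powR.
apply: (@le_integrable_real _ _ R leb1 posr
  (fun u => u `^ (- 1 - b) * Num.min (u `^ p) (u `^ q)) (fun u => 4 / a * f u)) => //.
- exact: measurable_posr.
- move=> u; rewrite posrE => u0.
  rewrite ger0_norm ?mulr_ge0 ?le_min ?powR_ge0//.
  have ua := powR_gt0 a u0.
  have -> : 4 / a * f u = 4 * u `^ (a - 1) / (1 + u `^ a) ^+ 2.
    by rewrite /f; field; rewrite !gt_eqF.
  rewrite ler_pdivlMr ?exprn_gt0//.
  have [u1|u1] := leP u 1.
    have u01 : 0 < u <= 1 by rewrite u0.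
    have h1 : u `^ (- 1 - b) * Num.min (u `^ p) (u `^ q) <= u `^ (a - 1).
      rewrite (@le_trans _ _ (u `^ (- 1 - b) * u `^ q))//.
        by rewrite ler_wpM2l ?powR_ge0// ge_min lexx orbT.
      rewrite powRDr// ger_powR//; have : a <= q - b by rewrite ge_min lexx orbT.
      lra.
    have h2 : (1 + u `^ a) ^+ 2 <= 4.
      have : u `^ a <= 1 by rewrite -(powRr0 u) ger_powR// ltW.
      by move=> ?; nra.
    rewrite [leRHS]mulrC ler_pM ?mulr_ge0 ?le_min ?powR_ge0//.
    - by apply/ltW/den0.
    - by apply/ltW/den0.
  have u1' := ltW u1.
  have h1 : u `^ (- 1 - b) * Num.min (u `^ p) (u `^ q) <= u `^ (- 1 - a).
    rewrite (@le_trans _ _ (u `^ (- 1 - b) * u `^ p))//.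
      by rewrite ler_wpM2l ?powR_ge0// ge_min lexx.
    rewrite powRDr// ler_powR//; have : a <= b - p by rewrite ge_min lexx.
    lra.
  have h2 : (1 + u `^ a) ^+ 2 <= 4 * u `^ (2 * a).
    have -> : u `^ (2 * a) = u `^ a * u `^ a by rewrite powRDr// -mulr2n mulr_natl.
    have : 1 <= u `^ a by rewrite -(powRr0 u) ler_powR// ltW.
    by move=> ?; nra.
  rewrite (le_trans (ler_pM _ _ h1 h2)) ?mulr_ge0 ?le_min ?powR_ge0 ?exprn_ge0 ?(ltW (den0 _))//.
  rewrite mulrCA ler_wpM2l// powRDr// le_eqVlt; apply/orP; left; apply/eqP; congr (_ `^ _); ring.
apply: integrable_realZl => //; exact: measurable_posr.
Qed.

(** The substitution v = c u^k, made on compact intervals and extended by monotone convergence; the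
    images of the segments again exhaust the half-line. *)
Lemma ge0_integral_power_substitution (g : R -> R) (c a : R) (k : nat) : 0 < c -> (0 < k)%N ->
  (forall x, 0 < x -> 0 <= g x) -> (forall x, 0 < x -> {for x, continuous g}) ->
  (\int[leb1]_(u in posr) (u `^ (- 1 - a * k%:R) * g (c * u ^+ k))%:E =
   (c `^ a / k%:R)%:E * \int[leb1]_(v in posr) (v `^ (- 1 - a) * g v)%:E)%E.
Proof.
move=> c0 k0 g0 cg; have k0' : 0 < (k%:R : R) by rewrite ltr0n.
pose F u := c * u ^+ k; pose G v := v `^ (- 1 - a) * g v.
have F0 u : 0 < u -> 0 < F u by move=> u0; rewrite mulr_gt0// exprn_gt0.
pose F' u := c * (k%:R * u ^+ k.-1).
have dF u : is_derive u (1 : R) F (F' u).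
  have D : is_derive u (1 : R) (fun t : R => t ^+ k) ((k%:R * u ^+ k.-1) *: (1 : R)).
    by rewrite (_ : (fun t : R => t ^+ k) = (id : R -> R) ^+ k); [exact: is_deriveX|apply/funext => t; rewrite exprfctE].
  have -> : F' u = c *: ((k%:R * u ^+ k.-1) *: (1 : R)) by rewrite /GRing.scale/= mulr1.
  by rewrite /F; apply: is_deriveZ.
have cF' u : {for u, continuous F'}.
  by apply: cvgM; [exact: cvg_cst|apply: cvgM; [exact: cvg_cst|exact: exprn_continuous]].
have cG v : 0 < v -> {for v, continuous G}.
  by move=> v0; apply: cvgM; [exact: continuous_powR|exact: cg].
have mG := continuous_posr_measurable cG.
have G0 v : 0 < v -> 0 <= G v by move=> v0; rewrite mulr_ge0 ?powR_ge0 ?g0.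
have incF : {in Num.pos &, {homo F : x y / x < y}}.
  by move=> x y x0 y0 xy; rewrite /F ltr_pM2l// ltrXn2r// ?nnegrE ?ltW// -lt0n.
have segF n : 0 < n.+2%:R^-1 :> R by rewrite invr_gt0.
have segL n : n.+2%:R^-1 < n.+2%:R :> R.
  by rewrite (@lt_trans _ _ 1)// ?invf_lt1 ?ltr0n// ltr1n.
(* The powers combine as (c u^k)^(-1-a) c k u^(k-1) = k c^(-a) u^(-1-ak). *)
have F'E u : 0 < u -> G (F u) * F' u = k%:R / c `^ a * (u `^ (- 1 - a * k%:R) * g (c * u ^+ k)).
  move=> u0; rewrite /G; have uk : u ^+ k.-1 = u `^ (k%:R - 1).
    by rewrite -powR_mulrn ?ltW//; congr (_ `^ _); rewrite -[in RHS](prednK k0) -natr1 addrK.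
  have FuE : F u `^ (- 1 - a) = c `^ (- 1 - a) * u `^ (k%:R * (- 1 - a)).
    by rewrite /F powRM ?exprn_ge0 ?ltW// -powR_mulrn ?ltW// powRrM.
  have c1 : c `^ (- 1 - a) * c = (c `^ a)^-1.
    by rewrite -[X in _ * X](powRr1 (ltW c0)) powRDr// -powRN; congr (_ `^ _); ring.
  have u1 : u `^ (k%:R * (- 1 - a)) * u `^ (k%:R - 1) = u `^ (- 1 - a * k%:R).
    by rewrite powRDr//; congr (_ `^ _); ring.
  by rewrite /F' uk FuE -c1 -u1 -/(F u); ring.
pose S n : set R := `[F n.+2%:R^-1, F n.+2%:R]%classic.
pose h u := u `^ (- 1 - a * k%:R) * g (c * u ^+ k).
have mh : measurable_fun posr h.
  apply: continuous_posr_measurable => u u0; apply: cvgM; first exact: continuous_powR.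
  apply: (@continuous_comp _ _ _ F g); first exact: is_derive1_continuous (dF u).
  exact/cg/F0.
have h0 u : 0 < u -> 0 <= h u by move=> u0; rewrite mulr_ge0 ?powR_ge0 ?g0// F0.
have sub n : (\int[leb1]_(v in S n) (G v)%:E =
    (k%:R / c `^ a)%:E * \int[leb1]_(u in segment n) (h u)%:E)%E.
  rewrite (@integration_by_substitution_increasing R F G _ _ (ltW (segL n))).
  - rewrite -ge0_integralZl_EFin ?divr_ge0 ?powR_ge0//.
    + apply: eq_integral => u /set_mem/segment_gt0 u0; rewrite -EFinM -F'E//.
      by rewrite -(derive1_pos (dF u)).
    + exact: measurable_itv.
    + by move=> u /segment_gt0 u0; rewrite lee_fin h0.
    + apply/measurable_EFinP; apply: (@measurable_funS _ _ _ _ posr) => //; first exact: measurable_posr.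
      by move=> u /segment_gt0; rewrite posrE.
  - move=> x y; rewrite !in_itv/= => /andP[x0 _] /andP[y0 _]; apply: incF; rewrite qualifE/=;
      exact: lt_le_trans (segF n) _.
  - move=> u _; rewrite (_ : F^`()%classic = F'); last first.
      by apply/funext => t; exact: derive1_pos.
    exact: cF'.
  - rewrite (_ : F^`()%classic = F'); last by apply/funext => t; exact: derive1_pos.
    by apply: cvgP; apply: cvg_at_right_filter; exact: cF'.
  - rewrite (_ : F^`()%classic = F'); last by apply/funext => t; exact: derive1_pos.
    by apply: cvgP; apply: cvg_at_left_filter; exact: cF'.
  - by apply: (@derivable_oo_LRcontinuous_pos F F') => //; exact: ltW.
  - apply: continuous_pos_within cG => x; rewrite /= in_itv/= => /andP[+ _].
    by apply: lt_le_trans; exact: F0.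
have C := ge0_integral_segment_cvg mh h0.
have kc0 : 0 < k%:R / c `^ a by rewrite divr_gt0// powR_gt0.
have CS : (\int[leb1]_(x in S n) (G x)%:E @[n --> \oo] --> \int[leb1]_(x in posr) (G x)%:E)%E.
  have SP n x : S n x -> 0 < x.
    by rewrite /S/= in_itv/= => /andP[+ _]; apply: lt_le_trans; exact: F0.
  have -> : posr = \bigcup_n S n.
    apply/seteqP; split=> [x|x [n _ /SP]]; last by rewrite posrE.
    rewrite posrE => x0; have xc : posr (x / c) by rewrite posrE divr_gt0.
    move: xc; rewrite -bigcup_segment => -[n _]; rewrite segmentE ler_pdivlMr// ler_pdivrMr// => /andP[h1 h2].
    have n1 : 1 <= n.+2%:R :> R by rewrite ler1n.
    have nk : n.+2%:R <= n.+2%:R ^+ k :> R.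
      by rewrite -[leLHS]expr1 ler_weXn2l.
    exists n => //; rewrite /S/= in_itv/=; apply/andP; split.
      by apply: le_trans h1; rewrite /F mulrC ler_pM2r// exprVn lef_pV2 ?qualifE/= ?exprn_gt0 ?ltr0n.
    by apply: (le_trans h2); rewrite /F mulrC ler_pM2l.
  apply: ge0_nondecreasing_set_cvg_integral.
  - move=> m n mn; apply/subsetPset => x; rewrite /S/= !in_itv/= => /andP[h1 h2].
    have Fle (y z : R) : 0 < y -> y <= z -> F y <= F z.
      by move=> y0 yz; rewrite /F ler_pM2l// lerXn2r// ?nnegrE ?(ltW y0)// (le_trans (ltW y0)).
    rewrite (le_trans _ h1) ?Fle ?lef_pV2 ?qualifE/= ?ler_nat ?ltr0n//.
    by rewrite (le_trans h2) ?Fle ?ltr0n ?ler_nat.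
  - by move=> n; exact: measurable_itv.
  - move=> n; apply/measurable_EFinP; apply: measurable_funS mG; first exact: measurable_posr.
    by move=> x /SP; rewrite posrE.
  - by move=> n x /SP/G0; rewrite lee_fin.
have CK : ((k%:R / c `^ a)%:E * \int[leb1]_(u in segment n) (h u)%:E @[n --> \oo] -->
  (k%:R / c `^ a)%:E * \int[leb1]_(u in posr) (h u)%:E)%E by exact: cvgeZl.
have E : ((k%:R / c `^ a)%:E * \int[leb1]_(u in posr) (h u)%:E = \int[leb1]_(x in posr) (G x)%:E)%E.
  apply: (cvg_unique _ CK) => //=.
  by move: CS; rewrite (_ : (fun n => _) =
    (fun n => (k%:R / c `^ a)%:E * \int[leb1]_(u in segment n) (h u)%:E)%E)//; apply/funext => n; exact: sub.
rewrite -/(G _) -[in RHS]E muleA -EFinM (_ : c `^ a / k%:R * (k%:R / c `^ a) = 1) ?mul1e//.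
by field; rewrite !gt_eqF// powR_gt0.
Qed.

End half_line.

(** * Moments of the weight law from its characteristic function *)

Section moments.
Context {R : realType}.
Implicit Types (q a u x : R).
Local Notation leb1 := (@lebesgue_measure R).

Lemma onem_cos_ge0 x : 0 <= 1 - cos x. Proof. by rewrite subr_ge0 cos_le1. Qed.

Lemma continuous_onem_cos x : {for x, continuous (fun t : R => 1 - cos t)}.
Proof. by apply: cvgB; [exact: cvg_cst|exact: continuous_cos]. Qed.

Lemma measurable_onem_cos_weight q : measurable_fun posr (fun v : R => v `^ (- 1 - q) * (1 - cos v)).
Proof.
apply: continuous_posr_measurable => v v0.
by apply: cvgM; [exact: continuous_powR|exact: continuous_onem_cos].
Qed.

Lemma integral_onem_cos_gt0 q : (0 < \int[leb1]_(v in posr) (v `^ (- 1 - q) * (1 - cos v))%:E)%E.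
Proof.
pose I12 : set R := `[1, 2]%classic.
have I12P v : I12 v -> 1 <= v /\ v <= 2 by rewrite /I12/= in_itv/= => /andP[].
have I12s : I12 `<=` posr by move=> v /I12P[v1 _]; rewrite posrE; exact: lt_le_trans v1.
have mI : measurable I12 by exact: measurable_itv.
have c0 : 0 < 1 - cos (1 : R).
  rewrite subr_gt0 -[ltRHS]cos0 ltr_cos ?in_itv/= ?lexx ?ler01 ?pi_ge0//.
  by rewrite (le_trans _ (pi_ge2 _))// ler1n.
pose k : R := Num.min 1 (2 `^ (- 1 - q)) * (1 - cos 1).
have k0 : 0 < k by rewrite mulr_gt0// lt_min ltr01 powR_gt0.
apply: (@lt_le_trans _ _ (\int[leb1]_(v in I12) k%:E)%E).
  have -> : (\int[leb1]_(v in I12) k%:E = k%:E)%E; last by rewrite lte_fin.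
  transitivity (k%:E * leb1 I12)%E; first exact: integral_cst.
  rewrite /I12 lebesgue_measure_itv/= lte_fin ltr1n/= -EFinB -EFinM; congr EFin; ring.
apply: (@le_trans _ _ (\int[leb1]_(v in I12) (v `^ (- 1 - q) * (1 - cos v))%:E)%E); last first.
  apply: ge0_subset_integral => //; first exact: measurable_posr.
    by apply/measurable_EFinP; exact: measurable_onem_cos_weight.
  by move=> v _; rewrite lee_fin mulr_ge0 ?powR_ge0 ?onem_cos_ge0.
apply: ge0_le_integral => //.
- by move=> v _; rewrite lee_fin ltW.
- by apply/measurable_EFinP; apply: measurable_funS (measurable_onem_cos_weight q) => //; exact: measurable_posr.
move=> v /I12P[v1 v2]; rewrite lee_fin ler_pM ?le_min ?ler01 ?powR_ge0 ?(ltW c0)//.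
  have [h|h] := leP 0 (- 1 - q).
    have := ge0_ler_powR h _ _ v1; rewrite !nnegrE ler01 (le_trans ler01 v1) powR1 => /(_ isT isT).
    by apply: le_trans; rewrite ge_min lexx.
  rewrite ge_min; apply/orP; right; rewrite (_ : - 1 - q = - (1 + q)); last by ring.
  have h' : 0 <= 1 + q by lra.
  rewrite !powRN lef_pV2 ?qualifE/= ?powR_gt0//.
    by rewrite ge0_ler_powR ?nnegrE// (le_trans ler01 v1).
  exact: lt_le_trans v1.
rewrite lerD2l lerN2; move: v1; rewrite le_eqVlt => /predU1P[->//|v1].
rewrite ltW// ltr_cos// in_itv/=.
- by rewrite ler01 (le_trans _ (pi_ge2 _))// ler1n.
- by rewrite (le_trans ler01 (ltW v1)) (le_trans v2 (pi_ge2 _)).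
Qed.

(** Up to a positive constant, |a|^q is thus a mixture of the functions 1 - cos(a u), which turns a
    moment into an integral of the real part of the characteristic function. *)
Lemma integral_onem_cosM q a : 0 < q ->
  (\int[leb1]_(u in posr) (u `^ (- 1 - q) * (1 - cos (a * u)))%:E =
   (`|a| `^ q)%:E * \int[leb1]_(v in posr) (v `^ (- 1 - q) * (1 - cos v))%:E)%E.
Proof.
move=> q0; have [->|a0] := eqVneq a 0.
  rewrite normr0 powR0 ?gt_eqF// mul0e; under eq_integral do rewrite mul0r cos0 subrr mulr0.
  exact: integral0.
have := @ge0_integral_power_substitution R (fun v => 1 - cos v) `|a| q 1 _ isT
  (fun x _ => onem_cos_ge0 x) (fun x _ => @continuous_onem_cos x).
rewrite normr_gt0 => /(_ a0); rewrite divr1 mulr1 => <-.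
apply: eq_integral => u _; congr (_ * (1 - _))%:E; rewrite expr1.
by have [h|h] := ler0P a; rewrite ?mulNr ?cosN.
Qed.

Lemma normr_le_sqrtD (x y : R) : `|x| <= Num.sqrt (x ^+ 2 + y ^+ 2).
Proof. by rewrite -sqrtr_sqr ler_sqrt ?addr_ge0 ?sqr_ge0// lerDl sqr_ge0. Qed.

Variables (alpha sigma b tau : R) (G : probability R R).
Hypothesis HG : normal_domain_of_attraction alpha sigma b tau G.
Hypothesis alpha0 : 0 < alpha.

(** In the real part of the expansion at 0 the drift and the skewness disappear. Near 0 it gives
    (sigma^alpha + 1) u^alpha; elsewhere 1 - cos <= 2 is enough. *)
Lemma charfun_Re_bound : exists K, forall u, 0 < u ->
  1 - \int[G]_x cos (u * x) <= K * Num.min (u `^ 0) (u `^ alpha).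
Proof.
have C2 u : 1 - \int[G]_x cos (u * x) <= 2.
  have mux : measurable_fun setT (fun x : R => u * x) by exact: measurable_funM.
  have := normr_Rintegral_cos G mux.
  by rewrite ler_norml => /andP[]; lra.
move/cvgrPdist_lt/(_ 1 ltr01) : HG; rewrite near_withinE => -[/= e e0 He].
(* The entries serve, in this order, u^alpha for u < e, the factor u^0 = 1, and u^alpha for u >=
   e. *)
exists (Num.max (sigma `^ alpha + 1) (Num.max 2 (2 / e `^ alpha))) => u u0.
set K := Num.max _ _.
have K1 : sigma `^ alpha + 1 <= K by rewrite le_max lexx.
have K2 : 2 <= K by rewrite le_max le_max lexx orbT.
have K3 : 2 / e `^ alpha <= K by rewrite le_max le_max lexx !orbT.
have K0 : 0 <= K by lra.
rewrite powRr0 minr_pMr// mulr1 le_min; apply/andP; split; first exact: le_trans (C2 u) K2.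
have [ue|eu] := ltP u e; last first.
  rewrite (le_trans (C2 u))// (le_trans _ (ler_wpM2r _ K3)) ?powR_ge0//.
  rewrite -mulrA ler_peMr// ler_pdivlMl ?powR_gt0// mulr1 ge0_ler_powR ?nnegrE ?(ltW alpha0) ?(ltW e0)//.
  exact: ltW.
have := He u; rewrite /= sub0r normrN gtr0_norm// => /(_ ue (lt0r_neq0 u0)).
rewrite sub0r normrN ger0_norm; last by rewrite divr_ge0 ?powR_ge0//; exact: sqrtr_ge0.
rewrite ltr_pdivrMr ?powR_gt0// mul1r => H.
have := le_lt_trans (normr_le_sqrtD _ _) H.
rewrite ltr_norml !mul0r subr0 mulr1 => /andP[h _].
have h' : 1 - \int[G]_x cos (u * x) <= (sigma `^ alpha + 1) * u `^ alpha by lra.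
by rewrite (le_trans h')// ler_wpM2r ?powR_ge0.
Qed.

(** The cosine representation of |m|^q is integrated against G and the order exchanged by Tonelli;
    what remains is dominated by u^(-1-q) min(1, u^alpha), integrable on the half-line because 0 < q
    < alpha. *)
Lemma moment_lt_alpha q : 0 < q < alpha -> (\int[G]_m (`|m| `^ q)%:E < +oo)%E.
Proof.
move=> /andP[q0 qa]; set c := (\int[leb1]_(v in posr) (v `^ (- 1 - q) * (1 - cos v))%:E)%E.
have c0 : (0 < c)%E by exact: integral_onem_cos_gt0.
have mq : measurable_fun setT (fun m : R => (`|m| `^ q)%:E).
  by apply/measurable_EFinP; exact: measurable_norm_powR.
(* Since c > 0, an infinite moment would make the product infinite; the value of c is irrelevant
   here. *)
suff : (\int[G]_m (`|m| `^ q)%:E * c < +oo)%E.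
  have : (0 <= \int[G]_m (`|m| `^ q)%:E)%E.
    by apply: integral_ge0 => m _; rewrite lee_fin powR_ge0.
  case: (\int[G]_m _)%E => [r| |] //=; first by rewrite ltry.
  by rewrite gt0_mulye.
rewrite -ge0_integralZr//; last exact: ltW.
have [K HK] := charfun_Re_bound.
pose F (z : R * measurableTypeR R) : \bar R := (\1_posr z.2 * (z.2 `^ (- 1 - q) * (1 - cos (z.1 * z.2))))%:E.
have F0 z : (0 <= F z)%E by rewrite lee_fin !mulr_ge0 ?powR_ge0 ?onem_cos_ge0.
have mp : measurable (posr : set (measurableTypeR R)) by exact: measurable_posr.
have mF : measurable_fun setT F.
  apply/measurable_EFinP; apply: measurable_funM.
    by apply: (@measurableT_comp _ _ _ _ _ _ (\1_posr : measurableTypeR R -> R)) => //; exact: measurable_indic.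
  apply: measurable_funM.
    by apply: (@measurableT_comp _ _ _ _ _ _ (@powR R ^~ (- 1 - q))) => //; exact: measurable_powR.
  apply: measurable_funB => //; apply: measurable_fun_cos; exact: measurable_funM.
have posr_indic (h : R -> R) : (\int[leb1]_(u in posr) (h u)%:E = \int[leb1]_u (\1_posr u * h u)%:E)%E.
  rewrite integral_mkcond; apply: eq_integral => u _.
  by rewrite patchE indicE; case: ifP; rewrite ?mul1r ?mul0r.
rewrite (eq_integral (fun m => \int[leb1]_u F (m, u))%E); last first.
  by move=> m _; rewrite /F/= -posr_indic integral_onem_cosM.
rewrite (@fubini_tonelli _ _ _ _ _ G leb1 F mF F0).
apply: (@le_lt_trans _ _ (\int[leb1]_(u in posr) (K * (u `^ (- 1 - q) * Num.min (u `^ 0) (u `^ alpha)))%:E)%E).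
  rewrite posr_indic; apply: ge0_le_integral => //.
  - by move=> u _; apply: integral_ge0 => m _; exact: F0.
  - exact: measurable_fun_fubini_tonelli_G.
  - apply/measurable_EFinP; apply: measurable_funM; first exact: measurable_indic.
    apply: measurable_funM => //; apply: measurable_funM; first exact: measurable_powR.
    by apply: measurable_minr; exact: measurable_powR.
  move=> u _; rewrite /F /= indicE; have [/set_mem|_] := boolP (u \in posr); last first.
    by rewrite mul0r; under eq_integral do rewrite mul0r; rewrite integral0.
  rewrite posrE mul1r => u0.
  under eq_integral do rewrite mul1r EFinM mulrC.
  rewrite ge0_integralZl_EFin ?powR_ge0//; last first.
    apply/measurable_EFinP; apply: measurable_funB => //; apply: measurable_fun_cos; exact: measurable_funM.
  rewrite (@integral_1Bcos _ _ _ G (fun m => u * m)); last exact: measurable_funM.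
  by rewrite -EFinM lee_fin mulrCA ler_wpM2l ?powR_ge0// HK.
have KI : leb1.-integrable posr (EFin \o (fun u => K * (u `^ (- 1 - q) * Num.min (u `^ 0) (u `^ alpha)))).
  by apply: integrable_realZl; [exact: measurable_posr|exact: integrable_powR_min].
by have := integrable_fin_num mp KI; rewrite fin_numElt => /andP[].
Qed.

End moments.

(** * The tangent relation, by rotating the half-line of integration *)

Section rotation.
Context {R : realType}.
Implicit Types (t v x : R).
Local Notation leb1 := (@lebesgue_measure R).

Lemma is_derive_expR_cos (p q : R -> R) x dp dq :
  is_derive x (1 : R) p dp -> is_derive x (1 : R) q dq ->
  is_derive x (1 : R) (fun t => expR (p t) * cos (q t))
    (expR (p x) * (dp * cos (q x) - dq * sin (q x))).
Proof.
move=> Dp Dq.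
have D1 := @is_derive1_comp _ _ _ x _ _ (is_derive_expR (p x)) Dp.
have D2 := @is_derive1_comp _ _ _ x _ _ (is_derive_cos (q x)) Dq.
have D := is_deriveM D1 D2.
rewrite (_ : expR (p x) * _ = (expR \o p) x *: (- sin (q x) * dq) + (cos \o q) x *: (expR (p x) * dp)).
  exact: D.
by rewrite /GRing.scale/=; ring.
Qed.

Lemma is_derive_expR_sin (p q : R -> R) x dp dq :
  is_derive x (1 : R) p dp -> is_derive x (1 : R) q dq ->
  is_derive x (1 : R) (fun t => expR (p t) * sin (q t))
    (expR (p x) * (dp * sin (q x) + dq * cos (q x))).
Proof.
move=> Dp Dq.
have D1 := @is_derive1_comp _ _ _ x _ _ (is_derive_expR (p x)) Dp.
have D2 := @is_derive1_comp _ _ _ x _ _ (is_derive_sin (q x)) Dq.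
have D := is_deriveM D1 D2.
rewrite (_ : expR (p x) * _ = (expR \o p) x *: (cos (q x) * dq) + (sin \o q) x *: (expR (p x) * dp)).
  exact: D.
by rewrite /GRing.scale/=; ring.
Qed.

(** The modulus of exp(- v e^(it)), at most 1 when v and cos t are nonnegative. *)
Definition rotE t v : R := expR (- (v * cos t)).
(* Real and imaginary parts of exp (- v e^(it)) - 1 + v e^(it), and of its
   derivative in v *)
Definition rotA t v : R := rotE t v * cos (v * sin t) - 1 + v * cos t.
Definition rotB t v : R := v * sin t - rotE t v * sin (v * sin t).
Definition rotA' t v : R :=
  cos t * (1 - rotE t v * cos (v * sin t)) - sin t * (rotE t v * sin (v * sin t)).
Definition rotB' t v : R :=
  sin t * (1 - rotE t v * cos (v * sin t)) + cos t * (rotE t v * sin (v * sin t)).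

Lemma is_derive_mull (c x : R) : is_derive x (1 : R) (fun t : R => t * c) c.
Proof. exact: is_derive1_mulr. Qed.

Lemma is_derive_cstM (c x : R) (f : R -> R) df : is_derive x (1 : R) f df ->
  is_derive x (1 : R) (fun t => c * f t) (c * df).
Proof. by move=> D; apply: is_deriveZ. Qed.

Lemma is_derive_oppf x (f : R -> R) df : is_derive x (1 : R) f df ->
  is_derive x (1 : R) (fun t => - f t) (- df).
Proof. by move=> D; apply: is_deriveN. Qed.

Lemma is_derive_rotA_v t v : is_derive v (1 : R) (rotA t) (rotA' t v).
Proof.
have Dp := is_derive_oppf (is_derive_mull (cos t) v).
have D := is_derive_expR_cos Dp (is_derive_mull (sin t) v).
have D1 := is_deriveD (is_deriveB D (is_derive_cst (1 : R) v 1)) (is_derive_mull (cos t) v).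
have -> : rotA' t v = rotE t v * (- cos t * cos (v * sin t) - sin t * sin (v * sin t)) - 0 + cos t.
  by rewrite /rotA'; ring.
exact: D1.
Qed.

Lemma is_derive_rotB_v t v : is_derive v (1 : R) (rotB t) (rotB' t v).
Proof.
have Dp := is_derive_oppf (is_derive_mull (cos t) v).
have D := is_derive_expR_sin Dp (is_derive_mull (sin t) v).
have D1 := is_deriveB (is_derive_mull (sin t) v) D.
have -> : rotB' t v = sin t - rotE t v * (- cos t * sin (v * sin t) + sin t * cos (v * sin t)).
  by rewrite /rotB'; ring.
exact: D1.
Qed.

Lemma is_derive_rotA_t t v : is_derive t (1 : R) (rotA ^~ v) (- (v * rotB' t v)).
Proof.
have Dc := is_derive_cstM v (is_derive_cos t); have Ds := is_derive_cstM v (is_derive_sin t).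
have D := is_derive_expR_cos (is_derive_oppf Dc) Ds.
have D1 := is_deriveD (is_deriveB D (is_derive_cst (1 : R) t 1)) Dc.
have -> : - (v * rotB' t v) = rotE t v * (- (v * - sin t) * cos (v * sin t) - v * cos t * sin (v * sin t)) - 0 + v * - sin t.
  by rewrite /rotB'; ring.
exact: D1.
Qed.

Lemma is_derive_rotB_t t v : is_derive t (1 : R) (rotB ^~ v) (v * rotA' t v).
Proof.
have Dc := is_derive_cstM v (is_derive_cos t); have Ds := is_derive_cstM v (is_derive_sin t).
have D := is_derive_expR_sin (is_derive_oppf Dc) Ds.
have D1 := is_deriveB Ds D.
have -> : v * rotA' t v = v * cos t - rotE t v * (- (v * - sin t) * sin (v * sin t) + v * cos t * cos (v * sin t)).
  by rewrite /rotA'; ring.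
exact: D1.
Qed.

(** These are the parts of 1 - exp(-w) for w = v e^(it) in the first quadrant, where exp(-w) has
    modulus at most 1: the difference is both bounded and O(v). *)
Lemma onem_expR_cos_bound t v : 0 <= cos t -> 0 <= sin t -> 0 <= v ->
  `|1 - rotE t v * cos (v * sin t)| <= Num.min 2 (2 * v) /\
  `|rotE t v * sin (v * sin t)| <= Num.min 1 v.
Proof.
move=> c0 s0 v0.
have E0 : 0 <= rotE t v by exact: expR_ge0.
have E1 : rotE t v <= 1 by rewrite -[leRHS]expR0 ler_expR oppr_le0 mulr_ge0.
have c1 : cos t <= 1 by exact: cos_le1.
have s1 : sin t <= 1 by exact: sin_le1.
have vc : v * cos t <= v by rewrite ler_piMr.
have vs : v * sin t <= v by rewrite ler_piMr.
have E2 : 1 - v <= rotE t v by rewrite (le_trans _ (expR_ge1Dx _))//; lra.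
have C1 : cos (v * sin t) <= 1 by exact: cos_le1.
have C2 : -1 <= cos (v * sin t) by exact: cos_geN1.
have S1 : `|sin (v * sin t)| <= v by rewrite (le_trans (sin_le_abs _))// ger0_norm// mulr_ge0.
have S2 : `|sin (v * sin t)| <= 1 by exact: sin_max.
have C3 : 1 - cos (v * sin t) <= v.
  have := @normB_cos R (v * sin t) 0.
  rewrite cos0 subr0 [`|v * _|]ger0_norm ?mulr_ge0// distrC ger0_norm ?subr_ge0//.
  by move/le_trans; apply.
split; rewrite le_min; apply/andP; split.
- by rewrite ler_norml; apply/andP; split; nra.
- by rewrite ler_norml; apply/andP; split; nra.
- by rewrite normrM (ger0_norm E0) mulr_ile1.
- by rewrite normrM (ger0_norm E0) (le_trans _ S1)// ler_piMl.
Qed.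

Lemma rot'_bound t v : 0 <= cos t -> 0 <= sin t -> 0 <= v ->
  `|rotA' t v| <= 3 * Num.min 1 v /\ `|rotB' t v| <= 3 * Num.min 1 v.
Proof.
move=> c0 s0 v0; have [H1 H2] := onem_expR_cos_bound c0 s0 v0.
have c1 : `|cos t| <= 1 by exact: cos_max.
have s1 : `|sin t| <= 1 by exact: sin_max.
have H3 : Num.min 2 (2 * v) = 2 * Num.min 1 v by rewrite minr_pMr// mulr1.
have mv : 0 <= Num.min 1 v by rewrite le_min ler01.
rewrite H3 in H1; rewrite (_ : 3 = 2 + 1 :> R); last by ring.
rewrite mulrDl mul1r; split; rewrite (le_trans (ler_normD _ _))// ?normrN (normrM (cos t)) (normrM (sin t)) lerD//.
- by rewrite (le_trans _ H1)// ler_piMl.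
- by rewrite (le_trans _ H2)// ler_piMl.
- by rewrite (le_trans _ H1)// ler_piMl.
- by rewrite (le_trans _ H2)// ler_piMl.
Qed.

Lemma primitive_min_bound (f f' : R -> R) C v : f 0 = 0 ->
  (forall x : R, is_derive x (1 : R) f (f' x)) ->
  (forall x, 0 <= x -> `|f' x| <= C * Num.min 1 x) -> 0 < v ->
  `|f v| <= C * Num.min v (v ^+ 2).
Proof.
move=> f0 df Hf v0.
have [x xv] := @MVT R f f' 0 v v0 (fun x _ => df x)
  (continuous_subspaceT (fun x => is_derive1_continuous (df x))).
move: xv; rewrite in_itv/= => /andP[x0 xv]; rewrite f0 !subr0 => ->.
have C0 : 0 <= C.
  have := Hf _ ler01; rewrite minxx mulr1; exact: le_trans.
rewrite normrM (gtr0_norm v0) expr2 -[X in Num.min X _](mulr1 v) -minr_pMr ?(ltW v0)//.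
rewrite mulrCA mulrC ler_pM2l// (le_trans (Hf _ (ltW x0)))// ler_wpM2l//.
by rewrite le_min !ge_min lexx (ltW xv) orbT.
Qed.

Lemma rot_bound t v : 0 <= cos t -> 0 <= sin t -> 0 < v ->
  `|rotA t v| <= 3 * Num.min v (v ^+ 2) /\ `|rotB t v| <= 3 * Num.min v (v ^+ 2).
Proof.
move=> c0 s0 v0; split.
  apply: (primitive_min_bound _ (is_derive_rotA_v t)) => // [|x x0].
    by rewrite /rotA /rotE !mul0r oppr0 expR0 cos0 mul1r subrr addr0.
  exact: (rot'_bound c0 s0 x0).1.
apply: (primitive_min_bound _ (is_derive_rotB_v t)) => // [|x x0].
  by rewrite /rotB /rotE !mul0r sin0 mulr0 subr0.
exact: (rot'_bound c0 s0 x0).2.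
Qed.

Variable g : R.
Hypothesis g12 : 1 < g < 2.

Let wt v : R := v `^ (- 1 - g).

Lemma integrable_rot_dominating (C : R) :
  leb1.-integrable posr (EFin \o (fun v => C * (wt v * Num.min (v `^ 1) (v `^ 2)))).
Proof.
by have /andP[g1 g2] := g12; apply: integrable_realZl; [exact: measurable_posr|exact: integrable_powR_min].
Qed.

Lemma le_integrable_rot (h : R -> R) C : measurable_fun posr h ->
  (forall v, 0 < v -> `|h v| <= C * Num.min v (v ^+ 2)) ->
  leb1.-integrable posr (EFin \o (fun v => wt v * h v)).
Proof.
move=> mh Hh; apply: (@le_integrable_real _ _ _ _ _ _ _ _ _ _ (integrable_rot_dominating C)).
- exact: measurable_posr.
- apply: measurable_funM => //; apply: measurable_funTS; exact: measurable_powR.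
move=> v; rewrite posrE => v0; rewrite powRr1 ?(ltW v0)// powR_mulrn ?(ltW v0)//.
by rewrite normrM (ger0_norm (powR_ge0 _ _)) mulrCA ler_wpM2l ?powR_ge0// Hh.
Qed.

Lemma Rintegral_segment_cvg (h : R -> R) : leb1.-integrable posr (EFin \o h) ->
  \int[leb1]_(v in segment n) h v @[n --> \oo] --> \int[leb1]_(v in posr) h v.
Proof.
move=> ih; have mh : measurable_fun posr h by case/integrableP : ih => /measurable_EFinP.
have mp : measurable (posr : set (measurableTypeR R)) by exact: measurable_posr.
have ms n : measurable (segment n : set (measurableTypeR R)) by exact: measurable_itv.
have sp n : (segment n : set R) `<=` posr by move=> x /segment_gt0; rewrite posrE.
have E n : \int[leb1]_(v in segment n) h v = \int[leb1]_(v in posr) (\1_(segment n) v * h v).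
  rewrite Rintegral_mkcond [in RHS]Rintegral_mkcond; apply: eq_Rintegral => v _.
  rewrite !patchE indicE; have [vs|_] := boolP (v \in segment n); last by rewrite mul0r if_same.
  by rewrite (mem_set (sp n _ (set_mem vs))) mul1r.
under eq_fun do rewrite E.
apply: (Rintegral_dct mp _ _ (integrable_norm ih)).
- by move=> n; apply: measurable_funM => //; apply: measurable_funTS; exact: measurable_indic.
- move=> v pv; apply: cvg_near_cst.
  have [n _ vn] : (\bigcup_n (segment n : set R)) v by rewrite bigcup_segment.
  exists n => // m /= nm; rewrite indicE mem_set ?mul1r//.
  by have /subsetPset sub := @nondecreasing_segment R _ _ nm; exact: sub.
- move=> n v _; rewrite normrM indicE; case: (v \in _); first by rewrite normr1 mul1r.
  by rewrite /= normr0 mul0r.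
Qed.

Lemma powR_inv_cvg0 (e : R) : 0 < e -> (n.+2%:R^-1 : R) `^ e @[n --> \oo] --> 0.
Proof.
move=> e0; have := powR_cvg0 e0; move/cvg_at_rightP; apply; split => [n|]; first by rewrite invr_gt0.
have H : (n.+1%:R^-1 : R) @[n --> \oo] --> 0 by exact: cvg_harmonic.
by rewrite (cvg_shiftS (fun n => n.+1%:R^-1 : R)).
Qed.

(** The boundary terms v^(-g) h(v) vanish at both ends: at infinity because |h| <= C v and g > 1, at
    0 because |h| <= C v^2 and g < 2. *)
Lemma integration_by_parts_powR (h h' : R -> R) C :
  (forall x : R, is_derive x (1 : R) h (h' x)) -> (forall x, {for x, continuous h'}) ->
  (forall v, 0 < v -> `|h v| <= C * Num.min v (v ^+ 2)) ->
  (forall v, 0 < v -> `|h' v| <= C * Num.min 1 v) ->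
  \int[leb1]_(v in posr) (wt v * (v * h' v)) = g * \int[leb1]_(v in posr) (wt v * h v).
Proof.
move=> dh ch' Hh Hh'; have /andP[g1 g2] := g12.
have mp : measurable (posr : set (measurableTypeR R)) by exact: measurable_posr.
have ch x : {for x, continuous h} by exact: is_derive1_continuous (dh x).
have ih : leb1.-integrable posr (EFin \o (fun v => wt v * h v)).
  by apply: (le_integrable_rot _ Hh); apply: continuous_posr_measurable => x _; exact: ch.
have ih' : leb1.-integrable posr (EFin \o (fun v => wt v * (v * h' v))).
  apply: (@le_integrable_rot (fun v => v * h' v) C).
    by apply: continuous_posr_measurable => x _; apply: cvgM; [exact: cvg_id|exact: ch'].
  move=> v v0; rewrite normrM (gtr0_norm v0) expr2 -[X in Num.min X _](mulr1 v) -minr_pMr ?(ltW v0)//.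
  by rewrite mulrCA ler_wpM2l ?(ltW v0)// Hh'.
apply/eqP; rewrite -subr_eq0 -RintegralZl// -RintegralB//; last exact: integrable_realZl.
pose F v := v `^ (- g) * h v.
pose f v := wt v * (v * h' v) - g * (wt v * h v).
have if_ : leb1.-integrable posr (EFin \o f) by apply: integrable_realB => //; exact: integrable_realZl.
have dF v : 0 < v -> is_derive v (1 : R) F (f v).
  move=> v0; have D := is_deriveM (is_derive1_powR (- g) v0) (dh v).
  have -> : f v = v `^ (- g) *: h' v + h v *: (- g * v `^ (- g - 1)).
    have wv : wt v * v = v `^ (- g).
      by rewrite /wt -[X in _ * X](powRr1 (ltW v0)) powRDr//; congr (_ `^ _); ring.
    rewrite /f /GRing.scale/= mulrA wv (_ : - g - 1 = - 1 - g); last by ring.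
    by rewrite -/(wt v); ring.
  exact: D.
have cf v : 0 < v -> {for v, continuous f}.
  move=> v0; apply: cvgB.
    apply: cvgM; first exact: continuous_powR.
    by apply: cvgM; [exact: cvg_id|exact: ch'].
  apply: cvgM; first exact: cvg_cst.
  by apply: cvgM; [exact: continuous_powR|exact: ch].
have L : \int[leb1]_(v in segment n) f v @[n --> \oo] --> 0.
  have E n : \int[leb1]_(v in segment n) f v = F n.+2%:R - F n.+2%:R^-1.
    have n0 : 0 < n.+2%:R^-1 :> R by rewrite invr_gt0.
    have nn : n.+2%:R^-1 < n.+2%:R :> R.
      by rewrite (@lt_trans _ _ 1)// ?invf_lt1 ?ltr0n// ltr1n.
    rewrite /Rintegral (@continuous_FTC2 R f F)//.
    - by apply: continuous_pos_within cf => x; exact: (@segment_gt0 _ n).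
    - exact: derivable_oo_LRcontinuous_pos dF (ltW nn).
    - by move=> x; rewrite in_itv/= => /andP[nx _]; apply: derive1_pos; apply: dF; exact: lt_trans nx.
  rewrite (_ : (fun n => _) = (fun n : nat => F n.+2%:R - F n.+2%:R^-1)); last by apply/funext => n; exact: E.
  have C0 : 0 <= C by have := Hh _ ltr01; rewrite expr1n minxx mulr1; exact: le_trans.
  rewrite -[X in _ --> X](subrr 0); apply: cvgB.
    apply: (@squeeze_cvgr _ _ _ _ (fun n => - (C * n.+2%:R^-1 `^ (g - 1))) (fun n => C * n.+2%:R^-1 `^ (g - 1))).
    - apply: nearW => n; rewrite -ler_norml normrM ger0_norm ?powR_ge0//.
      have n0 : 0 < n.+2%:R :> R by rewrite ltr0n.
      rewrite (le_trans (ler_wpM2l _ (Hh _ n0))) ?powR_ge0// mulrCA ler_wpM2l//.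
      apply: (@le_trans _ _ (n.+2%:R `^ (- g) * n.+2%:R)).
        by rewrite ler_wpM2l ?powR_ge0// ge_min lexx.
      rewrite -[X in _ * X <= _](powRr1 (ltW n0)) powRDr// -powR_inv1 ?(ltW n0)// -powRrM.
      by rewrite le_eqVlt; apply/orP; left; apply/eqP; congr (_ `^ _); ring.
    - rewrite -oppr0; apply: cvgN; rewrite -[X in _ --> X](mulr0 C).
      by apply: cvgMr; apply: powR_inv_cvg0; rewrite subr_gt0.
    - rewrite -[X in _ --> X](mulr0 C).
      by apply: cvgMr; apply: powR_inv_cvg0; rewrite subr_gt0.
  apply: (@squeeze_cvgr _ _ _ _ (fun n => - (C * n.+2%:R^-1 `^ (2 - g))) (fun n => C * n.+2%:R^-1 `^ (2 - g))).
  - apply: nearW => n; rewrite -ler_norml normrM ger0_norm ?powR_ge0//.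
    have n0 : 0 < n.+2%:R^-1 :> R by rewrite invr_gt0.
    rewrite (le_trans (ler_wpM2l _ (Hh _ n0))) ?powR_ge0// mulrCA ler_wpM2l//.
    apply: (@le_trans _ _ (n.+2%:R^-1 `^ (- g) * n.+2%:R^-1 ^+ 2)).
      by rewrite ler_wpM2l ?powR_ge0// ge_min lexx orbT.
    rewrite -powR_mulrn ?(ltW n0)// powRDr//.
    by rewrite le_eqVlt; apply/orP; left; apply/eqP; congr (_ `^ _); ring.
  - rewrite -oppr0; apply: cvgN; rewrite -[X in _ --> X](mulr0 C).
    by apply: cvgMr; apply: powR_inv_cvg0; rewrite subr_gt0.
  - rewrite -[X in _ --> X](mulr0 C).
    by apply: cvgMr; apply: powR_inv_cvg0; rewrite subr_gt0.
apply/eqP; apply: (cvg_unique _ (Rintegral_segment_cvg if_)) => //.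
Qed.

Lemma quarter_ge0 t : 0 <= t <= pi / 2 -> 0 <= cos t /\ 0 <= sin t.
Proof.
have p0 : 0 <= pi / 2 :> R by rewrite divr_ge0 ?pi_ge0.
move=> /andP[t0 tp]; split; first by apply: cos_ge0_pihalf; rewrite tp (le_trans _ t0)// oppr_le0.
by apply: sin_ge0_pi; rewrite t0 (le_trans tp)// ler_pdivrMr// ler_peMr ?pi_ge0// ler1n.
Qed.

Section rotation_derivative.
Variables (f f' : R -> R -> R) (C : R).
Hypothesis df : forall t v, is_derive t (1 : R) (f ^~ v) (v * f' t v).
Hypothesis cf : forall t v, {for v, continuous (f t)}.
Hypothesis Hf : forall t v, 0 <= t <= pi / 2 -> 0 < v -> `|f t v| <= C * Num.min v (v ^+ 2).
Hypothesis Hf' : forall t v, 0 <= t <= pi / 2 -> 0 < v -> `|f' t v| <= C * Num.min 1 v.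

Let F t := \int[leb1]_(v in posr) (wt v * f t v).

Let vf'_bound t v : 0 <= t <= pi / 2 -> 0 < v -> `|v * f' t v| <= C * Num.min v (v ^+ 2).
Proof.
move=> tp v0; rewrite normrM (gtr0_norm v0) expr2 -[X in Num.min X _](mulr1 v) -minr_pMr ?(ltW v0)//.
by rewrite mulrCA ler_wpM2l ?(ltW v0)// Hf'.
Qed.

Let integrable_f t : 0 <= t <= pi / 2 -> leb1.-integrable posr (EFin \o (fun v => wt v * f t v)).
Proof.
by move=> tp; apply: (le_integrable_rot _ (fun v => Hf tp)); apply: continuous_posr_measurable => x _.
Qed.

(** Differentiation under the integral sign; a multiple of v^(-1-g) min(v, v^2) dominates for all
    angles at once. *)
Lemma is_derive_rotation t : 0 < t < pi / 2 ->
  is_derive t (1 : R) F (\int[leb1]_(v in posr) (wt v * (v * f' t v))).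
Proof.
move=> /andP[t0 tp].
have mp : measurable (posr : set (measurableTypeR R)) by exact: measurable_posr.
pose D v := `|C| * (wt v * Num.min (v `^ 1) (v `^ 2)).
pose h t v := wt v * f t v.
have dh s v : is_derive s (1 : R) (h ^~ v) (wt v * (v * f' s v)) by exact: is_derive_cstM.
have I1 : (`]0, (pi / 2)[%classic : set R) t by rewrite /= in_itv/= t0.
have I2 x : (`]0, (pi / 2)[%classic : set R) x -> 0 <= x <= pi / 2.
  by rewrite /= in_itv/= => /andP[/ltW -> /ltW ->].
have intf x : (`]0, (pi / 2)[%classic : set R) x -> leb1.-integrable posr (EFin \o h x).
  by move=> /I2; exact: integrable_f.
have derf1 x v : (`]0, (pi / 2)[%classic : set R) x -> posr v -> derivable (h ^~ v) x 1.
  by move=> _ _; have [] := dh x v.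
have D0 v : 0 <= D v by rewrite mulr_ge0// mulr_ge0 ?le_min ?powR_ge0.
have iD : leb1.-integrable posr (EFin \o D) by exact: integrable_rot_dominating.
have DE x v : partial1of2 h x v = wt v * (v * f' x v).
  by rewrite partial1of2E; have [_ ->] := dh x v.
have G_ub x v : (`]0, (pi / 2)[%classic : set R) x -> posr v -> `|partial1of2 h x v| <= D v.
  move=> /I2 xp; rewrite posrE => v0; rewrite DE normrM (ger0_norm (powR_ge0 _ _)).
  rewrite /D mulrCA ler_wpM2l ?powR_ge0// powRr1 ?(ltW v0)// powR_mulrn ?(ltW v0)//.
  by rewrite (le_trans (vf'_bound xp v0))// ler_wpM2r ?ler_norm// le_min (ltW v0) exprn_ge0// ltW.
apply: DeriveDef.
  exact: (derivable_under_integral mp I1 intf derf1 D0 iD G_ub).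
rewrite -derive1E (differentiation_under_integral mp I1 intf derf1 D0 iD G_ub).
by apply: eq_Rintegral => v _; exact: DE.
Qed.

(** The endpoints carry the final identity, while the derivative is computed only inside. The mean
    value theorem for each v makes the integral Lipschitz in t with constant L, hence continuous up
    to 0 and pi/2. *)
Lemma continuous_rotation : {within `[0, pi / 2], continuous F}.
Proof.
have mp : measurable (posr : set (measurableTypeR R)) by exact: measurable_posr.
pose D v := `|C| * (wt v * Num.min (v `^ 1) (v `^ 2)).
have iD : leb1.-integrable posr (EFin \o D) by exact: integrable_rot_dominating.
set L := \int[leb1]_(v in posr) D v.
have lip s t : 0 <= s -> s < t -> t <= pi / 2 -> `|F t - F s| <= L * (t - s).
  move=> s0 st tp.
  have sI : 0 <= s <= pi / 2 by rewrite s0 (le_trans (ltW st)).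
  have tI : 0 <= t <= pi / 2 by rewrite tp andbT (le_trans s0)// ltW.
  rewrite /F -RintegralB//; [|exact: integrable_f|exact: integrable_f].
  apply: (le_trans (le_normr_Rintegral _ _)) => //.
    exact: (integrableB mp (integrable_f tI) (integrable_f sI)).
  rewrite mulrC /L -RintegralZl//; apply: le_Rintegral => //.
  - exact: (integrable_norm (integrableB mp (integrable_f tI) (integrable_f sI))).
  - exact: integrable_realZl.
  move=> v; rewrite posrE => v0.
  have [c + E] := @MVT R (f ^~ v) (fun t => v * f' t v) s t st (fun x _ => df x v)
    (continuous_subspaceT (fun x => is_derive1_continuous (df x v))).
  rewrite in_itv/= => /andP[sc ct].
  have cI : 0 <= c <= pi / 2 by rewrite (le_trans s0 (ltW sc)) (le_trans (ltW ct)).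
  rewrite -mulrBr E normrM (ger0_norm (powR_ge0 _ _)) normrM [`|t - s|]gtr0_norm ?subr_gt0//.
  rewrite mulrA [leRHS]mulrC ler_wpM2r ?subr_ge0 ?(ltW st)// /D mulrCA ler_wpM2l ?powR_ge0//.
  rewrite powRr1 ?(ltW v0)// powR_mulrn ?(ltW v0)//.
  by rewrite (le_trans (vf'_bound cI v0))// ler_wpM2r ?ler_norm// le_min (ltW v0) exprn_ge0// ltW.
have L0 : 0 <= L.
  by apply: Rintegral_ge0 => v _; rewrite /D mulr_ge0// mulr_ge0 ?le_min ?powR_ge0.
have {}lip s t : 0 <= s <= pi / 2 -> 0 <= t <= pi / 2 -> `|F t - F s| <= L * `|t - s|.
  move=> /andP[s0 sp] /andP[t0 tp]; have [st|ts|->] := ltgtP s t.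
  - by rewrite [`|t - s|]gtr0_norm ?subr_gt0// lip.
  - by rewrite distrC [`|t - s|]distrC [`|s - t|]gtr0_norm ?subr_gt0// lip.
  - by rewrite !subrr !normr0 mulr0.
apply/subspace_continuousP => x; rewrite /= in_itv/= => xI.
apply/cvgrPdist_le => e e0; rewrite near_withinE.
have L1 : 0 < L + 1 by rewrite ltr_pwDr.
near=> y; rewrite /= in_itv/= => yI; rewrite (le_trans (lip _ _ yI xI))//.
rewrite (@le_trans _ _ ((L + 1) * (e / (L + 1))))//; last by rewrite mulrC divfK// gt_eqF.
rewrite ler_pM// ?lerDl//.
near: y; apply/nbhs_ballP; exists (e / (L + 1)) => /=; first by rewrite divr_gt0.
by move=> z /= /ltW.
Unshelve. all: by end_near. Qed.

End rotation_derivative.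

(* The integrals A(t), B(t) of v^(-1-g) against rotA t, rotB t satisfy A' = - g B
   and B' = g A, so that A(t) sin(g t) - B(t) cos(g t) is constant on [0, pi/2];
   the claim is its value at both ends. *)
Lemma integral_sub_sin_tan :
  \int[leb1]_(v in posr) (wt v * (v - sin v)) =
  - tan (pi * g / 2) * \int[leb1]_(v in posr) (wt v * (1 - cos v)).
Proof.
have /andP[g1 g2] := g12; have p0 : 0 < pi :> R by exact: pi_gt0.
have cA t v : {for v, continuous (rotA t)} by exact: is_derive1_continuous (is_derive_rotA_v t v).
have cB t v : {for v, continuous (rotB t)} by exact: is_derive1_continuous (is_derive_rotB_v t v).
have cE t v : {for v, continuous (fun v => rotE t v * cos (v * sin t))}.
  exact: is_derive1_continuous (is_derive_expR_cos (is_derive_oppf (is_derive_mull (cos t) v)) (is_derive_mull (sin t) v)).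
have cS t v : {for v, continuous (fun v => rotE t v * sin (v * sin t))}.
  exact: is_derive1_continuous (is_derive_expR_sin (is_derive_oppf (is_derive_mull (cos t) v)) (is_derive_mull (sin t) v)).
have cA' t v : {for v, continuous (rotA' t)}.
  apply: cvgB; apply: cvgM; first exact: cvg_cst.
  - by apply: cvgB; [exact: cvg_cst|exact: cE].
  - exact: cvg_cst.
  - exact: cS.
have cB' t v : {for v, continuous (rotB' t)}.
  apply: cvgD; apply: cvgM; first exact: cvg_cst.
  - by apply: cvgB; [exact: cvg_cst|exact: cE].
  - exact: cvg_cst.
  - exact: cS.
have bA t v : 0 <= t <= pi / 2 -> 0 < v -> `|rotA t v| <= 3 * Num.min v (v ^+ 2).
  by move=> /quarter_ge0[c0 s0] v0; exact: (rot_bound c0 s0 v0).1.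
have bB t v : 0 <= t <= pi / 2 -> 0 < v -> `|rotB t v| <= 3 * Num.min v (v ^+ 2).
  by move=> /quarter_ge0[c0 s0] v0; exact: (rot_bound c0 s0 v0).2.
have bA' t v : 0 <= t <= pi / 2 -> 0 < v -> `|rotA' t v| <= 3 * Num.min 1 v.
  by move=> /quarter_ge0[c0 s0] v0; exact: (rot'_bound c0 s0 (ltW v0)).1.
have bB' t v : 0 <= t <= pi / 2 -> 0 < v -> `|rotB' t v| <= 3 * Num.min 1 v.
  by move=> /quarter_ge0[c0 s0] v0; exact: (rot'_bound c0 s0 (ltW v0)).2.
have bB'N t v : 0 <= t <= pi / 2 -> 0 < v -> `|- rotB' t v| <= 3 * Num.min 1 v.
  by move=> *; rewrite normrN; exact: bB'.
have dAt t v : is_derive t (1 : R) (rotA ^~ v) (v * - rotB' t v).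
  by rewrite mulrN; exact: is_derive_rotA_t.
pose A t := \int[leb1]_(v in posr) (wt v * rotA t v).
pose B t := \int[leb1]_(v in posr) (wt v * rotB t v).
(* The t-derivative of [rotA] is - v [rotB'], and integration by parts in v turns v [rotB'] into g
   [rotB]. *)
have dA t : 0 < t < pi / 2 -> is_derive t (1 : R) A (- (g * B t)).
  move=> tI; have tI' : 0 <= t <= pi / 2 by case/andP : tI => /ltW -> /ltW ->.
  rewrite -(@integration_by_parts_powR _ _ 3 (is_derive_rotB_v t) (cB' t))//; last 2 first.
  - by move=> v; exact: bB.
  - by move=> v; exact: bB'.
  rewrite -mulN1r -RintegralZl//; last 2 first.
  - exact: measurable_posr.
  - apply: (@le_integrable_rot (fun v => v * rotB' t v) 3).
      by apply: continuous_posr_measurable => x _; apply: cvgM; [exact: cvg_id|exact: cB'].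
    move=> v v0; rewrite normrM (gtr0_norm v0) expr2 -[X in Num.min X _](mulr1 v) -minr_pMr ?(ltW v0)//.
    by rewrite mulrCA ler_wpM2l ?(ltW v0)// bB'.
  rewrite (_ : Rintegral _ _ _ = \int[leb1]_(v in posr) (wt v * (v * - rotB' t v))); last first.
    by apply: eq_Rintegral => v _; ring.
  exact: (is_derive_rotation dAt cA bA bB'N tI).
have dB t : 0 < t < pi / 2 -> is_derive t (1 : R) B (g * A t).
  move=> tI; have tI' : 0 <= t <= pi / 2 by case/andP : tI => /ltW -> /ltW ->.
  rewrite -(@integration_by_parts_powR _ _ 3 (is_derive_rotA_v t) (cA' t))//; last 2 first.
  - by move=> v; exact: bA.
  - by move=> v; exact: bA'.
  exact: (is_derive_rotation is_derive_rotB_t cB bB bA' tI).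
pose Phi t := A t * sin (g * t) - B t * cos (g * t).
have dgt t : is_derive t (1 : R) (fun t => g * t) g.
  by have := is_derive_cstM g (is_derive_id t (1 : R)); rewrite mulr1.
have dPhi t : t \in `]0, (pi / 2)[ -> is_derive t (1 : R) Phi 0.
  rewrite in_itv/= => tI.
  have Ds := @is_derive1_comp _ _ _ t _ _ (is_derive_sin (g * t)) (dgt t).
  have Dc := @is_derive1_comp _ _ _ t _ _ (is_derive_cos (g * t)) (dgt t).
  have D := is_deriveB (is_deriveM (dA t tI) Ds) (is_deriveM (dB t tI) Dc).
  rewrite (_ : 0 = A t *: (cos (g * t) * g) + (sin \o (fun t => g * t)) t *: (- (g * B t)) -
    (B t *: (- sin (g * t) * g) + (cos \o (fun t => g * t)) t *: (g * A t))); last first.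
    by rewrite /GRing.scale/=; ring.
  exact: D.
have cAw := continuous_rotation dAt cA bA bB'N.
have cBw := continuous_rotation is_derive_rotB_t cB bB bA'.
have cPhi : {within `[0, (pi / 2)], continuous Phi}.
  move=> x; apply: cvgB; apply: cvgM.
  - exact: cAw.
  - apply: continuous_subspaceT => y; apply: (@continuous_comp _ _ _ (fun t => g * t) sin); last exact: continuous_sin.
    exact: is_derive1_continuous (dgt y).
  - exact: cBw.
  - apply: continuous_subspaceT => y; apply: (@continuous_comp _ _ _ (fun t => g * t) cos); last exact: continuous_cos.
    exact: is_derive1_continuous (dgt y).
have pi2 : 0 < pi / 2 :> R by rewrite divr_gt0.
have [c _] := @MVT R Phi (cst 0) 0 (pi / 2) pi2 dPhi cPhi.
(* At t = 0 the exponential is real and its imaginary part vanishes; at t = pi/2 the two integrands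
   become cos v - 1 and v - sin v. *)
have B0 : B 0 = 0.
  rewrite /B (eq_Rintegral _ (g := cst 0)); first by rewrite Rintegral_cst ?mul0r//; exact: measurable_posr.
  by move=> v _; rewrite /rotB sin0 !mulr0 sin0 mulr0 subrr mulr0.
rewrite /= mul0r {2}/Phi mulr0 sin0 mulr0 B0 mul0r !subr0 /Phi => /eqP; rewrite subr_eq0 => /eqP.
have -> : A (pi / 2) = - \int[leb1]_(v in posr) (wt v * (1 - cos v)).
  rewrite -mulN1r -RintegralZl//; last 2 first.
  - exact: measurable_posr.
  - apply: (@le_integrable_rot (fun v => 1 - cos v) 3).
      by apply: continuous_posr_measurable => x _; exact: continuous_onem_cos.
    move=> v v0; have := bA (pi / 2) v _ v0.
    rewrite lexx (ltW pi2) => /(_ isT); rewrite -normrN.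
    by rewrite /rotA /rotE cos_pihalf sin_pihalf mulr0 oppr0 expR0 mul1r mulr1 addr0 opprB.
  apply: eq_Rintegral => v _.
  by rewrite /rotA /rotE cos_pihalf sin_pihalf mulr0 oppr0 expR0 mul1r mulr1 addr0; ring.
have -> : B (pi / 2) = \int[leb1]_(v in posr) (wt v * (v - sin v)).
  apply: eq_Rintegral => v _.
  by rewrite /rotB /rotE cos_pihalf sin_pihalf mulr0 oppr0 expR0 mul1r mulr1.
(* The condition 1 < g < 2 puts g pi/2 strictly between pi/2 and pi, so the division by this cosine
   is legitimate. *)
have cg0 : cos (g * (pi / 2)) < 0.
  rewrite (_ : g * (pi / 2) = (g - 1) * (pi / 2) + pi / 2); last by ring.
  rewrite cosDpihalf oppr_lt0 sin_gt0_pihalf// mulr_gt0 ?subr_gt0//=.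
  by rewrite gtr_pMl//; lra.
rewrite (_ : pi * g / 2 = g * (pi / 2)); last by ring.
move=> E; apply: (mulIf (ltr0_neq0 cg0)); rewrite -E /tan.
by field; exact: ltr0_neq0.
Qed.

End rotation.

(** * The limit of the characteristic exponent *)

Section lebesgue_scaling.
Context {R : realType}.
Implicit Types (c : R) (h : R -> R).
Local Notation leb1 := (@lebesgue_measure R).

Lemma measurable_posrT : measurable (posr : set (measurableTypeR R)).
Proof. exact: measurable_posr. Qed.

Lemma integral_posr_indic h :
  (\int[leb1]_(u in posr) (h u)%:E = \int[leb1]_u (\1_posr u * h u)%:E)%E.
Proof.
rewrite integral_mkcond; apply: eq_integral => u _.
by rewrite patchE indicE; case: ifP; rewrite ?mul1r ?mul0r.
Qed.

Lemma lebesgue_measure_scale c (A : set (measurableTypeR R)) : 0 < c -> measurable A ->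
  (c%:E * leb1 [set u | A (c * u)%R])%E = leb1 A.
Proof.
move=> c0 mA.
pose sc : measurableTypeR R -> measurableTypeR R := fun u => c * u.
have ms : measurable_fun setT sc by exact: measurable_funM.
apply/esym.
pose pf : {measure set (measurableTypeR R) -> \bar R} := mscale (NngNum (ltW c0)) (pushforward leb1 sc).
apply: (lebesgue_measure_unique (mu := pf ms)) => // X [[a b] _ <-].
rewrite /= /mscale/= /pushforward/= [X in (_ = _ * leb1 X)%E](_ : _ = `]a / c, (b / c)]%classic); last first.
  by apply/seteqP; split=> u /=; rewrite !in_itv/= ltr_pdivrMr// ler_pdivlMr// [u * c]mulrC.
rewrite !lebesgue_measure_itv/= !lte_fin ltr_pM2r ?invr_gt0//.
case: ifPn => ab; last by rewrite mule0.
by rewrite -!EFinB -EFinM; congr EFin; field; rewrite gt_eqF.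
Qed.

Lemma ge0_integral_scale c h : 0 < c -> measurable_fun setT h -> (forall x, 0 <= h x) ->
  (\int[leb1]_v (h v)%:E = c%:E * \int[leb1]_u (h (c * u))%:E)%E.
Proof.
move=> c0 mh h0.
pose sc : measurableTypeR R -> measurableTypeR R := fun u => c * u.
have ms : measurable_fun setT sc by exact: measurable_funM.
pose pf : {measure set (measurableTypeR R) -> \bar R} := pushforward leb1 sc.
transitivity (\int[mscale (NngNum (ltW c0)) (pf ms)]_v (h v)%:E)%E.
  apply: eq_measure_integral => A mA _; first [exact: (lebesgue_measure_scale c0 mA)|apply/esym; exact: (lebesgue_measure_scale c0 mA)].
rewrite ge0_integral_mscale//; last 2 first.
- exact/measurable_EFinP.
- by move=> x _; rewrite lee_fin.
congr (_ * _)%E; rewrite /pf ge0_integral_pushforward//; last 2 first.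
- exact/measurable_EFinP.
- by move=> x _; rewrite lee_fin.
Qed.

Lemma ge0_integral_posr_scale c h : 0 < c -> measurable_fun setT h ->
  (forall x, 0 <= h x) ->
  (\int[leb1]_(v in posr) (h v)%:E = c%:E * \int[leb1]_(u in posr) (h (c * u))%:E)%E.
Proof.
move=> c0 mh h0; rewrite !integral_posr_indic.
rewrite (@ge0_integral_scale c (fun v => \1_posr v * h v))//.
- congr (_ * _)%E; apply: eq_integral => u _; congr (_ * _)%:E.
  by rewrite !indicE; congr (_ : bool)%:R; apply/idP/idP; rewrite !inE !posrE pmulr_rgt0.
- by apply: measurable_funM => //; apply: measurable_indic; exact: measurable_posrT.
- by move=> x; rewrite mulr_ge0.
Qed.

End lebesgue_scaling.

Section product_sigma_finite.
Context {R : realType} d1 d2 (T1 : measurableType d1) (T2 : measurableType d2).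
Variables (m1 : {sigma_finite_measure set T1 -> \bar R})
  (m2 : {sigma_finite_measure set T2 -> \bar R}).

(* In the library the canonical sigma-finite structure of a product is shadowed
   by the one of products of subprobabilities; hence this copy. *)
Definition prodm : set (T1 * T2) -> \bar R := (m1 \x m2)%E.

HB.instance Definition _ := Measure.on prodm.

Let prodm_sigma_finite : sigma_finite setT prodm.
Proof.
have /sigma_finiteP[A [TA ndA Aoo]] := sigma_finiteT m1.
have /sigma_finiteP[B [TB ndB Boo]] := sigma_finiteT m2.
exists (fun n => A n `*` B n).
  rewrite -setXTT TA TB; apply/seteqP; split=> [[x y] [[i _ Ax] [j _ By]]|[x y] [n _ [Ax By]]].
    exists (maxn i j) => //; split.
      by move: Ax; exact/subsetPset/ndA/leq_maxl.
    by move: By; exact/subsetPset/ndB/leq_maxr.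
  by split; exists n => //.
move=> n; have [mA Afin] := Aoo n; have [mB Bfin] := Boo n; split; first exact: measurableX.
by rewrite /prodm product_measure1E// lte_mul_pinfty// ge0_fin_numE.
Qed.

HB.instance Definition _ := Measure_isSigmaFinite.Build _ _ _ prodm prodm_sigma_finite.

End product_sigma_finite.

(** * Integrals of a nonnegative Lipschitz function over centres and weights *)

Section kappa_functional.
Context {R : realType} d1 (T1 : measurableType d1).
Variables (m1 : {sigma_finite_measure set T1 -> \bar R}) (G : probability R R).
Variables (kap : R -> R) (C p : R).
Hypotheses (k_ge0 : forall y, 0 <= kap y) (k0 : kap 0 = 0)
  (k_lip : forall a b, `|kap a - kap b| <= 2 * `|a - b|)
  (k_pow : forall y, kap y <= C * `|y| `^ p)
  (mk : measurable_fun setT kap)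
  (G1 : G.-integrable setT (EFin \o (fun m : R => `|m|)))
  (Gp : G.-integrable setT (EFin \o (fun m : R => `|m| `^ p))).

(** The functional behind Q_s: b is the rescaled mass of a ball as a function of its centre, and
    [kap] one of the nonnegative functions psi. *)
Definition kapint (b : T1 -> R) : R := \int[(m1 \x G)%E]_z kap (z.2 * b z.1).

Lemma measurable_kap_prod (b : T1 -> R) : measurable_fun setT b ->
  measurable_fun setT (fun z : T1 * R => kap (z.2 * b z.1)).
Proof.
by move=> mb; apply: measurableT_comp => //; apply: measurable_funM => //; exact: measurableT_comp.
Qed.

Lemma measurable_kapint d3 (T3 : measurableType d3) (b : T3 -> T1 -> R) :
  measurable_fun setT (fun q : T3 * T1 => b q.1 q.2) ->
  measurable_fun setT (fun t => kapint (b t)).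
Proof.
move=> mb; have H := @measurable_Rintegral_snd _ _ _ T3 (T1 * R)%type (prodm m1 G)
  (fun q : T3 * (T1 * R) => kap (q.2.2 * b q.1 q.2.1)).
apply: H; apply: measurableT_comp => //; apply: measurable_funM; first exact: measurableT_comp.
apply: (@measurableT_comp _ _ _ _ _ _ (fun q : T3 * T1 => b q.1 q.2) _ (fun q : T3 * (T1 * R) => (q.1, q.2.1))) => //.
by apply: measurable_fun_pair => //; exact: measurableT_comp.
Qed.

Lemma kap_le y : kap y <= 2 * `|y|.
Proof. by have := k_lip y 0; rewrite k0 !subr0 ger0_norm. Qed.

Lemma integrable_kapint (b : T1 -> R) : m1.-integrable setT (EFin \o b) ->
  (m1 \x G)%E.-integrable setT (EFin \o (fun z => kap (z.2 * b z.1))).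
Proof.
move=> ib; have mb : measurable_fun setT b by case/integrableP : ib => /measurable_EFinP.
apply: (@le_integrable_real _ _ _ _ _ (fun z : T1 * R => kap (z.2 * b z.1)) (fun z => 2 * (`|b z.1| * `|z.2|))) => //.
- exact: measurable_kap_prod.
- by move=> z _; rewrite ger0_norm// (le_trans (kap_le _))// normrM [`|z.2| * _]mulrC.
by have iP := integrable_prodM (integrable_norm ib) G1; exact: integrable_realZl.
Qed.

Lemma kapint_ge0 b : 0 <= kapint b.
Proof. by apply: Rintegral_ge0. Qed.

(** Lipschitz dependence on b in L^1: convergence of ball averages in L^1 suffices, without any
    pointwise convergence. *)
Lemma kapint_dist (b b' : T1 -> R) : m1.-integrable setT (EFin \o b) ->
  m1.-integrable setT (EFin \o b') ->
  `|kapint b - kapint b'| <= 2 * (\int[m1]_x `|b x - b' x|) * \int[G]_m `|m|.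
Proof.
move=> ib ib'; have iB := integrable_norm (integrable_realB measurableT ib ib').
rewrite /kapint -RintegralB//; [|exact: integrable_kapint|exact: integrable_kapint].
have iK := integrable_realB measurableT (integrable_kapint ib) (integrable_kapint ib').
apply: (le_trans (le_normr_Rintegral _ iK)) => //.
rewrite -mulrA -(Rintegral_prodM iB G1) -RintegralZl//; last exact: integrable_prodM.
apply: le_Rintegral => //; first exact: (integrable_norm iK).
  by apply: integrable_realZl => //; exact: integrable_prodM.
by move=> z _; rewrite (le_trans (k_lip _ _))// -mulrBr normrM [`|z.2| * _]mulrC.
Qed.

Lemma kapint_le1 (b : T1 -> R) : m1.-integrable setT (EFin \o b) ->
  kapint b <= 2 * (\int[m1]_x `|b x|) * \int[G]_m `|m|.
Proof.
move=> ib; rewrite /kapint -mulrA -(Rintegral_prodM (integrable_norm ib) G1).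
have iP := integrable_prodM (integrable_norm ib) G1.
rewrite -RintegralZl//; apply: le_Rintegral => //.
- exact: integrable_kapint.
- exact: integrable_realZl.
by move=> z _; rewrite (le_trans (kap_le _))// normrM [`|z.2| * _]mulrC.
Qed.

Lemma kapint_lep (b : T1 -> R) : m1.-integrable setT (EFin \o b) ->
  m1.-integrable setT (EFin \o (fun x => `|b x| `^ p)) ->
  kapint b <= C * (\int[m1]_x `|b x| `^ p) * \int[G]_m `|m| `^ p.
Proof.
move=> ib ibp; rewrite /kapint -mulrA -(Rintegral_prodM ibp Gp).
have iP := integrable_prodM ibp Gp.
rewrite -RintegralZl//; apply: le_Rintegral => //.
- exact: integrable_kapint.
- exact: integrable_realZl.
by move=> z _; rewrite (le_trans (k_pow _))// normrM powRM// [`|z.2| `^ _ * _]mulrC.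
Qed.

End kappa_functional.

Lemma measurable_set_ltr (R : realType) (a : R) : measurable [set v : R | v < a].
Proof.
by rewrite (_ : [set v | _] = `]-oo, a[%classic)//; apply/seteqP; split => x /=; rewrite in_itv.
Qed.

Lemma measurable_set_gtr (R : realType) (a : R) : measurable [set v : R | a < v].
Proof.
rewrite (_ : [set v | _] = `]a, +oo[%classic)//.
by apply/seteqP; split => x /=; rewrite in_itv/= andbT.
Qed.

(** * The scaling limit of the radial integral *)

Section scaling_limit.
Context {R : realType} (d : nat).
Variables (beta Cb p C : R) (f kap : R -> R) (G : probability R R) (phi : Rd R d -> R).
Local Notation leb := (lebesgue_tuple (R := R) d).
Local Notation leb1 := (@lebesgue_measure R).
Local Notation cd := (unit_ball_volume (R := R) d).
Hypotheses (d0 : (0 < d)%N) (p1 : 1 <= p) (dbeta : d%:R < beta) (betap : beta < p * d%:R).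
Hypotheses (k_ge0 : forall y, 0 <= kap y) (k0 : kap 0 = 0)
  (k_lip : forall a b, `|kap a - kap b| <= 2 * `|a - b|)
  (k_pow : forall y, kap y <= C * `|y| `^ p)
  (mk : measurable_fun setT kap)
  (G1 : G.-integrable setT (EFin \o (fun m : R => `|m|)))
  (Gp : G.-integrable setT (EFin \o (fun m : R => `|m| `^ p))).
Hypotheses (iphi : leb.-integrable setT (EFin \o phi))
  (iphip : leb.-integrable setT (EFin \o (fun x => `|phi x| `^ p))).
Hypotheses (mf : measurable_fun setT f) (f0 : forall r, 0 <= f r)
  (f_vol : (\int[leb1]_(r in posr) (r ^+ d * f r)%:E < +oo)%E)
  (f_tail : f r / r `^ (- 1 - beta) @[r --> +oo] --> Cb).

(** The mass of B(x, su) is divided by s^d and not by the volume of the ball, so the limit keeps the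
    factor c_d u^d. *)
Definition ball_avg (s u : R) (x : Rd R d) : R := ball_int phi x (s * u) / s ^+ d.
Definition ball_avg0 (u : R) (x : Rd R d) : R := cd * u ^+ d * phi x.

Local Notation Q s u := (kapint leb G kap (ball_avg s u)).
Local Notation Q0 u := (kapint leb G kap (ball_avg0 u)).
Local Notation wt := (fun u : R => u `^ (- 1 - beta)).

Let cd0 : 0 <= cd. Proof. exact: unit_ball_volume_ge0. Qed.
Let mphi : measurable_fun setT phi. Proof. by case/integrableP : iphi => /measurable_EFinP. Qed.
Let C0 : 0 <= C. Proof. by have := k_pow 1; rewrite normr1 powR1 mulr1; exact: le_trans. Qed.

Lemma measurable_ball_avg s u : measurable_fun setT (ball_avg s u).
Proof.
apply: measurable_funM => //.
exact: (measurableT_comp (measurable_ball_int mphi) (measurable_pair2 (s * u))).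
Qed.

(** The powers of s cancel, and the bound is uniform in s. *)
Lemma ball_avg_Lq q s u : 1 <= q -> leb.-integrable setT (EFin \o (fun x => `|phi x| `^ q)) ->
  0 < s -> 0 < u ->
  (\int[leb]_x (`|ball_avg s u x| `^ q)%:E <=
   ((cd * u ^+ d) `^ q * \int[leb]_x (`|phi x| `^ q))%:E)%E.
Proof.
move=> q1 iq s0 u0; have sd : 0 < s ^+ d by rewrite exprn_gt0.
have H := ball_int_Lp iphi iq q1 (mulr_gt0 s0 u0).
have mq := measurable_norm_powR q (measurable_ball_avg s u).
rewrite -(@lee_pmul2l _ ((s ^+ d) `^ q)%:E) ?lte_fin ?powR_gt0//.
rewrite -ge0_integralZl_EFin ?powR_ge0//; last exact/measurable_EFinP.
rewrite (eq_integral (fun x => (`|ball_int phi x (s * u)| `^ q)%:E)); last first.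
  move=> x _; rewrite -EFinM -powRM ?(ltW sd)//; congr (_ `^ _)%:E.
  by rewrite /ball_avg normrM normfV (gtr0_norm sd) mulrC divfK// gt_eqF.
apply: (le_trans H); rewrite EFin_Rintegral// -!EFinM lee_fin mulrA -powRM ?(ltW sd)//; last first.
  by rewrite mulr_ge0// exprn_ge0// ltW.
by rewrite (_ : cd * (s * u) ^+ d = s ^+ d * (cd * u ^+ d))// exprMn; ring.
Qed.

Lemma integrable_ball_avg_powR q s u : 1 <= q ->
  leb.-integrable setT (EFin \o (fun x => `|phi x| `^ q)) ->
  0 < s -> 0 < u -> leb.-integrable setT (EFin \o (fun x => `|ball_avg s u x| `^ q)).
Proof.
move=> q1 iq s0 u0; apply/integrableP; split.
  by apply/measurable_EFinP; apply: measurable_norm_powR; exact: measurable_ball_avg.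
under eq_integral do rewrite /= ger0_norm ?powR_ge0//.
by apply: (le_lt_trans (ball_avg_Lq q1 iq s0 u0)); rewrite ltry.
Qed.

Let iphi1 : leb.-integrable setT (EFin \o (fun x => `|phi x| `^ 1)).
Proof.
rewrite (_ : (fun x => _) = (fun x => `|phi x|)); first exact: (integrable_norm iphi).
by apply/funext => x; rewrite powRr1.
Qed.

Lemma integrable_ball_avg s u : 0 < s -> 0 < u -> leb.-integrable setT (EFin \o ball_avg s u).
Proof.
move=> s0 u0; apply: (@le_integrable_real _ _ _ _ _ _ (fun x => `|ball_avg s u x| `^ 1)) => //.
- exact: measurable_ball_avg.
- by move=> x _; rewrite powRr1.
exact: integrable_ball_avg_powR.
Qed.

Lemma integrable_ball_avg0 u : leb.-integrable setT (EFin \o ball_avg0 u).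
Proof. by apply: integrable_realZl. Qed.

Let M1 := \int[G]_m `|m|.
Let Mp := \int[G]_m `|m| `^ p.
Let I1 := \int[leb]_x `|phi x|.
Let Ip := \int[leb]_x `|phi x| `^ p.
Let M1_ge0 : 0 <= M1. Proof. by apply: Rintegral_ge0. Qed.
Let Mp_ge0 : 0 <= Mp. Proof. by apply: Rintegral_ge0 => m _; exact: powR_ge0. Qed.
Let I1_ge0 : 0 <= I1. Proof. by apply: Rintegral_ge0. Qed.
Let Ip_ge0 : 0 <= Ip. Proof. by apply: Rintegral_ge0 => x _; exact: powR_ge0. Qed.
(** The first entry comes from kap(y) <= 2 |y| and the first moments, the second from kap(y) <= C
    |y|^p and the p-th moments. *)
Definition kapint_const : R := Num.max (2 * (cd * I1) * M1) (C * (cd `^ p * Ip) * Mp).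
Local Notation K := kapint_const.

Lemma kapint_const_ge0 : 0 <= K.
Proof. by rewrite le_max; apply/orP; left; rewrite !mulr_ge0. Qed.

Lemma kapint_min_bound (b : Rd R d -> R) u : 0 < u ->
  leb.-integrable setT (EFin \o b) ->
  leb.-integrable setT (EFin \o (fun x => `|b x| `^ p)) ->
  \int[leb]_x `|b x| <= cd * u ^+ d * I1 ->
  \int[leb]_x `|b x| `^ p <= (cd * u ^+ d) `^ p * Ip ->
  kapint leb G kap b <= K * Num.min (u `^ d%:R) (u `^ (p * d%:R)).
Proof.
move=> u0 ib ibp H1 Hp; rewrite minr_pMr ?kapint_const_ge0// le_min; apply/andP; split.
  rewrite (le_trans (kapint_le1 k_ge0 k0 k_lip mk G1 ib))//.
  rewrite (@le_trans _ _ (2 * (cd * I1) * M1 * u `^ d%:R))//; last first.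
    by rewrite ler_wpM2r ?powR_ge0// le_max lexx.
  rewrite powR_mulrn ?(ltW u0)// (_ : _ * u ^+ d = 2 * (cd * u ^+ d * I1) * M1); last by ring.
  by rewrite ler_wpM2r// ler_wpM2l.
rewrite (le_trans (kapint_lep k_ge0 k0 k_lip k_pow mk G1 Gp ib ibp))//.
rewrite (@le_trans _ _ (C * (cd `^ p * Ip) * Mp * u `^ (p * d%:R)))//; last first.
  by rewrite ler_wpM2r ?powR_ge0// le_max lexx orbT.
have -> : u `^ (p * d%:R) = (u ^+ d) `^ p by rewrite mulrC powRrM powR_mulrn ?ltW.
move: Hp; rewrite powRM// ?exprn_ge0 ?(ltW u0)// => Hp.
rewrite (_ : _ * _ `^ p = C * (cd `^ p * (u ^+ d) `^ p * Ip) * Mp); last by ring.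
by rewrite ler_wpM2r// ler_wpM2l.
Qed.

Lemma kapint_avg_bound s u : 0 < s -> 0 < u ->
  Q s u <= K * Num.min (u `^ d%:R) (u `^ (p * d%:R)).
Proof.
move=> s0 u0; have i1 := integrable_ball_avg s0 u0.
have ip := integrable_ball_avg_powR p1 iphip s0 u0.
apply: kapint_min_bound => //.
- rewrite -lee_fin -EFin_Rintegral//; last exact: (integrable_norm i1).
  have := ball_avg_Lq (lexx 1) iphi1 s0 u0.
  rewrite powRr1; last by rewrite mulr_ge0// exprn_ge0// ltW.
  rewrite (_ : \int[leb]_x `|phi x| `^ 1 = I1); last by apply: eq_Rintegral => x _; rewrite powRr1.
  by move/(le_trans _); apply; under [leRHS]eq_integral do rewrite powRr1//.
- by rewrite -lee_fin -EFin_Rintegral//; exact: ball_avg_Lq.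
Qed.

Variables (s L : nat -> R).
Hypotheses (s_gt0 : forall n, 0 < s n) (s_cvg0 : s n @[n --> \oo] --> 0)
  (L_gt0 : forall n, 0 < L n) (L_cvgy : L n @[n --> \oo] --> +oo).

Lemma kapint_avg_cvg u : 0 < u -> Q (s n) u @[n --> \oo] --> Q0 u.
Proof.
move=> u0; apply/cvgrPdist_le => e e0.
have [_ Hosc] := vanishing_osc_integrable iphi.
(* The oscillation is given the tolerance e / (2 u^d (M1 + 1)): 2 M1 is the Lipschitz constant of
   the functional, and u^d is left of (s u)^d after division by s^d. *)
have c0 : 0 < 2 * u ^+ d * (M1 + 1) by rewrite !mulr_gt0 ?exprn_gt0// ltr_pwDr.
have [t t0 Ht] := Hosc _ (divr_gt0 e0 c0).
move/cvgrPdist_lt : s_cvg0 => /(_ _ (divr_gt0 t0 u0)); apply: filterS => n.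
rewrite sub0r normrN (gtr0_norm (s_gt0 n)) ltr_pdivlMr// => st.
have su0 : 0 < s n * u by rewrite mulr_gt0.
have ib := integrable_ball_avg (s_gt0 n) u0; have ib0 := integrable_ball_avg0 u.
rewrite distrC (le_trans (kapint_dist k_ge0 k0 k_lip mk G1 ib ib0))//.
have sd : 0 < s n ^+ d by rewrite exprn_gt0.
have iD := integrable_norm (integrable_realB measurableT ib ib0).
have H : \int[leb]_x `|ball_avg (s n) u x - ball_avg0 u x| <= e / (2 * u ^+ d * (M1 + 1)) * u ^+ d.
  rewrite -(ler_pM2l sd) -lee_fin.
  have := le_trans (ball_int_dist iphi su0) (Ht _ _); rewrite su0 st => /(_ isT).
  rewrite (_ : s n ^+ d * (_ * u ^+ d) = e / (2 * u ^+ d * (M1 + 1)) * (s n * u) ^+ d); last first.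
    by rewrite exprMn; ring.
  apply: le_trans; rewrite EFinM -EFin_Rintegral// -ge0_integralZl_EFin ?(ltW sd)//; last first.
    by case/integrableP : iD.
  rewrite le_eqVlt; apply/orP; left; apply/eqP; apply: eq_integral => x _.
  rewrite -EFinM -[in X in X * _](ger0_norm (ltW sd)) -normrM; congr (`|_|)%:E.
  by rewrite /ball_avg /ball_avg0 exprMn; field; rewrite gt_eqF.
rewrite (@le_trans _ _ (2 * (e / (2 * u ^+ d * (M1 + 1)) * u ^+ d) * (M1 + 1)))//.
  rewrite ler_pM ?mulr_ge0//; first by apply: Rintegral_ge0.
    by rewrite ler_wpM2l.
  by rewrite lerDl.
rewrite le_eqVlt; apply/orP; left; apply/eqP; field.
by rewrite !gt_eqF ?exprn_gt0// ltr_pwDr.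
Qed.

Let d0R : 0 < d%:R :> R. Proof. by rewrite ltr0n. Qed.
Let beta0 : 0 < beta. Proof. exact: lt_trans dbeta. Qed.

Definition tail_weight (l u : R) : R := l `^ (1 + beta) * f (l * u).
Local Notation w n u := (tail_weight (L n) u).

Lemma tail_weight_ge0 l u : 0 <= tail_weight l u.
Proof. by rewrite mulr_ge0 ?powR_ge0. Qed.

Lemma weighted_kapint_ge0 l r u : 0 <= tail_weight l u * Q r u.
Proof. by apply: mulr_ge0; [exact: tail_weight_ge0|exact: kapint_ge0]. Qed.

Lemma indic_weighted_ge0 (A : set R) x l q u : 0 <= q -> 0 <= \1_A x * (tail_weight l u * q) :> R.
Proof. by move=> q0; apply: mulr_ge0 => //; apply: mulr_ge0 => //; exact: tail_weight_ge0. Qed.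

Lemma measurable_tail_weight l : measurable_fun setT (tail_weight l).
Proof.
apply: measurable_funM => //.
by apply: (measurableT_comp mf); exact: measurable_funM.
Qed.

Lemma tail_weight_cvg u : 0 < u -> w n u @[n --> \oo] --> Cb * wt u.
Proof.
move=> u0; have Lu : L n * u @[n --> \oo] --> +oo.
  apply/cvgryPge => A; move/cvgryPge : L_cvgy => /(_ (A / u)); apply: filterS => n.
  by rewrite ler_pdivrMr.
have H : f (L n * u) / (L n * u) `^ (- 1 - beta) @[n --> \oo] --> Cb.
  exact: (cvg_comp _ _ Lu f_tail).
rewrite (_ : (fun n => w n u) = (fun n => f (L n * u) / (L n * u) `^ (- 1 - beta) * wt u)).
  by apply: cvgMl.
apply/funext => n; have Lu0 : 0 < L n * u by rewrite mulr_gt0.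
rewrite /tail_weight powRM ?(ltW u0) ?(ltW (L_gt0 n))// invfM -!mulrA mulVf ?gt_eqF ?powR_gt0// mulr1.
by rewrite -powRN mulrC; congr (_ * _ `^ _); ring.
Qed.

Lemma measurable_indic_scale (A : set R) l : measurable A ->
  measurable_fun setT (fun u : measurableTypeR R => \1_A (l * u) : R).
Proof.
move=> mA; apply: (@measurableT_comp _ _ _ _ _ _ (fun v : R => \1_A v : R) _ (fun u : measurableTypeR R => l * u)).
  exact: measurable_indic.
exact: measurable_funM.
Qed.

Lemma measurable_kapint_avg l : 0 < l -> measurable_fun setT (fun u : measurableTypeR R => Q l u).
Proof.
move=> l0; apply: (@measurable_kapint _ _ _ leb G kap mk _ (measurableTypeR R) (ball_avg l)).
apply: measurable_funM => //.
apply: (@measurableT_comp _ _ _ _ _ _ (fun z : Rd R d * measurableTypeR R => ball_int phi z.1 z.2) _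
  (fun q : measurableTypeR R * Rd R d => (q.2, l * q.1))).
  exact: measurable_ball_int.
by apply: measurable_fun_pair => //; exact: measurable_funM.
Qed.

(** The substitution v = l u. With q = d it reduces integrability to the finite volume condition on
    f; with q = pd > beta it yields the negative power of l that suppresses small radii. *)
Lemma integral_tail_weight_pow l q : 0 < l -> 0 <= q -> forall A : set R, measurable A ->
  (\int[leb1]_(u in posr) (\1_A (l * u) * (tail_weight l u * u `^ q))%:E =
  (l `^ (beta - q))%:E * \int[leb1]_(v in posr) (\1_A v * (f v * v `^ q))%:E)%E.
Proof.
move=> l0 q0 A mA.
rewrite [in RHS](@ge0_integral_posr_scale _ l (fun v => \1_A v * (f v * v `^ q)))//; last 2 first.
- apply: measurable_funM; first exact: measurable_indic.
  by apply: measurable_funM => //; exact: measurable_powR.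
- by move=> x; rewrite !mulr_ge0 ?powR_ge0.
rewrite muleA -EFinM -ge0_integralZl_EFin ?mulr_ge0 ?powR_ge0 ?(ltW l0)//; last 3 first.
- exact: measurable_posrT.
- by move=> u _; rewrite lee_fin !mulr_ge0 ?powR_ge0.
- apply/measurable_EFinP; apply: measurable_funTS.
  apply: (@measurableT_comp _ _ _ _ _ _ (fun v => \1_A v * (f v * v `^ q)) _ (fun u => l * u)); last exact: measurable_funM.
  apply: measurable_funM; first exact: measurable_indic.
  by apply: measurable_funM => //; exact: measurable_powR.
apply: eq_integral => u /set_mem; rewrite posrE => u0.
rewrite -EFinM; congr EFin; rewrite /tail_weight powRM ?(ltW l0) ?(ltW u0)//.
rewrite (_ : l `^ (1 + beta) = l `^ (beta - q) * l * l `^ q); first by ring.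
by rewrite -[X in _ * X * _](powRr1 (ltW l0)) !powRDr//; congr (_ `^ _); ring.
Qed.

Lemma integrable_tail_weight_kapint l r : 0 < l -> 0 < r ->
  leb1.-integrable posr (EFin \o (fun u => tail_weight l u * Q r u)).
Proof.
move=> l0 r0.
have mwQ : measurable_fun posr (fun u : measurableTypeR R => tail_weight l u * Q r u).
  by apply: measurable_funTS; apply: measurable_funM; [exact: measurable_tail_weight|exact: measurable_kapint_avg].
apply/integrableP; split; first exact/measurable_EFinP.
have I : (\int[leb1]_(u in posr) (K * (\1_setT (l * u) * (tail_weight l u * u `^ d%:R)))%:E < +oo)%E.
  under eq_integral do rewrite EFinM.
  rewrite ge0_integralZl_EFin ?kapint_const_ge0//; last 3 first.
  - exact: measurable_posrT.
  - by move=> u _; rewrite lee_fin; apply: indic_weighted_ge0; exact: powR_ge0.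
  - apply/measurable_EFinP; apply: measurable_funTS.
    under eq_fun do rewrite indicT mul1r.
    by apply: measurable_funM; [exact: measurable_tail_weight|exact: measurable_powR].
  rewrite integral_tail_weight_pow// ?ler0n//.
  rewrite (_ : (\int[leb1]_(v in posr) _)%E = (\int[leb1]_(r in posr) (r ^+ d * f r)%:E)%E).
    rewrite lte_mul_pinfty ?mule_ge0 ?lee_fin ?powR_ge0 ?kapint_const_ge0//.
    rewrite lte_mul_pinfty ?lee_fin ?powR_ge0//.
  apply: eq_integral => v /set_mem; rewrite posrE => v0.
  by rewrite indicT mul1r powR_mulrn ?(ltW v0)// mulrC.
apply: le_lt_trans I; apply: ge0_le_integral => //.
- exact: measurable_posrT.
- by apply/measurable_EFinP; exact: (measurableT_comp (@normr_measurable R setT)).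
- apply/measurable_EFinP; apply: measurable_funTS; apply: measurable_funM => //.
  under eq_fun do rewrite indicT mul1r.
  by apply: measurable_funM; [exact: measurable_tail_weight|exact: measurable_powR].
move=> u; rewrite posrE => u0; rewrite /= lee_fin indicT mul1r ger0_norm; last first.
  by rewrite mulr_ge0 ?tail_weight_ge0// kapint_ge0.
rewrite mulrCA ler_wpM2l ?tail_weight_ge0// (le_trans (kapint_avg_bound r0 u0))//.
by rewrite ler_wpM2l ?kapint_const_ge0// ge_min lexx.
Qed.

(** Below R0 only the d-th moment of f is under control. There v^(pd) <= R0^(pd-d) v^d, which leaves
    a constant times L^(beta-pd). *)
Lemma near_part_cvg0 R0 : 0 < R0 ->
  \int[leb1]_(u in posr) (\1_[set v : R | v < R0] (L n * u) * (w n u * Q (s n) u)) @[n --> \oo] --> 0.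
Proof.
move=> R00; have mA := measurable_set_ltr R0.
pose V := (\int[leb1]_(r in posr) (r ^+ d * f r)%:E)%E.
have Vlt : (V < +oo)%E by exact: f_vol.
have V0 : (0 <= V)%E.
  by apply: integral_ge0 => r; rewrite posrE => r0; rewrite lee_fin mulr_ge0 ?exprn_ge0// ltW.
have Vfin : V \is a fin_num by rewrite ge0_fin_numE.
pose B := K * (R0 `^ (p * d%:R - d%:R) * fine V).
apply: (@squeeze_cvgr _ _ _ _ (cst 0) (fun n => B * (L n) `^ (beta - p * d%:R))).
- apply: nearW => n; apply/andP; split.
    by apply: Rintegral_ge0 => u _; apply: indic_weighted_ge0; exact: kapint_ge0.
  set h := fun u => \1_[set v : R | v < R0] (L n * u) * (w n u * Q (s n) u).
  have mh : measurable_fun posr h.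
    apply: measurable_funTS; apply: measurable_funM.
      exact: measurable_indic_scale.
    by apply: measurable_funM; [exact: measurable_tail_weight|exact: measurable_kapint_avg].
  have h0 u : 0 <= h u by apply: indic_weighted_ge0; exact: kapint_ge0.
  have ih : leb1.-integrable posr (EFin \o h).
    apply: (@le_integrable_real _ _ _ _ _ _ _ _ _ _ (integrable_tail_weight_kapint (L_gt0 n) (s_gt0 n))) => //.
      exact: measurable_posrT.
    by move=> u _; rewrite ger0_norm// /h ler_piMl ?weighted_kapint_ge0//.
  rewrite -lee_fin -EFin_Rintegral//; last exact: measurable_posrT.
  have H1 : (\int[leb1]_(u in posr) (h u)%:E <=
    K%:E * \int[leb1]_(u in posr) (\1_[set v : R | v < R0] (L n * u) * (w n u * u `^ (p * d%:R)))%:E)%E.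
    rewrite -ge0_integralZl_EFin ?kapint_const_ge0//; last 3 first.
    - exact: measurable_posrT.
    - by move=> u _; rewrite lee_fin; apply: indic_weighted_ge0; exact: powR_ge0.
    - apply/measurable_EFinP; apply: measurable_funTS; apply: measurable_funM.
        exact: measurable_indic_scale.
      by apply: measurable_funM; [exact: measurable_tail_weight|exact: measurable_powR].
    apply: ge0_le_integral => //.
    - exact: measurable_posrT.
    - by move=> u _; rewrite lee_fin.
    - exact/measurable_EFinP.
    - apply/measurable_EFinP; apply: measurable_funTS; apply: measurable_funM => //; apply: measurable_funM.
        exact: measurable_indic_scale.
      by apply: measurable_funM; [exact: measurable_tail_weight|exact: measurable_powR].
    move=> u; rewrite posrE => u0; rewrite -EFinM lee_fin /h [X in _ <= X]mulrCA ler_wpM2l// [X in _ <= X]mulrCA ler_wpM2l ?tail_weight_ge0//.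
    by rewrite (le_trans (kapint_avg_bound (s_gt0 n) u0))// ler_wpM2l ?kapint_const_ge0// ge_min lexx orbT.
  apply: (le_trans H1); rewrite integral_tail_weight_pow//; last by rewrite mulr_ge0// ?(le_trans ler01 p1)// ler0n.
  have H2 : (\int[leb1]_(v in posr) (\1_[set v : R | (v < R0)%R] v * (f v * v `^ (p * d%:R)))%:E <=
    (R0 `^ (p * d%:R - d%:R))%:E * V)%E.
    rewrite /V -ge0_integralZl_EFin ?powR_ge0//; last 3 first.
    - exact: measurable_posrT.
    - by move=> r; rewrite posrE => r0; rewrite lee_fin mulr_ge0 ?exprn_ge0// ltW.
    - by apply/measurable_EFinP; apply: measurable_funTS; apply: measurable_funM => //; exact: measurable_funX.
    apply: ge0_le_integral => //.
    - exact: measurable_posrT.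
    - by move=> r _; rewrite lee_fin !mulr_ge0 ?powR_ge0.
    - apply/measurable_EFinP; apply: measurable_funTS; apply: measurable_funM; first exact: measurable_indic.
      by apply: measurable_funM => //; exact: measurable_powR.
    - apply: measurable_funeM; apply/measurable_EFinP; apply: measurable_funTS; apply: measurable_funM => //; exact: measurable_funX.
    move=> v; rewrite posrE => v0; rewrite -EFinM lee_fin indicE.
    have [/set_mem/= vR|_] := boolP (v \in _); last first.
      by rewrite mul0r !mulr_ge0 ?powR_ge0 ?exprn_ge0// ltW.
    rewrite mul1r [v ^+ d * _]mulrC mulrCA ler_wpM2l// -(powR_mulrn d (ltW v0)).
    rewrite -{1}(subrK d%:R (p * d%:R)) -powRDr// ler_wpM2r ?powR_ge0// ge0_ler_powR ?nnegrE ?(ltW v0) ?(ltW R00)//.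
      by rewrite subr_ge0 ltW// (lt_trans dbeta).
    exact: ltW.
  rewrite (le_trans (lee_wpmul2l _ (lee_wpmul2l _ H2))) ?lee_fin ?powR_ge0 ?kapint_const_ge0//.
  rewrite -(fineK Vfin) -!EFinM lee_fin /B le_eqVlt; apply/orP; left; apply/eqP; ring.
- exact: cvg_cst.
rewrite -[X in _ --> X](mulr0 B); apply: cvgMr.
have e0 : 0 < p * d%:R - beta by rewrite subr_gt0.
have Linv : (L n)^-1 @[n --> \oo] --> 0 by apply/gtr0_cvgV0 => //; exact: nearW.
have := powR_cvg0 e0; move/cvg_at_rightP => /(_ (fun n => (L n)^-1)).
have E n : (L n)^-1 `^ (p * d%:R - beta) = L n `^ (beta - p * d%:R).
  by rewrite -powR_inv1 ?(ltW (L_gt0 n))// -powRrM mulN1r opprB.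
rewrite (_ : (fun n => (L n)^-1 `^ _) = fun n => L n `^ (beta - p * d%:R)); last exact/funext.
by apply; split=> // n; rewrite invr_gt0.
Qed.

(** Beyond R0 the tail bound gives w(u) <= (Cb + 1) u^(-1-beta); together with the bound on Q the
    dominating function is integrable because d < beta < pd. For each u the condition R0 <= L u
    holds eventually. *)
Lemma far_part_cvg R0 : 0 < R0 ->
  (forall v, R0 <= v -> f v <= (Cb + 1) * v `^ (- 1 - beta)) ->
  \int[leb1]_(u in posr) (\1_[set v : R | R0 <= v] (L n * u) * (w n u * Q (s n) u)) @[n --> \oo] -->
  \int[leb1]_(u in posr) (Cb * wt u * Q0 u).
Proof.
move=> R00 HR0; have mA := measurable_set_ler R0 (@measurable_id _ _ setT).
have Cb1 : 0 <= Cb + 1.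
  by have := le_trans (f0 R0) (HR0 _ (lexx _)); rewrite pmulr_lge0// powR_gt0.
apply: (@Rintegral_dct _ _ _ leb1 posr _ _ (fun u => (Cb + 1) * K * (wt u * Num.min (u `^ d%:R) (u `^ (p * d%:R))))).
- exact: measurable_posrT.
- move=> n; apply: measurable_funTS; apply: measurable_funM.
    exact: measurable_indic_scale.
  by apply: measurable_funM; [exact: measurable_tail_weight|exact: measurable_kapint_avg].
- move=> u; rewrite posrE => u0.
  have H : w n u * Q (s n) u @[n --> \oo] --> Cb * wt u * Q0 u.
    by apply: cvgM; [exact: tail_weight_cvg|exact: kapint_avg_cvg].
  apply: cvg_trans H; apply: near_eq_cvg.
  move/cvgryPge : L_cvgy => /(_ (R0 / u)); apply: filterS => n; rewrite ler_pdivrMr// => h.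
  by rewrite indicE mem_set ?mul1r.
- apply: integrable_realZl; first exact: measurable_posrT.
  exact: integrable_powR_min.
move=> n u; rewrite posrE => u0.
rewrite ger0_norm; last by apply: indic_weighted_ge0; exact: kapint_ge0.
rewrite indicE.
have [/set_mem/= h|_] := boolP (_ \in _); last first.
  by rewrite mul0r !mulr_ge0 ?kapint_const_ge0// ?le_min ?powR_ge0.
rewrite mul1r (_ : (Cb + 1) * K * _ = ((Cb + 1) * wt u) * (K * Num.min (u `^ d%:R) (u `^ (p * d%:R)))); last by ring.
rewrite ler_pM ?tail_weight_ge0 ?kapint_ge0//; last exact: kapint_avg_bound.
rewrite /tail_weight (le_trans (ler_wpM2l (powR_ge0 _ _) (HR0 _ h)))// powRM ?(ltW u0) ?(ltW (L_gt0 n))//.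
rewrite mulrCA mulrA [X in X <= _](_ : _ = (Cb + 1) * (L n `^ (1 + beta) * L n `^ (- 1 - beta)) * wt u); last by ring.
by rewrite powRDr// (_ : 1 + beta + (- 1 - beta) = 0) ?powRr0 ?mulr1//; ring.
Qed.

(* The radii with L u < R0, where f is only integrable, contribute a vanishing
   part since Q(u) = O(u^(pd)) with pd > beta; on the others f has its power
   tail and dominated convergence applies. *)
Lemma scaling_limit :
  \int[leb1]_(u in posr) (w n u * Q (s n) u) @[n --> \oo] -->
  \int[leb1]_(u in posr) (Cb * wt u * Q0 u).
Proof.
have [R0 [R00 HR0]] : exists R0, 0 < R0 /\ forall v, R0 <= v -> f v <= (Cb + 1) * v `^ (- 1 - beta).
  move/cvgrPdist_le : f_tail => /(_ 1 ltr01) [A [_ HA]].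
  exists (Num.max 1 (A + 1)); split; first by rewrite lt_max ltr01.
  move=> v; rewrite ge_max => /andP[v1 Av].
  have v0 : 0 < v by exact: lt_le_trans v1.
  have := HA v; rewrite distrC ler_norml => /(_ (lt_le_trans (ltr_pwDr ltr01 (lexx A)) Av)) /andP[_].
  by rewrite lerBlDr ler_pdivrMr ?powR_gt0// addrC.
have ind n u : w n u * Q (s n) u = \1_[set v : R | v < R0] (L n * u) * (w n u * Q (s n) u) +
    \1_[set v : R | R0 <= v] (L n * u) * (w n u * Q (s n) u).
  have [h|h] := ltP (L n * u) R0.
    rewrite !indicE (mem_set (h : [set v : R | v < R0] _)) memNset ?mul1r ?mul0r ?addr0//=.
    by apply/negP; rewrite -ltNge.
  rewrite !indicE (mem_set (h : [set v : R | R0 <= v] _)) memNset ?mul1r ?mul0r ?add0r//=.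
  by apply/negP; rewrite -leNgt.
have mI (A : set R) n : measurable A -> leb1.-integrable posr
    (EFin \o (fun u => \1_A (L n * u) * (w n u * Q (s n) u))).
  move=> mA; apply: (@le_integrable_real _ _ _ _ _ _ _ _ _ _ (integrable_tail_weight_kapint (L_gt0 n) (s_gt0 n))).
  - exact: measurable_posrT.
  - apply: measurable_funTS; apply: measurable_funM.
      exact: measurable_indic_scale.
    by apply: measurable_funM; [exact: measurable_tail_weight|exact: measurable_kapint_avg].
  move=> u _; rewrite ger0_norm; last by apply: indic_weighted_ge0; exact: kapint_ge0.
  by rewrite ler_piMl ?weighted_kapint_ge0// indicE lern1 leq_b1.
have m1 := measurable_set_ltr R0.
have m2 := measurable_set_ler R0 (@measurable_id _ _ setT).
rewrite (_ : (fun n => _) = fun n =>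
    \int[leb1]_(u in posr) (\1_[set v : R | v < R0] (L n * u) * (w n u * Q (s n) u)) +
    \int[leb1]_(u in posr) (\1_[set v : R | R0 <= v] (L n * u) * (w n u * Q (s n) u))); last first.
  apply/funext => n; rewrite -RintegralD//; [|exact: measurable_posrT|exact: mI|exact: mI].
  by apply: eq_Rintegral => u _; exact: ind.
rewrite -[X in _ --> X]add0r; apply: cvgD; first exact: near_part_cvg0.
exact: far_part_cvg.
Qed.

End scaling_limit.

Section triple_product.
Context {R : realType} d1 d2 d3 (T1 : measurableType d1) (T2 : measurableType d2)
  (T3 : measurableType d3).
Variables (m1 : {sigma_finite_measure set T1 -> \bar R})
  (m2 : {sigma_finite_measure set T2 -> \bar R}) (m3 : {sigma_finite_measure set T3 -> \bar R}).
Local Open Scope ereal_scope.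

Lemma integral_triple_shuffle (F : T1 * T2 * T3 -> \bar R) :
  measurable_fun setT F -> (forall z, 0 <= F z) ->
  \int[(m1 \x m2) \x m3]_z F z = \int[m2]_y \int[m1 \x m3]_w F (w.1, y, w.2).
Proof.
move=> mF F0.
rewrite (@fubini_tonelli1 _ _ _ _ _ (prodm m1 m2) m3 F mF F0).
have mG := @measurable_fun_fubini_tonelli_F _ _ _ _ _ m3 F mF F0.
rewrite (@fubini_tonelli2 _ _ _ _ _ m1 m2 (fubini_F m3 F) mG); last first.
  by move=> x; apply: integral_ge0.
apply: eq_integral => y _; rewrite /fubini_G.
have my : measurable_fun setT (fun w : T1 * T3 => F (w.1, y, w.2)).
  apply: (measurableT_comp mF).
  by apply: measurable_fun_pair => //; apply: measurable_fun_pair.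
by rewrite (@fubini_tonelli1 _ _ _ _ _ m1 m3 _ my).
Qed.

End triple_product.

(** * The exponent as an integral over rescaled radii *)

Section ball_exponent.
Context {R : realType} (d : nat).
Variables (beta p C : R) (f kap : R -> R) (G : probability R R) (phi : Rd R d -> R).
Local Notation leb := (lebesgue_tuple (R := R) d).
Local Notation leb1 := (@lebesgue_measure R).
Hypotheses (p1 : 1 <= p) (beta0 : 0 < beta).
Hypotheses (k_ge0 : forall y, 0 <= kap y) (k0 : kap 0 = 0)
  (k_lip : forall a b, `|kap a - kap b| <= 2 * `|a - b|)
  (k_pow : forall y, kap y <= C * `|y| `^ p)
  (mk : measurable_fun setT kap)
  (G1 : G.-integrable setT (EFin \o (fun m : R => `|m|)))
  (Gp : G.-integrable setT (EFin \o (fun m : R => `|m| `^ p))).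
Hypotheses (iphi : leb.-integrable setT (EFin \o phi))
  (iphip : leb.-integrable setT (EFin \o (fun x => `|phi x| `^ p))).
Hypotheses (mf : measurable_fun setT f) (f0 : forall r, 0 <= f r)
  (fneg : forall r, r <= 0 -> f r = 0)
  (f_vol : (\int[leb1]_(r in posr) (r ^+ d * f r)%:E < +oo)%E).
Variables (l rho : R).
Hypotheses (l0 : 0 < l) (rho0 : 0 < rho).

Definition ball_density (z : weighted_ball R d) : R := l * (f (z.1.2 / rho) / rho).

Lemma ball_density_ge0 z : 0 <= ball_density z.
Proof. by rewrite /ball_density !mulr_ge0 ?invr_ge0// ltW. Qed.

Lemma measurable_ball_density : measurable_fun setT ball_density.
Proof.
apply: measurable_funM => //; apply: measurable_funM => //.
apply: (measurableT_comp mf); apply: measurable_funM => //.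
by apply: (@measurableT_comp _ _ _ _ _ _ snd _ fst).
Qed.

(** The intensity as a measure with a density over all real radii; f is taken to vanish at
    nonpositive ones. *)
Definition ball_measure : {measure set (weighted_ball R d) -> \bar R} :=
  @density_measure _ _ _ ((leb \x leb1) \x G)%E _ ball_density_ge0 measurable_ball_density.

Let L := l `^ beta^-1.
Let s := L * rho.
Let L0 : 0 < L. Proof. exact: powR_gt0. Qed.
Let s0 : 0 < s. Proof. exact: mulr_gt0. Qed.

(** The normalized integrand m mu(B(x,r)) / n2, since n2 = s^d. *)
Definition ball_functional (z : weighted_ball R d) : R :=
  z.2 * (ball_int phi z.1.1 z.1.2 / s ^+ d).

Let mphi : measurable_fun setT phi. Proof. by case/integrableP : iphi => /measurable_EFinP. Qed.

Lemma measurable_ball_functional : measurable_fun setT ball_functional.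
Proof.
apply: measurable_funM => //; apply: measurable_funM => //.
exact: (measurableT_comp (measurable_ball_int mphi)).
Qed.

Let q (r : measurableTypeR R) : R := kapint leb G kap (fun x => ball_int phi x r / s ^+ d).

Let mq : measurable_fun setT q.
Proof.
apply: (@measurable_kapint _ _ _ leb G kap mk _ (measurableTypeR R) (fun r x => ball_int phi x r / s ^+ d)).
apply: measurable_funM => //.
apply: (@measurableT_comp _ _ _ _ _ _ (fun z : Rd R d * measurableTypeR R => ball_int phi z.1 z.2) _
  (fun q : measurableTypeR R * Rd R d => (q.2, q.1))).
  exact: measurable_ball_int.
exact: measurable_fun_pair.
Qed.

(** An identity in [0, +oo], obtained by Tonelli without prior integrability on the left; the
    right-hand side then proves the left one finite. *)
Lemma ge0_integral_ball_measure :
  (\int[ball_measure]_z (kap (ball_functional z))%:E =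
   \int[leb1]_(u in posr) (tail_weight beta f L u * kapint leb G kap (ball_avg phi s u))%:E)%E.
Proof.
have mkh : measurable_fun setT (fun z => kap (ball_functional z)).
  by apply: measurableT_comp => //; exact: measurable_ball_functional.
rewrite ge0_integral_density_measure//; last 2 first.
- by move=> z; rewrite lee_fin.
- exact/measurable_EFinP.
rewrite integral_triple_shuffle; last 2 first.
- apply: emeasurable_funM; apply/measurable_EFinP => //.
  exact: measurable_ball_density.
- by move=> z; rewrite mule_ge0// lee_fin// ball_density_ge0.
pose D (r : R) := l * (f (r / rho) / rho).
have D0 r : 0 <= D r by rewrite /D !mulr_ge0 ?invr_ge0// ltW.
have mD : measurable_fun setT D.
  apply: measurable_funM => //; apply: measurable_funM => //.
  by apply: (measurableT_comp mf); exact: measurable_funM.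
transitivity (\int[leb1]_(r in posr) (D r * q r)%:E)%E.
  rewrite integral_posr_indic; apply: eq_integral => r _.
  have [r0|r0] := leP r 0.
    rewrite indicE memNset ?mul0r; last by rewrite posrE; apply/negP; rewrite -leNgt.
    rewrite integral0_eq// => w _; rewrite /ball_density/= fneg ?mul0r ?mulr0 ?mule0//.
    by rewrite pmulr_lle0// invr_gt0.
  rewrite indicE mem_set ?posrE// mul1r mulrC EFinM.
  have -> : (q r)%:E = (\int[(leb \x G)]_w (kap (ball_functional (w.1, r, w.2)))%:E)%E.
    have ib : leb.-integrable setT (EFin \o (fun x => ball_int phi x r / s ^+ d)).
      have := integrable_ball_avg iphi s0 (divr_gt0 r0 s0).
      by rewrite /ball_avg [s * (r / s)]mulrC divfK// gt_eqF.
    by rewrite /q /kapint -EFin_Rintegral//; exact: (integrable_kapint k_ge0 k0 k_lip mk G1 ib).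
  rewrite muleC -ge0_integralZl_EFin//; last 2 first.
  - by move=> w _; rewrite lee_fin.
  - apply/measurable_EFinP; apply: (measurableT_comp mkh).
    by apply: measurable_fun_pair => //; apply: measurable_fun_pair.
  by apply: eq_integral => w _; rewrite muleC.
rewrite (@ge0_integral_posr_scale _ s (fun r => D r * q r))//; last 2 first.
- exact: measurable_funM.
- by move=> x; apply: mulr_ge0 => //; exact: kapint_ge0.
rewrite -ge0_integralZl_EFin ?(ltW s0)//; last 3 first.
- exact: measurable_posrT.
- by move=> u _; rewrite lee_fin; apply: mulr_ge0 => //; exact: kapint_ge0.
- apply/measurable_EFinP; apply: measurable_funTS.
  apply: (@measurableT_comp _ _ _ _ _ _ (fun r : measurableTypeR R => D r * q r) _ (fun u : measurableTypeR R => s * u)).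
    exact: measurable_funM.
  exact: measurable_funM.
apply: eq_integral => u _; rewrite -EFinM mulrA; congr (_ * _)%:E.
rewrite /D /tail_weight /s [L * rho * u]mulrAC mulfK ?gt_eqF//.
(* L^beta = l by the choice of L: the factor l of the intensity and the factor L left of dr = s du
   after division by rho make up L^(1+beta). *)
have -> : L `^ (1 + beta) = L * l.
  rewrite -powRDr// powRr1 ?(ltW L0)//; congr (_ * _).
  by rewrite /L -powRrM mulVf ?gt_eqF// powRr1// ltW.
by field; rewrite gt_eqF.
Qed.

Lemma integrable_ball_measure : ball_measure.-integrable setT (EFin \o (kap \o ball_functional)).
Proof.
apply/integrableP; split.
  by apply/measurable_EFinP; apply: measurableT_comp => //; exact: measurable_ball_functional.
under eq_integral do rewrite /= ger0_norm//.
rewrite ge0_integral_ball_measure.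
have I := integrable_tail_weight_kapint beta p1 k_ge0 k0 k_lip k_pow mk G1 Gp iphi iphip mf f0 f_vol L0 s0.
by rewrite EFin_Rintegral ?ltry//; exact: measurable_posrT.
Qed.

Lemma Rintegral_ball_measure :
  \int[ball_measure]_z kap (ball_functional z) =
  \int[leb1]_(u in posr) (tail_weight beta f L u * kapint leb G kap (ball_avg phi s u)).
Proof. by rewrite /Rintegral ge0_integral_ball_measure. Qed.

End ball_exponent.

(** The signed power, multiplicative in x; it carries the skewness of stable laws. *)
Definition spow {R : realType} (g x : R) : R := Num.sg x * `|x| `^ g.

Section spow.
Context {R : realType}.
Implicit Type g : R.

Lemma spowM g (x y : R) : spow g (x * y) = spow g x * spow g y.
Proof. by rewrite /spow sgrM normrM powRM//; ring. Qed.

Lemma spow_pos g (x : R) : 0 < x -> spow g x = x `^ g.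
Proof. by move=> x0; rewrite /spow gtr0_sg// mul1r gtr0_norm. Qed.

Lemma spowN g (x : R) : spow g (- x) = - spow g x.
Proof. by rewrite /spow sgrN normrN mulNr. Qed.

Lemma spow0 g : spow g 0 = 0 :> R.
Proof. by rewrite /spow sgr0 mul0r. Qed.

Lemma normr_spow g (x : R) : `|spow g x| <= `|x| `^ g.
Proof.
rewrite /spow normrM [X in _ * X]ger0_norm ?powR_ge0// normr_sg.
by case: (x != 0); rewrite ?mul1r// mul0r powR_ge0.
Qed.

Lemma measurable_spow d (T : measurableType d) (f : T -> R) g :
  measurable_fun setT f -> measurable_fun setT (fun x => spow g (f x)).
Proof.
move=> mf; apply: measurable_funM; last exact: measurable_norm_powR.
rewrite (_ : (fun x => _) = (fun x => \1_[set y : R | 0 < y] (f x) - \1_[set y : R | y < 0] (f x))).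
  apply: measurable_funB.
    exact: (measurableT_comp (measurable_indic (measurable_set_gtr 0))).
  exact: (measurableT_comp (measurable_indic (measurable_set_ltr 0))).
apply/funext => x; rewrite !indicE; have [h|h|h] := ltgtP (f x) 0.
- by rewrite ltr0_sg// memNset ?mem_set ?sub0r//=; apply/negP; rewrite -leNgt ltW.
- by rewrite gtr0_sg// mem_set// memNset ?subr0//=; apply/negP; rewrite -leNgt ltW.
- by rewrite h sgr0 !memNset ?subrr//= ltxx.
Qed.

Lemma integrable_spow d (T : measurableType d) (mu : {measure set T -> \bar R}) (f : T -> R) g :
  measurable_fun setT f -> mu.-integrable setT (EFin \o (fun x => `|f x| `^ g)) ->
  mu.-integrable setT (EFin \o (fun x => spow g (f x))).
Proof.
move=> mf; apply: le_integrable_real => //; first exact: measurable_spow.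
by move=> x _; exact: normr_spow.
Qed.

End spow.

(** * Evaluation of the limiting radial integral *)

Section limit_functional.
Context {R : realType} (d : nat).
Variables (g p C : R) (kap : R -> R).
Local Notation leb := (lebesgue_tuple (R := R) d).
Local Notation leb1 := (@lebesgue_measure R).
Local Notation cd := (unit_ball_volume (R := R) d).
Hypotheses (d0 : (0 < d)%N) (g1 : 1 < g) (gp : g < p).
Hypotheses (k_ge0 : forall y, 0 <= kap y) (k0 : kap 0 = 0)
  (k_lip : forall a b, `|kap a - kap b| <= 2 * `|a - b|)
  (k_pow : forall y, kap y <= C * `|y| `^ p).

Local Notation wt := (fun v : R => v `^ (- 1 - g)).
Definition kap_up : R := \int[leb1]_(v in posr) (v `^ (- 1 - g) * kap v).
Definition kap_down : R := \int[leb1]_(v in posr) (v `^ (- 1 - g) * kap (- v)).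

Let d0R : 0 < d%:R :> R. Proof. by rewrite ltr0n. Qed.
Let C0 : 0 <= C. Proof. by have := k_pow 1; rewrite normr1 powR1 mulr1; exact: le_trans. Qed.

Lemma lipschitz2_continuous : continuous kap.
Proof.
move=> x; apply/cvgrPdist_le => e e0; near=> y.
rewrite (le_trans (k_lip _ _))// mulrC -ler_pdivlMr// ltW//.
by near: y; apply: cvgr_dist_lt => //; rewrite divr_gt0.
Unshelve. all: by end_near. Qed.

Lemma lipschitz2_measurable : measurable_fun setT kap.
Proof. by apply: continuous_measurable_fun; exact: lipschitz2_continuous. Qed.

Let integrable_kap_weight (e : R) : `|e| = 1 ->
  leb1.-integrable posr (EFin \o (fun v => v `^ (- 1 - g) * kap (e * v))).
Proof.
move=> e1; have I := @integrable_powR_min R 1 p g g1 gp.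
have I2 := integrable_realZl (Num.max 2 C) (measurable_posr : measurable (posr : set (measurableTypeR R))) I.
apply: (@le_integrable_real _ _ _ _ _ _ _ _ _ _ I2).
- exact: measurable_posr.
- apply: continuous_posr_measurable => v v0; apply: cvgM; first exact: continuous_powR.
  apply: (@continuous_comp _ _ _ (fun v => e * v) kap); last exact: lipschitz2_continuous.
  exact: mulrl_continuous.
move=> v; rewrite posrE => v0; rewrite ger0_norm ?mulr_ge0 ?powR_ge0//.
rewrite mulrCA ler_wpM2l ?powR_ge0// minr_pMr ?le_max ?ler0n//.
have nv : `|e * v| = v by rewrite normrM e1 mul1r gtr0_norm.
rewrite le_min; apply/andP; split.
  rewrite (le_trans (kap_le k_ge0 k0 k_lip _))// nv powRr1 ?(ltW v0)// ler_wpM2r ?(ltW v0)//.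
  by rewrite le_max lexx.
by rewrite (le_trans (k_pow _))// nv ler_wpM2r ?powR_ge0// le_max lexx orbT.
Qed.

Let integral_kap_up : (\int[leb1]_(v in posr) (v `^ (- 1 - g) * kap v)%:E = kap_up%:E)%E.
Proof.
rewrite /kap_up EFin_Rintegral//; first exact: measurable_posr.
have := @integrable_kap_weight 1 (normr1 _).
by under eq_fun do rewrite mul1r.
Qed.

Let integral_kap_down : (\int[leb1]_(v in posr) (v `^ (- 1 - g) * kap (- v))%:E = kap_down%:E)%E.
Proof.
rewrite /kap_down EFin_Rintegral//; first exact: measurable_posr.
have := @integrable_kap_weight (- 1) _.
rewrite normrN1 => /(_ erefl); by under eq_fun do rewrite mulN1r.
Qed.

(** For a > 0 this is a^g [kap_up] / d, and for a < 0 it is |a|^g [kap_down] / d. Written with the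
    even and the odd power it is a sum of multiplicative functions of a = m c_d phi(x), so centre
    and weight separate. *)
Definition kap_hat (a : R) : R :=
  (`|a| `^ g * (kap_up + kap_down) + spow g a * (kap_up - kap_down)) / (2 * d%:R).

(** The substitution v = |a| u^d, on the side of 0 prescribed by the sign of a. *)
Lemma integral_kap_power (a : R) :
  (\int[leb1]_(u in posr) (u `^ (- 1 - g * d%:R) * kap (a * u ^+ d))%:E = (kap_hat a)%:E)%E.
Proof.
rewrite /kap_hat; have [a0|a0|a0] := ltgtP 0 a; last rewrite -a0.
- rewrite ge0_integral_power_substitution//; last first.
    by move=> x _; exact: lipschitz2_continuous.
  by rewrite integral_kap_up spow_pos// gtr0_norm// -EFinM; congr EFin; field; rewrite gt_eqF.
- transitivity (\int[leb1]_(u in posr) (u `^ (- 1 - g * d%:R) * (kap \o -%R) (- a * u ^+ d))%:E)%E.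
    by apply: eq_integral => u _; rewrite /= mulNr opprK.
  rewrite (@ge0_integral_power_substitution _ (kap \o -%R)) ?oppr_gt0//; last 2 first.
  - by move=> x _; exact: k_ge0.
  - move=> x _; apply: continuous_comp; first exact: opp_continuous.
    exact: lipschitz2_continuous.
  have -> : spow g a = - (- a) `^ g by rewrite -spow_pos ?oppr_gt0// spowN opprK.
  rewrite integral_kap_down ltr0_norm// -EFinM; congr EFin.
  by field; rewrite gt_eqF.
rewrite normr0 spow0 powR0 ?mul0r ?addr0 ?mul0r; last by rewrite gt_eqF// (lt_trans ltr01).
by rewrite integral0_eq// => u _; rewrite mul0r k0 mulr0.
Qed.

Variables (G : probability R R) (phi : Rd R d -> R) (Cb : R).
Hypotheses (G1 : G.-integrable setT (EFin \o (fun m : R => `|m|)))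
  (Gp : G.-integrable setT (EFin \o (fun m : R => `|m| `^ p)))
  (Gg : G.-integrable setT (EFin \o (fun m : R => `|m| `^ g)))
  (iphi : leb.-integrable setT (EFin \o phi))
  (iphig : leb.-integrable setT (EFin \o (fun x => `|phi x| `^ g)))
  (iphip : leb.-integrable setT (EFin \o (fun x => `|phi x| `^ p))).
Hypothesis Cb0 : 0 <= Cb.

Let mphi : measurable_fun setT phi. Proof. by case/integrableP : iphi => /measurable_EFinP. Qed.
Let mk := lipschitz2_measurable.
Let cd0 : 0 <= cd. Proof. exact: unit_ball_volume_ge0. Qed.

Let kap_hatE (z : Rd R d * R) : kap_hat (z.2 * (cd * phi z.1)) =
  cd `^ g / (2 * d%:R) * ((kap_up + kap_down) * (`|phi z.1| `^ g * `|z.2| `^ g) +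
    (kap_up - kap_down) * (spow g (phi z.1) * spow g z.2)).
Proof.
rewrite /kap_hat mulrCA !spowM !normrM !powRM// (ger0_norm cd0).
have -> : spow g cd = cd `^ g.
  have [->|c0] := eqVneq cd 0; last by rewrite spow_pos// lt0r c0.
  by rewrite spow0 powR0// gt_eqF// (lt_trans ltr01).
by field; rewrite gt_eqF.
Qed.

Let mG : measurable_fun setT (fun m : R => m). Proof. exact: measurable_id. Qed.

(** Tonelli brings the integral in u inside, where it equals [kap_hat] at m c_d phi(x); the two
    products then factorize over centres and weights. *)
Lemma Rintegral_kapint_avg0 :
  \int[leb1]_(u in posr) (Cb * u `^ (- 1 - g * d%:R) * kapint leb G kap (ball_avg0 phi u)) =
  Cb * (cd `^ g / (2 * d%:R)) *
    ((kap_up + kap_down) * ((\int[leb]_x `|phi x| `^ g) * (\int[G]_m `|m| `^ g)) +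
     (kap_up - kap_down) * ((\int[leb]_x spow g (phi x)) * (\int[G]_m spow g m))).
Proof.
have iA := integrable_prodM iphig Gg.
have iS := integrable_prodM (integrable_spow mphi iphig) (integrable_spow mG Gg).
have iK : (leb \x G)%E.-integrable setT (EFin \o (fun z => kap_hat (z.2 * (cd * phi z.1)))).
  rewrite (funext kap_hatE).
  apply: integrable_realZl => //; apply: integrable_realD => //; exact: integrable_realZl.
transitivity (fine (Cb%:E * \int[(leb \x G)]_z (kap_hat (z.2 * (cd * phi z.1)))%:E)%E); last first.
  rewrite EFin_Rintegral// -EFinM/= -mulrA; congr (_ * _).
  under eq_Rintegral do rewrite kap_hatE.
  rewrite RintegralZl//; last by apply: integrable_realD => //; exact: integrable_realZl.
  congr (_ * _); rewrite RintegralD//; [|exact: integrable_realZl|exact: integrable_realZl].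
  rewrite (RintegralZl _ _ iA)// (RintegralZl _ _ iS)//.
  by rewrite (Rintegral_prodM iphig Gg) (Rintegral_prodM (integrable_spow mphi iphig) (integrable_spow mG Gg)).
rewrite /Rintegral; congr fine.
pose F (q : measurableTypeR R * (Rd R d * R)) :=
  (\1_posr q.1 * (q.1 `^ (- 1 - g * d%:R) * kap (q.2.2 * (cd * phi q.2.1) * q.1 ^+ d)))%:E.
have F0 q : (0 <= F q)%E by rewrite lee_fin !mulr_ge0 ?powR_ge0.
have mF : measurable_fun setT F.
  apply/measurable_EFinP; apply: measurable_funM.
    by apply: (measurableT_comp (measurable_indic measurable_posrT)).
  apply: measurable_funM; first by apply: (@measurableT_comp _ _ _ _ _ _ (fun x : R => x `^ _)) => //; exact: measurable_powR.
  apply: measurableT_comp => //; apply: measurable_funM; last exact: measurable_funX.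
  apply: measurable_funM; first exact: measurableT_comp.
  apply: measurable_funM => //; apply: measurableT_comp => //; exact: measurableT_comp.
rewrite [X in (_ * X)%E](_ : _ = \int[leb1]_u \int[(leb \x G)]_z F (u, z))%E; last first.
  rewrite (@fubini_tonelli _ _ _ _ _ leb1 (prodm leb G) F mF F0).
  apply: eq_integral => z _; rewrite -integral_kap_power integral_posr_indic.
  by apply: eq_integral.
rewrite -ge0_integralZl_EFin//; last 2 first.
- by move=> u _; exact: integral_ge0.
- exact: (@measurable_fun_fubini_tonelli_F _ _ _ _ _ (prodm leb G) F mF F0).
rewrite integral_posr_indic; apply: eq_integral => u _.
rewrite /F/= indicE; have [/set_mem|_] := boolP (u \in posr); last first.
  by rewrite mul0r integral0_eq ?mule0// => z _; rewrite mul0r.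
rewrite posrE => u0; rewrite mul1r.
have ik : (leb \x G)%E.-integrable setT (EFin \o (fun z : Rd R d * R => kap (z.2 * ball_avg0 phi u z.1))).
  apply: (integrable_kapint k_ge0 k0 k_lip mk G1); exact: integrable_ball_avg0.
rewrite -mulrA EFinM; congr (_ * _)%E; rewrite EFinM /kapint -EFin_Rintegral//.
rewrite -ge0_integralZl_EFin ?powR_ge0//; last 2 first.
- by move=> z _; rewrite lee_fin.
- by case/integrableP : ik.
apply: eq_integral => z _; rewrite mul1r -EFinM.
by rewrite /ball_avg0; congr (_ * kap _)%:E; ring.
Qed.

End limit_functional.

(** * The functions 1 - cos y and the parts of y - sin y *)

Section kappas.
Context {R : realType}.

(** The exponents 1 and 2 trade places at v = 1. Here p <= 2 enters: the trigonometric functions are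
    of order y^2 or smaller at 0. *)
Lemma minr_sqr_le_powR (p v : R) : 1 <= p <= 2 -> 0 <= v -> Num.min v (v ^+ 2) <= v `^ p.
Proof.
move=> /andP[p1 p2]; rewrite le_eqVlt => /predU1P[<-|v0].
  by rewrite ge_min powR_ge0.
rewrite -(powR_mulrn 2 (ltW v0)) -{1}(powRr1 (ltW v0)) ge_min.
have [v1|v1] := leP v 1.
  by rewrite (ger_powR _ p2) ?orbT// v0.
by rewrite ler_powR// ltW.
Qed.

Lemma onem_cos_lip (a b : R) : `|(1 - cos a) - (1 - cos b)| <= 2 * `|a - b|.
Proof.
rewrite (_ : _ - _ = cos b - cos a); last by ring.
rewrite distrC (le_trans (normB_cos _ _))// ler_peMl//; lra.
Qed.

Lemma onem_cos_le_powR (p y : R) : 1 <= p <= 2 -> 1 - cos y <= 2 * `|y| `^ p.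
Proof.
move=> p12; rewrite -cos_norm; have := normr_ge0 y; move: `|y| => v.
rewrite le_eqVlt => /predU1P[<-|v0]; first by rewrite cos0 subrr mulr_ge0// powR_ge0.
have : `|1 - cos v| <= 1 * Num.min v (v ^+ 2).
  apply: (@primitive_min_bound _ (fun t => 1 - cos t) sin) => //.
  - by rewrite cos0 subrr.
  - move=> x; have := is_deriveB (is_derive_cst (1 : R) x 1) (is_derive_cos x).
    by rewrite sub0r opprK.
  - move=> x x0; rewrite mul1r le_min sin_max/=.
    by rewrite (le_trans (sin_le_abs x))// ger0_norm.
rewrite mul1r => H; rewrite (le_trans (ler_norm _))// (le_trans H)//.
rewrite (le_trans (minr_sqr_le_powR p12 (ltW v0)))// ler_peMl ?powR_ge0//; lra.
Qed.

Lemma sub_sin_le_powR (p y : R) : 1 <= p <= 2 -> 0 <= y -> y - sin y <= 2 * y `^ p.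
Proof.
move=> p12; rewrite le_eqVlt => /predU1P[<-|v0].
  by rewrite sin0 subrr mulr_ge0// powR_ge0.
have : `|y - sin y| <= 2 * Num.min y (y ^+ 2).
  apply: (@primitive_min_bound _ (fun t => t - sin t) (fun t => 1 - cos t)) => //.
  - by rewrite sin0 subrr.
  - move=> x x0; rewrite ger0_norm ?onem_cos_ge0// minr_pMr// mulr1 le_min; apply/andP; split.
      have : -1 <= cos x by exact: cos_geN1.
      lra.
    have := onem_cos_lip x 0; rewrite cos0 subrr !subr0 (ger0_norm x0).
    by rewrite ger0_norm// onem_cos_ge0.
move=> H; rewrite (le_trans (ler_norm _))// (le_trans H)//.
by rewrite ler_wpM2l// minr_sqr_le_powR// ltW.
Qed.

(** As y - sin y is odd and nonnegative for y >= 0, its negative part is [sub_sin_pos (- y)]. *)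
Definition sub_sin_pos (y : R) : R := Num.max 0 (y - sin y).

Lemma sub_sin_pos_ge0 y : 0 <= sub_sin_pos y.
Proof. by rewrite /sub_sin_pos le_max lexx. Qed.

Lemma sub_sin_ge0 (y : R) : 0 <= y -> 0 <= y - sin y.
Proof.
by move=> y0; rewrite subr_ge0 (le_trans (ler_norm _))// (le_trans (sin_le_abs y))// ger0_norm.
Qed.

Lemma sub_sin_pos_id y : 0 <= y -> sub_sin_pos y = y - sin y.
Proof. by move=> y0; rewrite /sub_sin_pos max_r// sub_sin_ge0. Qed.

Lemma sub_sin_posN y : 0 <= y -> sub_sin_pos (- y) = 0.
Proof.
by move=> y0; rewrite /sub_sin_pos max_l// sinN -opprD oppr_le0 sub_sin_ge0.
Qed.

Lemma sub_sinE y : y - sin y = sub_sin_pos y - sub_sin_pos (- y).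
Proof.
have [y0|y0] := leP 0 y; first by rewrite sub_sin_posN// subr0 sub_sin_pos_id.
rewrite -{3}(opprK y) sub_sin_posN ?oppr_ge0 1?ltW// sub_sin_pos_id ?oppr_ge0 1?ltW//.
by rewrite sinN; ring.
Qed.

Lemma sub_sin_pos0 : sub_sin_pos 0 = 0.
Proof. by rewrite sub_sin_pos_id// sin0 subrr. Qed.

Lemma sub_sin_pos_lip (a b : R) : `|sub_sin_pos a - sub_sin_pos b| <= 2 * `|a - b|.
Proof.
have H : `|(a - sin a) - (b - sin b)| <= 2 * `|a - b|.
  rewrite (_ : _ - _ = (a - b) - (sin a - sin b)); last by ring.
  by rewrite (le_trans (ler_normB _ _))// mulr2n mulrDl mul1r lerD// normB_sin.
apply: (le_trans _ H); rewrite /sub_sin_pos; move: (a - sin a) (b - sin b) => x y.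
have [x0|x0] := leP 0 x; have [y0|y0] := leP 0 y.
- by [].
- rewrite subr0 !ger0_norm//; lra.
- rewrite sub0r normrN [leRHS]distrC !ger0_norm//; lra.
- by rewrite subrr normr0.
Qed.

Lemma sub_sin_pos_le_powR (p y : R) : 1 <= p <= 2 -> sub_sin_pos y <= 2 * `|y| `^ p.
Proof.
move=> p12; have [y0|y0] := leP 0 y.
  by rewrite sub_sin_pos_id// ger0_norm// sub_sin_le_powR.
have -> : sub_sin_pos y = 0 by rewrite -(opprK y) sub_sin_posN// oppr_ge0 ltW.
by rewrite mulr_ge0// powR_ge0.
Qed.

End kappas.

(** * Limits of the real and imaginary parts of the exponent *)

Section exponent_limit.
Context {R : realType} (d : nat).
Variables (beta p Cb : R) (f : R -> R) (G : probability R R) (phi : Rd R d -> R).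
Local Notation leb := (lebesgue_tuple (R := R) d).
Local Notation leb1 := (@lebesgue_measure R).
Local Notation cd := (unit_ball_volume (R := R) d).
Let g := beta / d%:R.
Hypotheses (d0 : (0 < d)%N) (g1 : 1 < g) (gp : g < p) (p2 : p <= 2).
Hypotheses
  (G1 : G.-integrable setT (EFin \o (fun m : R => `|m|)))
  (Gp : G.-integrable setT (EFin \o (fun m : R => `|m| `^ p)))
  (Gg : G.-integrable setT (EFin \o (fun m : R => `|m| `^ g)))
  (iphi : leb.-integrable setT (EFin \o phi))
  (iphig : leb.-integrable setT (EFin \o (fun x => `|phi x| `^ g)))
  (iphip : leb.-integrable setT (EFin \o (fun x => `|phi x| `^ p))).
Hypotheses (mf : measurable_fun setT f) (f0 : forall r, 0 <= f r)
  (fneg : forall r, r <= 0 -> f r = 0)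
  (f_vol : (\int[leb1]_(r in posr) (r ^+ d * f r)%:E < +oo)%E)
  (Cb0 : 0 <= Cb)
  (f_tail : f r / r `^ (- 1 - beta) @[r --> +oo] --> Cb).
Variables (lam rho : nat -> R).
Hypotheses (lam0 : forall n, 0 < lam n) (rho0 : forall n, 0 < rho n)
  (lam_cvg : lam n @[n --> \oo] --> +oo)
  (small : lam n * rho n `^ beta @[n --> \oo] --> 0).

Local Notation Lam n := (ball_measure d G mf f0 (lam0 n) (rho0 n)).
Local Notation h n := (ball_functional beta phi (lam n) (rho n)).

Let d0R : 0 < d%:R :> R. Proof. by rewrite ltr0n. Qed.
Let betaE : beta = g * d%:R. Proof. by rewrite /g divfK// gt_eqF. Qed.
Let dbeta : d%:R < beta. Proof. by rewrite betaE ltr_pMl. Qed.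
Let betap : beta < p * d%:R. Proof. by rewrite betaE ltr_pM2r. Qed.
Let beta0 : 0 < beta. Proof. exact: lt_trans dbeta. Qed.
Let p1 : 1 <= p. Proof. by rewrite ltW// (lt_trans g1). Qed.
Let p12 : 1 <= p <= 2. Proof. by rewrite p1. Qed.

(** The scaling limit for one [kap], whose conditions are met because s^beta = lambda rho^beta tends
    to 0 and L^beta = lambda to infinity. *)
Let ball_limit (kap : R -> R) (k_ge0 : forall y, 0 <= kap y) (k0 : kap 0 = 0)
    (k_lip : forall a b, `|kap a - kap b| <= 2 * `|a - b|)
    (k_pow : forall y, kap y <= 2 * `|y| `^ p) :
  (forall n, (Lam n).-integrable setT (EFin \o (kap \o h n))) /\
  \int[Lam n]_z kap (h n z) @[n --> \oo] -->
  Cb * (cd `^ g / (2 * d%:R)) *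
    ((kap_up g kap + kap_down g kap) * ((\int[leb]_x `|phi x| `^ g) * (\int[G]_m `|m| `^ g)) +
     (kap_up g kap - kap_down g kap) * ((\int[leb]_x spow g (phi x)) * (\int[G]_m spow g m))).
Proof.
have mk := lipschitz2_measurable k_lip.
split=> [n|].
  exact: (integrable_ball_measure p1 beta0 k_ge0 k0 k_lip k_pow mk G1 Gp iphi iphip mf f0 fneg f_vol).
under eq_fun do rewrite (Rintegral_ball_measure beta0 k_ge0 k0 k_lip mk G1 iphi mf f0 fneg).
have := @Rintegral_kapint_avg0 R d g p 2 kap d0 g1 gp k_ge0 k0 k_lip k_pow G phi Cb G1 Gg iphi iphig Cb0.
rewrite -betaE => <-.
apply: (scaling_limit p1 dbeta betap k_ge0 k0 k_lip k_pow mk G1 Gp iphi iphip mf f0 f_vol f_tail).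
- by move=> n; rewrite mulr_gt0// powR_gt0.
- rewrite (_ : (fun n => _) = fun n => (lam n * rho n `^ beta) `^ beta^-1); last first.
    apply/funext => n; rewrite powRM ?powR_ge0 ?(ltW (lam0 n))// -powRrM divff ?gt_eqF// powRr1//.
    exact: ltW.
  have := @powR_cvg0 R beta^-1; rewrite invr_gt0 => /(_ beta0).
  move/cvg_at_rightP => /(_ (fun n => lam n * rho n `^ beta)); apply; split => // n.
  by rewrite mulr_gt0// powR_gt0.
- by move=> n; rewrite powR_gt0.
apply/cvgryPge => A; move/cvgryPge : lam_cvg => /(_ (Num.max 1 A `^ beta)).
apply: filterS => n H.
have A0 : 0 <= Num.max 1 A by rewrite le_max ler01.
rewrite (@le_trans _ _ (Num.max 1 A))//; first by rewrite le_max lexx orbT.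
rewrite -[leLHS](powRr1 A0) -[X in _ `^ X](@divff _ beta) ?gt_eqF// powRrM.
by rewrite ge0_ler_powR// ?nnegrE ?powR_ge0 ?invr_ge0 ?(ltW beta0)// ltW.
Qed.

Let K := \int[leb1]_(v in posr) (v `^ (- 1 - g) * (1 - cos v)).

(** The integrability result for [kap] applied to the absolute value with exponent 1: it too is
    nonnegative, Lipschitz and 0 at 0. *)
Lemma integrable_ball_functional n : (Lam n).-integrable setT (EFin \o h n).
Proof.
have ng : G.-integrable setT (EFin \o (fun m : R => `|m| `^ 1)).
  by rewrite (_ : (fun m => _) = (fun m : R => `|m|))//; apply/funext => m; rewrite powRr1.
have nphi : leb.-integrable setT (EFin \o (fun x => `|phi x| `^ 1)).
  rewrite (_ : (fun m => _) = (fun m => `|phi m|)); first exact: (integrable_norm iphi).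
  by apply/funext => m; rewrite powRr1.
have lip (a b : R) : `| `|a| - `|b| | <= 2 * `|a - b|.
  by rewrite (le_trans (ler_dist_dist _ _))// ler_peMl//; lra.
have pow (y : R) : `|y| <= 1 * `|y| `^ 1 by rewrite powRr1// mul1r.
have I := @integrable_ball_measure R d beta 1 1 f (@Num.norm _ R) G phi (lexx _) beta0
  (@normr_ge0 _ _) (normr0 _) lip pow (lipschitz2_measurable lip) G1 ng iphi nphi mf f0 fneg f_vol _ _ (lam0 n) (rho0 n).
apply: (@le_integrable_real _ _ _ _ _ _ _ _ _ _ I) => //.
by apply: measurable_ball_functional.
Qed.

(** 1 - cos is even, so [kap_up] and [kap_down] agree and the signed term drops out. *)
Lemma cvg_integral_cos :
  \int[Lam n]_z (cos (h n z) - 1) @[n --> \oo] -->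
  - (limit_scale d Cb g G * \int[leb]_x `|phi x| `^ g).
Proof.
have [I H] := ball_limit onem_cos_ge0 (eq_trans (congr1 (fun x => 1 - x) (cos0 R)) (subrr _))
  onem_cos_lip (fun y => onem_cos_le_powR y p12).
rewrite (_ : (fun n => _) = fun n => - \int[Lam n]_z (1 - cos (h n z))); last first.
  apply/funext => n; rewrite -[RHS]mulN1r -(RintegralZl (- 1) measurableT (I n)).
  by apply: eq_Rintegral => z _; rewrite /= mulN1r opprB.
apply: cvgN; pose kap (y : R) := 1 - cos y.
rewrite (_ : limit_scale d Cb g G * _ = Cb * (cd `^ g / (2 * d%:R)) *
    ((kap_up g kap + kap_down g kap) * ((\int[leb]_x `|phi x| `^ g) * (\int[G]_m `|m| `^ g)) +
     (kap_up g kap - kap_down g kap) * ((\int[leb]_x spow g (phi x)) * (\int[G]_m spow g m)))); first exact: H.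
have E1 : kap_up g kap = K by [].
have E2 : kap_down g kap = K.
  by apply: eq_Rintegral => v _; rewrite /kap cosN.
rewrite E1 E2 subrr mul0r addr0 /limit_scale.
have -> : \int[leb1]_(r in posr) ((1 - cos r) / r `^ (1 + g)) = K.
  by apply: eq_Rintegral => v _; rewrite -powRN mulrC opprD.
by field; rewrite gt_eqF.
Qed.

(** [sub_sin_pos] lives on the positive half-line and its reflection on the negative one. In their
    difference the even terms cancel, the odd ones add up, and the tangent relation evaluates them;
    the sign of sin y - y offsets the minus in front of the tangent. *)
Lemma cvg_integral_sin :
  \int[Lam n]_z (sin (h n z) - h n z) @[n --> \oo] -->
  limit_skewness g G * tan (pi * g / 2) * (limit_scale d Cb g G * \int[leb]_x spow g (phi x)).
Proof.
have [I1 H1] := ball_limit sub_sin_pos_ge0 sub_sin_pos0 sub_sin_pos_lip (fun y => sub_sin_pos_le_powR y p12).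
have k2_ge0 (y : R) : 0 <= sub_sin_pos (- y) by exact: sub_sin_pos_ge0.
have k20 : sub_sin_pos (- 0) = 0 :> R by rewrite oppr0 sub_sin_pos0.
have k2_lip (a b : R) : `|sub_sin_pos (- a) - sub_sin_pos (- b)| <= 2 * `|a - b|.
  by rewrite (le_trans (sub_sin_pos_lip _ _))// -opprD normrN.
have k2_pow (y : R) : sub_sin_pos (- y) <= 2 * `|y| `^ p.
  by rewrite (le_trans (sub_sin_pos_le_powR _ p12))// normrN.
have [I2 H2] := ball_limit k2_ge0 k20 k2_lip k2_pow.
rewrite (_ : (fun n => _) = fun n => - (\int[Lam n]_z sub_sin_pos (h n z) -
    \int[Lam n]_z sub_sin_pos (- h n z))); last first.
  apply/funext => n; rewrite -(RintegralB measurableT (I1 n) (I2 n)) -mulN1r.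
  rewrite -(RintegralZl (- 1) measurableT (integrable_realB measurableT (I1 n) (I2 n))).
  by apply: eq_Rintegral => z _; rewrite /= -sub_sinE mulN1r opprB.
have H := cvgN (cvgB H1 H2).
rewrite (_ : limit_skewness _ _ * _ * _ = - (Cb * (cd `^ g / (2 * d%:R)) *
    ((kap_up g sub_sin_pos + kap_down g sub_sin_pos) *
      ((\int[leb]_x `|phi x| `^ g) * (\int[G]_m `|m| `^ g)) +
     (kap_up g sub_sin_pos - kap_down g sub_sin_pos) *
      ((\int[leb]_x spow g (phi x)) * (\int[G]_m spow g m))) -
    Cb * (cd `^ g / (2 * d%:R)) *
    ((kap_up g (fun y => sub_sin_pos (- y)) + kap_down g (fun y => sub_sin_pos (- y))) *
      ((\int[leb]_x `|phi x| `^ g) * (\int[G]_m `|m| `^ g)) +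
     (kap_up g (fun y => sub_sin_pos (- y)) - kap_down g (fun y => sub_sin_pos (- y))) *
      ((\int[leb]_x spow g (phi x)) * (\int[G]_m spow g m))))); first exact: H.
have g12 : 1 < g < 2 by rewrite g1 (lt_le_trans gp).
have S1 : kap_up g sub_sin_pos = - tan (pi * g / 2) * K.
  rewrite -(integral_sub_sin_tan g12); apply: eq_Rintegral => v /set_mem; rewrite posrE => v0.
  by rewrite sub_sin_pos_id// ltW.
have S2 : kap_down g (fun y => sub_sin_pos (- y)) = - tan (pi * g / 2) * K.
  by rewrite -S1; apply: eq_Rintegral => v _; rewrite opprK.
have Z1 : kap_down g sub_sin_pos = 0.
  rewrite /kap_down /Rintegral integral0_eq// => v; rewrite posrE => v0.
  by rewrite sub_sin_posN ?mulr0// ltW.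
have Z2 : kap_up g (fun y => sub_sin_pos (- y)) = 0 by exact: Z1.
rewrite S1 S2 Z1 Z2 /limit_scale.
have -> : \int[leb1]_(r in posr) ((1 - cos r) / r `^ (1 + g)) = K.
  by apply: eq_Rintegral => v _; rewrite -powRN mulrC opprD.
have iG := integrable_spow (@measurable_id _ _ setT) Gg.
(* If the absolute moment is 0, the quotient defining the skewness is 0 by convention; the signed
   moment, bounded by the absolute one, is then 0 as well. *)
have E : limit_skewness g G * (\int[G]_m `|m| `^ g) = \int[G]_m spow g m.
  rewrite /limit_skewness; have [E0|E0] := eqVneq (\int[G]_m `|m| `^ g) 0; last by rewrite divfK.
  have := le_normr_Rintegral measurableT iG.
  rewrite E0 mulr0 => H0; apply/esym/eqP; rewrite -normr_le0 (le_trans H0)// -E0.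
  apply: le_Rintegral => //.
    exact: (integrable_norm iG).
  by move=> m _; exact: normr_spow.
by rewrite -E; field; rewrite gt_eqF.
Qed.

End exponent_limit.

(** * Stable integrals *)

Section powR_sequences.
Context {R : realType}.

Lemma cvg_powR_seq (u : nat -> R) (l q : R) : (forall n, 0 <= u n) -> 0 < q ->
  u n @[n --> \oo] --> l -> (u n) `^ q @[n --> \oo] --> l `^ q.
Proof.
move=> u0 q0 ul.
have : 0 <= l by apply: (cvgr_to_ge ul); exact: nearW.
rewrite le_eqVlt => /predU1P[l0|l0]; last first.
  by apply: (cvg_comp u (fun x : R => x `^ q) ul); exact: continuous_powR.
rewrite -l0 powR0 ?gt_eqF//; apply/cvgrPdist_le => e e0.
have e1 : 0 < e `^ q^-1 by exact: powR_gt0.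
move/cvgrPdist_le : ul => /(_ _ e1); apply: filterS => n.
rewrite -l0 !sub0r !normrN !ger0_norm ?powR_ge0// => H.
have E : (e `^ q^-1) `^ q = e by rewrite -powRrM mulVf ?gt_eqF// powRr1// ltW.
rewrite -E.
by rewrite ge0_ler_powR// ?nnegrE ?powR_ge0// ltW.
Qed.

End powR_sequences.

Section power_integrals.
Context {R : realType} d (T : measurableType d) (mu : {measure set T -> \bar R}) (g : R).
Hypothesis g1 : 1 <= g.
Implicit Types f : T -> R.

Let g0 : 0 < g. Proof. exact: lt_le_trans g1. Qed.

(** The g-th power of the L^g norm, the form in which the norm enters a stable exponent. *)
Definition Lpow f : R := \int[mu]_x `|f x| `^ g.
Definition in_Lpow f := measurable_fun setT f /\
  mu.-integrable setT (EFin \o (fun x => `|f x| `^ g)).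

Lemma Lfun_in_Lpow f : f \in Lfun mu g%:E -> in_Lpow f.
Proof.
move=> /andP[/[!inE] mf /=]; rewrite /finite_norm => H; split => //.
apply/integrableP; split; first by apply/measurable_EFinP; exact: measurable_norm_powR.
under eq_integral do rewrite /= ger0_norm ?powR_ge0//.
have <- : ('N[mu]_g%:E[(EFin \o f)] `^ g)%E = (\int[mu]_x (`|f x| `^ g)%:E)%E.
  by rewrite poweR_Lnorm ?gt_eqF//; apply: eq_integral.
by apply: poweR_lty.
Qed.

Lemma LnormE f : in_Lpow f -> 'N[mu]_g%:E[(EFin \o f)]%E = ((Lpow f) `^ g^-1)%:E.
Proof.
move=> [mf If]; rewrite unlock /Lnorm -poweR_EFin; congr (_ `^ _)%E.
by rewrite /Lpow -EFin_Rintegral//; apply: eq_integral.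
Qed.

Lemma Lpow_ge0 f : 0 <= Lpow f.
Proof. by apply: Rintegral_ge0 => x _; exact: powR_ge0. Qed.

Lemma normrD_powR (x y : R) : `|x + y| `^ g <= 2 `^ g * (`|x| `^ g + `|y| `^ g).
Proof.
have H (a b : R) : 0 <= a -> a <= b -> (a + b) `^ g <= 2 `^ g * (a `^ g + b `^ g).
  move=> a0 ab; have b0 := le_trans a0 ab.
  rewrite (@le_trans _ _ ((2 * b) `^ g))//.
    by rewrite ge0_ler_powR ?(ltW g0)// ?nnegrE ?addr_ge0// ?mulr_ge0//; lra.
  by rewrite powRM// ler_wpM2l ?powR_ge0// lerDr powR_ge0.
rewrite (@le_trans _ _ ((`|x| + `|y|) `^ g))//.
  by rewrite ge0_ler_powR ?(ltW g0)// ?nnegrE ?addr_ge0// ler_normD.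
have [xy|xy] := leP `|x| `|y|; first exact: H.
by rewrite addrC [X in _ * X]addrC; apply: H => //; exact: ltW.
Qed.

Lemma in_LpowD f1 f2 : in_Lpow f1 -> in_Lpow f2 -> in_Lpow (fun x => f1 x + f2 x).
Proof.
move=> [m1 i1] [m2 i2]; have mD := measurable_funD m1 m2; split => //.
apply: (@le_integrable_real _ _ _ _ _ _ (fun x => 2 `^ g * (`|f1 x| `^ g + `|f2 x| `^ g))) => //.
- exact: measurable_norm_powR.
- by move=> x _; rewrite ger0_norm ?powR_ge0// normrD_powR.
by apply: integrable_realZl => //; exact: integrable_realD.
Qed.

Lemma in_LpowZ c f : in_Lpow f -> in_Lpow (fun x => c * f x).
Proof.
move=> [mf i_f]; split; first exact: measurable_funM.
rewrite (_ : (fun x => _) = (fun x => `|c| `^ g * `|f x| `^ g)).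
  exact: integrable_realZl.
by apply/funext => x; rewrite normrM powRM.
Qed.

Lemma in_LpowN f : in_Lpow f -> in_Lpow (fun x => - f x).
Proof.
by move=> /(in_LpowZ (- 1)); rewrite (_ : (fun x => -1 * _) = (fun x => - f x))//;
  apply/funext => x; rewrite mulN1r.
Qed.

Lemma in_LpowB f1 f2 : in_Lpow f1 -> in_Lpow f2 -> in_Lpow (fun x => f1 x - f2 x).
Proof. by move=> h1 h2; exact: in_LpowD h1 (in_LpowN h2). Qed.

Lemma in_Lpow_sum (I : Type) (r : seq I) (F : I -> T -> R) :
  (forall i, in_Lpow (F i)) -> in_Lpow (fun x => \sum_(i <- r) F i x).
Proof.
move=> H; elim: r => [|i r IH].
  under eq_fun do rewrite big_nil; split => //.
  rewrite (_ : EFin \o _ = fun=> 0%E); first exact: integrable0.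
  by apply/funext => x; rewrite /= normr0 powR0// gt_eqF.
by under eq_fun do rewrite big_cons; exact: in_LpowD.
Qed.

Lemma Lpow_minkowski f1 f2 : in_Lpow f1 -> in_Lpow f2 ->
  Lpow (fun x => f1 x + f2 x) `^ g^-1 <= Lpow f1 `^ g^-1 + Lpow f2 `^ g^-1.
Proof.
move=> h1 h2; have [[m1 _] [m2 _]] := (h1, h2).
have := @minkowski_EFin _ _ _ mu f1 f2 g m1 m2 g1.
by rewrite (LnormE h1) (LnormE h2) (LnormE (in_LpowD h1 h2)) -EFinD lee_fin.
Qed.

Lemma LpowN f : Lpow (fun x => - f x) = Lpow f.
Proof. by apply: eq_Rintegral => x _; rewrite normrN. Qed.

(** Minkowski's inequality in both directions gives convergence of the norms, and the g-th power is
    continuous. *)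
Lemma cvg_Lpow (f_ : nat -> T -> R) f : (forall n, in_Lpow (f_ n)) -> in_Lpow f ->
  Lpow (fun x => f_ n x - f x) @[n --> \oo] --> 0 ->
  Lpow (f_ n) @[n --> \oo] --> Lpow f.
Proof.
move=> h_ h H.
have gi : 0 < g^-1 by rewrite invr_gt0.
have E u : 0 <= u -> u = (u `^ g^-1) `^ g.
  by move=> u0; rewrite -powRrM mulVf ?gt_eqF// powRr1.
rewrite [X in _ --> X](E _ (Lpow_ge0 _)).
rewrite (_ : (fun n => Lpow (f_ n)) = (fun n => (Lpow (f_ n) `^ g^-1) `^ g)); last first.
  by apply/funext => n; rewrite -E// Lpow_ge0.
apply: cvg_powR_seq => // [n|]; first exact: powR_ge0.
have := @cvg_powR_seq _ _ _ _ (fun n => Lpow_ge0 (fun x => f_ n x - f x)) gi H.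
rewrite powR0 ?gt_eqF// => /cvgrPdist_le H0.
apply/cvgrPdist_le => e e0; have := H0 _ e0; apply: filterS => n.
rewrite sub0r normrN ger0_norm ?powR_ge0// => Hn.
rewrite (le_trans _ Hn)// ler_norml; apply/andP; split.
  rewrite lerNl opprB lerBlDr.
  have := Lpow_minkowski (in_LpowB (h_ n) h) h.
  by rewrite (_ : (fun x => f_ n x - f x + f x) = f_ n)//; apply/funext => x; rewrite subrK.
rewrite lerBlDr.
have := Lpow_minkowski (in_LpowN (in_LpowB (h_ n) h)) (h_ n).
rewrite LpowN (_ : (fun x => - (f_ n x - f x) + f_ n x) = f)//.
by apply/funext => x; rewrite opprB subrK.
Qed.

Lemma in_Lpow_max0 f : in_Lpow f -> in_Lpow (fun x => Num.max (f x) 0).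
Proof.
move=> [mf i_f]; have mm : measurable_fun setT (fun x => Num.max (f x) 0).
  exact: measurable_funrpos.
split => //; apply: (@le_integrable_real _ _ _ _ _ _ (fun x => `|f x| `^ g)) => //.
  exact: measurable_norm_powR.
move=> x _; rewrite ger0_norm ?powR_ge0// ge0_ler_powR ?(ltW g0)// ?nnegrE//.
by rewrite ger0_norm ?le_max ?lexx ?orbT// ge_max normr_ge0 ler_norm.
Qed.

(** The signed power becomes a combination of two absolute ones. Since taking positive parts is
    1-Lipschitz, convergence of signed integrals reduces to convergence of norms. *)
Lemma spow_max0 (x : R) : spow g x = 2 * `|Num.max x 0| `^ g - `|x| `^ g.
Proof.
have [x0|x0] := leP x 0; last by rewrite spow_pos// gtr0_norm//; ring.
rewrite -{1}(opprK x) spowN normr0 powR0 ?gt_eqF// mulr0 sub0r.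
move: x0; rewrite le_eqVlt => /predU1P[->|x0].
  by rewrite oppr0 spow0 normr0 powR0// gt_eqF.
by rewrite spow_pos ?oppr_gt0// ltr0_norm.
Qed.

Lemma max0_dist (x y : R) : `|Num.max x 0 - Num.max y 0| <= `|x - y|.
Proof.
have [x0|x0] := leP x 0; have [y0|y0] := leP y 0.
- by rewrite subrr normr0.
- by rewrite sub0r normrN distrC !ger0_norm; lra.
- by rewrite subr0 !ger0_norm; lra.
- by [].
Qed.

Lemma cvg_Rintegral_spow (f_ : nat -> T -> R) f : (forall n, in_Lpow (f_ n)) -> in_Lpow f ->
  Lpow (fun x => f_ n x - f x) @[n --> \oo] --> 0 ->
  \int[mu]_x spow g (f_ n x) @[n --> \oo] --> \int[mu]_x spow g (f x).
Proof.
move=> h_ h H.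
have E f1 : in_Lpow f1 -> \int[mu]_x spow g (f1 x) = 2 * Lpow (fun x => Num.max (f1 x) 0) - Lpow f1.
  move=> h1; have [mm im] := in_Lpow_max0 h1.
  rewrite /Lpow -RintegralZl// -RintegralB//; last 2 first.
  - exact: integrable_realZl.
  - by case: h1.
  by apply: eq_Rintegral => x _; exact: spow_max0.
rewrite E// (_ : (fun n => _) = fun n => 2 * Lpow (fun x => Num.max (f_ n x) 0) - Lpow (f_ n)); last first.
  by apply/funext => n; exact: E.
apply: cvgB; last exact: cvg_Lpow.
apply: cvgMr; apply: cvg_Lpow => [n||]; [exact: in_Lpow_max0|exact: in_Lpow_max0|].
apply: (@squeeze_cvgr _ _ _ _ (cst 0) (fun n => Lpow (fun x => f_ n x - f x))) => //.
  apply: nearW => n; rewrite Lpow_ge0/=; apply: le_Rintegral => //.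
  - by have [] := in_LpowB (in_Lpow_max0 (h_ n)) (in_Lpow_max0 h).
  - by have [] := in_LpowB (h_ n) h.
  move=> x _; rewrite ge0_ler_powR ?(ltW g0)// ?nnegrE//.
  exact: max0_dist.
exact: cvg_cst.
Qed.

Lemma Lpow_sum_cvg0 (k : nat) (t : 'I_k -> R) (F : nat -> 'I_k -> T -> R) :
  (forall n j, in_Lpow (F n j)) ->
  (forall j, Lpow (F n j) @[n --> \oo] --> 0) ->
  Lpow (fun x => \sum_j t j * F n j x) @[n --> \oo] --> 0.
Proof.
move=> hF H; rewrite /index_enum; elim: (Finite.enum _) => [|j r IH].
  under eq_fun do under eq_fun do rewrite big_nil.
  rewrite (_ : (fun n => _) = fun=> 0); first exact: cvg_cst.
  apply/funext => n; rewrite /Lpow; under eq_Rintegral do rewrite normr0 powR0 ?gt_eqF//.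
  by rewrite /Rintegral integral0.
apply: (@squeeze_cvgr _ _ _ _ (cst 0) (fun n => 2 `^ g * (`|t j| `^ g * Lpow (F n j) +
    Lpow (fun x => \sum_(j <- r) t j * F n j x)))).
- apply: nearW => n; rewrite Lpow_ge0/=.
  have [mS iS] : in_Lpow (fun x => \sum_(j <- r) t j * F n j x).
    by apply: in_Lpow_sum => i; exact: in_LpowZ.
  have [m1 i1] := in_LpowZ (t j) (hF n j).
  have -> : `|t j| `^ g * Lpow (F n j) = Lpow (fun x => t j * F n j x).
    rewrite /Lpow -RintegralZl//; last by case: (hF n j).
    by apply: eq_Rintegral => x _; rewrite normrM powRM.
  rewrite /Lpow -RintegralD// -RintegralZl//; last exact: integrable_realD.
  apply: le_Rintegral => //.
  + have [] : in_Lpow (fun x => \sum_(j <- j :: r) t j * F n j x) by apply: in_Lpow_sum => i; exact: in_LpowZ.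
    by [].
  + by apply: integrable_realZl => //; exact: integrable_realD.
  by move=> x _; rewrite big_cons normrD_powR.
- exact: cvg_cst.
rewrite -[X in _ --> X](mulr0 (2 `^ g)); apply: cvgMr.
rewrite -[X in _ --> X]addr0; apply: cvgD => //.
by rewrite -[X in _ --> X](mulr0 (`|t j| `^ g)); exact: cvgMr.
Qed.

End power_integrals.

(** * Stable random measures on finitely many cells *)

Section stable_measure.
Context {R : realType} dO (Om : measurableType dO) (P : probability Om R)
  dE (E : measurableType dE) (g : R) (m : {measure set E -> \bar R}) (b : R)
  (M : set E -> {RV P >-> R}).
Hypotheses (g1 : 1 < g) (srm : stable_random_measure g m b M).
Import HBSimple.

Let g0 : 0 < g. Proof. exact: lt_trans g1. Qed.

(** Sigma-additivity for a sequence of empty sets: the partial sums n M(empty) converge, so their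
    increment M(empty) is 0. *)
Lemma srm_set0 : {ae P, forall w, M set0 w = 0}.
Proof.
have := srm_sigma_additive srm (fun _ => measurable0) (@trivIset_set0 _ _ setT).
rewrite bigcup0// measure0 ltry => /(_ isT); apply: filterS => w H.
have H1 : \sum_(0 <= i < n.+1) M set0 w @[n --> \oo] --> M set0 w.
  by rewrite (cvg_shiftS (fun n => \sum_(0 <= i < n) M set0 w)).
have H2 : M set0 w @[n --> \oo] --> (0 : R).
  rewrite -(subrr (M set0 w)) (_ : (fun _ : nat => M set0 w) = fun n =>
    \sum_(0 <= i < n.+1) M set0 w - \sum_(0 <= i < n) M set0 w); first exact: cvgB.
  by apply/funext => n; rewrite big_nat_recr//= addrAC subrr add0r.
exact: (cvg_unique _ (cvg_cst _ : M set0 w @[n --> \oo] --> M set0 w) H2).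
Qed.

(** Sigma-additivity for the family completed by empty sets. The predicate Q selects some of the
    cells, as the level sets of a simple function require. *)
Lemma srm_finite_additive n (Q : pred 'I_n) (A : 'I_n -> set E) :
  (forall i, measurable (A i)) -> trivIset setT A -> (forall i, m (A i) < +oo)%E ->
  {ae P, forall w, M (\bigcup_(i in [set i | Q i]) A i) w = \sum_(i | Q i) M (A i) w}.
Proof.
move=> mA tA Afin.
pose B (l : nat) := if insub l is Some i then if Q i then A i else set0 else set0.
have BE (i : 'I_n) : B i = if Q i then A i else set0 by rewrite /B valK.
have Bout l : (n <= l)%N -> B l = set0 by move=> nl; rewrite /B insubN// -leqNgt.
have mB l : measurable (B l).
  by rewrite /B; case: insubP => // i _ _; case: ifP.
have UB : \bigcup_l B l = \bigcup_(i in [set i | Q i]) A i.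
  apply/seteqP; split=> x.
    by move=> [l _]; rewrite /B; case: insubP => // i _ _; case: ifP => // Qi Aix; exists i.
  by move=> [i Qi Aix]; exists i => //; rewrite BE Qi.
have tB : trivIset setT B.
  move=> l l' _ _ [x []]; rewrite /B; case: insubP => // i _ <-; case: ifP => // _ Ai.
  case: insubP => // j _ <-; case: ifP => // _ Aj; congr (nat_of_ord _).
  by apply: tA => //; exists x.
have UBn : \bigcup_l B l = \big[setU/set0]_(l < n) B l.
  rewrite -bigcup_mkord; apply/seteqP; split=> x [l]; last by move=> _ ?; exists l.
  have [ln|nl] := ltnP l n; first by move=> _ ?; exists l.
  by rewrite Bout.
have Ufin : (m (\bigcup_l B l) < +oo)%E.
  rewrite UBn measure_semi_additive_ord_I//; last 2 first.
  - by apply: (sub_trivIset _ tB).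
  - exact: bigsetU_measurable.
  apply: lte_sum_pinfty => i _; rewrite BE.
  by case: ifP => _; [exact: Afin|rewrite measure0 ltry].
have := srm_sigma_additive srm mB tB Ufin; rewrite UB.
move: srm_set0; apply: filterS2 => w M0 H.
have E0 : (fun l => \sum_(0 <= i < l + n) M (B i) w) = fun=> \sum_(i | Q i) M (A i) w.
  apply/funext => l; rewrite (big_cat_nat (n := n)) ?leq_addl//=.
  rewrite [X in _ + X]big_nat_cond [X in _ + X]big1 ?addr0; last first.
    by move=> i /andP[/andP[ni _] _]; rewrite Bout.
  rewrite big_mkord [RHS]big_mkcond/=; apply: eq_bigr => i _; rewrite BE.
  by case: ifP.
have H1 : \sum_(0 <= i < l + n) M (B i) w @[l --> \oo] --> M (\bigcup_(i in [set i | Q i]) A i) w.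
  by rewrite (cvg_shiftn n (fun l => \sum_(0 <= i < l) M (B i) w)).
rewrite E0 in H1.
by apply: (cvg_unique _ H1 (cvg_cst _)).
Qed.

(** The definition sums over the values of h, whereas independence is used on prescribed cells: each
    level set is reassembled from the cells with that coefficient. The value 0 is treated apart, its
    level set being possibly of infinite control measure. *)
Lemma simple_stable_integralE n (s : 'I_n -> R) (A : 'I_n -> set E) (h : {sfun E >-> R}) :
  (forall i, measurable (A i)) -> trivIset setT A -> (forall i, m (A i) < +oo)%E ->
  (forall x, h x = \sum_i s i * \1_(A i) x) ->
  {ae P, forall w, simple_stable_integral M h w = \sum_i s i * M (A i) w}.
Proof.
move=> mA tA Afin hE.
have : {ae P, forall w, forall i : 'I_n,
    M (\bigcup_(j in [set j | s j == s i]) A j) w = \sum_(j | s j == s i) M (A j) w}.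
  by apply: filter_forall => i; exact: srm_finite_additive.
move: srm_set0; apply: filterS2 => w M0 H.
have level y : y != 0 -> h @^-1` [set y] = \bigcup_(j in [set j | s j == y]) A j.
  move=> y0; apply/seteqP; split=> x /=.
    have [[i Aix]|Hx] := pselect (exists i, A i x).
      by rewrite hE (sum_indic_disjoint tA _ Aix) => /eqP si; exists i.
    rewrite hE sum_indic_out => [y0'|i Ai]; last by apply: Hx; exists i.
    by rewrite y0' eqxx in y0.
  by move=> [j /= /eqP <- Ajx]; rewrite hE (sum_indic_disjoint tA _ Ajx).
rewrite /simple_stable_integral fsbig_finite//=.
set D := finmap.enum_fset _.
have uD : uniq D by exact: finmap.fset_uniq.
have DE y : (y \in D) = (y \in range h) by rewrite -in_fset_set.
transitivity (\sum_(y <- D) \sum_(j < n | s j == y) s j * M (A j) w).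
  rewrite big_seq [RHS]big_seq; apply: eq_bigr => y; rewrite DE inE => -[x _ hx].
  have [->|y0] := eqVneq y 0.
    by rewrite mul0r big1// => j /eqP ->; rewrite mul0r.
  rewrite level//.
  have [i si] : exists i, s i = y.
    have [[i Aix]|Hx] := pselect (exists i, A i x).
      by exists i; rewrite -hx hE (sum_indic_disjoint tA _ Aix).
    by rewrite -hx hE sum_indic_out ?eqxx// in y0 => i Ai; apply: Hx; exists i.
  by rewrite -si H mulr_sumr; apply: eq_bigr => j /eqP ->.
rewrite (exchange_big_dep xpredT)//=; apply: eq_bigr => j _.
have [sD|sD] := boolP (s j \in D).
  rewrite big_mkcond (bigD1_seq (s j))//= eqxx big1 ?addr0// => y /negbTE ys.
  by rewrite eq_sym ys.
(* A coefficient that h never takes can only belong to an empty cell. *)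
have -> : A j = set0.
  apply/seteqP; split=> // x Ajx; move/negP : sD; apply; rewrite DE inE; exists x => //.
  by rewrite hE (sum_indic_disjoint tA _ Ajx).
by rewrite M0 mulr0 big1// => y _; rewrite mulr0.
Qed.

End stable_measure.

(** * Characteristic functions of stable integrals *)

Section stable_integral_cfun.
Context {R : realType} dO (Om : measurableType dO) (P : probability Om R)
  dE (E : measurableType dE) (g : R) (m : {measure set E -> \bar R}) (b : R)
  (M : set E -> {RV P >-> R}).
Hypotheses (g1 : 1 < g) (srm : stable_random_measure g m b M).
Import HBSimple.

Let g0 : 0 < g. Proof. exact: lt_trans g1. Qed.
Let tg : R := tan (pi * g / 2).

Lemma charfun_distribution (X : {RV P >-> R}) (t : R) :
  charfun (distribution P X) t = cfun P (fun w => t * X w).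
Proof.
have mt (Q : probability R R) : measurable_fun setT (fun x : R => t * x) by exact: measurable_funM.
rewrite /charfun /cfun /Rintegral; congr (fine _ +i* fine _)%C.
- apply: (integral_distribution (f := fun x => (cos (t * x))%:E)).
    by apply/measurable_EFinP; apply: measurable_fun_cos; exact: measurable_funM.
  by apply: integrable_cos; exact: measurable_funM.
- apply: (integral_distribution (f := fun x => (sin (t * x))%:E)).
    by apply/measurable_EFinP; apply: measurable_fun_sin; exact: measurable_funM.
  by apply: integrable_sin; exact: measurable_funM.
Qed.

Lemma cfun_srm A (t : R) : measurable A -> (m A < +oo)%E ->
  cfun P (fun w => t * M A w) =
  expC ((- (fine (m A) * `|t| `^ g)) +i* (b * tg * (fine (m A) * spow g t)))%C.
Proof.
move=> mA Afin; rewrite -charfun_distribution (srm_law srm mA Afin t); congr expC.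
rewrite /stable_symbol -powRrM mulVf ?gt_eqF// powRr1; last exact: fine_ge0.
rewrite mul0r /spow /tg; apply/eqP; rewrite eq_complex /=; apply/andP; split; apply/eqP; ring.
Qed.

Lemma cfun_srm_sum n (A : 'I_n -> set E) (c : 'I_n -> R) :
  (forall i, measurable (A i)) -> trivIset setT A -> (forall i, m (A i) < +oo)%E ->
  cfun P (fun w => \sum_i c i * M (A i) w) =
  expC ((- \sum_i fine (m (A i)) * `|c i| `^ g) +i*
        (b * tg * \sum_i fine (m (A i)) * spow g (c i)))%C.
Proof.
move=> mA tA Afin.
have mc i : measurable_fun setT (fun x : R => c i * x) by exact: measurable_funM.
rewrite (@cfun_sum_independent _ _ _ _ _ _ _ (fun i => M (A i) : Om -> R) (fun i x => c i * x) (fun i => _) mc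
  (srm_independent srm mA Afin tA)); last by [].
rewrite (eq_bigr _ (fun i _ => cfun_srm (c i) (mA i) (Afin i))).
by rewrite -expC_sum sum_complex sumrN mulr_sumr.
Qed.

Lemma Rintegral_sum_indic n (A : 'I_n -> set E) (c : 'I_n -> R) :
  (forall i, measurable (A i)) -> (forall i, m (A i) < +oo)%E ->
  \int[m]_x (\sum_i c i * \1_(A i) x) = \sum_i fine (m (A i)) * c i.
Proof.
move=> mA Afin; have iA i : m.-integrable setT (EFin \o (\1_(A i) : E -> R)).
  apply/integrableP; split; first exact/measurable_EFinP/measurable_indic.
  by under eq_integral do rewrite /= ger0_norm//; rewrite integral_indic// setIT.
rewrite Rintegral_sum//; last by move=> i; exact: integrable_realZl.
by apply: eq_bigr => i _; rewrite RintegralZl// /Rintegral integral_indic// setIT mulrC.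
Qed.

(** All the functions are written on common cells of finite measure, where the values of M are
    independent; the sums over cells are the integrals on the right because both powers vanish at
    0. *)
Lemma cfun_simple_stable_integral k (t : 'I_k -> R) (h : 'I_k -> {sfun E >-> R}) :
  (forall j, in_Lpow m g (h j)) ->
  cfun P (fun w => \sum_j t j * simple_stable_integral M (h j) w) =
  expC ((- Lpow m g (fun x => \sum_j t j * h j x)) +i*
        (b * tg * \int[m]_x spow g (\sum_j t j * h j x)))%C.
Proof.
move=> hL.
have [n [s [A [mA tA Afin hE]]]] := sfun_common_repr (fun j y => measure_level_set_lty (y := y) (hL j).2).
pose c i := \sum_j t j * s i j.
have hc x : \sum_j t j * h j x = \sum_i c i * \1_(A i) x.
  under eq_bigr do rewrite hE mulr_sumr.
  rewrite exchange_big/=; apply: eq_bigr => i _; rewrite mulr_suml; apply: eq_bigr => j _.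
  by rewrite mulrA.
have mMA i : measurable_fun setT (M (A i)) by [].
have mI j : measurable_fun setT (simple_stable_integral M (h j)).
  rewrite /simple_stable_integral; under eq_fun do rewrite fsbig_finite//=.
  by apply: measurable_sum => y; exact: measurable_funM.
rewrite (@eq_cfun_ae _ _ _ _ _ (fun w => \sum_i c i * M (A i) w)); last 3 first.
- by apply: measurable_sum => j; exact: measurable_funM.
- by apply: measurable_sum => i; exact: measurable_funM.
- have : {ae P, forall w, forall j, simple_stable_integral M (h j) w = \sum_i s i j * M (A i) w}.
    by apply: filter_forall => j; exact: (simple_stable_integralE srm mA tA Afin (hE j)).
  apply: filterS => w H; under eq_bigr do rewrite H mulr_sumr.
  rewrite exchange_big/=; apply: eq_bigr => i _; rewrite mulr_suml; apply: eq_bigr => j _.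
  by rewrite mulrA.
rewrite (cfun_srm_sum c mA tA Afin).
have -> : Lpow m g (fun x => \sum_j t j * h j x) = \sum_i fine (m (A i)) * `|c i| `^ g.
  rewrite -(Rintegral_sum_indic (fun i => `|c i| `^ g) mA Afin); apply: eq_Rintegral => x _; rewrite hc.
  by rewrite (@comp_sum_indic _ _ _ A tA c (fun y => `|y| `^ g))//= normr0 powR0// gt_eqF.
suff -> : \int[m]_x spow g (\sum_j t j * h j x) = \sum_i fine (m (A i)) * spow g (c i) by [].
rewrite -(Rintegral_sum_indic (fun i => spow g (c i)) mA Afin); apply: eq_Rintegral => x _; rewrite hc.
by rewrite (@comp_sum_indic _ _ _ A tA c (spow g))//= spow0.
Qed.

(** cos and sin are bounded by 1 and 1-Lipschitz: off the events where some coordinate is e' away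
    from its limit they move by at most e' times the sum of the |t j|. *)
Lemma cvg_cfun_in_probability k (t : 'I_k -> R) (X : nat -> 'I_k -> Om -> R) (Y : 'I_k -> Om -> R) :
  (forall n j, measurable_fun setT (X n j)) -> (forall j, measurable_fun setT (Y j)) ->
  (forall j, cvg_in_probability P (fun n => X n j) (Y j)) ->
  \int[P]_w cos (\sum_j t j * X n j w) @[n --> \oo] --> \int[P]_w cos (\sum_j t j * Y j w) /\
  \int[P]_w sin (\sum_j t j * X n j w) @[n --> \oo] --> \int[P]_w sin (\sum_j t j * Y j w).
Proof.
move=> mX mY XY.
have mSX n : measurable_fun setT (fun w => \sum_j t j * X n j w).
  by apply: measurable_sum => j; exact: measurable_funM.
have mSY : measurable_fun setT (fun w => \sum_j t j * Y j w).
  by apply: measurable_sum => j; exact: measurable_funM.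
have key (T : R -> R) : (forall x y, `|T x - T y| <= `|x - y|) -> (forall x, `|T x| <= 1) ->
    (forall f : Om -> R, measurable_fun setT f -> measurable_fun setT (fun w => T (f w))) ->
    \int[P]_w T (\sum_j t j * X n j w) @[n --> \oo] --> \int[P]_w T (\sum_j t j * Y j w).
  move=> Tlip T1 mT; apply/cvgrPdist_le => e e0.
  pose S := \sum_j `|t j|.
  have S0 : 0 <= S by exact: sumr_ge0.
  pose e' := e / 2 / (S + 1).
  have e'0 : 0 < e' by rewrite !divr_gt0// ltr_pwDr.
  pose B n j := [set w | e' <= `|X n j w - Y j w|].
  have mB n j : measurable (B n j).
    by apply: measurable_set_ler; apply: measurableT_comp => //; exact: measurable_funB.
  have Hs : \sum_j fine (P (B n j)) @[n --> \oo] --> 0.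
    rewrite [X in _ --> X](_ : _ = \sum_(j < k) (0 : R)); last by rewrite big1.
    apply: cvg_sumr => j; exact: (fine_cvg (XY j _ e'0)).
  have e4 : 0 < e / 4 by rewrite divr_gt0.
  move/cvgrPdist_le : Hs => /(_ _ e4); apply: filterS => n.
  rewrite sub0r normrN => Hn; rewrite distrC.
  have a0 : 0 <= e / 2 by rewrite ltW// divr_gt0.
  have := @Rintegral_dist_le R k _ _ P (fun w => T (\sum_j t j * X n j w)) (fun w => T (\sum_j t j * Y j w))
    (B n) 1 (e / 2) (mT _ (mSX n)) (mT _ mSY) (mB n) ler01 (fun w => T1 _) (fun w => T1 _) a0.
  move=> /(_ _)/le_trans; apply.
    move=> w Hw; rewrite (le_trans (Tlip _ _))// -sumrB (le_trans (ler_norm_sum _ _ _))//.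
    rewrite (@le_trans _ _ (\sum_j `|t j| * e'))//.
      apply: ler_sum => j _; rewrite -mulrBr normrM ler_wpM2l//.
      by have /negP := Hw j; rewrite -ltNge => /ltW.
    rewrite -mulr_suml -/S /e' mulrCA ler_piMr// ler_pdivrMr ?mul1r ?lerDl//.
    by rewrite ltr_pwDr.
  have := le_trans (ler_norm _) Hn; rewrite -mulr_natl; lra.
split; apply: key.
- exact: normB_cos.
- by move=> x; exact: cos_max.
- by move=> f; exact: measurable_fun_cos.
- exact: normB_sin.
- by move=> x; exact: sin_max.
- by move=> f; exact: measurable_fun_sin.
Qed.

(** The identity for simple functions passes to the limit, on the left by convergence in
    probability, on the right by convergence in L^g. The outcome depends on the integrands alone,
    whatever the approximations. *)
Lemma cfun_stable_integral k (t : 'I_k -> R) (phi : 'I_k -> E -> R) (Z : 'I_k -> Om -> R) :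
  (forall j, measurable_fun setT (Z j)) ->
  (forall j, stable_integral g m M (phi j) (Z j)) ->
  cfun P (fun w => \sum_j t j * Z j w) =
  expC ((- Lpow m g (fun x => \sum_j t j * phi j x)) +i*
        (b * tg * \int[m]_x spow g (\sum_j t j * phi j x)))%C.
Proof.
move=> mZ HZ.
have g1' : 1 <= g by exact: ltW.
have phiL j : in_Lpow m g (phi j) by case: (HZ j) => /(Lfun_in_Lpow g1').
have /choice[h Hh] : forall j, exists h_ : nat -> {sfun E >-> R},
    [/\ forall n, in_Lpow m g (h_ n),
      Lpow m g (fun x => h_ n x - phi j x) @[n --> \oo] --> 0 &
      cvg_in_probability P (fun n => simple_stable_integral M (h_ n)) (Z j)].
  move=> j; have [pj [h_ [hL hN hP]]] := HZ j; exists h_; split => //.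
    by move=> n; exact: (Lfun_in_Lpow g1' (hL n)).
  have hL' n := Lfun_in_Lpow g1' (hL n).
  have hB n := in_LpowB g1' (hL' n) (phiL j).
  (* The definition speaks of norms; their g-th powers give the convergence of [Lpow]. *)
  have H1 : (Lpow m g (fun x => h_ n x - phi j x)) `^ g^-1 @[n --> \oo] --> 0.
    have := fine_cvg hN; rewrite (_ : fine \o _ = fun n => (Lpow m g (fun x => h_ n x - phi j x)) `^ g^-1).
      exact.
    by apply/funext => n; rewrite /= (LnormE (hB n)).
  have := @cvg_powR_seq _ _ _ g (fun n => powR_ge0 _ _) g0 H1.
  rewrite powR0 ?gt_eqF// (_ : (fun n => _) = fun n => Lpow m g (fun x => h_ n x - phi j x))//.
  by apply/funext => n; rewrite -powRrM mulVf ?gt_eqF// powRr1// Lpow_ge0.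
have hL n j : in_Lpow m g (h j n) by have [] := Hh j.
have hP j : cvg_in_probability P (fun n => simple_stable_integral M (h j n)) (Z j) by have [] := Hh j.
have S0 : in_Lpow m g (fun x => \sum_j t j * phi j x).
  by apply: in_Lpow_sum => // j; exact: in_LpowZ.
have Sn n : in_Lpow m g (fun x => \sum_j t j * h j n x).
  by apply: in_Lpow_sum => // j; exact: in_LpowZ.
have Hd : Lpow m g (fun x => \sum_j t j * h j n x - \sum_j t j * phi j x) @[n --> \oo] --> 0.
  rewrite (_ : (fun n => _) = fun n => Lpow m g (fun x => \sum_j t j * (h j n x - phi j x))); last first.
    apply/funext => n; apply: eq_Rintegral => x _; rewrite -sumrB.
    by congr (`|_| `^ _); apply: eq_bigr => j _; rewrite mulrBr.
  apply: (@Lpow_sum_cvg0 _ _ _ m g g1' k t (fun n j x => h j n x - phi j x)).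
    by move=> n j; exact: in_LpowB.
  by move=> j; have [] := Hh j.
have HA := cvg_Lpow g1' Sn S0 Hd.
have HB := cvg_Rintegral_spow g1' Sn S0 Hd.
have mI n j : measurable_fun setT (simple_stable_integral M (h j n)).
  rewrite /simple_stable_integral; under eq_fun do rewrite fsbig_finite//=.
  by apply: measurable_sum => y; exact: measurable_funM.
have [Hc Hs] := cvg_cfun_in_probability t mI mZ hP.
have Ecs n := cfun_simple_stable_integral t (hL n).
have Ec n : \int[P]_w cos (\sum_j t j * simple_stable_integral M (h j n) w) =
    expR (- Lpow m g (fun x => \sum_j t j * h j n x)) *
    cos (b * tg * \int[m]_x spow g (\sum_j t j * h j n x)) by have [] := Ecs n.
have Es n : \int[P]_w sin (\sum_j t j * simple_stable_integral M (h j n) w) =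
    expR (- Lpow m g (fun x => \sum_j t j * h j n x)) *
    sin (b * tg * \int[m]_x spow g (\sum_j t j * h j n x)) by have [] := Ecs n.
have HE : expR (- Lpow m g (fun x => \sum_j t j * h j n x)) @[n --> \oo] -->
    expR (- Lpow m g (fun x => \sum_j t j * phi j x)).
  by apply: (@cvg_comp _ _ _ _ expR _ _ _ (cvgN HA)); exact: continuous_expR.
have HM : b * tg * \int[m]_x spow g (\sum_j t j * h j n x) @[n --> \oo] -->
    b * tg * \int[m]_x spow g (\sum_j t j * phi j x) by exact: cvgMr.
have HC : cos (b * tg * \int[m]_x spow g (\sum_j t j * h j n x)) @[n --> \oo] -->
    cos (b * tg * \int[m]_x spow g (\sum_j t j * phi j x)).
  by apply: (@cvg_comp _ _ _ _ cos _ _ _ HM); exact: continuous_cos.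
have HS : sin (b * tg * \int[m]_x spow g (\sum_j t j * h j n x)) @[n --> \oo] -->
    sin (b * tg * \int[m]_x spow g (\sum_j t j * phi j x)).
  by apply: (@cvg_comp _ _ _ _ sin _ _ _ HM); exact: continuous_sin.
rewrite (funext Ec) in Hc; rewrite (funext Es) in Hs.
rewrite /cfun /expC /=; congr (_ +i* _)%C.
- exact: (cvg_unique _ Hc (cvgM HE HC)).
- exact: (cvg_unique _ Hs (cvgM HE HS)).
Qed.

End stable_integral_cfun.

(** * Convergence of the normalized field *)

Section right_limits.
Context {R : realType}.

Lemma seq_cvg_at_right0 (u : nat -> R) : (forall n, 0 < u n) ->
  u n @[n --> \oo] --> 0 -> u n @[n --> \oo] --> 0^'+.
Proof.
move=> u0 ucv V HV; have H : nbhs (0 : R) (fun x => 0 < x -> V x) by exact: HV.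
have H1 : \forall n \near \oo, 0 < u n -> V (u n) by exact: ucv H.
suff : \forall n \near \oo, V (u n) by [].
by apply: filterS H1 => n; apply.
Qed.

(** If F left a neighbourhood of l arbitrarily close to 0, points of ]0, 1/(n+1)] where it does so
    would form a sequence contradicting the hypothesis. *)
Lemma cvg_at_right0_seq (T : topologicalType) (F : R -> T) (l : T) :
  (forall u : nat -> R, (forall n, 0 < u n) -> u n @[n --> \oo] --> 0 ->
    F (u n) @[n --> \oo] --> l) ->
  F x @[x --> 0^'+] --> l.
Proof.
move=> H V Vl; apply: contrapT => nV.
have /choice[u Hu] : forall n, exists x : R, [/\ 0 < x, x <= n.+1%:R^-1 & ~ V (F x)].
  move=> n; apply: contrapT => /forallNP Hx; apply: nV.
  exists (n.+1%:R^-1); first by rewrite /= invr_gt0.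
  move=> x /=; rewrite sub0r normrN => xn x0; apply: contrapT => VFx; apply: (Hx x); split => //.
  by rewrite ltW// -(gtr0_norm x0).
have u0 n : 0 < u n by have [] := Hu n.
have ucv : u n @[n --> \oo] --> 0.
  apply: (@squeeze_cvgr _ _ _ _ (cst 0) (@harmonic R)); [|exact: cvg_cst|exact: cvg_harmonic].
  by apply: nearW => n; have [un0 un _] := Hu n; rewrite (ltW un0).
have [n _ /(_ n (leqnn n))] := H u u0 ucv V Vl.
by have [] := Hu n.
Qed.

End right_limits.

Section power_interpolation.
Context {R : realType} d (T : measurableType d) (mu : {measure set T -> \bar R}).

(** x dominates on [0, 1] and x^p beyond; this gives all the exponents between 1 and alpha from the
    two extreme ones. *)
Lemma powR_interpolation (p q x : R) : 1 <= q <= p -> 0 <= x -> x `^ q <= x + x `^ p.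
Proof.
move=> /andP[q1 qp]; rewrite le_eqVlt => /predU1P[<-|x0].
  by rewrite powR0 ?addr_ge0// ?powR_ge0// gt_eqF// (lt_le_trans ltr01).
have [x1|x1] := leP x 1.
  by rewrite ler_wpDr ?powR_ge0// -[leRHS](powRr1 (ltW x0)) ger_powR// x0.
by rewrite ler_wpDl ?(ltW x0)// ler_powR// ltW.
Qed.

Lemma integrable_powR_interpolation (f : T -> R) (p q : R) : 1 <= q <= p ->
  mu.-integrable setT (EFin \o f) -> mu.-integrable setT (EFin \o (fun x => `|f x| `^ p)) ->
  mu.-integrable setT (EFin \o (fun x => `|f x| `^ q)).
Proof.
move=> pq fi fp; have mf : measurable_fun setT f by case/integrableP : fi => /measurable_EFinP.
apply: (@le_integrable_real _ _ _ _ _ _ (fun x => `|f x| + `|f x| `^ p)) => //.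
- exact: measurable_norm_powR.
- by move=> x _; rewrite ger0_norm ?powR_ge0// powR_interpolation.
- by apply: integrable_realD => //; exact: (integrable_norm fi).
Qed.

End power_interpolation.

Section ball_field_prm.
Context {R : realType} (d : nat).
Local Notation leb := (lebesgue_tuple (R := R) d).

(* The density f is unconstrained at nonpositive radii. *)
Definition radius_restriction (f : R -> R) (r : R) : R := if 0 < r then f r else 0.
Local Notation pd := radius_restriction.

Lemma measurable_radius_restriction f : measurable_fun (`]0, +oo[ : set R) f ->
  measurable_fun setT (pd f).
Proof.
move=> mf; rewrite (_ : pd f = f \_ (`]0, +oo[ : set R)).
  by apply: (measurable_restrictT _ _).1 mf.
apply/funext => r; rewrite patchE /pd.
by congr (if _ then _ else _); apply/idP/idP; rewrite inE/= in_itv/= andbT.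
Qed.

Lemma radius_restriction_ge0 f r : (forall r, 0 < r -> 0 <= f r) -> 0 <= pd f r.
Proof. by move=> f0; rewrite /pd; case: ifP => // r0; exact: f0. Qed.

Lemma radius_restriction_neg f r : r <= 0 -> pd f r = 0.
Proof. by rewrite /pd leNgt => /negbTE ->. Qed.

(** The restriction of the domain to positive radii is moved into the density. *)
Lemma ball_intensityE f (mf : measurable_fun setT (pd f)) (f0 : forall r, 0 <= pd f r)
    (G : probability R R) (l rho : R) (l0 : 0 < l) (rho0 : 0 < rho) :
  ball_intensity (d := d) l f G rho = ball_measure d G mf f0 l0 rho0.
Proof.
apply/funext => A; rewrite /ball_intensity integral_mkcondr; apply: eq_integral => z _.
rewrite patchE /ball_density /pd pmulr_lgt0 ?invr_gt0//.
have [|] := boolP (z \in positive_radii); first by rewrite inE /positive_radii/= => ->.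
move=> /negP H; case: ifPn => // z0; last by rewrite mul0r mulr0.
by exfalso; apply: H; rewrite inE.
Qed.

Definition ball_mass (phi : Rd R d -> R) (z : weighted_ball R d) : R :=
  z.2 * ball_int phi z.1.1 z.1.2.

(** Balls of nonpositive radius are empty, so the field may be integrated over all radii. *)
Lemma ball_int_le0 (phi : Rd R d -> R) x (r : R) : r <= 0 -> ball_int phi x r = 0.
Proof.
move=> r0; rewrite /ball_int /Rintegral integral0_eq// => y _.
rewrite ballkE ltNge (le_trans r0) ?sqrtr_ge0//= mul0r//.
Qed.

Lemma ball_fieldE dO (Om : measurableType dO)
    (N : Om -> {measure set (weighted_ball R d) -> \bar R}) (mu : signed_measure R d) phi :
  has_density mu phi -> ball_field N mu = prm_integral N (ball_mass phi).
Proof.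
move=> Hmu; apply/funext => w; rewrite /ball_field /prm_integral Rintegral_mkcond.
apply: eq_Rintegral => z _; rewrite patchE.
have E : fine (mu (eball z.1.1 z.1.2)) = ball_int phi z.1.1 z.1.2.
  by rewrite Hmu -?Rintegral_eball//; exact: measurable_eball.
have [|zn] := boolP (z \in positive_radii); first by rewrite /ball_mass E.
rewrite /ball_mass ball_int_le0 ?mulr0// leNgt; apply/negP => z0.
by move/negP : zn; apply; rewrite inE.
Qed.

Lemma ball_int_sum k (t : 'I_k -> R) (phi : 'I_k -> Rd R d -> R) x r :
  (forall j, leb.-integrable setT (EFin \o phi j)) ->
  ball_int (fun y => \sum_j t j * phi j y) x r = \sum_j t j * ball_int (phi j) x r.
Proof.
move=> iphi; rewrite /ball_int; under eq_Rintegral do rewrite mulr_sumr.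
have ib j := integrable_ballkM x r (iphi j).
rewrite Rintegral_sum//.
  by apply: eq_bigr => j _; rewrite -RintegralZl//; apply: eq_Rintegral => y _; rewrite mulrCA.
move=> j; rewrite (_ : (fun y => _) = (fun y => t j * (ballk r x y * phi j y))); last first.
  by apply/funext => y; rewrite mulrCA.
exact: integrable_realZl.
Qed.

End ball_field_prm.

Lemma Rintegral_mscale (R : realType) d (T : measurableType d) (mu : {measure set T -> \bar R})
    (c : {nonneg R}) (f : T -> R) : mu.-integrable setT (EFin \o f) ->
  \int[mscale c mu]_x f x = c%:num * \int[mu]_x f x.
Proof.
move=> fi; have mf := measurable_int _ fi.
have H (h : T -> \bar R) : measurable_fun setT h -> (forall x, 0 <= h x)%E ->
    (\int[mscale c mu]_x h x = c%:num%:E * \int[mu]_x h x)%E.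
  by move=> mh h0; rewrite ge0_integral_mscale.
rewrite /Rintegral integralE H//; last exact: measurable_funepos.
rewrite H//; last exact: measurable_funeneg.
have pf := integrable_pos_fin_num measurableT fi.
have nf := integrable_neg_fin_num measurableT fi.
rewrite [in RHS]integralE -(fineK pf) -(fineK nf) -!EFinM -!EFinB/=; ring.
Qed.

(** * The normalized field as a centred Poisson integral *)

Section normalized_field.
Context {R : realType} (d : nat) dO (Om : measurableType dO) (P : probability Om R)
  (N : Om -> {measure set (weighted_ball R d) -> \bar R}).
Local Notation leb := (lebesgue_tuple (R := R) d).
Variables (beta l rho : R) (Lam : {measure set (weighted_ball R d) -> \bar R}).
Hypotheses (prm : poisson_random_measure P Lam N) (l0 : 0 < l) (rho0 : 0 < rho).
Variables (k : nat) (t : 'I_k -> R) (mu : 'I_k -> signed_measure R d) (phi : 'I_k -> Rd R d -> R).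
Hypotheses (Hmu : forall j, has_density (mu j) (phi j))
  (iphi : forall j, leb.-integrable setT (EFin \o phi j))
  (Hint : forall psi, leb.-integrable setT (EFin \o psi) ->
    Lam.-integrable setT (EFin \o ball_functional beta psi l rho)).

Let n2 := l `^ (d%:R / beta) * rho ^+ d.
Let s := l `^ beta^-1 * rho.
Let n2E : n2 = s ^+ d.
Proof. by rewrite /n2 /s exprMn -(powR_mulrn d (powR_ge0 _ _)) -powRrM [d%:R / _]mulrC. Qed.
Let s0 : 0 < s. Proof. by rewrite mulr_gt0// powR_gt0. Qed.
Let n20 : 0 < n2. Proof. by rewrite n2E exprn_gt0. Qed.

Definition normalized_field j (w : Om) : R :=
  (ball_field N (mu j) w - fine ('E_P[ball_field N (mu j)])%E) / n2.

Let massE j : ball_mass (phi j) = (fun z => n2 * ball_functional beta (phi j) l rho z).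
Proof.
by apply/funext => z; rewrite /ball_mass /ball_functional -/s -n2E; field; rewrite gt_eqF.
Qed.

Let imass j : Lam.-integrable setT (EFin \o ball_mass (phi j)).
Proof. by rewrite massE; apply: integrable_realZl => //; exact: Hint. Qed.

Let mmass j : measurable_fun setT (ball_mass (phi j)).
Proof. by case/integrableP : (imass j) => /measurable_EFinP. Qed.

Let mean j : fine ('E_P[ball_field N (mu j)])%E = \int[Lam]_z ball_mass (phi j) z.
Proof. by rewrite (ball_fieldE N (Hmu j)) unlock -(prm_expectation prm (imass j)). Qed.

Lemma measurable_normalized_field j : measurable_fun setT (normalized_field j).
Proof.
rewrite /normalized_field (ball_fieldE N (Hmu j)).
apply: measurable_funM => //; apply: measurable_funB => //.
exact: (measurable_prm_integral prm (mmass j)).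
Qed.

(** The Poisson integral is almost surely linear and [ball_int] is linear in the density, so the
    combination is the centred integral attached to the combined density. *)
Lemma cfun_normalized_field :
  let h := ball_functional beta (fun x => \sum_j t j * phi j x) l rho in
  cfun P (fun w => \sum_j t j * normalized_field j w) =
  expC ((\int[Lam]_z (cos (h z) - 1)) +i* (\int[Lam]_z (sin (h z) - h z)))%C.
Proof.
move=> h.
have ih : Lam.-integrable setT (EFin \o h).
  by apply: Hint; apply: integrable_real_sum => // j; exact: integrable_realZl.
have mh : measurable_fun setT h by case/integrableP : ih => /measurable_EFinP.
have hE z : h z = \sum_j (t j / n2) * ball_mass (phi j) z.
  rewrite /h /ball_functional ball_int_sum// mulr_suml mulr_sumr; apply: eq_bigr => j _.
  by rewrite -/s -n2E /ball_mass; ring.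
rewrite -(cfun_prm prm ih); apply: eq_cfun_ae.
- by apply: measurable_sum => j; apply: measurable_funM => //; exact: measurable_normalized_field.
- by apply: measurable_funB => //; exact: (measurable_prm_integral prm mh).
have := prm_integral_lin prm (fun j => t j / n2) imass.
apply: filterS => w; rewrite (_ : (fun z => _) = h); last by apply/funext => z; rewrite hE.
move=> ->; rewrite (_ : \int[Lam]_z h z = \sum_j (t j / n2) * \int[Lam]_z ball_mass (phi j) z).
  rewrite -sumrB; apply: eq_bigr => j _.
  by rewrite /normalized_field mean (ball_fieldE N (Hmu j)); ring.
transitivity (\int[Lam]_z \sum_j (t j / n2) * ball_mass (phi j) z); first exact: eq_Rintegral.
rewrite Rintegral_sum//.
  by apply: eq_bigr => j _; rewrite RintegralZl.
by move=> j; exact: integrable_realZl.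
Qed.

End normalized_field.

Theorem theorem2p16 (R : realType) (d : nat)
    (beta Cbeta alpha sigma b tau : R) (f : R -> R) (G : probability R R)
    (lambda : R -> R)
    (dO : R -> measure_display) (Om : forall rho : R, measurableType (dO rho))
    (P : forall rho : R, probability (Om rho) R)
    (N : forall rho : R, Om rho -> {measure set (weighted_ball R d) -> \bar R})
    (dO' : measure_display) (Om' : measurableType dO') (P' : probability Om' R)
    (M : set (Rd R d) -> {RV P' >-> R})
    (Z : signed_measure R d -> {RV P' >-> R}) :
  (1 <= d)%N ->
  forall Cbeta_gt0 : 0 < Cbeta,
  radius_density (d := d) beta Cbeta f ->
  1 < alpha <= 2 -> 0 < sigma -> -1 <= b <= 1 ->
  normal_domain_of_attraction alpha sigma b tau G ->
  d%:R < beta < alpha * d%:R ->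
  (forall rho, 0 < rho -> 0 < lambda rho) ->
  lambda rho @[rho --> 0^'+] --> +oo ->
  lambda rho * rho `^ beta @[rho --> 0^'+] --> (0 : R) ->
  (forall rho, 0 < rho ->
    poisson_random_measure (P rho) (ball_intensity (lambda rho) f G rho)
      (N rho)) ->
  let n2 := fun rho => lambda rho `^ (d%:R / beta) * rho ^+ d in
  let gamma := beta / d%:R in
  let m := limit_control d gamma G (ltW Cbeta_gt0) in
  stable_random_measure gamma m (limit_skewness gamma G) M ->
  (forall mu phi, L1_Lp alpha phi -> has_density mu phi ->
    stable_integral gamma m M phi (Z mu)) ->
  cvg_fdd P P' (L1_Lp_measure alpha)
    (fun rho mu w =>
       (ball_field (N rho) mu w - fine ('E_(P rho)[ball_field (N rho) mu])%E)
       / n2 rho)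
    0^'+ (fun mu => Z mu).
Proof.
move=> d0 C0 [mf f0 fvol ftail] /andP[a1 a2] _ _ HG /andP[db ba] lam0 lamy lam_small prm n2 gamma m srm HZ.
move=> k mu Hmu g cg gC.
have d0R : (0 : R) < d%:R by rewrite ltr0n.
have g1 : 1 < gamma by rewrite /gamma ltr_pdivlMr// mul1r.
have ga : gamma < alpha by rewrite /gamma ltr_pdivrMr.
(* Any exponent strictly between gamma and alpha would do; p <= 2 is inherited from alpha. *)
pose p := (gamma + alpha) / 2.
have gp : gamma < p by rewrite /p; lra.
have pa : p < alpha by rewrite /p; lra.
have p2 : p <= 2 by lra.
have Gq q : 0 < q < alpha -> G.-integrable setT (EFin \o (fun x : R => `|x| `^ q)).
  move=> q0a; apply/integrableP; split.
    by apply/measurable_EFinP; exact: (measurable_norm_powR q (@measurable_id _ _ setT)).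
  under eq_integral do rewrite /= ger0_norm ?powR_ge0//.
  by apply: (moment_lt_alpha HG) => //; exact: lt_trans a1.
have Gg := Gq gamma; have Gp := Gq p.
have G1 : G.-integrable setT (EFin \o (fun x : R => `|x|)).
  have := Gq 1; rewrite ltr01 a1 => /(_ isT).
  by rewrite (_ : (fun x : R => `|x| `^ 1) = (fun x => `|x|))//; apply/funext => x; rewrite powRr1.
have {}Gg : G.-integrable setT (EFin \o (fun x : R => `|x| `^ gamma)) by apply: Gg; lra.
have {}Gp : G.-integrable setT (EFin \o (fun x : R => `|x| `^ p)) by apply: Gp; lra.
pose leb := lebesgue_tuple (R := R) d.
have /choice[phi Hphi] : forall j, exists phi, L1_Lp alpha phi /\ has_density (mu j) phi.
  by move=> j; have [phi ? ?] := Hmu j; exists phi.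
have iphi j : leb.-integrable setT (EFin \o phi j).
  by have [[/Lfun1_integrable]] := Hphi j.
(* Interpolation between L^1 and L^alpha, needed for the exponents gamma and p. *)
have iphiq j q : 1 <= q <= alpha -> leb.-integrable setT (EFin \o (fun x => `|phi j x| `^ q)).
  move=> q1a; have [[_ H] _] := Hphi j.
  have [_ H'] := Lfun_in_Lpow (ltW a1) H.
  exact: (integrable_powR_interpolation q1a (iphi j) H').
have mpf := measurable_radius_restriction mf.
have pf0 r : 0 <= radius_restriction f r by exact: radius_restriction_ge0.
have pfneg := radius_restriction_neg f.
have pfE r : 0 < r -> radius_restriction f r = f r by rewrite /radius_restriction => ->.
have pfvol : (\int[lebesgue_measure]_(r in posr) (r ^+ d * radius_restriction f r)%:E < +oo)%E.
  rewrite (_ : (\int[_]_(r in _) _)%E = (\int[lebesgue_measure]_(r in posr) (r ^+ d * f r)%:E)%E)//.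
  by apply: eq_integral => r; rewrite inE posrE => r0; rewrite pfE.
have pftail : radius_restriction f r / r `^ (- 1 - beta) @[r --> +oo] --> Cbeta.
  apply: cvg_trans ftail; apply: near_eq_cvg.
  by exists 0; split=> // r r0; rewrite pfE.
(* From here on rho is a sequence, and each index has its own probability space. *)
apply: cvg_at_right0_seq => rho rho0 rho_cvg.
have rho_r := seq_cvg_at_right0 rho0 rho_cvg.
have l0 n : 0 < lambda (rho n) by exact: lam0.
have ly : lambda (rho n) @[n --> \oo] --> +oo by exact: (cvg_comp _ _ rho_r lamy).
have lsmall : lambda (rho n) * rho n `^ beta @[n --> \oo] --> 0.
  exact: (cvg_comp _ _ rho_r lam_small).
pose Lam n := ball_measure d G mpf pf0 (l0 n) (rho0 n).
have prmn n : poisson_random_measure (P (rho n)) (Lam n) (N (rho n)).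
  by have := prm _ (rho0 n); rewrite (ball_intensityE d mpf pf0 G (l0 n) (rho0 n)).
have beta0 : 0 < beta by exact: lt_trans db.
have Hint n psi : leb.-integrable setT (EFin \o psi) ->
    (Lam n).-integrable setT (EFin \o ball_functional beta psi (lambda (rho n)) (rho n)).
  by move=> ipsi; exact: (integrable_ball_functional d0 g1 G1 ipsi mpf pf0 pfneg pfvol l0 rho0 n).
pose X n j := normalized_field (P (rho n)) (N (rho n)) beta (lambda (rho n)) (rho n) mu j.
have mX n j : measurable_fun setT (X n j).
  exact: (measurable_normalized_field (prmn n) (l0 n) (rho0 n) (fun j => (Hphi j).2) iphi (Hint n)).
have key t : \int[P (rho n)]_w cos (\sum_j t j * X n j w) @[n --> \oo] -->
      \int[P']_w cos (\sum_j t j * Z (mu j) w) /\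
    \int[P (rho n)]_w sin (\sum_j t j * X n j w) @[n --> \oo] -->
      \int[P']_w sin (\sum_j t j * Z (mu j) w).
  (* The combined density: one exponent describes the whole vector in the direction t. *)
  pose Phi x := \sum_j t j * phi j x.
  have iPhi : leb.-integrable setT (EFin \o Phi).
    by apply: integrable_real_sum => // j; exact: integrable_realZl.
  have iPhiq q : 1 <= q <= alpha -> leb.-integrable setT (EFin \o (fun x => `|Phi x| `^ q)).
    move=> q1a; have [q1 _] := andP q1a.
    have [] : in_Lpow leb q Phi; last by [].
    apply: (in_Lpow_sum q1) => j; apply: in_LpowZ; split; last exact: iphiq.
    by case/integrableP : (iphi j) => /measurable_EFinP.
  have iPhig : leb.-integrable setT (EFin \o (fun x => `|Phi x| `^ gamma)) by apply: iPhiq; lra.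
  have iPhip : leb.-integrable setT (EFin \o (fun x => `|Phi x| `^ p)) by apply: iPhiq; lra.
  pose h n := ball_functional beta Phi (lambda (rho n)) (rho n).
  have HE n : cfun (P (rho n)) (fun w => \sum_j t j * X n j w) =
      expC ((\int[Lam n]_z (cos (h n z) - 1)) +i* (\int[Lam n]_z (sin (h n z) - h n z)))%C.
    exact: (cfun_normalized_field (prmn n) (l0 n) (rho0 n) t (fun j => (Hphi j).2) iphi (Hint n)).
  have HL : cfun P' (fun w => \sum_j t j * Z (mu j) w) =
      expC ((- (limit_scale d Cbeta gamma G * \int[leb]_x `|Phi x| `^ gamma)) +i*
        (limit_skewness gamma G * tan (pi * gamma / 2) *
          (limit_scale d Cbeta gamma G * \int[leb]_x spow gamma (Phi x))))%C.
    rewrite (cfun_stable_integral g1 srm t _ (fun j => HZ _ _ (Hphi j).1 (Hphi j).2))//.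
    (* The control measure is [limit_scale] times Lebesgue measure, and this factor comes out of
       both integrals. *)
    rewrite /Lpow /m /limit_control !Rintegral_mscale//.
    by apply: integrable_spow => //; case/integrableP : iPhi => /measurable_EFinP.
  have Hre := cvg_integral_cos d0 g1 gp p2 G1 Gp Gg iPhi iPhig iPhip mpf pf0 pfneg pfvol (ltW C0) pftail l0 rho0 ly lsmall.
  have Him := cvg_integral_sin d0 g1 gp p2 G1 Gp Gg iPhi iPhig iPhip mpf pf0 pfneg pfvol (ltW C0) pftail l0 rho0 ly lsmall.
  have Hexp : expR (\int[Lam n]_z (cos (h n z) - 1)) @[n --> \oo] -->
      expR (- (limit_scale d Cbeta gamma G * \int[leb]_x `|Phi x| `^ gamma)).
    by apply: (@cvg_comp _ _ _ _ expR _ _ _ Hre); exact: continuous_expR.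
  have Ec n : \int[P (rho n)]_w cos (\sum_j t j * X n j w) =
      expR (\int[Lam n]_z (cos (h n z) - 1)) * cos (\int[Lam n]_z (sin (h n z) - h n z)).
    by have [] := HE n.
  have Es n : \int[P (rho n)]_w sin (\sum_j t j * X n j w) =
      expR (\int[Lam n]_z (cos (h n z) - 1)) * sin (\int[Lam n]_z (sin (h n z) - h n z)).
    by have [] := HE n.
  rewrite (funext Ec) (funext Es); move: HL => [-> ->]; split; apply: cvgM => //.
    by apply: (@cvg_comp _ _ _ _ cos _ _ _ Him); exact: continuous_cos.
  by apply: (@cvg_comp _ _ _ _ sin _ _ _ Him); exact: continuous_sin.
have mZ j : measurable_fun setT (Z (mu j)) by [].
exact: (levy_continuity mX mZ (fun t => (key t).1) (fun t => (key t).2) cg gC).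
Qed.
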